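(* Let $n\ge1$, let $\mathcal{Q}$ be a quotient module of $H^2(\mathbb{B}^n)$, and let $X\in\mathcal{B}_1(\mathcal{Q})$ be a nonzero module map. Set $\psi=X(P_{\mathcal{Q}}1)$. Let $\mathcal{A}(\mathbb{B}^n)$ denote either one of the classes $\mathcal{I}(\mathbb{B}^n)$ or $\mathcal{E}(\mathbb{B}^n)$. The following conditions are equivalent: (1) $X$ admits a lift, i.e. there exists $\varphi\in\mathcal{S}(\mathbb{B}^n)$ with $X=S_\varphi$. (2) There exists $\varphi\in\mathcal{S}(\mathbb{B}^n)$ such that $\psi-\varphi\in\mathcal{Q}^\perp$. (Moreover, in this case $X=S_\varphi$.) (3) The functional $X_{\mathcal{Q}}:(\mathcal{M}_{\mathcal{Q}},\|\cdot\|_1)\to\mathbb{C}$, $X_{\mathcal{Q}}f=\int_{\mathbb{S}^n}\psi f\,d\sigma$ $(f\in\mathcal{M}_{\mathcal{Q}})$, is a contraction. (4) $\operatorname{dist}_{L^1(\mathbb{S}^n)}\Big(\dfrac{\overline{\psi}}{\|\psi\|_2^2},\widetilde{\mathcal{M}_{\mathcal{Q}}}\Big)\ge 1$, where $\widetilde{\mathcal{M}_{\mathcal{Q}}}=[\mathcal{Q}^{conj}\ominus\{\overline{\psi}\}]\dot+[\mathcal{M}(\mathbb{S}^n)\dot+H^2_0(\mathbb{S}^n)]$. (5) There exists a sequence $\{\varphi_k\}\subseteq\mathcal{A}(\mathbb{B}^n)$ such that $\lim_{k\to\infty}\int_{\mathbb{S}^n}\varphi_kf\,d\sigma=\int_{\mathbb{S}^n}\psi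 f\,d\sigma$ for all $f\in\mathcal{M}_{\mathcal{Q}}$. (6) There exists a sequence $\{\varphi_k\}\subseteq\mathcal{A}(\mathbb{B}^n)$ such that $\lim_{k\to\infty}\int_{\mathbb{S}^n}\varphi_kf\,d\sigma=\int_{\mathbb{S}^n}\psi f\,d\sigma$ for all $f\in\mathcal{Q}^{conj}$.
   Context: $\mathbb{B}^n$ is the open unit ball of $\mathbb{C}^n$, $\mathbb{D}=\mathbb{B}^1$, $\mathbb{S}^n=\partial\mathbb{B}^n$, $\sigma$ the normalized surface measure on $\mathbb{S}^n$. $H^\infty(\mathbb{B}^n)$: bounded analytic functions on $\mathbb{B}^n$ with sup norm; $\mathcal{S}(\mathbb{B}^n)$: its closed unit ball. $H^2(\mathbb{B}^n)$: the Hardy space of analytic $f$ on $\mathbb{B}^n$ with $\|f\|^2=\sup_{0<r<1}\int_{\mathbb{S}^n}|f(r\zeta)|^2d\sigma(\zeta)<\infty$. Via boundary values ($K$-limits, a.e. equal to radial limits), $H^2(\mathbb{B}^n)$ is identified unitarily with $H^2(\mathbb{S}^n)=\overline{\mathbb{C}[z_1,\dots,z_n]}^{L^2(\mathbb{S}^n)}$, and $H^\infty$ functions with their boundary functions. For $\varphi\in H^\infty(\mathbb{B}^n)$, $T_\varphi f=\varphi f$ on $H^2(\mathbb{B}^n)$. A quotient module is a nonzero closed subspace $\mathcal{Q}\subseteq H^2(\mathbb{B}^n)$ with $T_{z_i}^*\mathcal{Q}\subseteq\mathcal{Q}$ for $i=1,\dots,n$; $P_{\mathcal{Q}}$ is the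 orthogonal projection onto $\mathcal{Q}$, $\mathcal{Q}^\perp=H^2(\mathbb{B}^n)\ominus\mathcal{Q}$, and $S_\varphi=P_{\mathcal{Q}}T_\varphi|_{\mathcal{Q}}$. $\mathcal{B}_1(\mathcal{Q})$ is the set of bounded operators on $\mathcal{Q}$ of norm at most $1$. A bounded operator $X$ on $\mathcal{Q}$ is a module map if $XS_{z_i}=S_{z_i}X$ for all $i$. For $S\subseteq L^2(\mathbb{S}^n)$, $S^{conj}=\{\overline f:f\in S\}$. $\mathcal{M}(\mathbb{S}^n)=L^2(\mathbb{S}^n)\ominus[H^2(\mathbb{S}^n)+H^2(\mathbb{S}^n)^{conj}]$; $H^2_0(\mathbb{S}^n)=H^2(\mathbb{S}^n)\ominus\{1\}$ (the Hardy functions vanishing at $0$). $\mathcal{M}_{\mathcal{Q}}=\mathcal{Q}^{conj}\dot+[\mathcal{M}(\mathbb{S}^n)\dot+H^2_0(\mathbb{S}^n)]$, where $\dot+$ denotes the (algebraic) direct sum, all these spaces being viewed as subspaces of $L^1(\mathbb{S}^n)$ and $\mathcal{M}_{\mathcal{Q}}$ being given the $L^1(\mathbb{S}^n)$ norm $\|\cdot\|_1$. $\mathcal{Q}^{conj}\ominus\{\overline\psi\}$ is the $L^2$-orthogonal complement of $\overline\psi$ in $\mathcal{Q}^{conj}$; $\|\cdot\|_2$ is the $L^2(\mathbb{S}^n)$ norm; $\operatorname{dist}_V(x,S)=\inf\{\|x-y\|_V:y\in S\}$. $\mathcal{I}(\mathbb{B}^n)$ is the set of inner functions: $\varphi\in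 H^\infty(\mathbb{B}^n)$ with $|\varphi|=1$ $\sigma$-a.e. on $\mathbb{S}^n$. $\mathcal{E}(\mathbb{B}^n)$ is the set of extremal functions: all $\varphi\in\mathcal{S}(\mathbb{B}^n)$ for which there are finitely many distinct points $z_1,\dots,z_m\in\mathbb{B}^n$ and scalars $w_1,\dots,w_m\in\mathbb{D}$ with $\varphi(z_i)=w_i$ for all $i$, such that every $\eta\in\mathcal{S}(\mathbb{B}^n)$ with $\eta(z_i)=w_i$ for all $i$ has $\|\eta\|_\infty=1$. *)

(* Defs.v *)
From HB Require Import structures.
From mathcomp Require Import all_boot all_order all_algebra.
From mathcomp Require Import all_classical all_reals all_analysis.
From mathcomp Require Import complex.
From mathcomp Require mpoly.

Set Implicit Arguments.
Unset Strict Implicit.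
Unset Printing Implicit Defensive.

Import Order.TTheory GRing.Theory Num.Theory.
Import numFieldNormedType.Exports.
Import ComplexField.Normc.

Local Open Scope classical_set_scope.
Local Open Scope complex_scope.
Local Open Scope ring_scope.

Notation Cn R n := 'rV[R[i]]_n.
Notation Cfun R n := (Cn R n -> R[i]).

Definition CnBorel (R : realType) (n : nat) :=
  g_sigma_algebraType (@open (Cn R n : normedModType R[i])).

Section Ball.
Context {R : realType} {n : nat}.
Implicit Types (z : Cn R n) (f phi eta : Cfun R n).

(* The Euclidean norm; the norm `|z| of the library on row vectors is the sup
   norm, which induces the same topology. *)
Definition enorm z : R := Num.sqrt (\sum_(i < n) normc (z 0 i) ^+ 2).

Definition cball : set (Cn R n) := [set z | enorm z < 1].

Definition csphere : set (Cn R n) := [set z | enorm z = 1].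

(* A function on the ball is represented by its extension by 0 to C^n, so that
   Leibniz equality is equality on the ball.  Holomorphy is complex (Frechet)
   differentiability: the scalar field of C^n is R[i]. *)
Definition analytic f :=
  (forall z : (Cn R n : normedModType R[i]),
     cball z -> differentiable (f : _ -> R[i]^o) z) /\
  (forall z, ~ cball z -> f z = 0).

Definition one_ball : Cfun R n := patch (fun=> 0) cball (fun=> 1).

(* Not cut off outside the ball: only used as a multiplier of functions that
   vanish there. *)
Definition coordf (i : 'I_n) : Cfun R n := fun z => z 0 i.

Definition multop phi f : Cfun R n := fun z => phi z * f z.

Definition supnorm phi : \bar R :=
  ereal_sup [set (normc (phi z))%:E | z in cball].

Definition Hinfty : set (Cfun R n) :=
  [set phi | analytic phi /\ (supnorm phi < +oo)%E].

Definition schur_class : set (Cfun R n) :=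
  [set phi | Hinfty phi /\ (supnorm phi <= 1%:E)%E].

Definition extremal_functions : set (Cfun R n) :=
  [set phi | schur_class phi /\
    exists (m : nat) (z : 'I_m -> Cn R n) (w : 'I_m -> R[i]),
      [/\ injective z,
          forall j, cball (z j),
          forall j, normc (w j) < 1,
          forall j, phi (z j) = w j &
          forall eta, schur_class eta -> (forall j, eta (z j) = w j) ->
            supnorm eta = 1%:E]].

(* Radial limits, defined sigma-almost everywhere on the sphere for the
   functions of the Hardy spaces, where they agree with K-limits.  Elsewhere
   the value is the junk value of [lim]. *)
Definition bdry f : Cfun R n :=
  fun zeta => lim ((f (r%:C *: zeta) : R[i]^o) @[r --> (1 : R)^'-]).

(* Elements of the orthogonal group O(2n) acting on C^n = R^{2n}; an additive
   norm-preserving map is automatically real-linear and bijective. *)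
Definition rotation (T : Cn R n -> Cn R n) :=
  {morph T : z w / z + w} /\ (forall z, enorm (T z) = enorm z).

Definition conj_set (S : set (Cfun R n)) : set (Cfun R n) :=
  [set (fun z => (f z)^*) | f in S].

Definition sum_set (S1 S2 : set (Cfun R n)) : set (Cfun R n) :=
  [set f + g | f in S1 & g in S2].

(* The normalized surface measure is the unique rotation-invariant Borel
   probability measure on the sphere; it is seen here as a measure on C^n
   carried by the sphere. *)
Definition normalized_surface_measure (sigma : probability (CnBorel R n) R) :=
  sigma csphere = 1%:E /\
  forall (T : Cn R n -> Cn R n) (A : set (CnBorel R n)),
    rotation T -> measurable A -> sigma (T @^-1` A) = sigma A.

End Ball.

Section Hardy.
Context {R : realType} {n : nat} (sigma : probability (CnBorel R n) R).
Implicit Types (u v f g h phi : Cfun R n) (Q S V : set (Cfun R n)).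

(* Functions on the sphere are represented by functions on C^n considered up
   to sigma-a.e. equality; every set of such functions below is closed under
   a.e. equality. *)

Definition cintegral u : R[i] :=
  (\int[sigma]_z complex.Re (u z)) +i* (\int[sigma]_z complex.Im (u z)).

Definition cLnorm (p : \bar R) u : \bar R :=
  Lnorm sigma p (fun z => (normc (u z))%:E).

Definition L2 : set (Cfun R n) :=
  [set u | [/\ measurable_fun setT ((fun z => complex.Re (u z)) : CnBorel R n -> R),
               measurable_fun setT ((fun z => complex.Im (u z)) : CnBorel R n -> R) &
               (cLnorm 2%:E u < +oo)%E]].

Definition L2dot u v : R[i] := cintegral (fun z => u z * (v z)^*).

Definition L2ominus V S : set (Cfun R n) :=
  [set u | V u /\ forall v, S v -> L2dot u v = 0].

Definition mpolyf (p : mpoly.mpoly n R[i]) : Cfun R n :=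
  fun z => mpoly.meval (fun i => z 0 i) p.

Definition H2S : set (Cfun R n) :=
  [set u | L2 u /\ forall e : R, 0 < e ->
     exists p : mpoly.mpoly n R[i],
       (cLnorm 2%:E (u - mpolyf p)%R < e%:E)%E].

Definition H2S0 : set (Cfun R n) := L2ominus H2S [set (fun=> 1)].

Definition MS : set (Cfun R n) := L2ominus L2 (sum_set H2S (conj_set H2S)).

Definition H2normsq f : \bar R :=
  ereal_sup [set (\int[sigma]_z ((normc (f (r%:C *: z)%R) ^+ 2)%R%:E))%E
            | r in [set r : R | 0 < r < 1]].

Definition H2norm f : R := Num.sqrt (fine (H2normsq f)).

Definition H2 : set (Cfun R n) :=
  [set f | analytic f /\ (H2normsq f < +oo)%E].

(* The inner product of H^2 of the ball, through its unitary identification with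
   a space of boundary functions. *)
Definition H2dot f g : R[i] := L2dot (bdry f) (bdry g).

(* The Hilbert space adjoint, specified by its defining identity; likewise
   [H2proj] below for the orthogonal projection onto a closed subspace. *)
Definition adjoint (T : Cfun R n -> Cfun R n) f : Cfun R n :=
  xget (fun=> 0) [set h | H2 h /\ forall g, H2 g -> H2dot (T g) f = H2dot g h].

Definition closed_subspace Q :=
  [/\ Q `<=` H2,
      Q (fun=> 0),
      forall (a : R[i]) f g, Q f -> Q g -> Q (fun z => a * f z + g z) &
      forall (F : nat -> Cfun R n) f, (forall k, Q (F k)) -> H2 f ->
        H2norm (F k - f) @[k --> \oo] --> (0 : R) -> Q f].

Definition quotient_module Q :=
  [/\ closed_subspace Q,
      exists2 f, Q f & f <> (fun=> 0) &
      forall (i : 'I_n) f, Q f -> Q (adjoint (multop (coordf i)) f)].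

Definition H2proj Q f : Cfun R n :=
  xget (fun=> 0) [set g | Q g /\ forall h, Q h -> H2dot (f - g) h = 0].

Definition H2perp Q : set (Cfun R n) :=
  [set f | H2 f /\ forall g, Q g -> H2dot f g = 0].

Definition compression Q phi f : Cfun R n := H2proj Q (multop phi f).

(* An operator on Q is a map on functions of which only the restriction to Q
   matters. *)
Definition linear_on Q (X : Cfun R n -> Cfun R n) :=
  (forall f, Q f -> Q (X f)) /\
  (forall (a : R[i]) f g, Q f -> Q g ->
     X (fun z => a * f z + g z) = (fun z => a * X f z + X g z)).

Definition opnorm Q (X : Cfun R n -> Cfun R n) : \bar R :=
  ereal_sup [set (H2norm (X f))%:E | f in [set f | Q f /\ H2norm f <= 1]].

Definition op_unit_ball Q : set (Cfun R n -> Cfun R n) :=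
  [set X | linear_on Q X /\ (opnorm Q X <= 1%:E)%E].

Definition module_map Q (X : Cfun R n -> Cfun R n) :=
  forall (i : 'I_n) f, Q f ->
    X (compression Q (coordf i) f) = compression Q (coordf i) (X f).

Definition boundary_set Q : set (Cfun R n) :=
  [set u | L2 u /\ exists2 f, Q f & {ae sigma, forall z, u z = bdry f z}].

Definition Qconj Q : set (Cfun R n) := conj_set (boundary_set Q).

Definition MQ Q : set (Cfun R n) := sum_set (Qconj Q) (sum_set MS H2S0).

Definition MQtilde Q psi : set (Cfun R n) :=
  sum_set (L2ominus (Qconj Q) [set (fun z => (bdry psi z)^*)])
          (sum_set MS H2S0).

Definition L1dist u S : \bar R := ereal_inf [set cLnorm 1%:E (u - v) | v in S].

Definition inner_functions : set (Cfun R n) :=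
  [set phi | Hinfty phi /\ {ae sigma, forall z, normc (bdry phi z) = 1}].

Definition pairing phi f : R[i] := cintegral (fun z => bdry phi z * f z).

End Hardy.

(* Main.v *)
(* An analytic function on the ball is the sum of its homogeneous components:
   Cauchy's theorem expands it along every complex line through 0, and a
   component is a polynomial because it is one along every line parallel to an
   axis. Components of different degrees are orthogonal, so H^2 is a space of
   square summable series; radial limits come from a maximal inequality for
   averages over rotations.

   (3) => (2): minimise the L^2 distance of the unit ball of L^infty to
   psi + Q^perp. The conjugate of the residual w belongs to M_Q, so moving
   towards - w / |w| decreases the distance unless w = 0.

   (5), (6): every Schur function is a limit of inner functions, obtained from a
   polynomial of norm < 1 by adding, with greedily chosen signs, peaking
   polynomials of high degree at the points of a separated set; and of extremal
   functions, which maximise the real part at 0 among the Schur functions with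
   prescribed values at finitely many points. *)
From HB Require Import structures.
Require Import Defs.
From mathcomp Require Import all_boot all_order all_algebra.
From mathcomp Require Import all_classical all_reals all_analysis.
From mathcomp Require Import complex measurable_realfun.
From mathcomp Require mpoly separable cyclotomic cyclic.
From mathcomp Require Import ring lra zify.
Import (canonicals) mpoly.

Set Implicit Arguments.
Unset Strict Implicit.
Unset Printing Implicit Defensive.

Import Order.TTheory GRing.Theory Num.Theory.
Import numFieldNormedType.Exports.
Import ComplexField.Normc.

Local Open Scope classical_set_scope.
Local Open Scope complex_scope.
Local Open Scope ring_scope.

Local Notation Re := complex.Re.
Local Notation Im := complex.Im.
Local Notation le_via y := (@le_trans _ _ y).
Local Notation "f @[ x --> F ] ~~> l" :=
  ((f : _[i]^o) @[x --> F] --> (l : _[i]^o)) (at level 60, x name, l at level 20).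

(** The measure is known only through its invariance under real rotations, so every quantitative
    fact is drawn from that. Reflections give caps of equal radius equal measure, and counting caps
    bounds this measure below by a power of the radius. Hence the sup norm of a homogeneous
    polynomial exceeds its L^2 norm by a factor at most polynomial in the degree, which any
    geometric factor absorbs. On the sphere, circle means are finite means over roots of unity; a
    Poisson kernel folded modulo m supplies positive weights that imitate dilations. Compactness
    always comes from an ultrafilter on [nat], which gives limits at all points and in all
    coefficients at once.

    For the equivalences, the point is that [MQ Q] is the annihilator of Q^perp for the bilinear
    pairing ([MQP]): its summands M(S) and H^2_0 do not see analytic functions. So (3), (5) and (6)
    depend on psi only modulo Q^perp, and (4) is the distance formula from a point where the
    functional is 1 to its kernel. *)

Lemma eqW d (T : porderType d) (a b : T) : a = b -> (a <= b)%O.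
Proof. by move=> ->. Qed.
Lemma half_gt0 (R : realType) (e : R) : 0 < e -> 0 < e / 2.
Proof. by move=> e0; rewrite divr_gt0. Qed.

(** * Complex numbers: modulus, convergence, roots of unity *)

Section ComplexBasics.
Context {R : realType}.
Implicit Types (x y z : R[i]) (a b : R).

Lemma normcE' x : `|x| = (normc x)%:C.
Proof. by case: x. Qed.
Lemma normc_ge0 x : 0 <= normc x.
Proof. by case: x => a b; exact: sqrtr_ge0. Qed.
Lemma normcR a : normc a%:C = `|a|.
Proof. by rewrite /= expr0n /= addr0 sqrtr_sqr. Qed.
Lemma normcJ' x : normc x^* = normc x.
Proof. by case: x => a b /=; rewrite sqrrN. Qed.
Lemma normcB x y : normc (x - y) = normc (y - x).
Proof. by rewrite -(normcN (x - y)) opprB. Qed.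
Lemma normcX x k : normc (x ^+ k) = normc x ^+ k.
Proof. by elim: k => [|k IH]; rewrite ?expr0 ?normc1 // !exprS normcM IH. Qed.
Lemma normc_eq0 x : (normc x == 0) = (x == 0).
Proof. by apply/eqP/eqP => [/eq0_normc //|->]; exact: normc0. Qed.
Lemma normc_gt0 x : (0 < normc x) = (x != 0).
Proof. by rewrite lt_def normc_eq0 normc_ge0 andbT. Qed.
Lemma normc_sqr x : (normc x ^+ 2) = Re x ^+ 2 + Im x ^+ 2.
Proof. by case: x => a b /=; rewrite sqr_sqrtr // addr_ge0 ?sqr_ge0. Qed.

Lemma mulcJ x : x * x^* = (normc x ^+ 2)%:C.
Proof.
by rewrite normc_sqr; case: x => a b /=; simpc; congr (_ +i* _); ring.
Qed.

Lemma le_normcB x y : normc (x - y) <= normc x + normc y.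
Proof. by rewrite -(normcN y); exact: le_normcD. Qed.
Lemma normcD_le x y a : normc x + normc y <= a -> normc (x + y) <= a.
Proof. exact: le_trans (le_normcD x y). Qed.
Lemma normcD_lt x y a : normc x + normc y < a -> normc (x + y) < a.
Proof. exact: le_lt_trans (le_normcD x y). Qed.
Lemma normcB_le x y a : normc x + normc y <= a -> normc (x - y) <= a.
Proof. exact: le_trans (le_normcB x y). Qed.

Lemma normc_sum_le I (r : seq I) (P : pred I) (F : I -> R[i]) a :
  \sum_(i <- r | P i) normc (F i) <= a -> normc (\sum_(i <- r | P i) F i) <= a.
Proof.
apply: le_trans; elim/big_rec2: _ => [|i y z Pi le]; first by rewrite normc0.
exact: le_trans (le_normcD _ _) (lerD _ _).
Qed.

Lemma eqc_small x y : (forall e, 0 < e -> normc (x - y) <= e) -> x = y.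
Proof.
move=> h; apply/eqP; rewrite -subr_eq0 -normc_eq0 eq_le normc_ge0 andbT.
by apply/ler_addgt0Pr => e /h; rewrite add0r.
Qed.

Lemma ler_dist_normc x y : `|normc x - normc y| <= normc (x - y).
Proof.
have h u v : normc u - normc v <= normc (u - v).
  by rewrite lerBlDr -{1}(subrK v u) le_normcD.
by rewrite ler_norml h lerNl opprB normcB h.
Qed.

Lemma Re_le_normc x : `|Re x| <= normc x.
Proof.
rewrite -(@ler_pXn2r _ 2) ?nnegrE ?normc_ge0 // normc_sqr real_normK ?num_real //.
by rewrite lerDl sqr_ge0.
Qed.

Lemma Im_le_normc x : `|Im x| <= normc x.
Proof.
rewrite -(@ler_pXn2r _ 2) ?nnegrE ?normc_ge0 // normc_sqr real_normK ?num_real //.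
by rewrite lerDr sqr_ge0.
Qed.

Lemma normc_le_ReIm x : normc x <= `|Re x| + `|Im x|.
Proof.
rewrite -(@ler_pXn2r _ 2) ?nnegrE ?normc_ge0 ?addr_ge0 // normc_sqr.
rewrite sqrrD !real_normK ?num_real // -addrA lerD2l lerDr.
by rewrite mulrn_wge0 ?mulr_ge0.
Qed.

Lemma ReD x y : Re (x + y) = Re x + Re y.
Proof. by case: x y => ? ? []. Qed.
Lemma ImD x y : Im (x + y) = Im x + Im y.
Proof. by case: x y => ? ? []. Qed.
Lemma ReN x : Re (- x) = - Re x.
Proof. by case: x. Qed.
Lemma ImN x : Im (- x) = - Im x.
Proof. by case: x. Qed.
Lemma ReM x y : Re (x * y) =
  Re x * Re y - Im x * Im y.
Proof. by case: x y => ? ? []. Qed.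
Lemma ImM x y : Im (x * y) =
  Re x * Im y + Im x * Re y.
Proof. by case: x y => ? ? [? ?] /=; rewrite [X in _ + X]mulrC. Qed.
Lemma ReJ x : Re x^* = Re x.
Proof. by case: x. Qed.
Lemma ImJ x : Im x^* = - Im x.
Proof. by case: x. Qed.

Lemma complexP x y :
  Re x = Re y -> Im x = Im y -> x = y.
Proof. by case: x y => ? ? [? ?] /= -> ->. Qed.

Lemma gtc0P x : 0 < x -> 0 < Re x /\ x = (Re x)%:C.
Proof. by rewrite ltcE /= => /andP[/eqP + ->]; case: x => a b /= ->. Qed.

Lemma cvgcP (T : Type) (F : set_system T) {FF : Filter F}
    (f : T -> R[i]) (l : R[i]) :
  (f x @[x --> F] ~~> l) <->
  (forall e : R, 0 < e -> \forall x \near F, normc (f x - l) < e).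
Proof.
split=> [h e e0|h].
  have e0' : (0 : R[i]) < e%:C by rewrite ltcR.
  move/cvgrPdist_lt : h => /(_ _ e0').
  apply: filterS => x /=.
  by rewrite normcE' ltcR normcB.
apply/cvgrPdist_lt => e e0.
have [e0' eE] := gtc0P e0.
apply: filterS (h _ e0') => x hx.
by rewrite eE normcE' ltcR normcB.
Qed.

Lemma cvgcM (T : Type) (F : set_system T) {FF : Filter F} (f g : T -> R[i]) (a b : R[i]) :
  f x @[x --> F] ~~> a ->
  g x @[x --> F] ~~> b ->
  (f x * g x) @[x --> F] ~~> (a * b).
Proof. exact: (@cvgM R[i] T F FF f g a b). Qed.

Lemma cvgcD (T : Type) (F : set_system T) {FF : Filter F} (f g : T -> R[i]) (a b : R[i]) :
  f x @[x --> F] ~~> a ->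
  g x @[x --> F] ~~> b ->
  (f x + g x) @[x --> F] ~~> (a + b).
Proof. exact: (@cvgD R[i] R[i]^o T F FF f g a b). Qed.

Lemma cvgc_cst (T : Type) (F : set_system T) {FF : Filter F} (a : R[i]) :
  a @[x --> F] ~~> a.
Proof. exact: cvg_cst. Qed.

Lemma cvgc_sum (T : Type) (F : set_system T) {FF : Filter F} I (r : seq I)
    (P : pred I) (f : I -> T -> R[i]) (a : I -> R[i]) :
  (forall i, P i -> f i x @[x --> F] ~~> a i) ->
  (\sum_(i <- r | P i) f i x) @[x --> F] ~~> (\sum_(i <- r | P i) a i).
Proof.
move=> h; elim: r => [|i r IH].
  by rewrite big_nil; under eq_fun do rewrite big_nil; exact: cvgc_cst.
rewrite big_cons; under eq_fun do rewrite big_cons.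
case: (P i) (h i) => [hi|_]; last exact: IH.
by apply: (cvgcD (hi isT) IH).
Qed.

Lemma cvgc_unique (T : Type) (F : set_system T) {FF : ProperFilter F} (f : T -> R[i]) (a b : R[i]) :
  f x @[x --> F] ~~> a ->
  f x @[x --> F] ~~> b -> a = b.
Proof. exact: (@cvg_unique _ (@norm_hausdorff _ R[i]^o)). Qed.

(** X^m - 1 splits over the algebraically closed field [R[i]] and is separable, so it has m distinct
    roots, and a finite group of roots of unity is cyclic. *)
Lemma prim_root_exists (m : nat) : (0 < m)%N -> exists w : R[i], m.-primitive_root w.
Proof.
move=> m0; pose p : {poly R[i]} := 'X^m - 1.
have [r Dp] := closed_field_poly_normal p.
rewrite (monicP _) ?monicXnsubC // scale1r in Dp.
have rn1 : all m.-unity_root r by apply/allP=> z; rewrite -root_prod_XsubC -Dp.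
have sz_r : (m < (size r).+1)%N.
  by rewrite -(size_prod_XsubC r id) -Dp size_XnsubC.
have [|z] := hasP (cyclic.has_prim_root m0 rn1 _ sz_r); last by exists z.
by rewrite -separable.separable_prod_XsubC -Dp cyclotomic.separable_Xn_sub_1 // pnatr_eq0 -lt0n.
Qed.

Lemma normc_unity (m : nat) (w : R[i]) : (0 < m)%N -> w ^+ m = 1 -> normc w = 1.
Proof.
move=> m0 /(congr1 (fun x : R[i] => normc x)); rewrite normcX normc1 => /eqP.
by rewrite pexpr_eq1 ?normc_ge0 -?lt0n // => /eqP.
Qed.

(** Orthogonality of the characters of Z/m. It extracts a coefficient from a finite mean over
    rotations, in place of an integral over the circle. *)
Lemma sum_prim_root (m : nat) (w : R[i]) (k : nat) : m.-primitive_root w ->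
  \sum_(l < m) w ^+ (l * k) = if (m %| k)%N then m%:R else 0.
Proof.
move=> wp; have wm := prim_expr_order wp.
rewrite (prim_order_dvd wp).
under eq_bigr do rewrite mulnC exprM.
have [->|wk] := eqVneq (w ^+ k) 1.
  by rewrite (eq_bigr (fun=> 1)) ?sumr_const ?card_ord // => i _; rewrite expr1n.
have : (w ^+ k - 1) * (\sum_(l < m) (w ^+ k) ^+ l) = 0.
  by rewrite -subrX1 -exprM mulnC exprM wm expr1n subrr.
by move/eqP; rewrite mulf_eq0 subr_eq0 (negbTE wk) /= => /eqP.
Qed.

End ComplexBasics.

#[global] Hint Extern 0 (is_true (_ <= normc _)) => exact: normc_ge0 : core.

(** * The Euclidean norm and the Hermitian product *)

Section EuclideanNorm.
Context {R : realType} {n : nat}.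
Local Notation CN := (Cn R n : normedModType R[i]).
Implicit Types (z w h : Cn R n) (f g : Cfun R n).

(** Lagrange's identity: the double sum of squares is twice the difference of the two sides. *)
Lemma CauchySchwarz_sum (I : finType) (a b : I -> R) :
  (\sum_i a i * b i) ^+ 2 <= (\sum_i a i ^+ 2) * (\sum_i b i ^+ 2).
Proof.
have : 0 <= \sum_i \sum_j (a i * b j - a j * b i) ^+ 2.
  by apply: sumr_ge0 => i _; apply: sumr_ge0 => j _; exact: sqr_ge0.
have -> : \sum_i \sum_j (a i * b j - a j * b i) ^+ 2 =
   \sum_i \sum_j (a i ^+ 2 * b j ^+ 2) + \sum_i \sum_j (a j ^+ 2 * b i ^+ 2)
   - 2 * \sum_i \sum_j (a i * b i) * (a j * b j).
  rewrite mulr_sumr -big_split -sumrB /=; apply: eq_bigr => i _.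
  by rewrite mulr_sumr -big_split -sumrB /=; apply: eq_bigr => j _; ring.
rewrite [X in _ + X - _]exchange_big /=.
have E (u v : I -> R) : \sum_i \sum_j u i * v j = (\sum_i u i) * (\sum_j v j).
  by rewrite mulr_suml; apply: eq_bigr => i _; rewrite mulr_sumr.
rewrite (E (fun i => a i ^+ 2) (fun i => b i ^+ 2)).
rewrite (E (fun i => a i * b i) (fun i => a i * b i)) expr2; lra.
Qed.

Lemma enorm_ge0 z : 0 <= enorm z.
Proof. exact: sqrtr_ge0. Qed.
Lemma enorm_sqr z : enorm z ^+ 2 = \sum_(i < n) normc (z 0 i) ^+ 2.
Proof. by rewrite sqr_sqrtr //; apply: sumr_ge0 => i _; exact: sqr_ge0. Qed.

Lemma enormZ (a : R[i]) z : enorm (a *: z) = normc a * enorm z.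
Proof.
rewrite -[normc a]ger0_norm // -sqrtr_sqr -sqrtrM ?sqr_ge0 //.
congr Num.sqrt; rewrite mulr_sumr; apply: eq_bigr => i _.
by rewrite mxE normcM exprMn.
Qed.

Lemma enormZR (a : R) z : 0 <= a -> enorm (a%:C *: z) = a * enorm z.
Proof. by move=> a0; rewrite enormZ normcR ger0_norm. Qed.

Lemma normc_le_enorm z i : normc (z 0 i) <= enorm z.
Proof.
rewrite -(@ler_pXn2r _ 2) ?nnegrE ?enorm_ge0 // enorm_sqr.
by rewrite (bigD1 i) //= lerDl sumr_ge0 // => j _; exact: sqr_ge0.
Qed.

Lemma enorm_eq0 z : enorm z = 0 -> z = 0.
Proof.
move=> h; apply/matrixP => i j; rewrite ord1 mxE; apply: eq0_normc; apply/eqP.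
by rewrite eq_le normc_ge0 andbT -h normc_le_enorm.
Qed.

Definition hdot z w : R[i] := \sum_(i < n) z 0 i * (w 0 i)^*.

Lemma hdotDl z z' w : hdot (z + z') w = hdot z w + hdot z' w.
Proof. by rewrite -big_split; apply: eq_bigr => i _; rewrite mxE mulrDl. Qed.
Lemma hdotZl a z w : hdot (a *: z) w = a * hdot z w.
Proof. by rewrite mulr_sumr; apply: eq_bigr => i _; rewrite mxE mulrA. Qed.

Lemma conjc_sum I (r : seq I) (P : pred I) (F : I -> R[i]) :
  (\sum_(i <- r | P i) F i)^* = \sum_(i <- r | P i) (F i)^*.
Proof. exact: rmorph_sum. Qed.

Lemma conjcM (x y : R[i]) : (x * y)^* = x^* * y^*.
Proof. exact: rmorphM. Qed.
Lemma conjcD (x y : R[i]) : (x + y)^* = x^* + y^*.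
Proof. exact: rmorphD. Qed.
Lemma conjcN (x : R[i]) : (- x)^* = - x^*.
Proof. exact: rmorphN. Qed.
Lemma conjcB (x y : R[i]) : (x - y)^* = x^* - y^*.
Proof. exact: rmorphB. Qed.
Lemma conjcK' (x : R[i]) : x^*^* = x.
Proof. exact: conjCK. Qed.

Lemma hdotC z w : hdot z w = (hdot w z)^*.
Proof.
rewrite /hdot conjc_sum; apply: eq_bigr => i _.
by rewrite conjcM conjcK' mulrC.
Qed.

Lemma hdotDr z w w' : hdot z (w + w') = hdot z w + hdot z w'.
Proof. by rewrite hdotC hdotDl conjcD -!hdotC. Qed.
Lemma hdotZr a z w : hdot z (a *: w) = a^* * hdot z w.
Proof. by rewrite hdotC hdotZl conjcM -hdotC. Qed.

Lemma hdotzz z : hdot z z = (enorm z ^+ 2)%:C.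
Proof.
rewrite enorm_sqr rmorph_sum; apply: eq_bigr => i _.
by rewrite mulcJ.
Qed.

Lemma normc_hdot_le z w : normc (hdot z w) <= enorm z * enorm w.
Proof.
apply: normc_sum_le.
rewrite -(@ler_pXn2r _ 2) ?nnegrE ?mulr_ge0 ?enorm_ge0 ?sumr_ge0 //.
rewrite exprMn !enorm_sqr; under eq_bigr do rewrite normcM normcJ'.
exact: CauchySchwarz_sum.
Qed.

Lemma enormD_sqr z w :
  enorm (z + w) ^+ 2 = enorm z ^+ 2 + enorm w ^+ 2 + 2 * Re (hdot z w).
Proof.
have : hdot (z + w) (z + w) = hdot z z + hdot w w + (hdot z w + hdot w z).
  by rewrite !(hdotDl, hdotDr); ring.
rewrite !hdotzz (hdotC w z) => /(congr1 (@Re R)) /=.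
by rewrite /= !ReD ReJ /= => ->; ring.
Qed.

Lemma enormN z : enorm (- z) = enorm z.
Proof. by rewrite -scaleN1r enormZ normcN normc1 mul1r. Qed.
Lemma enorm0 : enorm (0 : Cn R n) = 0.
Proof. by rewrite -(scale0r (0 : Cn R n)) enormZ normc0 mul0r. Qed.
Lemma enormB z w : enorm (z - w) = enorm (w - z).
Proof. by rewrite -enormN opprB. Qed.

Lemma enormD z w : enorm (z + w) <= enorm z + enorm w.
Proof.
rewrite -(@ler_pXn2r _ 2) ?nnegrE ?addr_ge0 ?enorm_ge0 //.
rewrite enormD_sqr sqrrD [leRHS]addrAC lerD2l -[leRHS]mulr_natl ler_pM2l //.
apply: le_trans (ler_norm _) _; apply: le_trans (Re_le_normc _) _.
exact: normc_hdot_le.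
Qed.

Lemma enorm_lt_sum z : enorm z <= \sum_(i < n) normc (z 0 i).
Proof.
have h0 i : 0 <= normc (z 0 i) by exact: normc_ge0.
rewrite -(@ler_pXn2r _ 2) ?nnegrE ?enorm_ge0 ?sumr_ge0 // enorm_sqr.
rewrite [leRHS]expr2 mulr_suml; apply: ler_sum => i _.
rewrite expr2 ler_wpM2l // (bigD1 i) //= lerDl sumr_ge0 //.
Qed.

Lemma nbhs_enormP z (A : set (Cn R n)) :
  nbhs (z : CN) A <->
  exists2 e : R, 0 < e & forall w, enorm (w - z) < e -> A w.
Proof.
split.
  move/nbhs_ballP => [e /= e0 he].
  have [e0' eE] := gtc0P e0.
  exists (Re e) => // w hw; apply: he; split => // i j.
  rewrite /ball /= ord1 eE normcE' ltcR normcB.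
  by apply: le_lt_trans hw; have := normc_le_enorm (w - z) j; rewrite !mxE.
move=> [e e0 he]; apply/nbhs_ballP.
(* Division by n + 1 rather than n covers n = 0 and makes the sum of n such bounds strictly smaller
   than e. *)
exists ((e / n.+1%:R)%:C) => /=; first by rewrite ltcR divr_gt0.
move=> w [_ hw]; apply: he; apply: le_lt_trans (enorm_lt_sum _) _.
apply: (@le_lt_trans _ _ (\sum_(i < n) e / n.+1%:R)).
  apply: ler_sum => i _; have := hw 0 i; rewrite /ball /= normcE' ltcR normcB.
  by rewrite !mxE => /ltW.
rewrite sumr_const card_ord -[X in X < _]mulr_natr mulrAC ltr_pdivrMr //.
by rewrite ltr_pM2l ?ltr_nat.
Qed.

Lemma contP f z : {for z, continuous (f : CN -> R[i]^o)} <->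
  (forall e : R, 0 < e -> exists2 d : R, 0 < d &
     forall w, enorm (w - z) < d -> normc (f w - f z) < e).
Proof.
split.
  move=> /cvgcP h e e0; have /nbhs_enormP[d d0 hd] := h e e0.
  by exists d.
have FF : Filter (nbhs (z : CN)) by exact: nbhs_filter.
move=> h; apply: (proj2 (@cvgcP R _ _ FF _ _)) => e e0; apply/nbhs_enormP; exact: h.
Qed.

End EuclideanNorm.

#[global] Hint Extern 0 (is_true (_ <= enorm _)) => exact: enorm_ge0 : core.

(** * Polynomial functions and separate interpolation *)

Section PolynomialFunctions.
Context {R : realType} {n : nat}.
Local Notation CN := (Cn R n : normedModType R[i]).
Implicit Types (z w h : Cn R n) (f g : Cfun R n) (k : nat).

Definition ispoly f := exists p : mpoly.mpoly n R[i], f = mpolyf p.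

Definition hpoly k f := ispoly f /\ forall a z, f (a *: z) = a ^+ k * f z.

Lemma ispoly_cst c : ispoly (fun=> c).
Proof. by exists (mpoly.mpolyC n c); apply/funext => z; rewrite /mpolyf mpoly.mevalC. Qed.
Lemma ispoly_coord i : ispoly (coordf i).
Proof. by exists (mpoly.mpolyX R[i] (mpoly.mnm1 i)); apply/funext => z; rewrite /mpolyf mpoly.mevalXU. Qed.

Lemma ispolyD f g : ispoly f -> ispoly g -> ispoly (fun z => f z + g z).
Proof.
move=> [p ->] [q ->]; exists (p + q); apply/funext => z.
by rewrite /mpolyf mpoly.mevalD.
Qed.

Lemma ispolyM f g : ispoly f -> ispoly g -> ispoly (fun z => f z * g z).
Proof.
move=> [p ->] [q ->]; exists (p * q); apply/funext => z.
by rewrite /mpolyf mpoly.mevalM.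
Qed.

Lemma ispoly_sum I (r : seq I) (P : pred I) (F : I -> Cfun R n) :
  (forall i, P i -> ispoly (F i)) -> ispoly (fun z => \sum_(i <- r | P i) F i z).
Proof.
move=> h; elim: r => [|i r IH].
  by under eq_fun do rewrite big_nil; exact: ispoly_cst.
under eq_fun do rewrite big_cons.
by case: (boolP (P i)) => // Pi; apply: ispolyD => //; exact: h.
Qed.

Lemma ispoly_prod I (r : seq I) (P : pred I) (F : I -> Cfun R n) :
  (forall i, P i -> ispoly (F i)) -> ispoly (fun z => \prod_(i <- r | P i) F i z).
Proof.
move=> h; elim: r => [|i r IH].
  by under eq_fun do rewrite big_nil; exact: ispoly_cst.
under eq_fun do rewrite big_cons.
by case: (boolP (P i)) => // Pi; apply: ispolyM => //; exact: h.
Qed.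

Lemma ispolyZ c f : ispoly f -> ispoly (fun z => c * f z).
Proof. by move=> hf; apply: ispolyM => //; exact: ispoly_cst. Qed.

Lemma ispolyX f k : ispoly f -> ispoly (fun z => f z ^+ k).
Proof.
move=> hf; elim: k => [|k IH].
  by under eq_fun do rewrite expr0; exact: ispoly_cst.
by under eq_fun do rewrite exprS; exact: ispolyM.
Qed.

Lemma ispolyB f g : ispoly f -> ispoly g -> ispoly (fun z => f z - g z).
Proof.
move=> hf hg; have -> : (fun z => f z - g z) = (fun z => f z + (-1) * g z).
  by apply/funext => z; rewrite mulN1r.
by apply: ispolyD => //; exact: ispolyZ.
Qed.

Lemma ispoly_comp_poly f (q : {poly R[i]}) : ispoly f -> ispoly (fun z => q.[f z]).
Proof.
move=> hf; under eq_fun do rewrite horner_coef.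
by apply: ispoly_sum => i _; apply: ispolyZ; exact: ispolyX.
Qed.

(** Replaces the monomial representation by an induction on ring operations; continuity, expansions
    along lines, Lipschitz bounds and the stability of Q^perp all use it. *)
Lemma ispoly_ind (P : Cfun R n -> Prop) :
  (forall c, P (fun=> c)) -> (forall i, P (coordf i)) ->
  (forall f g, P f -> P g -> P (fun z => f z + g z)) ->
  (forall f g, P f -> P g -> P (fun z => f z * g z)) ->
  forall f, ispoly f -> P f.
Proof.
move=> Pc Px PD PM f [p ->].
have -> : mpolyf p = fun z => \sum_(m <- mpoly.msupp p) mpoly.mcoeff m p *
    \prod_(i < n) z 0 i ^+ mpoly.fun_of_multinom m i.
  by apply/funext => z; rewrite /mpolyf mpoly.mevalE.
elim: (mpoly.msupp p) => [|m r IH].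
  by under eq_fun do rewrite big_nil; exact: Pc.
under eq_fun do rewrite big_cons.
apply: (PD _ _ _ IH); apply: (PM (fun=> _)); first exact: Pc.
elim: (index_enum _) => [|i s IHs].
  by under eq_fun do rewrite big_nil; exact: Pc.
under eq_fun do rewrite big_cons.
apply: (PM _ _ _ IHs); elim: (mpoly.fun_of_multinom m i) => [|k IHk].
  by under eq_fun do rewrite expr0; exact: Pc.
by under eq_fun do rewrite exprS; apply: (PM _ _ (Px i) IHk).
Qed.

Lemma ispoly_cont f : ispoly f ->
  continuous (f : CN -> R[i]^o).
Proof.
elim/ispoly_ind => [c|i|f1 f2 h1 h2|f1 f2 h1 h2] z.
- exact: cst_continuous.
- by apply/contP => e e0; exists e => // w; apply: le_lt_trans;
    have := normc_le_enorm (w - z) i; rewrite !mxE.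
- exact: (cvgcD (h1 z) (h2 z)).
- exact: (cvgcM (h1 z) (h2 z)).
Qed.

Lemma poly_eq0 (p : {poly R[i]}) : (forall x, p.[x] = 0) -> p = 0.
Proof.
move=> h; apply/eqP; apply: contraT => p0.
have := @max_poly_roots _ p [seq i%:R | i <- iota 0 (size p)] p0.
rewrite size_map size_iota ltnn => -> //.
  by apply/allP => x _; rewrite rootE h.
by rewrite map_inj_uniq ?iota_uniq // => i j /eqP; rewrite eqr_nat => /eqP.
Qed.

Definition hpart (p : mpoly.mpoly n R[i]) k : Cfun R n := fun z =>
  \sum_(m <- mpoly.msupp p | mpoly.mdeg m == k) mpoly.mcoeff m p *
    \prod_(i < n) z 0 i ^+ mpoly.fun_of_multinom m i.

Lemma hpoly_hpart p k : hpoly k (hpart p k).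
Proof.
split=> [|a z].
  apply: ispoly_sum => m _; apply: ispolyZ; apply: ispoly_prod => i _.
  by apply: (@ispolyX (coordf i)); exact: ispoly_coord.
rewrite /hpart mulr_sumr; apply: eq_bigr => m /eqP <-.
rewrite mulrCA; congr (_ * _); rewrite mpoly.mdegE -prodrXr -big_split /=.
by apply: eq_bigr => i _; rewrite mxE exprMn.
Qed.

Lemma mpolyf_hpart p : exists d0 : nat, forall d, (d0 <= d)%N -> forall z,
  mpolyf p z = \sum_(k < d) hpart p k z.
Proof.
have [d0 hd0] : exists d : nat, forall m, m \in mpoly.msupp p -> (mpoly.mdeg m < d)%N.
  exists (\max_(m <- mpoly.msupp p) (mpoly.mdeg m)).+1 => m mp.
  by rewrite ltnS; apply: (@leq_bigmax_seq _ _ predT).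
exists d0 => d dd z; rewrite /mpolyf mpoly.mevalE /hpart [RHS](exchange_big_dep predT) //=.
rewrite !big_seq; apply: eq_bigr => m mp.
by rewrite (big_pred1 (Ordinal (leq_trans (hd0 _ mp) dd))).
Qed.

Lemma ispoly_decomp f : ispoly f -> exists d (F : nat -> Cfun R n),
  (forall k, hpoly k (F k)) /\ forall z, f z = \sum_(k < d) F k z.
Proof.
move=> [p ->]; have [d h] := mpolyf_hpart p.
by exists d, (hpart p); split=> [k|]; [exact: hpoly_hpart|exact: h].
Qed.

(** On the line through z both sides are polynomials in the scalar, and an infinite field separates
    polynomials; the coefficients of X^k are compared. *)
Lemma hpoly_uniq d (F : nat -> Cfun R n) k f : (forall k, hpoly k (F k)) ->
  hpoly k f -> (forall z, f z = \sum_(j < d) F j z) ->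
  f = if (k < d)%N then F k else fun=> 0.
Proof.
move=> hF [_ hf] fE; apply/funext => z.
pose q : {poly R[i]} := \poly_(j < d) F j z - f z *: 'X^k.
have : q = 0.
  apply: poly_eq0 => x; rewrite !hornerE horner_poly mulrC -hf fE.
  by apply/eqP; rewrite subr_eq0; apply/eqP; apply: eq_bigr => j _;
    rewrite (hF j).2 mulrC.
move=> /(congr1 (fun p : {poly R[i]} => p`_k)); rewrite coefB coef_poly coefZ coefXn eqxx.
by rewrite coef0 mulr1 => /eqP; rewrite subr_eq0 => /eqP <-; case: ifP.
Qed.

Definition set_coord (i : 'I_n) (a : R[i]) z : Cn R n :=
  \row_j (if j == i then a else z 0 j).

(** Lagrange basis polynomial for the nodes 0, ..., k. *)
Definition lagr k (a : 'I_k.+1) : {poly R[i]} :=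
  \prod_(b < k.+1 | b != a) ((a%:R - b%:R)^-1 *: ('X - b%:R%:P)).

Lemma size_lagr k (a : 'I_k.+1) : (size (lagr a) <= k.+1)%N.
Proof.
rewrite /lagr; apply: leq_trans (size_prod_leq _ _) _.
rewrite leq_subLR; apply: leq_ltn_trans (leq_sum _ (E2 := fun=> 2%N) _) _.
  by move=> b _; apply: leq_trans (size_scale_leq _ _) _; rewrite size_XsubC.
rewrite sum_nat_const; have -> : #|[pred b | b != a]| = k.
  by have := cardC1 a; rewrite card_ord.
by rewrite muln2 addnS -addnn leqnn.
Qed.

Lemma lagr_node k (a c : 'I_k.+1) : (lagr a).[c%:R] = (c == a)%:R.
Proof.
rewrite /lagr horner_prod; have [->|ca] := eqVneq c a.
  apply: big1 => b ba; rewrite !hornerE mulVf // subr_eq0 eqr_nat.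
  by apply: contra ba => /eqP h; apply/eqP/val_inj.
by rewrite (bigD1 c) //= !hornerE subrr mulr0 mul0r.
Qed.

Lemma lagr_interp k (q : {poly R[i]}) x : (size q <= k.+1)%N ->
  q.[x] = \sum_(a < k.+1) q.[a%:R] * (lagr a).[x].
Proof.
move=> sq; pose r := q - \sum_(a < k.+1) q.[a%:R] *: lagr a.
suff r0 : r = 0.
  have : r.[x] = 0 by rewrite r0 horner0.
  rewrite /r hornerD hornerN horner_sum => /eqP; rewrite subr_eq0 => /eqP ->.
  by apply: eq_bigr => a _; rewrite hornerZ.
apply/eqP; apply: contraT => r0.
have sr : (size r <= k.+1)%N.
  apply: leq_trans (size_polyD _ _) _; rewrite geq_max sq size_polyN.
  apply: leq_trans (size_sum _ _ _) _; apply/bigmax_leqP => a _.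
  exact: leq_trans (size_scale_leq _ _) (size_lagr _).
have := @max_poly_roots _ r [seq i%:R | i <- iota 0 k.+1] r0.
rewrite size_map size_iota ltnNge sr; apply => //.
  apply/allP => y /mapP[j]; rewrite mem_iota add0n => /= jk ->.
  rewrite rootE /r hornerD hornerN horner_sum (bigD1 (Ordinal jk)) //=.
  rewrite big1 ?addr0 => [|a aj]; rewrite !hornerE (lagr_node _ (Ordinal jk)).
    by rewrite eqxx mulr1 subrr.
  by rewrite eq_sym (negbTE aj) mulr0.
by rewrite map_inj_uniq ?iota_uniq // => i j /eqP; rewrite eqr_nat => /eqP.
Qed.

(** A polynomial of degree at most k in each variable separately, expressed through finitely many
    values of f: in this form the property can be used for functions about which nothing else is
    known. *)
Definition seppoly k f := forall (i : 'I_n) z,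
  f z = \sum_(a < k.+1) f (set_coord i a%:R z) * (lagr a).[z 0 i].

(** Interpolating one coordinate after the other leaves only values of f on a finite grid. Nodes and
    coefficients do not depend on f, so for these functions pointwise convergence is the convergence
    of finitely many numbers. *)
Lemma seppoly_interp k : exists (A : finType) (nd : A -> Cn R n) (L : A -> Cfun R n),
  (forall a, ispoly (L a)) /\
  forall f, seppoly k f -> forall z, f z = \sum_a f (nd a) * L a z.
Proof.
(* [mix j v z] takes its first j coordinates from v and the others from z; the induction replaces
   one coordinate of z at a time. *)
pose mix j (v z : Cn R n) : Cn R n := \row_i (if (i < j)%N then v 0 i else z 0 i).
suff H j : (j <= n)%N ->
  exists (A : finType) (nd : A -> Cn R n) (L : A -> Cfun R n),
  (forall a, ispoly (L a)) /\
  forall f, seppoly k f -> forall z, f z = \sum_a f (mix j (nd a) z) * L a z.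
  have [A [nd [L [h1 h2]]]] := H n (leqnn n); exists A, nd, L; split => // f hf z.
  rewrite (h2 f hf z); apply: eq_bigr => a _; congr (f _ * _).
  by apply/matrixP => x y; rewrite mxE ltn_ord ord1.
elim: j => [_|j IH jn].
  exists unit, (fun=> 0), (fun _ _ => 1); split=> [_|f hf z]; first exact: ispoly_cst.
  rewrite (big_pred1 tt) ?mulr1; last by case.
  by congr f; apply/matrixP => x y; rewrite mxE ord1.
have [A [nd [L [h1 h2]]]] := IH (ltnW jn); pose oj := Ordinal jn.
exists (A * 'I_k.+1)%type,
  (fun ab : A * 'I_k.+1 => set_coord oj (nat_of_ord ab.2)%:R (nd ab.1)),
  (fun (ab : A * 'I_k.+1) z => L ab.1 z * (lagr ab.2).[z 0 oj]);
  split=> [[a b]|f hf z] /=.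
  apply: ispolyM => //; apply: (@ispoly_comp_poly (coordf oj)); exact: ispoly_coord.
rewrite (h2 f hf z) -(pair_bigA _ (fun (a : A) (b : 'I_k.+1) =>
  f (mix j.+1 (set_coord oj b%:R (nd a)) z) * (L a z * (lagr b).[z 0 oj]))) /=.
apply: eq_bigr => a _; rewrite (hf oj) mulr_suml; apply: eq_bigr => b _.
rewrite -mulrA [in X in _ = X](mulrC (L a z)); congr (f _ * (_ * _)).
  apply/matrixP => x y; rewrite !mxE ltnS.
  have [->|yj] := eqVneq y oj; first by rewrite leqnn.
  by rewrite [(y <= j)%N]leq_eqVlt; move: yj; rewrite -val_eqE /= => /negbTE ->.
by rewrite mxE /= ltnn.
Qed.

(** By uniqueness of components, f consists of the monomials of degree k of any polynomial that
    represents it, and each of these has degree at most k in each variable. *)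
Lemma hpoly_seppoly k f : hpoly k f -> seppoly k f.
Proof.
move=> hf; have [p fp] := hf.1.
have fE : f = hpart p k.
  have [d0 hd] := mpolyf_hpart p.
  rewrite (hpoly_uniq (d := maxn d0 k.+1) (hpoly_hpart p) hf); last first.
    by rewrite {1}fp; apply: hd; exact: leq_maxl.
  by rewrite leq_max ltnSn orbT.
move=> i z; rewrite fE /hpart; under [RHS]eq_bigr do rewrite mulr_suml.
rewrite exchange_big /=; apply: eq_bigr => m /eqP mk.
have mi : (mpoly.fun_of_multinom m i <= k)%N.
  by rewrite -mk mpoly.mdegE (bigD1 i) //= leq_addr.
under [RHS]eq_bigr do rewrite -mulrA.
rewrite -mulr_sumr; congr (_ * _); rewrite (bigD1 i) //=.
have sX : (size ('X^(mpoly.fun_of_multinom m i) : {poly R[i]}) <= k.+1)%N.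
  by rewrite size_polyXn ltnS.
have := lagr_interp (z 0 i) sX; rewrite hornerXn => ->.
rewrite mulr_suml; apply: eq_bigr => a _; rewrite hornerXn.
rewrite [in RHS](bigD1 i) //= !mxE eqxx mulrAC; congr (_ * _ * _).
by apply: eq_bigr => j ji; rewrite mxE (negbTE ji).
Qed.

Lemma hpoly_lim (T : Type) (F : set_system T) {FF : ProperFilter F} k
    (fs : T -> Cfun R n) f :
  (forall t, hpoly k (fs t)) ->
  (forall z, fs t z @[t --> F] ~~> f z) -> hpoly k f.
Proof.
move=> hfs hlim; have [A [nd [L [h1 h2]]]] := seppoly_interp k.
have fE z : f z = \sum_a f (nd a) * L a z.
  have : fs t z @[t --> F] ~~> (\sum_a f (nd a) * L a z).
    under eq_fun do rewrite (h2 _ (hpoly_seppoly (hfs _))).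
    apply: cvgc_sum => a _; apply: cvgcM; [exact: hlim|exact: cvgc_cst].
  exact: (cvgc_unique (hlim z)).
split=> [|a z].
  by rewrite (funext fE); apply: ispoly_sum => a _; exact: ispolyZ.
apply: (cvgc_unique (hlim _)).
under eq_fun do rewrite (hfs _).2.
by apply: cvgcM; [exact: cvgc_cst|exact: hlim].
Qed.

(** The vector l is the gradient at z. It is chosen before the direction h, so the linear terms
    along all the lines through z come from one linear form. *)
Lemma poly_line f : ispoly f -> forall z, exists l : Cn R n, forall h,
  exists q : {poly R[i]}, [/\ forall a, f (z + a *: h) = q.[a], q`_0 = f z &
    q`_1 = \sum_i l 0 i * h 0 i].
Proof.
elim/ispoly_ind => [c|i|f1 f2 h1 h2|f1 f2 h1 h2] z.
- exists 0 => h; exists c%:P; split=> [a||]; rewrite ?hornerC ?coefC //=.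
  by rewrite big1 // => j _; rewrite mxE mul0r.
- exists (delta_mx 0 i) => h; exists ((z 0 i)%:P + h 0 i *: 'X); split=> [a||].
  + by rewrite /coordf !mxE !hornerE mulrC.
  + by rewrite coefD coefC coefZ coefX /= mulr0 addr0.
  + rewrite coefD coefC coefZ coefX /= mulr1 add0r (bigD1 i) //= mxE !eqxx mul1r.
    by rewrite big1 ?addr0 // => j ji; rewrite mxE (negbTE ji) andbF mul0r.
- have [l1 H1] := h1 z; have [l2 H2] := h2 z; exists (l1 + l2) => h.
  have [q1 [A1 B1 C1]] := H1 h; have [q2 [A2 B2 C2]] := H2 h.
  exists (q1 + q2); split=> [a||]; rewrite ?hornerD ?coefD ?A1 ?A2 ?B1 ?B2 //.
  by rewrite C1 C2 -big_split; apply: eq_bigr => j _; rewrite mxE mulrDl.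
- have [l1 H1] := h1 z; have [l2 H2] := h2 z; exists (f2 z *: l1 + f1 z *: l2) => h.
  have [q1 [A1 B1 C1]] := H1 h; have [q2 [A2 B2 C2]] := H2 h.
  exists (q1 * q2); split=> [a||]; rewrite ?hornerM ?coefM ?A1 ?A2 //.
    by rewrite big_ord_recl big_ord0 /= addr0 B1 B2.
  rewrite !big_ord_recl big_ord0 /= addr0 B1 B2 /bump /= C1 C2.
  rewrite mulr_sumr mulr_suml -big_split; apply: eq_bigr => j _.
  by rewrite !mxE mulrDl /=; ring.
Qed.

(** The mean of q over the m-th roots of unity, twisted by the power - j, isolates the coefficient j
    as soon as m exceeds both j and the size of q. *)
Lemma cauchy_estimate (q : {poly R[i]}) (r M : R) j : 0 <= r ->
  (forall a, normc a = r -> normc q.[a] <= M) -> normc q`_j * r ^+ j <= M.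
Proof.
move=> r0 hM; pose m := (size q + j).+1.
have [w wp] := @prim_root_exists R m isT.
have wn i : normc (w ^+ i) = 1.
  by rewrite normcX (@normc_unity _ m w) ?expr1n ?(prim_expr_order wp).
have jm : (j < m)%N by rewrite ltnS leq_addl.
have E : \sum_(l < m) q.[r%:C * w ^+ l] * w ^+ (l * (m - j)) = m%:R * (q`_j * r%:C ^+ j).
  have qE a : q.[a] = \sum_(i < m) q`_i * a ^+ i.
    rewrite (horner_coef_wide a (n := m)) // ltnW // ltnS; exact: leq_addr.
  under eq_bigr do rewrite qE mulr_suml.
  rewrite exchange_big /= (bigD1 (Ordinal jm)) //= [X in _ + X]big1 ?addr0.
    rewrite (eq_bigr (fun=> q`_j * r%:C ^+ j)) ?sumr_const ?card_ord ?mulr_natl // => l _.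
    rewrite exprMn -mulrA -mulrA -exprM -exprD -mulnDr subnKC 1?ltnW //.
    by rewrite mulnC exprM (prim_expr_order wp) expr1n mulr1.
  move=> i ij; under eq_bigr => l _.
    rewrite exprMn -mulrA -mulrA -exprM -exprD -mulnDr; over.
  rewrite -!mulr_sumr (sum_prim_root _ wp) ifF ?mulr0 //.
  apply/negbTE; apply: contra ij => mdvd; apply/eqP/val_inj => /=.
  have im := ltn_ord i; move: mdvd => /dvdnP[[|[|c]]].
  - by rewrite mul0n; lia.
  - by rewrite mul1n; lia.
  - by rewrite !mulSn; lia.
have m0 : 0 < m%:R :> R by rewrite ltr0n.
rewrite -(ler_pM2l m0) -[r in normc _ * r ^+ j]ger0_norm // -(normcR r) -normcX -normcM.
have -> : (m%:R : R) = normc (m%:R : R[i]).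
  by rewrite -(rmorph_nat (real_complex R)) normcR ger0_norm.
rewrite -normcM -E; apply: normc_sum_le.
rewrite -(rmorph_nat (real_complex R)) normcR ger0_norm //.
rewrite -[m in leRHS]card_ord mulr_natl -sumr_const; apply: ler_sum => l _.
by rewrite normcM wn mulr1 hM // normcM wn mulr1 normcR ger0_norm.
Qed.

End PolynomialFunctions.

(** * Cauchy's theorem in one variable *)

Section ComplexIntegral.
Context {R : realType}.
Local Notation mu := (@lebesgue_measure R).
Implicit Types (a b c d : R) (h k : R -> R[i]).

Definition cint a b h : R[i] :=
  (\int[mu]_(x in `[a, b]) Re (h x)) +i* (\int[mu]_(x in `[a, b]) Im (h x)).

Definition ccont a b h := forall x, a <= x <= b -> forall e : R, 0 < e ->
  exists2 d : R, 0 < d & forall y, `|y - x| < d -> normc (h y - h x) < e.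

Lemma ccontD a b h k : ccont a b h -> ccont a b k -> ccont a b (fun x => h x + k x).
Proof.
move=> H K x xab e e0; have e2 : 0 < e / 2 by lra.
have [d d0 Hd] := H x xab _ e2; have [d' d0' Kd] := K x xab _ e2.
exists (Num.min d d'); first by rewrite lt_min d0.
move=> y; rewrite lt_min => /andP[y1 y2].
rewrite opprD addrACA; apply: normcD_lt.
by rewrite (splitr e) ltrD ?Hd ?Kd.
Qed.

Lemma ccontZ a b q h : ccont a b h -> ccont a b (fun x => q * h x).
Proof.
move=> H x xab e e0; have q0 := normc_ge0 q.
have e2 : 0 < e / (normc q + 1) by rewrite divr_gt0 // ltr_wpDl.
have [d d0 Hd] := H x xab _ e2; exists d => // y yd.
rewrite -mulrBr normcM; have := Hd y yd; rewrite ltr_pdivlMr ?ltr_wpDl //.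
by have := normc_ge0 (h y - h x); nra.
Qed.

Lemma ccontB a b h k : ccont a b h -> ccont a b k -> ccont a b (fun x => h x - k x).
Proof.
by move=> h1 h2; have := ccontD h1 (ccontZ (-1) h2); under eq_fun do rewrite mulN1r.
Qed.

Lemma ccont_integrable a b h : ccont a b h ->
  mu.-integrable `[a, b] (EFin \o (fun x => Re (h x))) /\
  mu.-integrable `[a, b] (EFin \o (fun x => Im (h x))).
Proof.
move=> H.
have K (p : R[i] -> R) : (forall x y, `|p x - p y| <= normc (x - y)) ->
    mu.-integrable `[a, b] (EFin \o (fun x => p (h x))).
  move=> hp; apply: continuous_compact_integrable; first exact: segment_compact.
  apply: continuous_in_subspaceT => x; rewrite inE /= in_itv /= => xab.
  apply/(@cvgrPdist_lt _ R^o) => e e0; have [d d0 Hd] := H x xab _ e0.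
  near=> y; rewrite distrC; apply: le_lt_trans (hp _ _) _; apply: Hd.
  near: y; rewrite /=; apply/nbhs_ballP; exists d => //= y.
  by rewrite /ball /= distrC.
split; apply: (K) => x y.
  by rewrite -ReN -ReD; exact: Re_le_normc.
by rewrite -ImN -ImD; exact: Im_le_normc.
Unshelve. all: by end_near.
Qed.

Lemma cintD a b h k : ccont a b h -> ccont a b k ->
  cint a b (fun x => h x + k x) = cint a b h + cint a b k.
Proof.
move=> /ccont_integrable[h1 h2] /ccont_integrable[k1 k2].
apply: complexP; rewrite ?ReD ?ImD /cint /=.
  by rewrite -RintegralD //; apply: eq_Rintegral => x _; rewrite ReD.
by rewrite -RintegralD //; apply: eq_Rintegral => x _; rewrite ImD.
Qed.

Lemma cintZ a b q h : ccont a b h ->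
  cint a b (fun x => q * h x) = q * cint a b h.
Proof.
move=> /ccont_integrable[h1 h2].
have iZ (p : R) (f : R -> R) : mu.-integrable `[a, b] (EFin \o f) ->
    mu.-integrable `[a, b] (EFin \o (fun x => p * f x)).
  by move=> hf; have := integrableZl _ p hf; apply; exact: measurable_itv.
apply: complexP; rewrite ?ReM ?ImM /cint /=.
  rewrite -RintegralZl // -[X in _ - X]RintegralZl // -RintegralB //; [|exact: iZ..].
  by apply: eq_Rintegral => x _; rewrite ReM.
rewrite -RintegralZl // -[X in _ + X]RintegralZl // -RintegralD //; [|exact: iZ..].
by apply: eq_Rintegral => x _; rewrite ImM.
Qed.

Lemma eq_cint a b h k : (forall x, a <= x <= b -> h x = k x) -> cint a b h = cint a b k.
Proof.
move=> hk; congr (_ +i* _); apply: eq_Rintegral => x; rewrite inE /= in_itv /= => xab;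
  by rewrite hk.
Qed.

Lemma cintB a b h k : ccont a b h -> ccont a b k ->
  cint a b (fun x => h x - k x) = cint a b h - cint a b k.
Proof.
move=> H K; under [cint a b (fun x => h x - k x)]eq_cint do rewrite -[k _]mul1r -mulNr.
by rewrite cintD ?cintZ ?mulN1r //; exact: ccontZ.
Qed.

Lemma Rint_bound a b (f : R -> R) M : a <= b ->
  mu.-integrable `[a, b] (EFin \o f) -> (forall x, a <= x <= b -> `|f x| <= M) ->
  `|\int[mu]_(x in `[a, b]) f x| <= M * (b - a).
Proof.
move=> ab hf hM; apply: le_trans (le_normr_Rintegral _ hf) _ => //.
have muab : fine (mu `[a, b]) = b - a.
  rewrite lebesgue_measure_itv /= lte_fin; case: ltP => //= ba.
  by apply/esym/eqP; rewrite subr_eq0; apply/eqP/le_anti; rewrite ab ba.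
rewrite -muab -Rintegral_cst //; apply: le_Rintegral => //.
- exact: (integrable_norm hf).
- have : ccont a b (fun=> M%:C).
    by move=> x _ e e0; exists 1 => // y _; rewrite subrr normc0.
  by move=> /ccont_integrable[].
Qed.

(** The factor 2 comes from bounding real and imaginary parts separately; it reappears in the
    constants of [power_series]. *)
Lemma cint_bound a b h M : a <= b -> ccont a b h ->
  (forall x, a <= x <= b -> normc (h x) <= M) ->
  normc (cint a b h) <= 2 * M * (b - a).
Proof.
move=> ab /ccont_integrable[h1 h2] hM.
apply: le_trans (normc_le_ReIm _) _; rewrite -mulrA mulr_natl mulr2n; apply: lerD.
  by apply: Rint_bound => // x /hM; apply: le_trans; exact: Re_le_normc.
by apply: Rint_bound => // x /hM; apply: le_trans; exact: Im_le_normc.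
Qed.

Lemma ccont_cst a b q : ccont a b (fun=> q).
Proof. by move=> x _ e e0; exists 1 => // y _; rewrite subrr normc0. Qed.

Lemma cint_cst a b q : a <= b -> cint a b (fun=> q) = (b - a)%:C * q.
Proof.
move=> ab; have muab : fine (mu `[a, b]) = b - a.
  rewrite lebesgue_measure_itv /= lte_fin; case: ltP => //= ba.
  by apply/esym/eqP; rewrite subr_eq0; apply/eqP/le_anti; rewrite ab ba.
rewrite /cint !Rintegral_cst // muab; case: q => x y /=.
by apply: complexP => /=; ring.
Qed.

Lemma cint_split a b c h : a <= b -> b <= c -> ccont a c h ->
  cint a c h = cint a b h + cint b c h.
Proof.
move=> ab bc /ccont_integrable[h1 h2].
have K (f : R -> R) : mu.-integrable `[a, c] (EFin \o f) ->
    \int[mu]_(x in `[a, c]) f x = \int[mu]_(x in `[a, b]) f x + \int[mu]_(x in `[b, c]) f x.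
  move=> hf; have := @Rintegral_itvB R f (BLeft a) (BRight c) b hf.
  rewrite !bnd_simp => /(_ ab bc) E.
  rewrite -(@Rintegral_itv_obnd_cbnd _ b (BRight c)); last first.
    by apply: integrableS hf => //; apply: subset_itvr; rewrite bnd_simp.
  by rewrite -E addrC subrK.
apply: complexP; rewrite ?ReD ?ImD; exact: K.
Qed.

End ComplexIntegral.

Section Goursat.
Context {R : realType}.
Variable H : R -> R -> R[i].
Implicit Types (a b c d x y : R).

(** Complex differentiability at x0 + i y0, for a function of two real variables: H will be a
    function composed with the exponential in polar coordinates. *)
Definition hdiff x0 y0 := exists D : R[i], forall e : R, 0 < e ->
  exists2 d : R, 0 < d & forall x y, `|x - x0| < d -> `|y - y0| < d ->
  normc (H x y - H x0 y0 - D * ((x - x0) +i* (y - y0))) <= e * (`|x - x0| + `|y - y0|).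

(** The contour integral along the boundary of [a, b] x [c, d], counterclockwise. *)
Definition rect_int a b c d : R[i] :=
  cint a b (fun x => H x c - H x d) + 'i%C * cint c d (fun y => H b y - H a y).

Lemma hdiff_cont x0 y0 : hdiff x0 y0 -> forall e : R, 0 < e ->
  exists2 d : R, 0 < d & forall x y, `|x - x0| < d -> `|y - y0| < d ->
  normc (H x y - H x0 y0) < e.
Proof.
move=> [D hD] e e0; have [d d0 hd] := hD 1 ltr01.
have D0 := normc_ge0 D; pose t := e / (2 * (normc D + 1) + 1).
have t0 : 0 < t by rewrite divr_gt0 //; lra.
exists (Num.min d t); first by rewrite lt_min d0.
move=> x y; rewrite !lt_min => /andP[x1 x2] /andP[y1 y2].
have := hd x y x1 y1; set q := (_ +i* _); set s := `|x - x0| + `|y - y0| => h.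
have qs : normc q <= s by apply: le_trans (normc_le_ReIm _) _.
have st : s < 2 * t by rewrite mulr_natl mulr2n; exact: ltrD.
rewrite -(subrK (D * q) (H x y - H x0 y0)); apply: normcD_lt.
rewrite normcM; have et : e = t * (2 * (normc D + 1) + 1) by rewrite mulfVK //; lra.
have s0 : 0 <= s by rewrite addr_ge0.
have : normc D * normc q <= normc D * s by rewrite ler_wpM2l.
by rewrite et; nra.
Qed.

Lemma hdiff_ccontx a b y : (forall x, a <= x <= b -> hdiff x y) -> ccont a b (H ^~ y).
Proof.
move=> h x xab e e0; have [d d0 hd] := hdiff_cont (h x xab) e0.
by exists d => // z zd; apply: hd => //; rewrite subrr normr0.
Qed.

Lemma hdiff_cconty x c d : (forall y, c <= y <= d -> hdiff x y) -> ccont c d (H x).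
Proof.
move=> h y yab e e0; have [r r0 hd] := hdiff_cont (h y yab) e0.
by exists r => // z zd; apply: hd => //; rewrite subrr normr0.
Qed.

Variables (a0 b0 c0 d0 : R).
Hypotheses (ab0 : a0 <= b0) (cd0 : c0 <= d0).
Hypothesis hH : forall x y, a0 <= x <= b0 -> c0 <= y <= d0 -> hdiff x y.

Record rect := Rect { ra : R ; rb : R ; rc : R ; rd : R }.

Definition subrect (r : rect) :=
  [/\ a0 <= ra r, ra r <= rb r & rb r <= b0] /\ [/\ c0 <= rc r, rc r <= rd r & rd r <= d0].

Definition half (r s : rect) :=
  [/\ ra r <= ra s, rb s <= rb r, rc r <= rc s & rd s <= rd r] /\
  (rb s - ra s = (rb r - ra r) / 2 /\ rd s - rc s = (rd r - rc r) / 2).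

Definition phi (r : rect) := rect_int (ra r) (rb r) (rc r) (rd r).

Lemma cx a b y : a0 <= a -> b <= b0 -> c0 <= y <= d0 -> ccont a b (H ^~ y).
Proof.
move=> aa bb yy; apply: hdiff_ccontx => x /andP[x1 x2]; apply: hH => //.
by rewrite (le_trans aa x1) (le_trans x2 bb).
Qed.

Lemma cy c d x : c0 <= c -> d <= d0 -> a0 <= x <= b0 -> ccont c d (H x).
Proof.
move=> aa bb yy; apply: hdiff_cconty => y /andP[x1 x2]; apply: hH => //.
by rewrite (le_trans aa x1) (le_trans x2 bb).
Qed.

Lemma rect_intE r : subrect r -> phi r =
  cint (ra r) (rb r) (H ^~ (rc r)) - cint (ra r) (rb r) (H ^~ (rd r)) +
  'i%C * (cint (rc r) (rd r) (H (rb r)) - cint (rc r) (rd r) (H (ra r))).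
Proof.
move=> [[h1 h2 h3] [h4 h5 h6]]; rewrite /phi /rect_int !cintB //.
- by apply: cy => //; lra.
- by apply: cy => //; lra.
- by apply: cx => //; lra.
- by apply: cx => //; lra.
Qed.

Lemma last_quarter (x s t a b c d : R) : x <= s + t -> s <= a + b -> t <= c + d ->
  4 * a < x -> 4 * b < x -> 4 * c < x -> x <= 4 * d.
Proof. lra. Qed.

(** The inner sides cancel, so the integral is the sum over the four quarters, and one of them
    carries at least a fourth of the modulus. *)
Lemma bisect r : subrect r -> exists s, [/\ subrect s, half r s &
  normc (phi r) <= 4 * normc (phi s)].
Proof.
move=> hr; have [[h1 h2 h3] [h4 h5 h6]] := hr.
pose m := (ra r + rb r) / 2; pose p := (rc r + rd r) / 2.
have [am mb] : ra r <= m /\ m <= rb r by rewrite /m; lra.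
have [cp pd] : rc r <= p /\ p <= rd r by rewrite /p; lra.
pose s1 := Rect (ra r) m (rc r) p; pose s2 := Rect m (rb r) (rc r) p.
pose s3 := Rect (ra r) m p (rd r); pose s4 := Rect m (rb r) p (rd r).
have am' := le_trans h1 am; have mb' := le_trans mb h3.
have cp' := le_trans h4 cp; have pd' := le_trans pd h6.
have [hs1 hs2 hs3 hs4] : [/\ subrect s1, subrect s2, subrect s3 & subrect s4].
  by split; split; split.
have m1 : m - ra r = (rb r - ra r) / 2 by rewrite /m; field.
have m2 : rb r - m = (rb r - ra r) / 2 by rewrite /m; field.
have p1 : p - rc r = (rd r - rc r) / 2 by rewrite /p; field.
have p2 : rd r - p = (rd r - rc r) / 2 by rewrite /p; field.
have [e1 e2 e3 e4] : [/\ half r s1, half r s2, half r s3 & half r s4].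
  by split; split; split.
have E : phi r = phi s1 + phi s2 + (phi s3 + phi s4).
  rewrite !rect_intE //=.
  rewrite (@cint_split _ (ra r) m (rb r) (H ^~ (rc r))) //; last by apply: cx; rewrite // h4 (le_trans h5 h6).
  rewrite (@cint_split _ (ra r) m (rb r) (H ^~ (rd r))) //; last by apply: cx; rewrite // h6 (le_trans h4 h5).
  rewrite (@cint_split _ (rc r) p (rd r) (H (ra r))) //; last by apply: cy; rewrite // h1 (le_trans h2 h3).
  rewrite (@cint_split _ (rc r) p (rd r) (H (rb r))) //; last by apply: cy; rewrite // h3 (le_trans h1 h2).
  by ring.
have [?|n1] := leP (normc (phi r)) (4 * normc (phi s1)); first by exists s1.
have [?|n2] := leP (normc (phi r)) (4 * normc (phi s2)); first by exists s2.
have [?|n3] := leP (normc (phi r)) (4 * normc (phi s3)); first by exists s3.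
exists s4; split=> //.
have := le_normcD (phi s1 + phi s2) (phi s3 + phi s4); rewrite -E => h.
exact: (last_quarter h (le_normcD _ _) (le_normcD _ _) n1 n2 n3).
Qed.

Lemma nested_point (a b : nat -> R) : (forall j k, a j <= b k) -> exists x, forall k, a k <= x <= b k.
Proof.
move=> ab; exists (sup [set a k | k in setT]) => k; apply/andP; split.
  by apply: ub_le_sup; [exists (b 0%N) => _ [j _ <-]|exists k].
by apply: ge_sup; [by exists (a 0%N), 0%N|move=> _ [j _ <-]].
Qed.

(** Nested quarters shrink to a point, near which H is affine up to e times the distance, and affine
    functions integrate to 0 along a rectangle. The remaining integral over the k-th rectangle is
    O(e / 4 ^ k), against the factor 4 ^ k lost by bisecting. *)
Lemma goursat : rect_int a0 b0 c0 d0 = 0.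
Proof.
pose r0 := Rect a0 b0 c0 d0.
have hr0 : subrect r0 by split; split.
have [f hf] : exists f : rect -> rect, forall r, subrect r ->
    [/\ subrect (f r), half r (f r) & normc (phi r) <= 4 * normc (phi (f r))].
  have /choice[f hf] : forall r, exists s, subrect r ->
     [/\ subrect s, half r s & normc (phi r) <= 4 * normc (phi s)].
    move=> r; have [hr|nr] := pselect (subrect r); last by exists r.
    by have [s hs] := bisect hr; exists s.
  by exists f.
pose r k := iter k f r0.
have hr k : subrect (r k) by elim: k => //= k /hf[].
have hh k : half (r k) (r k.+1) by have [] := hf _ (hr k).
have mono k j : [/\ ra (r k) <= ra (r (k + j)%N), rb (r (k + j)%N) <= rb (r k),
    rc (r k) <= rc (r (k + j)%N) & rd (r (k + j)%N) <= rd (r k)].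
  elim: j => [|j [i1 i2 i3 i4]]; first by rewrite addn0.
  rewrite addnS; have [[j1 j2 j3 j4] _] := hh (k + j)%N.
  by split; [exact: le_trans i1 j1|exact: le_trans j2 i2|exact: le_trans i3 j3|
    exact: le_trans j4 i4].
have abk j k : ra (r j) <= rb (r k) /\ rc (r j) <= rd (r k).
  have [u1 u2 u3 u4] := mono j k; have [v1 v2 v3 v4] := mono k j.
  have [[_ w1 _] [_ w2 _]] := hr (j + k)%N.
  rewrite addnC in v2 v4.
  by split; [exact: le_trans u1 (le_trans w1 v2)|exact: le_trans u3 (le_trans w2 v4)].
have len k : rb (r k) - ra (r k) = (b0 - a0) / 2 ^+ k /\ rd (r k) - rc (r k) = (d0 - c0) / 2 ^+ k.
  elim: k => [|k [IH1 IH2]]; first by rewrite expr0 !divr1.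
  have [_ [-> ->]] := hh k; rewrite IH1 IH2 exprSr invfM !mulrA //.
have ph k : normc (phi r0) <= 4 ^+ k * normc (phi (r k)).
  elim: k => [|k IH]; first by rewrite expr0 mul1r.
  apply: le_trans IH _; rewrite exprSr -mulrA ler_wpM2l ?exprn_ge0 //.
  by have [] := hf _ (hr k).
have [x xk] := nested_point (fun j k => (abk j k).1); have [y yk] := nested_point (fun j k => (abk j k).2).
have [D hD] := hH (xk 0%N) (yk 0%N).
pose S := (b0 - a0) + (d0 - c0); have S0 : 0 <= S by rewrite addr_ge0 ?subr_ge0.
apply: eq0_normc; apply/eqP; rewrite eq_le normc_ge0 andbT.
apply/ler_addgt0Pr => e e0; rewrite add0r.
(* 4 S^2 is the constant of the last estimate; the added 1 covers the case of a rectangle reduced to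
   a point. *)
have e' : 0 < e / (4 * S ^+ 2 + 1) by rewrite divr_gt0 // ltr_wpDl // mulr_ge0 // sqr_ge0.
have [d dpos hd] := hD _ e'; set t := e / _ in e' hd.
have [k Sk] : exists k, S / 2 ^+ k < d.
  have [k hk] : exists k : nat, S / d < k%:R.
    by exists (Num.truncn (S / d)).+1; rewrite truncnS_gt.
  exists k; rewrite ltr_pdivrMr ?exprn_gt0 // mulrC -ltr_pdivrMr //.
  by apply: lt_trans hk _; rewrite -natrX ltr_nat ltn_expl.
have [L1 L2] := len k.
have phk : normc (rect_int a0 b0 c0 d0) <=
  4 ^+ k * normc (rect_int (ra (r k)) (rb (r k)) (rc (r k)) (rd (r k))) := ph k.
have [[q1 q2 q3] [q4 q5 q6]] := hr k; have xr := xk k; have yr := yk k.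
move: (ra (r k)) (rb (r k)) (rc (r k)) (rd (r k)) L1 L2 phk q1 q2 q3 q4 q5 q6 xr yr.
move=> a b c dd L1 L2 phk q1 q2 q3 q4 q5 q6 xr yr.
pose E u v := H u v - H x y - D * ((u - x) +i* (v - y)).
have LW : (b - a) + (dd - c) = S / 2 ^+ k by rewrite L1 L2 -mulrDl.
have hE u v : a <= u <= b -> c <= v <= dd -> normc (E u v) <= t * (S / 2 ^+ k).
  move=> uu vv.
  have du : `|u - x| <= b - a by rewrite ler_norml; lra.
  have dv : `|v - y| <= dd - c by rewrite ler_norml; lra.
  apply: le_trans (hd u v _ _) _; [lra|lra|].
  by rewrite ler_wpM2l ?(ltW e') // -LW lerD.
have cE1 v : c <= v <= dd -> ccont a b (E ^~ v).
  move=> vv; rewrite /E; under eq_fun do rewrite -addrA.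
  apply: ccontD; first by apply: cx => //; lra.
  have cl : ccont a b (fun u : R => ((u - x) +i* (v - y))).
    move=> u _ e1 e10; exists e1 => // u' hu.
    by rewrite (_ : _ - _ = (u' - u)%:C) ?normcR //; simpc; congr (_ +i* _); ring.
  by have := ccontD (ccont_cst (- H x y)) (ccontZ (- D) cl);
    under eq_fun do rewrite mulNr.
have cE2 u : a <= u <= b -> ccont c dd (E u).
  move=> uu; rewrite /E; under eq_fun do rewrite -addrA.
  apply: ccontD; first by apply: cy => //; lra.
  have cl : ccont c dd (fun v : R => ((u - x) +i* (v - y))).
    move=> v _ e1 e10; exists e1 => // v' hv.
    rewrite (_ : _ - _ = 'i%C * (v' - v)%:C) ?normcM ?normcR; last first.
      by simpc; congr (_ +i* _); ring.
    by rewrite /= expr0n expr1n add0r sqrtr1 mul1r.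
  by have := ccontD (ccont_cst (- H x y)) (ccontZ (- D) cl);
    under eq_fun do rewrite mulNr.
have [ca cb] : c <= c <= dd /\ c <= dd <= dd by lra.
have [ac bc] : a <= a <= b /\ a <= b <= b by lra.
have I1 : cint a b (fun u => H u c - H u dd) =
    cint a b (fun u => E u c - E u dd) + (b - a)%:C * (D * (0 +i* (c - dd))).
  rewrite -cint_cst // -cintD; [|by apply: ccontB; exact: cE1|exact: ccont_cst].
  apply: eq_cint => u _; rewrite /E.
  have -> : (0 +i* (c - dd)) = ((u - x) +i* (c - y)) - ((u - x) +i* (dd - y)) :> R[i].
    by simpc; congr (_ +i* _); ring.
  by ring.
have I2 : cint c dd (fun v => H b v - H a v) =
    cint c dd (fun v => E b v - E a v) + (dd - c)%:C * (D * (b - a)%:C).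
  rewrite -cint_cst // -cintD; [|by apply: ccontB; exact: cE2|exact: ccont_cst].
  apply: eq_cint => v _; rewrite /E.
  have -> : (b - a)%:C = ((b - x) +i* (v - y)) - ((a - x) +i* (v - y)) :> R[i].
    by simpc; congr (_ +i* _); ring.
  by ring.
(* The linear parts of the horizontal and of the vertical sides cancel. *)
have hPhi : rect_int a b c dd = cint a b (fun u => E u c - E u dd) +
    'i%C * cint c dd (fun v => E b v - E a v).
  rewrite /rect_int I1 I2 mulrDr addrACA -[RHS]addr0; congr (_ + _).
  by rewrite [D]complexE; simpc; congr (_ +i* _); ring.
apply: (le_trans phk); rewrite hPhi.
set T := t * (S / 2 ^+ k) in hE.
have B1 : normc (cint a b (fun u => E u c - E u dd)) <= 2 * (T + T) * (b - a).
  apply: cint_bound => //; first by apply: ccontB; exact: cE1.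
  by move=> u uu; apply: normcB_le; rewrite lerD ?hE.
have B2 : normc (cint c dd (fun v => E b v - E a v)) <= 2 * (T + T) * (dd - c).
  apply: cint_bound => //; first by apply: ccontB; exact: cE2.
  by move=> u uu; apply: normcB_le; rewrite lerD ?hE.
have B3 : normc (cint a b (fun u => E u c - E u dd) +
    'i%C * cint c dd (fun v => E b v - E a v)) <= 4 * T * (S / 2 ^+ k).
  apply: normcD_le; rewrite normcM.
  rewrite [normc 'i%C]/= expr0n expr1n add0r sqrtr1 mul1r -LW; lra.
apply: le_trans (ler_wpM2l _ B3) _; first by rewrite exprn_ge0.
rewrite /T /t; have -> : 4 ^+ k = (2 ^+ k) ^+ 2 :> R.
  by rewrite -exprM mulnC exprM expr2 -natrM.
have : 2 ^+ k != 0 :> R by rewrite expf_neq0.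
move: (2 ^+ k) => q q0.
have -> : q ^+ 2 * (4 * (e / (4 * S ^+ 2 + 1) * (S / q)) * (S / q)) =
   e * ((4 * S ^+ 2) / (4 * S ^+ 2 + 1)).
  have : 4 * S ^+ 2 + 1 != 0 by rewrite gt_eqF // ltr_wpDl // mulr_ge0 // sqr_ge0.
  by move=> ?; field; exact/andP.
rewrite ger_pMr // ler_pdivrMr ?mul1r ?lerDl //.
by rewrite ltr_wpDl // mulr_ge0 // sqr_ge0.
Qed.

End Goursat.

Arguments ComplexField.Normc.normc {R} x : simpl never.

Section Holomorphic.
Context {R : realType}.
Implicit Types (f g : R[i] -> R[i]) (u w : R[i]) (r s t : R).

Definition cc f w := forall e : R, 0 < e ->
  exists2 d : R, 0 < d & forall u, normc (u - w) < d -> normc (f u - f w) < e.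

Lemma nbhs_normcP w (A : set R[i]) :
  nbhs (w : R[i]^o) A <-> exists2 d : R, 0 < d & forall u, normc (u - w) < d -> A u.
Proof.
split.
  move/nbhs_ballP => [e /= e0 he].
  have [e0' eE] := gtc0P e0.
  exists (Re e) => // u hu; apply: he.
  by rewrite /ball /= eE normcE' ltcR normcB.
move=> [d d0 hd]; apply/nbhs_ballP; exists d%:C; first by rewrite /= ltcR.
by move=> u; rewrite /ball /= normcE' ltcR normcB => /hd.
Qed.

Lemma ccP f w : cc f w <-> ((f u : R[i]^o) @[u --> (w : R[i]^o)] --> (f w : R[i]^o)).
Proof.
split=> [h|/cvgcP h e e0]; last exact/nbhs_normcP/h.
have FF : Filter (nbhs (w : R[i]^o)) by exact: nbhs_filter.
by apply: (proj2 (@cvgcP R _ _ FF _ _)) => e e0; apply/nbhs_normcP; exact: h.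
Qed.

Lemma ccD f g w : cc f w -> cc g w -> cc (fun u => f u + g u) w.
Proof. by move=> /ccP hf /ccP hg; apply/ccP; exact: (@cvgcD R _ _ (nbhs_filter (w : R[i]^o)) _ _ _ _ hf hg). Qed.
Lemma ccM f g w : cc f w -> cc g w -> cc (fun u => f u * g u) w.
Proof. by move=> /ccP hf /ccP hg; apply/ccP; exact: (@cvgcM R _ _ (nbhs_filter (w : R[i]^o)) _ _ _ _ hf hg). Qed.
Lemma cc_cst c w : cc (fun=> c) w.
Proof. by move=> e e0; exists 1 => // u _; rewrite subrr normc0. Qed.
Lemma cc_id w : cc id w.
Proof. by move=> e e0; exists e. Qed.
Lemma ccV f w : f w != 0 -> cc f w -> cc (fun u => (f u)^-1) w.
Proof. by move=> fw /ccP hf; apply/ccP; exact: (@cvgV R[i] _ _ _ f (f w) fw hf). Qed.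

Lemma ccX f w k : cc f w -> cc (fun u => f u ^+ k) w.
Proof.
move=> hf; elim: k => [|k IH].
  by under eq_fun do rewrite expr0; exact: cc_cst.
by under eq_fun do rewrite exprS; exact: ccM.
Qed.

Lemma cc_near f g w : (exists2 d : R, 0 < d & forall u, normc (u - w) < d -> f u = g u) ->
  cc f w -> cc g w.
Proof.
move=> [d d0 fg] hf e e0; have [d' d'0 hd] := hf e e0.
exists (Num.min d d'); first by rewrite lt_min d0.
move=> u; rewrite lt_min => /andP[u1 u2]; rewrite -!fg ?hd //.
by rewrite subrr normc0.
Qed.

(* Caratheodory's form of complex differentiability: the difference quotient
   extends continuously. *)
Definition cder f w := exists2 phi : R[i] -> R[i], cc phi w &
  forall u, f u = f w + phi u * (u - w).

Lemma cder_cc f w : cder f w -> cc f w.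
Proof.
move=> [phi hphi fE].
have : cc (fun u => f w + phi u * (u + - w)) w.
  apply: ccD; first exact: cc_cst.
  by apply: ccM => //; apply: ccD; [exact: cc_id|exact: cc_cst].
by apply: cc_near; exists 1 => // u _; rewrite -fE.
Qed.

Lemma cder_quot f w D : cc (fun u => if u == w then D else (f u - f w) / (u - w)) w ->
  cder f w.
Proof.
move=> h; exists (fun u => if u == w then D else (f u - f w) / (u - w)) => // u.
case: eqP => [->|/eqP uw]; first by rewrite subrr mulr0 addr0.
by rewrite mulfVK ?subr_eq0 // addrC subrK.
Qed.

Lemma cder_cst c w : cder (fun=> c) w.
Proof. by exists (fun=> 0) => [|u]; [exact: cc_cst|rewrite mul0r addr0]. Qed.
Lemma cder_id w : cder id w.
Proof. by exists (fun=> 1) => [|u]; [exact: cc_cst|rewrite mul1r addrC subrK]. Qed.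

Lemma cderD f g w : cder f w -> cder g w -> cder (fun u => f u + g u) w.
Proof.
move=> [p hp fE] [q hq gE]; exists (fun u => p u + q u); first exact: ccD.
by move=> u; rewrite fE gE; ring.
Qed.

Lemma cderM f g w : cder f w -> cder g w -> cder (fun u => f u * g u) w.
Proof.
move=> [p hp fE] hg; have gc := cder_cc hg; have [q hq gE] := hg.
exists (fun u => p u * g u + f w * q u).
  by apply: ccD; [exact: ccM|apply: ccM => //; exact: cc_cst].
by move=> u; rewrite [f u]fE gE; ring.
Qed.

Lemma cderX f w k : cder f w -> cder (fun u => f u ^+ k) w.
Proof.
move=> hf; elim: k => [|k IH].
  by under eq_fun do rewrite expr0; exact: cder_cst.
by under eq_fun do rewrite exprS; exact: cderM.
Qed.

Lemma cder_invB a w : w != a -> cder (fun u => (u - a)^-1) w.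
Proof.
move=> wa; apply: (@cder_quot _ _ (- (w - a)^-1 ^+ 2)).
have h : cc (fun u => - (u + - a)^-1 * (w - a)^-1) w.
  apply: ccM; last exact: cc_cst.
  under eq_fun do rewrite -mulN1r.
  apply: ccM; first exact: cc_cst.
  by apply: ccV; rewrite ?subr_eq0 //; apply: ccD; [exact: cc_id|exact: cc_cst].
apply: cc_near h; exists (normc (w - a)).
  by rewrite normc_gt0 subr_eq0.
move=> u ua; have ua' : u - a != 0.
  by apply: contraTneq ua => /eqP; rewrite subr_eq0 => /eqP ->; rewrite normcB ltxx.
case: eqP => [->|/eqP uw]; first by rewrite expr2 mulNr.
have wa' : w - a != 0 by rewrite subr_eq0.
have uw' : u - w != 0 by rewrite subr_eq0.
by field; rewrite ua' wa' uw'.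
Qed.

Definition expi t : R[i] := cos t +i* sin t.

Lemma normc_expi t : normc (expi t) = 1.
Proof. by rewrite /normc /expi cos2Dsin2 sqrtr1. Qed.

Lemma expiD s t : expi (s + t) = expi s * expi t.
Proof.
by rewrite /expi cosD sinD; simpc; congr (_ +i* _); ring.
Qed.

Lemma expi0 : expi 0 = 1. Proof. by rewrite /expi cos0 sin0. Qed.

Lemma expi2pi : expi (2 * pi) = 1.
Proof.
rewrite mulr_natl mulr2n expiD /expi cospi sinpi.
by apply: complexP => /=; ring.
Qed.

Definition cexp s t : R[i] := (expR s)%:C * expi t.

Lemma is_derive_eps (F : R -> R) x dF : is_derive x (1 : R) F dF ->
  forall e : R, 0 < e -> exists2 d : R, 0 < d & forall h, `|h| < d ->
  `|F (x + h) - F x - dF * h| <= e * `|h|.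
Proof.
move=> [Fd Fv] e e0.
have : h^-1 *: (F (h *: (1 : R) + x) - F x) @[h --> (0 : R)^'] --> dF.
  by rewrite -Fv; exact: Fd.
move=> /cvgrPdist_lt/(_ e e0) /nbhs_ballP[d /= d0 hd].
exists d => // h hh; have [->|h0] := eqVneq h 0.
  by rewrite addr0 subrr mulr0 subr0 normr0 mulr0.
have := hd h; rewrite /ball /= sub0r normrN => /(_ hh h0).
rewrite /GRing.scale /= mulr1 [h + x]addrC distrC => /ltW le.
have -> : F (x + h) - F x - dF * h = (h^-1 * (F (x + h) - F x) - dF) * h.
  by rewrite mulrBl mulrAC mulVf // mul1r.
by rewrite normrM ler_wpM2r.
Qed.

(** The exponential law moves the point to 0, where only the derivatives of exp, cos and sin are
    needed. *)
Lemma hdiff_cexp s t : hdiff cexp s t.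
Proof.
exists (cexp s t) => e e0.
have N0 := normc_ge0 (cexp s t); set N := normc (cexp s t) in N0.
pose e1 := Num.min 1 (e / (5 * (N + 1))).
have e10 : 0 < e1 by rewrite lt_min ltr01 divr_gt0 // mulr_gt0 // ltr_wpDl.
have e1le : e1 <= 1 by rewrite ge_min lexx.
have e1N : N * (5 * e1) <= e.
  have : e1 <= e / (5 * (N + 1)) by rewrite ge_min lexx orbT.
  rewrite ler_pdivlMr ?mulr_gt0 ?ltr_wpDl // => h; nra.
clearbody e1.
have [d1 d10 h1] := is_derive_eps (is_derive_expR 0) e10.
have [d2 d20 h2] := is_derive_eps (is_derive_cos 0) e10.
have [d3 d30 h3] := is_derive_eps (is_derive_sin 0) e10.
exists (Num.min (Num.min d1 d2) (Num.min d3 e1)); first by rewrite !lt_min d10 d20 d30 e10.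
move=> x y; set h := x - s; set k := y - t.
rewrite !lt_min => /andP[/andP[x1 x2] /andP[x3 x4]] /andP[/andP[y1 y2] /andP[y3 y4]].
have -> : cexp x y - cexp s t - cexp s t * (h +i* k) =
   cexp s t * (cexp h k - 1 - (h +i* k)).
  have -> : cexp x y = cexp s t * cexp h k.
    rewrite /cexp mulrACA -expiD -rmorphM -expRD /h /k.
    by congr (_%:C * expi _); [congr expR|]; rewrite addrC subrK.
  by rewrite !mulrBr mulr1.
rewrite normcM -/N; apply: le_trans (ler_wpM2l N0 (_ : _ <= 5 * e1 * (`|h| + `|k|))) _; last first.
  by rewrite mulrA ler_wpM2r // addr_ge0.
have := h1 h x1; have := h2 k y2; have := h3 k y3.
rewrite !add0r expR0 cos0 sin0 !oppr0 mul0r !addr0 ?subr0 !mul1r => k3 k2 k1.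
have -> : cexp h k - 1 - (h +i* k) = (expR h - 1 - h)%:C * expi k +
   ((1 + h)%:C * ((cos k - 1) +i* (sin k - k)) + 0 +i* (h * k)).
  by apply: complexP; rewrite /cexp /expi /=; ring.
apply: normcD_le; rewrite normcM normc_expi mulr1 normcR.
apply: le_trans (lerD k1 (le_normcD _ _)) _; rewrite normcM normcR.
have A : normc ((cos k - 1) +i* (sin k - k)) <= 2 * e1 * `|k|.
  by apply: le_trans (normc_le_ReIm _) _ => /=; lra.
have B : `|1 + h| <= 2.
  by apply: le_trans (ler_normD _ _) _; rewrite normr1; lra.
have C : normc (0 +i* (h * k)) <= e1 * `|k|.
  apply: le_trans (normc_le_ReIm _) _ => /=; rewrite normr0 add0r normrM.
  by rewrite ler_wpM2r // ltW.
have := normc_ge0 ((cos k - 1) +i* (sin k - k)); have := normr_ge0 (1 + h).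
have := normr_ge0 h; have := normr_ge0 k => hk hh b0 a0.
have D : `|1 + h| * normc ((cos k - 1) +i* (sin k - k)) <= 2 * (2 * e1 * `|k|).
  by apply: ler_pM.
have : 0 <= e1 * `|h| by rewrite mulr_ge0 // ltW.
lra.
Qed.

Lemma hdiff_comp f (H : R -> R -> R[i]) x y : hdiff H x y -> cder f (H x y) ->
  hdiff (fun a b => f (H a b)) x y.
Proof.
move=> Hd [p hp fE]; have [D hD] := Hd; exists (p (H x y) * D) => e e0.
set P := p (H x y); have P0 := normc_ge0 P; have D0 := normc_ge0 D.
pose e1 := Num.min 1 (e / (2 * (normc P + normc D + 2))).
have e10 : 0 < e1 by rewrite lt_min ltr01 divr_gt0 // mulr_gt0 //; lra.
have e1le : e1 <= 1 by rewrite ge_min lexx.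
have e1N : e1 * (2 * (normc P + normc D + 2)) <= e.
  have : e1 <= e / (2 * (normc P + normc D + 2)) by rewrite ge_min lexx orbT.
  by rewrite ler_pdivlMr // mulr_gt0 //; lra.
have [d1 d10 h1] := hD _ e10; have [d2 d20 h2] := hp _ e10.
have [d3 d30 h3] := hdiff_cont Hd d20.
exists (Num.min d1 d3); first by rewrite lt_min d10.
move=> a b; rewrite !lt_min => /andP[a1 a2] /andP[b1 b2].
have := h1 a b a1 b1; set q := (_ +i* _); set S := (_ + `|b - y|) => h4.
have S0 : 0 <= S by rewrite addr_ge0.
have qS : normc q <= S by apply: le_trans (normc_le_ReIm _) _.
have h5 := h2 _ (h3 a b a2 b2); move: h4 h5; rewrite -/P; set K := H a b; set K0 := H x y => h4 h5.
have h6 : normc (K - K0) <= (normc D + 1) * S.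
  rewrite -(subrK (D * q) (K - K0)); apply: normcD_le.
  rewrite normcM; have : normc D * normc q <= normc D * S by rewrite ler_wpM2l.
  have : e1 * S <= S by rewrite ler_piMl.
  lra.
have -> : f K - f K0 - P * D * q = (p K - P) * (K - K0) + P * (K - K0 - D * q).
  by rewrite [f K]fE -/K0; ring.
apply: normcD_le; rewrite !normcM.
have A : normc (p K - P) * normc (K - K0) <= e1 * ((normc D + 1) * S).
  by apply: ler_pM => //; rewrite ltW.
have B : normc P * normc (K - K0 - D * q) <= normc P * (e1 * S) by rewrite ler_wpM2l.
have : e1 * (2 * (normc P + normc D + 2)) * S <= e * S by rewrite ler_wpM2r.
have : 0 <= e1 * S by rewrite mulr_ge0 // ltW.
have : 0 <= e1 * S * normc P by rewrite !mulr_ge0 // ltW.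
have : 0 <= e1 * S * normc D by rewrite !mulr_ge0 // ltW.
lra.
Qed.

End Holomorphic.

(** * Power series expansions *)

Section CauchyFormula.
Context {R : realType}.
Implicit Types (f g : R[i] -> R[i]) (u w : R[i]) (r s t : R).

(** The contour integral of f (u) / (i u) over the circle of radius r. With this normalisation a
    constant has the same integral for every radius, also for r = 0. *)
Definition circ_int f r := cint 0 (2 * pi) (fun t => f (r%:C * expi t)).

Lemma twopi_ge0 : (0 : R) <= 2 * pi.
Proof. by rewrite mulr_ge0 // pi_ge0. Qed.
Lemma twopi_gt0 : (0 : R) < 2 * pi.
Proof. by rewrite mulr_gt0 // pi_gt0. Qed.

Lemma twopi_split (e : R) : e = 2 * (e / (2 * (2 * pi))) * (2 * pi - 0).
Proof.
rewrite subr0; have := @pi_gt0 R; move: pi => p p0; field.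
by rewrite gt_eqF.
Qed.

Lemma normc_circ r t : 0 <= r -> normc (r%:C * expi t) = r.
Proof. by move=> r0; rewrite normcM normc_expi mulr1 normcR ger0_norm. Qed.

Lemma expi_cont t (e : R) : 0 < e ->
  exists2 d : R, 0 < d & forall t', `|t' - t| < d -> normc (expi t' - expi t) < e.
Proof.
move=> e0; have [d d0 hd] := hdiff_cont (hdiff_cexp (0 : R) t) e0; exists d => // t' ht.
by have := hd 0 t'; rewrite /cexp expR0 !mul1r subrr normr0; apply.
Qed.

Lemma circ_cont f r : 0 <= r -> (forall u, normc u = r -> cc f u) ->
  ccont 0 (2 * pi) (fun t => f (r%:C * expi t)).
Proof.
move=> r0 hf t _ e e0; have [d d0 hd] := hf _ (normc_circ t r0) e e0.
have [d' d'0 hd'] := @expi_cont t (d / (r + 1)) ltac:(by rewrite divr_gt0 // ltr_wpDl).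
exists d' => // t' /hd' h; apply: hd; rewrite -mulrBr normcM normcR ger0_norm //.
move: h; rewrite ltr_pdivlMr ?ltr_wpDl //.
by have := normc_ge0 (expi t' - expi t); nra.
Qed.

(** In the coordinates log r and t the annulus is a rectangle. Its horizontal sides cancel by
    periodicity, so Goursat's theorem equates the vertical ones. *)
Lemma circ_int_annulus f r1 r2 : 0 < r1 -> r1 <= r2 ->
  (forall u, r1 <= normc u <= r2 -> cder f u) -> circ_int f r1 = circ_int f r2.
Proof.
move=> r10 r12 hf; have r20 : 0 < r2 := lt_le_trans r10 r12.
pose H (x y : R) := f (cexp x y).
have Hd x y : ln r1 <= x <= ln r2 -> 0 <= y <= 2 * pi -> hdiff H x y.
  move=> /andP[x1 x2] _; apply: hdiff_comp; first exact: hdiff_cexp.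
  apply: hf; rewrite /cexp normc_circ ?expR_ge0 // -[r1]lnK ?posrE // -[r2]lnK ?posrE //.
  by rewrite !ler_expR x1 x2.
have ab : ln r1 <= ln r2 by rewrite ler_ln.
have := goursat ab twopi_ge0 Hd; rewrite /rect_int.
have -> : cint (ln r1) (ln r2) (fun x => H x 0 - H x (2 * pi)) = 0.
  rewrite (@eq_cint _ _ _ _ (fun=> 0)) ?cint_cst ?mulr0 // => x _.
  by rewrite /H /cexp expi0 expi2pi subrr.
rewrite add0r => /eqP; rewrite mulf_eq0 => /orP[/eqP[] /eqP|].
  by rewrite oner_eq0.
have cH r : 0 < r -> r1 <= r <= r2 -> ccont 0 (2 * pi) (H (ln r)).
  move=> r0 rr; rewrite /H /cexp lnK ?posrE //; apply: circ_cont => [|u ur]; first exact: ltW.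
  by apply: cder_cc; apply: hf; rewrite ur.
rewrite cintB; [|by apply: cH; rewrite // lexx r12|by apply: cH; rewrite // lexx r12].
by rewrite /H /cexp !lnK ?posrE // subr_eq0 => /eqP h; rewrite /circ_int; exact/esym.
Qed.

(** Continuity in the radius, by compactness of [0, 2 pi]. It lets a circle cross a point where f is
    only known to be continuous, and shrink to radius 0. *)
Lemma circ_int_cont f r : 0 <= r -> (forall u, normc u = r -> cc f u) ->
  forall e : R, 0 < e -> exists2 d : R, 0 < d & forall r', 0 <= r' -> `|r' - r| < d ->
  (forall u, normc u = r' -> cc f u) -> normc (circ_int f r' - circ_int f r) <= e.
Proof.
move=> r0 hf e e0; pose e1 := e / (2 * (2 * pi)).
have e10 : 0 < e1 by rewrite divr_gt0 // mulr_gt0 // twopi_gt0.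
pose P r' t := normc (f (r'%:C * expi t) - f (r%:C * expi t)) < e1.
have : nbhs (r : R^o) (fun r' => `[(0:R), 2 * pi] `<=` P r').
  have h := proj1 (compact_near_coveringP _) (@segment_compact R 0 (2 * pi)).
  refine (h R (nbhs (r : R^o)) (fun r' t => P r' t) (nbhs_filter _) _).
  move=> t _; rewrite /P.
  have e2 : 0 < e1 / 2 by rewrite divr_gt0.
  have [d d0 hd] := hf _ (normc_circ t r0) _ e2.
  have dd : 0 < d / (r + 2) by rewrite divr_gt0 // ltr_wpDl.
  have [d' d'0 hd'] := expi_cont t dd.
  exists ([set t' | `|t' - t| < d'], [set r' | `|r' - r| < Num.min 1 (d / (r + 2))]).
    split; apply/nbhs_ballP.
      by exists d' => // t'; rewrite /ball /= distrC.
    exists (Num.min 1 (d / (r + 2))); first by rewrite /= lt_min ltr01.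
    by move=> r'; rewrite /ball /= distrC.
  move=> [t' r'] /= [ht]; rewrite lt_min => /andP[h1 h2].
  have tt := hd' _ ht.
  have A q : `|q - r| < d / (r + 2) -> normc (q%:C * expi t' - r%:C * expi t) < d.
    move=> hq.
    have -> : q%:C * expi t' - r%:C * expi t = (q - r)%:C * expi t' + r%:C * (expi t' - expi t).
      by rewrite rmorphB; ring.
    apply: normcD_lt; rewrite !normcM normc_expi mulr1 !normcR (ger0_norm r0).
    have dE : d = d / (r + 2) * (r + 2) by rewrite mulfVK // gt_eqF // ltr_wpDl.
    by have := normc_ge0 (expi t' - expi t); nra.
  have B1 := hd _ (A _ h2).
  have B2 : normc (f (r%:C * expi t') - f (r%:C * expi t)) < e1 / 2.
    by apply: hd; apply: A; rewrite subrr normr0.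
  have -> : f (r'%:C * expi t') - f (r%:C * expi t') =
     (f (r'%:C * expi t') - f (r%:C * expi t)) - (f (r%:C * expi t') - f (r%:C * expi t)).
    by ring.
  by apply: le_lt_trans (le_normcB _ _) _; rewrite (splitr e1) ltrD.
move=> /nbhs_ballP[d /= d0 hd]; exists d => // r' r'0 hr' hf'.
have := hd r'; rewrite /ball /= distrC => /(_ hr') hP.
rewrite /circ_int -cintB; [|exact: circ_cont..].
have -> : e = 2 * e1 * (2 * pi - 0).
  exact: twopi_split.
apply: cint_bound; first exact: twopi_ge0.
  by apply: ccontB; exact: circ_cont.
by move=> t tt; apply/ltW/hP; rewrite /= in_itv.
Qed.

(** Rescaling the circle multiplies the integral by a power of the radius, while [circ_int_annulus]
    says that it does not change; for k > 0 it must be 0. *)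
Lemma circ_int_invX k r : 0 < r ->
  circ_int (fun u => u^-1 ^+ k) r = if k == 0%N then (2 * pi)%:C else 0.
Proof.
move=> r0; case: k => [|k] /=.
  rewrite /circ_int (@eq_cint _ _ _ _ (fun=> 1)) => [|t _]; last by rewrite expr0.
  by rewrite cint_cst ?subr0 ?mulr1 // twopi_ge0.
have hd u : 0 < normc u -> cder (fun u : R[i] => u^-1 ^+ k.+1) u.
  rewrite normc_gt0 => u0; apply: cderX.
  by have := cder_invB u0; under eq_fun do rewrite subr0.
have cE s : 0 < s -> circ_int (fun u => u^-1 ^+ k.+1) s =
    (s^-1 ^+ k.+1)%:C * circ_int (fun u => u^-1 ^+ k.+1) 1.
  move=> s0; rewrite /circ_int -cintZ.
    by apply: eq_cint => t _; rewrite mul1r invfM exprMn -fmorphV -rmorphXn.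
  apply: (@circ_cont (fun u => u^-1 ^+ k.+1) 1) => // u u1.
  by apply: cder_cc; apply: hd; rewrite u1.
have E : circ_int (fun u => u^-1 ^+ k.+1) 1 = circ_int (fun u => u^-1 ^+ k.+1) 2.
  by apply: circ_int_annulus; rewrite ?ler1n // => u /andP[u1 _]; apply: hd; lra.
move: (cE r r0) (cE 2 (ltr0Sn _ _)); rewrite -E.
move: (circ_int _ 1) => C -> h2; suff -> : C = 0 by rewrite mulr0.
apply/eqP; move/eqP: h2; rewrite -subr_eq0 -[X in X - _]mul1r -mulrBl.
rewrite mulf_eq0 => /orP[|//]; rewrite -[1]/(1%:C) -rmorphB => /eqP[] /eqP.
rewrite subr_eq0 => /eqP h; have : (2^-1 : R) ^+ k.+1 < 1.
  by rewrite exprn_ilt1 ?invr_ge0 ?invf_lt1 ?ltr1n.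
by rewrite -h ltxx.
Qed.

Lemma geom_ident (l u : R[i]) K : u != 0 -> u != l ->
  u * (u - l)^-1 = \sum_(k < K) l ^+ k * u^-1 ^+ k + (l * u^-1) ^+ K * (u * (u - l)^-1).
Proof.
move=> u0 ul; elim: K => [|K IH]; first by rewrite big_ord0 expr0 mul1r add0r.
rewrite big_ord_recr /= {1}IH -addrA; congr (_ + _).
rewrite -exprMn exprSr -mulrA -[X in _ = X + _]mulr1 -mulrDr; congr (_ * _).
have ul' : u - l != 0 by rewrite subr_eq0.
by field; rewrite u0 ul'.
Qed.

Lemma third_gap (a b d d' : R) : a < b -> 0 < d -> 0 < d' ->
  exists t, [/\ 0 < t, t < d, t < d' & a + t < b - t].
Proof.
move=> ab d0 d'0; have m0 : 0 < Num.min (Num.min d d') (b - a) by rewrite !lt_min d0 d'0 subr_gt0.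
exists (Num.min (Num.min d d') (b - a) / 3).
have : Num.min (Num.min d d') (b - a) <= Num.min (Num.min d d') (b - a) by [].
by rewrite !le_min => /andP[/andP[h1 h2] h3]; split; lra.
Qed.

(** With D the extended difference quotient at l, the integrand extends to F (u) = D (u) u,
    continuous on the disc, differentiable off l and 0 at 0. The radius goes from s to |l| and from
    |l| to 0 through annuli that avoid l, and continuity in the radius closes the gaps. *)
Lemma circ_int_cauchy f rho s l : 0 < s -> s < rho -> normc l < s ->
  (forall u, normc u < rho -> cder f u) ->
  circ_int (fun u => (f u - f l) * (u * (u - l)^-1)) s = 0.
Proof.
move=> s0 srho ls hf.
have [D hD fD] := hf l (lt_trans ls srho).
pose F u := if u == l then D l * l else (f u - f l) * (u * (u - l)^-1).
have FE u : F u = D u * u.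
  rewrite /F; case: eqP => [-> //|/eqP ul].
  have ul' : u - l != 0 by rewrite subr_eq0.
  by rewrite fD; field.
have Dc u : normc u < rho -> cc D u.
  move=> ur; have [->//|ul] := eqVneq u l.
  have : cc (fun u => (f u - f l) * (u - l)^-1) u.
    apply: ccM; last by apply: cder_cc; exact: cder_invB.
    by apply: ccD; [exact/cder_cc/hf|exact: cc_cst].
  apply: cc_near; exists (normc (u - l)); first by rewrite normc_gt0 subr_eq0.
  move=> v vl; have vl' : v - l != 0.
    by apply: contraTneq vl => /eqP; rewrite subr_eq0 => /eqP ->; rewrite normcB ltxx.
  by rewrite [f v]fD; field.
have Fc u : normc u < rho -> cc F u.
  move=> ur; have : cc (fun u => D u * u) u by apply: ccM; [exact: Dc|exact: cc_id].
  by apply: cc_near; exists 1 => // v _; rewrite FE.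
have Fd u : normc u < rho -> u != l -> cder F u.
  move=> ur ul; have : cder (fun u => (f u + - f l) * (u * (u - l)^-1)) u.
    apply: cderM; first by apply: cderD; [exact: hf|exact: cder_cst].
    by apply: cderM; [exact: cder_id|exact: cder_invB].
  move=> [phi hphi hE].
  apply: (@cder_quot _ _ _ (phi u)); apply: cc_near hphi.
  exists (normc (u - l)); first by rewrite normc_gt0 subr_eq0.
  move=> v vl; have vl' : v != l.
    by apply: contraTneq vl => ->; rewrite normcB ltxx.
  case: eqP => [->//|/eqP vu]; rewrite /F (negbTE vl') (negbTE ul) hE.
  have vu' : v - u != 0 by rewrite subr_eq0.
  by rewrite addrC addKr mulfK.
rewrite (_ : circ_int _ s = circ_int F s); last first.
  apply: eq_cint => t _; rewrite /F ifF //; apply/negbTE; apply: contraTneq ls => <-.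
  by rewrite normc_circ ?ltxx // ltW.
have annF a b : 0 < a -> a <= b -> b < rho ->
    (b < normc l) || (normc l < a) -> circ_int F a = circ_int F b.
  move=> a0 ab br h; apply: circ_int_annulus => // u /andP[u1 u2].
  apply: Fd; first exact: le_lt_trans br.
  by apply: contraTneq h => ue; rewrite negb_or -!leNgt -ue u1 u2.
have cont a : 0 <= a -> a < rho -> forall e : R, 0 < e -> exists2 d : R, 0 < d &
    forall r, 0 <= r -> r < rho -> `|r - a| < d -> normc (circ_int F r - circ_int F a) <= e.
  have FC r u : r < rho -> normc u = r -> cc F u by move=> rr ur; apply: Fc; rewrite ur.
  move=> a0 ar e e0; have [d d0 hd] := circ_int_cont a0 (fun u => FC a u ar) e0.
  by exists d => // r r0 rr ra; apply: hd => // u; exact: FC.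
have key a b : 0 <= a -> a <= b -> b < rho -> (b <= normc l) || (normc l <= a) ->
    circ_int F a = circ_int F b.
  move=> a0; rewrite le_eqVlt => /orP[/eqP -> //|ab] br h; apply: eqc_small => e e0.
  have e2 := half_gt0 e0.
  have [d d0 hd] := cont a a0 (lt_trans ab br) _ e2.
  have [d' d'0 hd'] := cont b (ltW (le_lt_trans a0 ab)) br _ e2.
  have [t [t0 td td' tb]] := third_gap ab d0 d'0.
  have E : circ_int F (a + t) = circ_int F (b - t).
    by apply: annF; move: h; clear -a0 t0 tb br; lra.
  have -> : circ_int F a - circ_int F b =
    (circ_int F (b - t) - circ_int F b) - (circ_int F (a + t) - circ_int F a).
    by rewrite E opprB [RHS]addrC subrKA.
  apply: normcB_le; rewrite (splitr e); apply: lerD; [apply: hd'|apply: hd].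
  - by clear -a0 t0 tb; lra.
  - by clear -t0 br; lra.
  - by rewrite addrC addKr normrN gtr0_norm.
  - by clear -a0 t0; lra.
  - by clear -t0 tb br; lra.
  - by rewrite addrC addKr gtr0_norm.
rewrite -(key (normc l) s) ?lexx ?orbT ?normc_ge0 ?(ltW ls) // -(key 0 (normc l)) ?lexx ?normc_ge0 //; last first.
  exact: lt_trans srho.
rewrite /circ_int (@eq_cint _ _ _ _ (fun=> 0)) ?cint_cst ?mulr0 ?twopi_ge0 // => t _.
by rewrite mul0r FE mulr0.
Qed.

Lemma ccont_sum a b I (q : seq I) (P : pred I) (F : I -> R -> R[i]) :
  (forall i, P i -> ccont a b (F i)) -> ccont a b (fun x => \sum_(i <- q | P i) F i x).
Proof.
move=> h; elim: q => [|i q IH].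
  by under eq_fun do rewrite big_nil; exact: ccont_cst.
under eq_fun do rewrite big_cons.
by case: (boolP (P i)) => // Pi; apply: ccontD => //; exact: h.
Qed.

Lemma cint_sum a b I (q : seq I) (F : I -> R -> R[i]) : a <= b ->
  (forall i, ccont a b (F i)) ->
  cint a b (fun x => \sum_(i <- q) F i x) = \sum_(i <- q) cint a b (F i).
Proof.
move=> ab h; elim: q => [|i q IH].
  rewrite big_nil (@eq_cint _ _ _ _ (fun=> 0)) ?cint_cst ?mulr0 // => x _.
  by rewrite big_nil.
rewrite big_cons -IH -cintD //; last exact: ccont_sum.
by apply: eq_cint => x _; rewrite big_cons.
Qed.

(** A finite geometric sum with its exact remainder stands for the Cauchy kernel, so no sum is
    interchanged with an integral. *)
Lemma power_series f (rho s M : R) : 0 < s -> s < rho ->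
  (forall u, normc u < rho -> cder f u) ->
  (forall u, normc u <= s -> normc (f u) <= M) ->
  exists c : nat -> R[i], (forall k, normc (c k) * s ^+ k <= 2 * M) /\
  forall l K, normc l < s -> normc (f l - \sum_(k < K) c k * l ^+ k) <=
    4 * M * (normc l / s) ^+ K / (1 - normc l / s).
Proof.
move=> s0 srho hf hM.
have p0 : (0 : R) < 2 * pi := twopi_gt0.
have pn : (2 * pi)%:C != 0 :> R[i] by rewrite eq_complex /= gt_eqF.
have M0 : 0 <= M by apply: le_trans (normc_ge0 _) (hM 0 _); rewrite normc0 ltW.
have fc u : normc u = s -> cc f u by move=> us; apply/cder_cc/hf; rewrite us.
have vc u : normc u = s -> cc (fun u => u^-1) u.
  move=> us; apply: ccV; last exact: cc_id.
  by rewrite -normc_gt0 us.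
exists (fun k => (2 * pi)%:C^-1 * circ_int (fun u => f u * u^-1 ^+ k) s); split.
  move=> k; rewrite normcM normcV normcR (ger0_norm (ltW p0)).
  have : normc (circ_int (fun u => f u * u^-1 ^+ k) s) <= 2 * (M * s^-1 ^+ k) * (2 * pi - 0).
    apply: cint_bound; first exact: ltW.
      apply: (@circ_cont (fun u => f u * u^-1 ^+ k) s (ltW s0)) => u us; apply: ccM; [exact: fc|apply: ccX; exact: vc].
    move=> t _; rewrite normcM normcX normcV normc_circ ?(ltW s0) //.
    by rewrite ler_wpM2r ?exprn_ge0 ?invr_ge0 ?(ltW s0) // hM // normc_circ ?(ltW s0).
  rewrite subr0 => h; apply: le_trans (ler_wpM2r _ (ler_wpM2l _ h)) _.
  - by rewrite exprn_ge0 // ltW.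
  - by rewrite invr_ge0 ltW.
  have sk : s ^+ k != 0 by rewrite expf_neq0 // gt_eqF.
  have p2 : 2 * pi != 0 :> R by rewrite gt_eqF.
  rewrite exprVn; set x := 2 * pi in p2 *; set y := s ^+ k in sk *.
  by have -> : x^-1 * (2 * (M / y) * x) * y = 2 * M; [field; exact/andP|].
move=> l K ls; set q := normc l / s.
have q0 : 0 <= q by rewrite divr_ge0 // ltW.
have q1 : q < 1 by rewrite ltr_pdivrMr // mul1r.
have un t : normc (s%:C * expi t) = s by rewrite normc_circ // ltW.
have uln t : s%:C * expi t != l by apply: contraTneq ls => <-; rewrite un ltxx.
have u0n t : s%:C * expi t != 0 by rewrite -normc_gt0 un.
(* For K = 0 the sum lacks the term k = 0, from which f l is recovered below; the bound M on f is
   enough. *)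
case: K => [|K].
  rewrite big_ord0 subr0 expr0 mulr1.
  apply: le_trans (hM l (ltW ls)) _; rewrite ler_pdivlMr ?subr_gt0 //; nra.
have H := circ_int_cauchy s0 srho ls hf.
pose G k u := l ^+ k * (f u * u^-1 ^+ k) - f l * (l ^+ k * u^-1 ^+ k).
pose E u := (f u - f l) * ((l * u^-1) ^+ K.+1 * (u * (u - l)^-1)).
have Gc k u : normc u = s -> cc (G k) u.
  move=> us; rewrite /G; under eq_fun do rewrite -mulNr.
  apply: ccD; (apply: ccM; first exact: cc_cst); apply: ccM.
  - exact: fc. - by apply: ccX; exact: vc. - exact: cc_cst. - by apply: ccX; exact: vc.
have Ec u : normc u = s -> cc E u.
  move=> us; apply: ccM; first by apply: ccD; [exact: fc|exact: cc_cst].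
  apply: ccM; first by apply: ccX; apply: ccM; [exact: cc_cst|exact: vc].
  apply: ccM; first exact: cc_id.
  apply: ccV; last by apply: ccD; [exact: cc_id|exact: cc_cst].
  by rewrite subr_eq0; apply: contraTneq ls => <-; rewrite us ltxx.
have S : circ_int (fun u => (f u - f l) * (u * (u - l)^-1)) s =
    \sum_(k < K.+1) circ_int (G k) s + circ_int E s.
  rewrite /circ_int -cint_sum -?cintD //.
  - apply: eq_cint => t _; rewrite (geom_ident K.+1 (u0n t) (uln t)) mulrDr; congr (_ + _).
    by rewrite mulr_sumr; apply: eq_bigr => k _; rewrite /G; ring.
  - by apply: ccont_sum => k _; apply: (circ_cont (ltW s0)); exact: Gc.
  - exact: (circ_cont (ltW s0)).
  - exact: ltW.
  - by move=> k; apply: (circ_cont (ltW s0)); exact: Gc.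
have Gk k : circ_int (G k) s = l ^+ k * circ_int (fun u => f u * u^-1 ^+ k) s -
    (if k == 0%N then f l * (2 * pi)%:C else 0).
  have c1 : ccont 0 (2 * pi) (fun t => f (s%:C * expi t) * (s%:C * expi t)^-1 ^+ k).
    apply: (@circ_cont (fun u => f u * u^-1 ^+ k) s (ltW s0)) => u us.
    by apply: ccM; [exact: fc|apply: ccX; exact: vc].
  have c2 : ccont 0 (2 * pi) (fun t => (s%:C * expi t)^-1 ^+ k).
    by apply: (@circ_cont (fun u => u^-1 ^+ k) s (ltW s0)) => u us; apply: ccX; exact: vc.
  rewrite /circ_int /G cintB; [|by apply: ccontZ|by do 2! apply: ccontZ].
  rewrite (cintZ (l ^+ k) c1) (cintZ (f l) (ccontZ (l ^+ k) c2)) (cintZ (l ^+ k) c2).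
  have := circ_int_invX k s0; rewrite /circ_int => ->.
  by case: k {c1 c2} => [|k] /=; rewrite ?expr0 ?mul1r // !mulr0.
have Sif : \sum_(k < K.+1) (if (k : nat) == 0%N then f l * (2 * pi)%:C else 0) =
    f l * (2 * pi)%:C by rewrite big_ord_recl /= big1 ?addr0.
rewrite S (eq_bigr _ (fun (k : 'I_K.+1) _ => Gk k)) sumrB Sif in H.
have fE : f l - \sum_(k < K.+1) (2 * pi)%:C^-1 * circ_int (fun u => f u * u^-1 ^+ k) s * l ^+ k =
    (2 * pi)%:C^-1 * circ_int E s.
  have -> : circ_int E s = f l * (2 * pi)%:C - \sum_(k < K.+1) l ^+ k * circ_int (fun u => f u * u^-1 ^+ k) s.
    by move/eqP: H; rewrite addrC addr_eq0 opprB => /eqP.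
  rewrite mulrBr [X in _ = X - _]mulrC mulfK // mulr_sumr; congr (_ - _).
  by apply: eq_bigr => k _; ring.
rewrite fE normcM normcV normcR (ger0_norm (ltW p0)).
have : normc (circ_int E s) <= 2 * (2 * M * (q ^+ K.+1 / (1 - q))) * (2 * pi - 0).
  apply: cint_bound; first exact: ltW.
    exact: (circ_cont (ltW s0)).
  move=> t _; rewrite /E !normcM; apply: ler_pM; rewrite ?mulr_ge0 //.
    apply: normcB_le; rewrite mulr_natl mulr2n lerD ?hM ?un //; exact: ltW.
  rewrite normcX normcM !normcV un -/q ler_wpM2l ?exprn_ge0 //.
  rewrite normc_expi mulr1 normcR (gtr0_norm s0) ler_pdivrMr; last first.
    by rewrite normc_gt0 subr_eq0.
  rewrite mulrC ler_pdivlMr ?subr_gt0 // mulrBr mulr1 /q mulrCA divff ?gt_eqF // mulr1.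
  rewrite lerBlDr -{1}(un t) -{1}(subrK l (s%:C * expi t)); exact: le_normcD.
rewrite subr0 => h; rewrite mulrC ler_pdivrMr //; apply: le_trans h _.
by apply: eqW; ring.
Qed.

End CauchyFormula.

(** * Homogeneous expansions of analytic functions of the ball *)

Section UltraLimits.
Context {R : realType} {T : Type} (U : set_system T) {UU : UltraFilter U}.

(** One ultrafilter gives limits to all bounded families simultaneously, which spares the diagonal
    extraction of subsequences. *)
Lemma ultra_lim_real (x : T -> R) (M : R) : (forall t, `|x t| <= M) ->
  exists l, (x t : R^o) @[t --> U] --> (l : R^o).
Proof.
move=> hM; have := @segment_compact R (- M) M => /(_ (x @ U) _) [].
  by rewrite /fmap /=; apply: filterE => t; rewrite /= in_itv /= -ler_norml; exact: hM.
move=> l [_ hl]; exists l => B lB.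
have [//|nB] := in_ultra_setVsetC (x @^-1` B) UU.
by have [y [nby yb]] := hl (~` B) B nB lB; case: (nby yb).
Qed.

Lemma ultra_lim (x : T -> R[i]) (M : R) : (forall t, normc (x t) <= M) ->
  exists l, x t @[t --> U] ~~> l.
Proof.
move=> hM.
have [a ha] := @ultra_lim_real (fun t => Re (x t)) M (fun t => le_trans (Re_le_normc _) (hM t)).
have [b hb] := @ultra_lim_real (fun t => Im (x t)) M (fun t => le_trans (Im_le_normc _) (hM t)).
exists (a +i* b); apply/cvgcP => e e0.
have e2 := half_gt0 e0.
move/cvgrPdist_lt : ha => /(_ _ e2) ha; move/cvgrPdist_lt : hb => /(_ _ e2) hb.
apply: filterS2 ha hb => t /= h1 h2.
apply: le_lt_trans (normc_le_ReIm _) _.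
by rewrite ReD ReN ImD ImN /= (splitr e) ltrD // distrC.
Qed.

End UltraLimits.

Section Expansion.
Context {R : realType} {n : nat}.
Implicit Types (f g : Cfun R n) (z w a b : Cn R n).

Definition cballr (r : R) z := enorm z <= r.

Lemma analytic_slice f a b l : analytic f -> cball (a + l *: b) ->
  cder (fun u => f (a + u *: b)) l.
Proof.
move=> [hf _] hz; have /(@diff_derivable _ _ _ _ _ b) := hf _ hz.
move=> /cvg_ex[/= D]; set z := a + l *: b.
move=> /(@cvgrPdist_lt _ R[i]^o) hD.
apply: (@cder_quot _ _ _ D) => e e0.
have e0' : (0 : R[i]) < e%:C by rewrite ltcR.
have /nbhs_ballP[d /= d0 hd] := hD _ e0'.
have [d0' dE] := gtc0P d0; exists (Re d) => //.
move=> u ul; rewrite eqxx; have [_|ul'] := eqVneq u l; first by rewrite subrr normc0.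
have := hd (u - l); rewrite /ball /= sub0r normrN normcE' dE ltcR => /(_ ul).
rewrite subr_eq0 => /(_ ul'); rewrite normcE' ltcR normcB.
have -> : (u - l) *: b + z = a + u *: b.
  by rewrite /z /= scalerBl addrCA subrK.
by rewrite /GRing.scale /= mulrC.
Qed.

Lemma analytic_cont f z : analytic f -> cball z ->
  {for z, continuous (f : (Cn R n : normedModType R[i]) -> R[i]^o)}.
Proof. by move=> [hf _] hz; apply: differentiable_continuous; exact: hf. Qed.

Lemma ball_bounded f (r : R) :
  (forall z, cballr r z -> {for z, continuous (f : (Cn R n : normedModType R[i]) -> R[i]^o)}) ->
  exists M, forall z, cballr r z -> normc (f z) <= M.
Proof.
move=> hf; apply: contrapT => hM.
have /choice[x hx] : forall k : nat, exists z, cballr r z /\ k%:R < normc (f z).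
  move=> k; apply: contrapT => hk; apply: hM; exists k%:R => z hz.
  by rewrite leNgt; apply/negP => h; apply: hk; exists z.
have [U [UU hU]] := @ultraFilterLemma nat \oo _.
have /choice[l hl] : forall i : 'I_n, exists l, x k 0 i @[k --> U] ~~> l.
  move=> i; apply: (@ultra_lim _ _ _ UU _ r) => k.
  by apply: le_trans (normc_le_enorm _ _) _; exact: (hx k).1.
pose y : Cn R n := \row_i l i.
have hy (e : R) : 0 < e -> U [set k | enorm (x k - y) < e].
  move=> e0; have e1 : 0 < e / n.+1%:R by rewrite divr_gt0.
  have : \forall k \near U, forall i : 'I_n, normc (x k 0 i - l i) < e / n.+1%:R.
    by apply: filter_forall => i; move/cvgcP : (hl i); apply.
  apply: filterS => k /= hk; apply: le_lt_trans (enorm_lt_sum _) _.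
  apply: (@le_lt_trans _ _ (\sum_(i < n) e / n.+1%:R)).
    by apply: ler_sum => i _; rewrite !mxE; apply/ltW/hk.
  rewrite sumr_const card_ord -[X in X < _]mulr_natr mulrAC ltr_pdivrMr //.
  by rewrite ltr_pM2l ?ltr_nat.
have ry : cballr r y.
  apply/ler_addgt0Pr => e e0; have /filter_ex[k /= hk] := hy e e0.
  rewrite -(subrK (x k) y); apply: le_trans (enormD _ _) _; rewrite addrC lerD //.
    exact: (hx k).1.
  by rewrite enormB ltW.
have /contP /(_ 1 ltr01) [d d0 hd] := hf y ry.
pose N := (Num.truncn (normc (f y) + 1)).+1.
have h1 : U [set k | (N <= k)%N] by apply: hU; exists N.
have hh : U ([set k | (N <= k)%N] `&` [set k | enorm (x k - y) < d]).
  by apply: filterI => //; exact: hy.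
have /filter_ex[k [/= k1 k2]] := hh.
have := (hx k).2; apply/negP; rewrite -leNgt.
have := hd _ k2; move=> /(le_lt_trans (ler_dist_normc _ _)) => h.
have : normc (f (x k)) <= normc (f y) + 1 by move: h; rewrite ltr_norml; lra.
move=> /le_trans; apply; apply: ltW; apply: lt_le_trans (truncnS_gt _) _.
by rewrite ler_nat.
Qed.

(** Once the lower coefficients agree, the difference of the k-th terms is O(|l| ^ (k + 1)), and l
    tends to 0. *)
Lemma coef_uniq (c c' : nat -> R[i]) (s C : R) : 0 < s -> 0 <= C ->
  (forall l K, normc l < s -> normc (\sum_(k < K) c k * l ^+ k - \sum_(k < K) c' k * l ^+ k) <=
     C * (normc l / s) ^+ K / (1 - normc l / s)) ->
  forall k, c k = c' k.
Proof.
move=> s0 C0 h k; elim/ltn_ind: k => k IH.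
apply/eqP; rewrite -subr_eq0 -normc_eq0; apply/eqP/le_anti; rewrite normc_ge0 andbT.
apply/ler_addgt0Pr => e e0; rewrite add0r.
pose B := 2 * C / s ^+ k.+1; have B0 : 0 <= B by rewrite divr_ge0 ?mulr_ge0 // exprn_ge0 // ltW.
pose x := Num.min (s / 2) (e / (B + 1)).
have x0 : 0 < x by rewrite lt_min !divr_gt0 // ltr_wpDl.
have xs : x <= s / 2 by rewrite ge_min lexx.
have xe : x * (B + 1) <= e.
  have : x <= e / (B + 1) by rewrite ge_min lexx orbT.
  by rewrite ler_pdivlMr // ltr_wpDl.
have nx : normc x%:C = x by rewrite normcR gtr0_norm.
have := h x%:C k.+1; rewrite nx => /(_ _) -h1.
have {}h1 := h1 ltac:(lra); move: h1.
rewrite !big_ord_recr /= (eq_bigr (fun i : 'I_k => c' i * x%:C ^+ i)); last first.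
  by move=> i _; rewrite IH.
rewrite opprD addrACA subrr add0r -mulrBl normcM normcX nx => h1.
have q2 : 1 / 2 <= 1 - x / s.
  have : x / s <= 1 / 2 by rewrite ler_pdivrMr // mulrC; lra.
  lra.
have h2 : normc (c k - c' k) * x ^+ k <= B * x * x ^+ k.
  apply: le_trans h1 _.
  apply: (le_via (C * (x / s) ^+ k.+1 * 2)).
    rewrite ler_wpM2l //; last by rewrite -[2]invrK lef_pV2 ?posrE; lra.
    by rewrite mulr_ge0 // exprn_ge0 // divr_ge0 // ltW.
  rewrite /B expr_div_n exprSr; apply: eqW.
  have : s ^+ k.+1 != 0 by rewrite expf_neq0 // gt_eqF.
  by move=> ?; field.
move: h2; rewrite ler_pM2r ?exprn_gt0 // => /le_trans; apply.
by apply: le_trans xe; rewrite mulrC ler_wpM2l ?(ltW x0) // lerDl.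
Qed.

(** The bounds for every r < 1 belong to the definition: they contain uniform convergence on smaller
    balls, hence polynomial approximation. *)
Definition expands f (F : nat -> Cfun R n) := (forall k, hpoly k (F k)) /\
  forall r : R, 0 < r -> r < 1 -> exists2 M : R, 0 <= M &
    (forall k z, normc (F k z) * r ^+ k <= M * enorm z ^+ k) /\
    (forall z K, enorm z < r -> normc (f z - \sum_(k < K) F k z) <=
       M * (enorm z / r) ^+ K / (1 - enorm z / r)).

(** Interpolation is exact on the Taylor polynomial of degree k, so only the remainder counts, with
    its factor s ^ (- k - 1). If h grows like s ^ k the defect is O(1 / s): a Liouville argument,
    used in [homog_seppoly]. *)
Lemma lagr_defect (h : R[i] -> R[i]) (rho s B : R) k l : 0 < s -> s < rho ->
  (forall u, normc u < rho -> cder h u) ->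
  (forall u, normc u <= s -> normc (h u) <= B) ->
  2 * normc l <= s -> 2 * k%:R <= s ->
  normc (h l - \sum_(a < k.+1) h a%:R * (lagr a).[l]) <=
    8 * B / s ^+ k.+1 * (normc l ^+ k.+1 + \sum_(a < k.+1) a%:R ^+ k.+1 * normc (lagr a).[l]).
Proof.
move=> s0 srho hd hB ls ks.
have B0 : 0 <= B by apply: le_trans (normc_ge0 _) (hB 0 _); rewrite normc0 ltW.
have [c [_ hc]] := power_series s0 srho hd hB.
pose S u := \sum_(j < k.+1) c j * u ^+ j.
have SE u : S u = \sum_(a < k.+1) S a%:R * (lagr a).[u].
  pose q : {poly R[i]} := \poly_(j < k.+1) c j.
  have qE v : q.[v] = S v by rewrite horner_poly.
  rewrite -qE (lagr_interp _ (size_poly _ _)); apply: eq_bigr => a _.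
  by rewrite qE.
have bd u : 2 * normc u <= s -> normc (h u - S u) <= 8 * B / s ^+ k.+1 * normc u ^+ k.+1.
  move=> us; have u0 := normc_ge0 u.
  apply: le_trans (hc u k.+1 _) _; first lra.
  have us2 : normc u / s <= 1 / 2 by rewrite ler_pdivrMr //; lra.
  have p0 : 0 <= (normc u / s) ^+ k.+1 by rewrite exprn_ge0 // divr_ge0 // ltW.
  apply: (le_via (4 * B * (normc u / s) ^+ k.+1 * 2)).
    rewrite ler_wpM2l //; first by rewrite !mulr_ge0.
    by rewrite -[2]invrK lef_pV2 ?posrE; lra.
  rewrite expr_div_n; apply: eqW.
  have : s ^+ k.+1 != 0 by rewrite expf_neq0 // gt_eqF.
  by move=> ?; field.
have nk (a : 'I_k.+1) : normc (a%:R : R[i]) = a%:R.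
  by rewrite -(rmorph_nat (real_complex R)) normcR ger0_norm.
have -> : h l - \sum_(a < k.+1) h a%:R * (lagr a).[l] =
   (h l - S l) - \sum_(a < k.+1) (h a%:R - S a%:R) * (lagr a).[l].
  have -> : \sum_(a < k.+1) (h a%:R - S a%:R) * (lagr a).[l] =
      \sum_(a < k.+1) h a%:R * (lagr a).[l] - S l.
    by rewrite (SE l) -sumrB; apply: eq_bigr => a _; rewrite mulrBl.
  by ring.
apply: normcB_le; rewrite mulrDr lerD ?bd //.
apply: normc_sum_le; rewrite mulr_sumr; apply: ler_sum => a _.
rewrite normcM mulrA ler_wpM2r //.
have := bd a%:R; rewrite nk; apply.
by apply: le_trans ks; rewrite ler_wpM2l // ler_nat -ltnS.
Qed.

Lemma analytic_slice_series f z (r : R) : analytic f -> 0 < r -> r < 1 -> z != 0 ->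
  forall M : R, (forall w, cballr r w -> normc (f w) <= M) ->
  exists c : nat -> R[i], (forall k, normc (c k) * r ^+ k <= 2 * M * enorm z ^+ k) /\
  forall l K, normc l * enorm z < r ->
    normc (f (l *: z) - \sum_(k < K) c k * l ^+ k) <=
    4 * M * (normc l * enorm z / r) ^+ K / (1 - normc l * enorm z / r).
Proof.
move=> hf r0 r1 z0 M hM.
have z0' : 0 < enorm z.
  by rewrite lt_def enorm_ge0 andbT; apply: contra z0 => /eqP/enorm_eq0 ->.
pose s := r / enorm z; have s0 : 0 < s by rewrite divr_gt0.
have srho : s < (enorm z)^-1 by rewrite /s gtr_pMl ?invr_gt0.
have hd u : normc u < (enorm z)^-1 -> cder (fun u => f (u *: z)) u.
  move=> uz; have := @analytic_slice f 0 z u hf.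
  under eq_fun do rewrite add0r.
  by apply; rewrite add0r /cball /= enormZ -ltr_pdivlMr // div1r.
have hM' u : normc u <= s -> normc (f (u *: z)) <= M.
  by move=> us; apply: hM; rewrite /cballr enormZ -ler_pdivlMr.
have [c [h1 h2]] := power_series s0 srho hd hM'.
exists c; split=> [k|l K ls].
  have := h1 k; rewrite /s expr_div_n mulrA ler_pdivrMr ?exprn_gt0 //.
have -> : normc l * enorm z / r = normc l / s by rewrite /s invf_div mulrA.
by apply: h2; rewrite /s ltr_pdivlMr.
Qed.

Lemma slice_coef_uniq f z (c c' : nat -> R[i]) (a a' C C' : R) : 0 < a -> 0 < a' -> 0 <= C -> 0 <= C' ->
  (forall l K, normc l < a -> normc (f (l *: z) - \sum_(k < K) c k * l ^+ k) <=
    C * (normc l / a) ^+ K / (1 - normc l / a)) ->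
  (forall l K, normc l < a' -> normc (f (l *: z) - \sum_(k < K) c' k * l ^+ k) <=
    C' * (normc l / a') ^+ K / (1 - normc l / a')) ->
  forall k, c k = c' k.
Proof.
move=> a0 a'0 C0 C'0 h h'; pose s := Num.min a a'.
have s0 : 0 < s by rewrite lt_min a0.
apply: (@coef_uniq c c' s (C + C')) => // [|l K ls]; first exact: addr_ge0.
have [la la'] : normc l < a /\ normc l < a' by move: ls; rewrite lt_min => /andP[].
have -> : \sum_(k < K) c k * l ^+ k - \sum_(k < K) c' k * l ^+ k =
   (f (l *: z) - \sum_(k < K) c' k * l ^+ k) - (f (l *: z) - \sum_(k < K) c k * l ^+ k) by ring.
apply: normcB_le; rewrite addrC mulrDl mulrDl.
have mono (t : R) (D : R) : 0 < t -> s <= t -> 0 <= D -> normc l < t ->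
    D * (normc l / t) ^+ K / (1 - normc l / t) <= D * (normc l / s) ^+ K / (1 - normc l / s).
  move=> t0 st D0 lt.
  have le1 : normc l / t <= normc l / s by rewrite ler_wpM2l // lef_pV2.
  have p0 : 0 <= normc l / t by rewrite divr_ge0 // ltW.
  have q1 : normc l / s < 1 by rewrite ltr_pdivrMr // mul1r.
  apply: ler_pM.
  - by rewrite mulr_ge0 // exprn_ge0.
  - by rewrite invr_ge0 subr_ge0 ltW // (le_lt_trans le1).
  - by rewrite ler_wpM2l // lerXn2r // nnegrE // (le_trans p0).
  - by rewrite lef_pV2 ?posrE ?subr_gt0 // ?(le_lt_trans le1) // lerD2l lerN2.
apply: lerD.
  by apply: le_trans (h _ _ la) _; apply: mono => //; rewrite ge_min lexx.
by apply: le_trans (h' _ _ la') _; apply: mono => //; rewrite ge_min lexx orbT.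
Qed.

(** The coefficients are read off discs that correspond to the radius 1/2. Their uniqueness then
    gives the bounds for all r < 1, and also the homogeneity, since z and [a *: z] span the same
    line. *)
Lemma analytic_expands_homog f : analytic f -> exists F : nat -> Cfun R n,
  (forall k (a : R[i]) z, F k (a *: z) = a ^+ k * F k z) /\
  forall r : R, 0 < r -> r < 1 -> exists2 M : R, 0 <= M &
    (forall k z, normc (F k z) * r ^+ k <= M * enorm z ^+ k) /\
    (forall z K, enorm z < r -> normc (f z - \sum_(k < K) F k z) <=
       M * (enorm z / r) ^+ K / (1 - enorm z / r)).
Proof.
move=> hf.
have bnd (r : R) : 0 < r -> r < 1 -> exists2 M, 0 <= M & forall w, cballr r w -> normc (f w) <= M.
  move=> r0 r1; have [M hM] := @ball_bounded f r (fun z hz => analytic_cont hf (le_lt_trans hz r1)).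
  exists M => //; apply: le_trans (normc_ge0 (f 0)) (hM 0 _).
  by rewrite /cballr enorm0 ltW.
have h2 : (0 : R) < 1 / 2 by lra.
have h2' : (1 / 2 : R) < 1 by lra.
have [M0 M00 hM0] := bnd _ h2 h2'.
pose ok z (c : nat -> R[i]) (r M : R) := (forall k, normc (c k) * r ^+ k <= 2 * M * enorm z ^+ k) /\
  forall l K, normc l * enorm z < r ->
    normc (f (l *: z) - \sum_(k < K) c k * l ^+ k) <=
    4 * M * (normc l * enorm z / r) ^+ K / (1 - normc l * enorm z / r).
(* The point 0 spans no line; its coefficients are prescribed by hand. *)
have /choice[c hc] : forall z, exists c, (z != 0 -> ok z c (1 / 2) M0) /\
    (z = 0 -> c = fun k => if k == 0%N then f 0 else 0).
  move=> z; have [->|z0] := eqVneq z 0; first by exists (fun k => if k == 0%N then f 0 else 0).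
  by have [c hc] := analytic_slice_series hf h2 h2' z0 hM0; exists c; split => // z00; rewrite z00 eqxx in z0.
pose F k z := c z k; exists F.
have c0 : c 0 = fun k => if k == 0%N then f 0 else 0 by exact: (hc 0).2.
have ez z : z != 0 -> 0 < enorm z.
  by move=> z0; rewrite lt_def enorm_ge0 andbT; apply: contra z0 => /eqP/enorm_eq0 ->.
have okr (r M : R) z : 0 < r -> r < 1 -> (forall w, cballr r w -> normc (f w) <= M) ->
    z != 0 -> ok z (c z) r M.
  move=> r0 r1 hM z0; have M1 : 0 <= M.
    by apply: le_trans (normc_ge0 (f 0)) (hM 0 _); rewrite /cballr enorm0 ltW.
  have [c' hc'] := analytic_slice_series hf r0 r1 z0 hM.
  suff -> : c z = c' by exact: hc'.
  apply/funext; apply: (@slice_coef_uniq f z _ _ (1 / 2 / enorm z) (r / enorm z) (4 * M0) (4 * M)).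
  - by rewrite divr_gt0 // ez.
  - by rewrite divr_gt0 // ez.
  - exact: mulr_ge0.
  - exact: mulr_ge0.
  - move=> l K; rewrite ltr_pdivlMr ?ez // => lz.
    by have := ((hc z).1 z0).2 l K lz; rewrite (invf_div (1 / 2)) !mulrA.
  - move=> l K; rewrite ltr_pdivlMr ?ez // => lz.
    by have := hc'.2 l K lz; rewrite (invf_div r) !mulrA.
split=> [k a z|r r0 r1].
  rewrite /F; have [->|z0] := eqVneq z 0.
    rewrite scaler0 c0; case: k => [|k] /=; first by rewrite expr0 mul1r.
    by rewrite mulr0.
  have [->|a0] := eqVneq a 0.
    rewrite scale0r c0; case: k => [|k] /=; last by rewrite exprS !mul0r.
    rewrite expr0 mul1r; have [_ /(_ 0 1%N)] := (hc z).1 z0.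
    rewrite normc0 !mul0r => /(_ h2); rewrite expr1 mulr0 mul0r big_ord_recl big_ord0 expr0 mulr1 addr0 scale0r.
    by move=> h; apply/eqP; rewrite -subr_eq0 -normc_eq0 eq_le normc_ge0 andbT.
  have az : a *: z != 0 by rewrite scaler_eq0 negb_or a0.
  have na : 0 < normc a by rewrite normc_gt0.
  move: k; apply: (@slice_coef_uniq f (a *: z) _ _ (1 / 2 / enorm (a *: z)) (1 / 2 / enorm (a *: z)) (4 * M0) (4 * M0)).
  - by rewrite divr_gt0 // ez.
  - by rewrite divr_gt0 // ez.
  - exact: mulr_ge0.
  - exact: mulr_ge0.
  - move=> l K; rewrite ltr_pdivlMr ?ez // => lz.
    by have := ((hc _).1 az).2 l K lz; rewrite (invf_div (1 / 2)) !mulrA.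
  - move=> l K; rewrite ltr_pdivlMr ?ez // enormZ mulrA -normcM => lz.
    have E : normc (l * a) * enorm z / (1 / 2) = normc l / (1 / 2 / enorm (a *: z)).
      by rewrite enormZ normcM; have := ez z z0 => e0; field; rewrite !gt_eqF.
    have := ((hc _).1 z0).2 (l * a) K lz; rewrite E enormZ scalerA.
    rewrite (eq_bigr (fun i : 'I_K => a ^+ i * c z i * l ^+ i)) //.
    by move=> i _; rewrite exprMn; ring.
have [M M1 hM] := bnd r r0 r1; exists (4 * M); first exact: mulr_ge0.
split=> [k z|z K zr].
  have [->|z0] := eqVneq z 0.
    rewrite /F c0 enorm0; case: k => [|k] /=.
      rewrite !expr0 !mulr1; apply: le_trans (hM 0 _) _; first by rewrite /cballr enorm0 ltW.
      by rewrite ler_peMl // ler1n.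
    by rewrite normc0 mul0r exprS mul0r mulr0.
  have [h _] := okr r M z r0 r1 hM z0; apply: le_trans (h k) _.
  by rewrite ler_wpM2r ?exprn_ge0 // ler_wpM2r // ler_nat.
have [z0|z0] := eqVneq z 0.
  rewrite z0 enorm0 mul0r /F c0; case: K => [|K].
    rewrite big_ord0 subr0 expr0 subr0 divr1 mulr1.
    apply: le_trans (hM 0 _) _; first by rewrite /cballr enorm0 ltW.
    by rewrite ler_peMl // ler1n.
  by rewrite big_ord_recl /= big1 // addr0 subrr normc0 exprS mul0r mulr0 mul0r.
have [_ h] := okr r M z r0 r1 hM z0.
have := h 1 K; rewrite normc1 mul1r scale1r => /(_ zr).
by under eq_bigr do rewrite expr1n mulr1.
Qed.

Lemma cder_sum I (q : seq I) (P : pred I) (g : I -> R[i] -> R[i]) l :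
  (forall i, P i -> cder (g i) l) -> cder (fun u => \sum_(i <- q | P i) g i u) l.
Proof.
move=> h; elim: q => [|i q IH].
  by under eq_fun do rewrite big_nil; exact: cder_cst.
under eq_fun do rewrite big_cons.
by case: (boolP (P i)) => // Pi; apply: cderD => //; exact: h.
Qed.

Lemma enorm_delta (i : 'I_n) : enorm (delta_mx 0 i : Cn R n) = 1.
Proof.
rewrite /enorm (bigD1 i) //= mxE !eqxx normc1 expr1n big1 ?addr0 ?sqrtr1 // => j ji.
by rewrite mxE (negbTE ji) andbF normc0 expr0n.
Qed.

Lemma homog_avg (F : nat -> Cfun R n) (w : R[i]) m k y : m.-primitive_root w -> (k < m)%N ->
  (forall k (a : R[i]) z, F k (a *: z) = a ^+ k * F k z) ->
  \sum_(j < m) (\sum_(q < m) F q (w ^+ j *: y)) * w ^+ (j * (m - k)) = m%:R * F k y.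
Proof.
move=> wp km hF.
under eq_bigr do rewrite mulr_suml.
rewrite exchange_big /= (bigD1 (Ordinal km)) //= [X in _ + X]big1 ?addr0 => [|q qk].
  rewrite (eq_bigr (fun=> F k y)) ?sumr_const ?card_ord ?mulr_natl // => j _.
  rewrite hF mulrAC -exprM -exprD -mulnDr subnKC 1?ltnW // mulnC exprM.
  by rewrite (prim_expr_order wp) expr1n mul1r.
under eq_bigr => j _ do rewrite hF mulrAC -exprM -exprD -mulnDr.
rewrite -mulr_suml (sum_prim_root _ wp) ifF ?mul0r //.
apply/negbTE; apply: contra qk => /dvdnP[c cE]; apply/eqP/val_inj => /=.
move: cE; have := ltn_ord q; case: c => [|[|c]] qm.
- by rewrite mul0n; lia.
- by rewrite mul1n; lia.
- by rewrite !mulSn; lia.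
Qed.

(** So far F k is controlled only along lines through 0. A finite mean h of f over rotations is
    holomorphic along the line x + u e and within 1 / L of F k for |u| < L + 1; it is O(L ^ k)
    there, so [lagr_defect] makes its interpolation error O(1 / L). As L is arbitrary, F k equals
    its interpolation polynomial. *)
Lemma homog_seppoly f (F : nat -> Cfun R n) M : analytic f -> 0 <= M ->
  (forall k (a : R[i]) z, F k (a *: z) = a ^+ k * F k z) ->
  (forall k z, normc (F k z) * (1 / 2) ^+ k <= M * enorm z ^+ k) ->
  (forall z K, enorm z < 1 / 2 -> normc (f z - \sum_(k < K) F k z) <=
       M * (enorm z / (1 / 2)) ^+ K / (1 - enorm z / (1 / 2))) ->
  forall k, seppoly k (F k).
Proof.
move=> hf M0 hF hb hs k i z.
pose x := set_coord i 0 z; pose e : Cn R n := delta_mx 0 i.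
have xe l : set_coord i l z = x + l *: e.
  apply/matrixP => u j; rewrite !mxE; case: eqP => [_|_].
    by rewrite ord1 eqxx mulr1 add0r.
  by rewrite andbF mulr0 addr0.
pose P l := F k (x + l *: e); pose l := z 0 i.
have -> : F k z = P l.
  by rewrite /P -xe; congr (F k _); apply/matrixP => u j; rewrite !mxE ord1; case: eqP => [->|].
under eq_bigr do rewrite xe -/(P _); rewrite -/l.
apply/eqP; rewrite -subr_eq0 -normc_eq0 eq_le normc_ge0 andbT.
apply/ler_addgt0Pr => eps eps0; rewrite add0r.
pose N := enorm x + 1; have N0 : 0 <= N by rewrite addr_ge0.
pose Ck := M * 2 ^+ k; have Ck0 : 0 <= Ck by rewrite mulr_ge0 // exprn_ge0.
have FC w : normc (F k w) <= Ck * enorm w ^+ k.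
  have := hb k w; rewrite -(@ler_pM2r _ (2 ^+ k)) ?exprn_gt0 // -mulrA -exprMn.
  by rewrite (_ : 1 / 2 * 2 = 1 :> R) ?expr1n ?mulr1 1?mulrAC //; lra.
pose SA := \sum_(a < k.+1) a%:R ^+ k.+1 * normc (lagr a).[l].
pose A := normc l ^+ k.+1 + SA.
pose B1 := 1 + \sum_(a < k.+1) normc (lagr a).[l].
have A0 : 0 <= A.
  apply: addr_ge0; first by rewrite exprn_ge0.
  by apply: sumr_ge0 => a _; rewrite mulr_ge0 // exprn_ge0.
have B10 : 0 <= B1 by rewrite addr_ge0 // sumr_ge0 // => a _; exact: normc_ge0.
pose D := Ck * (N + 1) ^+ k + 1.
have D0 : 0 <= D by rewrite addr_ge0 // mulr_ge0 // exprn_ge0 // addr_ge0.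
pose Ct := 8 * D * A + B1; have Ct0 : 0 <= Ct by rewrite addr_ge0 // !mulr_ge0.
pose L := 1 + 2 * normc l + 2 * k%:R + Ct / eps.
have nl := normc_ge0 l; have k0 : 0 <= k%:R :> R by [].
have Ce : 0 <= Ct / eps by rewrite divr_ge0 // ltW.
have L1 : 1 <= L by rewrite /L; lra.
have L0 : 0 < L by lra.
have Ll : 2 * normc l <= L by rewrite /L; lra.
have Lk : 2 * k%:R <= L by rewrite /L; lra.
have Le : Ct / L <= eps.
  rewrite ler_pdivrMr // mulrC -ler_pdivrMr // /L; lra.
(* Scaling by t brings the part |u| < L + 1 of the line into the ball of radius 1/4, where the
   expansion converges geometrically; homogeneity undoes the scaling. *)
pose t := (4 * (N + L + 1))^-1; have t0 : 0 < t by rewrite invr_gt0; lra.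
have tk0 : 0 < t ^+ k by rewrite exprn_gt0.
pose X := (t ^+ k)^-1 * 2 * M * L.
have X0 : 0 <= X by rewrite !mulr_ge0 ?invr_ge0 // ltW.
(* m is so large that truncating at degree m costs at most 1 / L, even after the scaling back by t ^
   (- k). *)
pose m := (Num.truncn X + k).+1.
have km : (k < m)%N by rewrite ltnS leq_addl.
have Xm : X <= 2 ^+ m.
  apply: (le_via m%:R); last by rewrite -natrX ler_nat ltnW // ltn_expl.
  by apply/ltW/(lt_le_trans (truncnS_gt _)); rewrite ler_nat ltnS leq_addr.
have m0 : (0 < m)%N by [].
have [w wp] := @prim_root_exists R m m0.
have wn j : normc (w ^+ j) = 1.
  by rewrite normcX (normc_unity m0 (prim_expr_order wp)) expr1n.
have nm : normc (m%:R : R[i]) = m%:R.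
  by rewrite -(rmorph_nat (real_complex R)) normcR ger0_norm.
have mR : 0 < m%:R :> R by rewrite ltr0n.
have mC : m%:R != 0 :> R[i] by rewrite pnatr_eq0.
pose y u := t%:C *: (x + u *: e).
have yb u : normc u < L + 1 -> enorm (y u) < 1 / 4.
  move=> uL; rewrite enormZR ?(ltW t0) //.
  have : enorm (x + u *: e) < N + L + 1.
    apply: le_lt_trans (enormD _ _) _; rewrite enormZ enorm_delta mulr1 /N.
    by clear - uL; lra.
  have -> : 1 / 4 = t * (N + L + 1) by rewrite /t; field; rewrite gt_eqF //; clear - N0 L0; lra.
  by rewrite ltr_pM2l.
pose h u := (t ^+ k)^-1%:C * (m%:R^-1 * \sum_(j < m) f (w ^+ j *: y u) * w ^+ (j * (m - k))).
have PE u : P u = (t ^+ k)^-1%:C * F k (y u).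
  rewrite /y hF mulrA -rmorphXn -rmorphM mulVf ?mul1r //.
  by rewrite gt_eqF.
have hP u : normc u < L + 1 -> normc (h u - P u) <= L^-1.
  move=> /yb yu; rewrite PE /h -mulrBr normcM normcR (ger0_norm (ltW _)) ?invr_gt0 //.
  rewrite -[F k (y u)](mulKf mC) -(homog_avg _ wp km hF) -mulrBr -sumrB normcM normcV nm.
  apply: (le_via ((t ^+ k)^-1 * (m%:R^-1 * \sum_(j < m) 2 * M / 2 ^+ m))).
    rewrite ler_wpM2l ?invr_ge0 ?(ltW tk0) // ler_wpM2l ?invr_ge0 ?(ltW mR) //.
    apply: normc_sum_le; apply: ler_sum => j _.
    rewrite -mulrBl normcM wn mulr1.
    have ey : enorm (w ^+ j *: y u) = enorm (y u) by rewrite enormZ wn mul1r.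
    apply: le_trans (hs _ m _) _; rewrite ey; first by clear - yu; lra.
    have y0 := enorm_ge0 (y u).
    have q1 : enorm (y u) / (1 / 2) <= 1 / 2 by clear - yu y0; lra.
    have q0 : 0 <= enorm (y u) / (1 / 2) by clear - yu y0; lra.
    have -> : 2 * M / 2 ^+ m = M * (1 / 2) ^+ m * 2 by rewrite div1r exprVn; ring.
    apply: ler_pM.
    - by rewrite mulr_ge0 // exprn_ge0.
    - by rewrite invr_ge0; clear - q1; lra.
    - by rewrite ler_wpM2l // lerXn2r // nnegrE.
    - by rewrite -[2]invrK lef_pV2 ?posrE //; clear - q1; lra.
  rewrite (_ : \sum_(j < m) 2 * M / 2 ^+ m = m%:R * (2 * M / 2 ^+ m)); last first.
    by rewrite sumr_const card_ord [RHS]mulr_natl.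
  rewrite mulKf ?gt_eqF //.
  rewrite -(@ler_pM2r _ L) // mulVf ?gt_eqF //.
  have -> : (t ^+ k)^-1 * (2 * M / 2 ^+ m) * L = X / 2 ^+ m by rewrite /X; ring.
  by rewrite ler_pdivrMr ?exprn_gt0 // mul1r.
have hd u : normc u < L + 1 -> cder h u.
  move=> /yb yu; apply: cderM; first exact: cder_cst.
  apply: cderM; first exact: cder_cst.
  apply: cder_sum => j _; apply: cderM; last exact: cder_cst.
  have := @analytic_slice f ((w ^+ j * t%:C) *: x) ((w ^+ j * t%:C) *: e) u hf.
  have E v : (w ^+ j * t%:C) *: x + v *: ((w ^+ j * t%:C) *: e) = w ^+ j *: y v.
    by rewrite /y !scalerDr !scalerA [v * _]mulrC.
  rewrite E; under eq_fun do rewrite E; apply.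
  by rewrite /cball /= enormZ wn mul1r; clear - yu; lra.
have hB u : normc u <= L -> normc (h u) <= D * L ^+ k.
  move=> uL; rewrite -(subrK (P u) (h u)); apply: normcD_le.
  have uL' : normc u < L + 1 by clear - uL; lra.
  have Lk1 : 1 <= L ^+ k by rewrite exprn_ege1.
  have h1 := hP u uL'; have h2 : L^-1 <= 1 by rewrite invf_le1.
  have h3 : normc (P u) <= Ck * ((N + 1) * L) ^+ k.
    apply: le_trans (FC _) _; rewrite ler_wpM2l // lerXn2r ?nnegrE //.
      exact: mulr_ge0 (addr_ge0 N0 ler01) (ltW L0).
    apply: le_trans (enormD _ _) _; rewrite enormZ enorm_delta mulr1 mulrDl mul1r lerD //.
    by apply: (le_via N); rewrite /N ?lerDl // ler_peMr.
  by rewrite /D mulrDl mul1r -mulrA -exprMn addrC lerD // (le_trans h1) // (le_trans h2).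
have rho : L < L + 1 by rewrite ltrDl.
have := lagr_defect L0 rho hd hB Ll Lk; rewrite -/SA -/A => hdef.
have -> : P l - \sum_(a < k.+1) P a%:R * (lagr a).[l] =
   (h l - \sum_(a < k.+1) h a%:R * (lagr a).[l]) -
   ((h l - P l) - \sum_(a < k.+1) (h a%:R - P a%:R) * (lagr a).[l]).
  have -> : \sum_(a < k.+1) (h a%:R - P a%:R) * (lagr a).[l] =
      \sum_(a < k.+1) h a%:R * (lagr a).[l] - \sum_(a < k.+1) P a%:R * (lagr a).[l].
    by rewrite -sumrB; apply: eq_bigr => a _; rewrite mulrBl.
  by ring.
apply: normcB_le; apply: le_trans Le; rewrite /Ct mulrDl; apply: lerD.
  apply: le_trans hdef _; apply: eqW.
  rewrite exprSr; have : L ^+ k != 0 by rewrite expf_neq0 // gt_eqF.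
  have : L != 0 by rewrite gt_eqF.
  by move: (L ^+ k) => Lk' ? ?; field; exact/andP.
apply: normcB_le; rewrite /B1 mulrDl mul1r; apply: lerD.
  by apply: hP; clear - Ll L0 nl; lra.
apply: normc_sum_le; rewrite mulr_suml; apply: ler_sum => a _.
rewrite normcM mulrC ler_wpM2l //; apply: hP.
rewrite -(rmorph_nat (real_complex R)) normcR ger0_norm //.
have : a%:R <= k%:R :> R by rewrite ler_nat -ltnS.
by clear - Lk L0 k0; lra.
Qed.

Theorem analytic_expands f : analytic f -> exists F, expands f F.
Proof.
move=> hf; have [F [hF hr]] := analytic_expands_homog hf.
exists F; split=> // k; split=> //.
have h2 : (0 : R) < 1 / 2 by lra.
have h2' : (1 / 2 : R) < 1 by lra.
have [M M0 [h3 h4]] := hr _ h2 h2'.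
have sp := homog_seppoly hf M0 hF h3 h4 k.
have [A [nd [L [hL1 hL2]]]] := @seppoly_interp R n k.
rewrite (funext (hL2 _ sp)); apply: ispoly_sum => a _; exact: ispolyZ.
Qed.

End Expansion.

(** * Analyticity as uniform polynomial approximation *)

Section AnalyticCriterion.
Context {R : realType} {n : nat}.
Local Notation CN := (Cn R n : normedModType R[i]).
Implicit Types (f g : Cfun R n) (z w h : Cn R n).

Definition rowdot (l : Cn R n) : CN -> R[i]^o :=
  fun h => \sum_i l 0 i * h 0 i.

Lemma rowdot_linear l : linear (rowdot l).
Proof.
move=> a h k; rewrite /rowdot /GRing.scale /= mulr_sumr -big_split.
by apply: eq_bigr => i _; rewrite !mxE mulrDr mulrCA.
Qed.

HB.instance Definition _ l := @GRing.isLinear.Build R[i] (Cn R n) R[i]^o _ (rowdot l) (rowdot_linear l).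

Lemma rowdot_cont l : continuous (rowdot l).
Proof.
move=> z; apply: (@ispoly_cont R n (rowdot l)).
apply: ispoly_sum => i _; apply: ispolyZ; exact: (ispoly_coord i).
Qed.

Lemma normr_rowE h : (`|h : CN| : R[i]) = (Re `|h : CN|)%:C.
Proof.
have := normr_ge0 (h : CN).
by rewrite lecE /= => /andP[/eqP + _]; case: (`|_|) => a b /= ->.
Qed.

Lemma enorm_le_norm h : enorm h <= n%:R * Re `|h : CN|.
Proof.
set a := Re _.
have hi i : normc (h 0 i) <= a.
  apply/ler_addgt0Pr => e e0.
  have : ball (0 : CN) (a + e)%:C h.
    by rewrite -ball_normE /ball_ /= sub0r normrN normr_rowE ltcR -/a ltrDl.
  move=> [_ /(_ 0 i)]; rewrite /ball /= mxE sub0r normrN normcE' ltcR => /ltW.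
  exact.
apply: le_trans (enorm_lt_sum _) _.
apply: (le_via (\sum_(i < n) a)); first exact: ler_sum.
by rewrite sumr_const card_ord mulr_natl.
Qed.

(** A quadratic remainder bound with fixed constants, unlike differentiability itself, survives
    pointwise limits. *)
Lemma differentiable_quadratic f z l (C d : R) : 0 <= C -> 0 < d ->
  (forall h, enorm h < d -> normc (f (z + h) - f z - rowdot l h) <= C * enorm h ^+ 2) ->
  differentiable (f : _ -> R[i]^o) (z : CN).
Proof.
move=> C0 d0 H.
have E : (f : CN -> R[i]^o) \o shift (z : CN) = cst (f z) + rowdot l +o_ (0 : CN) id.
  apply/eqaddoP => e e0.
  have [e0' eE] := gtc0P e0.
  apply/nbhs_enormP; exists (Num.min d (Re e / (C * n%:R + 1))).
    by rewrite lt_min d0 divr_gt0 // ltr_wpDl // mulr_ge0.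
  move=> h; rewrite subr0 lt_min => /andP[h1 h2].
  rewrite eE normcE' normr_rowE -rmorphM lecR /= !fctE /= opprD addrA.
  rewrite (addrC h z); apply: le_trans (H h h1) _.
  have := enorm_le_norm h; set a := Re `|_| => h3.
  have a0 : 0 <= a by have := normr_ge0 (h : CN); rewrite normr_rowE lecR.
  move: h2; rewrite ltr_pdivlMr ?ltr_wpDl ?mulr_ge0 // => h2.
  have h0 := enorm_ge0 h; have n0 : 0 <= n%:R :> R by [].
  apply: (le_via (C * enorm h * (n%:R * a))).
    by rewrite expr2 mulrA ler_wpM2l // mulr_ge0.
  have -> : C * enorm h * (n%:R * a) = (enorm h * (C * n%:R)) * a by ring.
  rewrite ler_wpM2r //; apply: le_trans (ltW h2); rewrite ler_wpM2l // lerDl //.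
have dE := diff_unique (@rowdot_cont l) E.
by apply/diff_locallyP; rewrite dE; split=> //; exact: rowdot_cont.
Qed.

(** Equivalent to [analytic] for functions that vanish off the ball ([analytic_criterion]); sums and
    products are easy in this form. *)
Definition polyapprox f := forall r e : R, r < 1 -> 0 < e ->
  exists2 p, ispoly p & forall z, enorm z <= r -> normc (f z - p z) <= e.

Lemma ulim_le (T : Type) (F : set_system T) {FF : ProperFilter F} (x : T -> R[i]) l (M : R) :
  x t @[t --> F] ~~> l -> (\forall t \near F, normc (x t) <= M) -> normc l <= M.
Proof.
move=> /cvgcP hx hM; apply/ler_addgt0Pr => e e0.
have /filter_ex[t [/= h1 h2]] : \forall t \near F, normc (x t - l) < e /\ normc (x t) <= M.
  by near=> t; split; near: t => //; exact: hx.
rewrite -[l](subrK (x t)); apply: normcD_le.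
by rewrite addrC lerD // normcB ltW.
Unshelve. all: by end_near. Qed.

(** Cauchy estimates on the lines through z. The constants depend only on the sup bound B, hence are
    uniform over a bounded sequence of polynomials. *)
Lemma poly_quadratic p z (rho B : R) : ispoly p -> 0 < rho ->
  (forall w, enorm (w - z) <= rho -> normc (p w) <= B) ->
  exists l : Cn R n, (forall i, normc (l 0 i) <= B / rho) /\
    forall h, 2 * enorm h <= rho -> normc (p (z + h) - p z - rowdot l h) <= 2 * B / rho ^+ 2 * enorm h ^+ 2.
Proof.
move=> hp rho0 hB; have [l hl] := poly_line hp z; exists l.
have B0 : 0 <= B by apply: le_trans (normc_ge0 (p z)) (hB z _); rewrite subrr enorm0 ltW.
split=> [i|h hr].
  have [q [q1 q2 q3]] := hl (delta_mx 0 i).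
  have : normc q`_1 * rho ^+ 1 <= B.
    apply: cauchy_estimate => [|a an]; first exact: ltW.
    by rewrite -q1; apply: hB; rewrite addrC addKr enormZ enorm_delta mulr1 an.
  rewrite q3 (bigD1 i) //= mxE !eqxx mulr1 big1 ?addr0 ?ler_pdivlMr // => j ji.
  by rewrite mxE (negbTE ji) andbF mulr0.
have [q [q1 q2 q3]] := hl h.
have [h0|h0] := eqVneq (enorm h) 0.
  rewrite (enorm_eq0 h0) addr0 subrr sub0r normcN /rowdot big1 => [|i _]; last by rewrite mxE mulr0.
  by rewrite normc0 enorm0 expr0n mulr0.
have hp0 : 0 < enorm h by rewrite lt_def h0 enorm_ge0.
pose t := rho / enorm h; have t2 : 2 <= t by rewrite ler_pdivlMr.
have t0 : 0 < t by rewrite divr_gt0.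
have qc j : normc q`_j <= B / t ^+ j.
  rewrite ler_pdivlMr ?exprn_gt0 //; apply: cauchy_estimate => [|a an]; first exact: ltW.
  by rewrite -q1; apply: hB; rewrite addrC addKr enormZ an /t mulfVK.
have pE : p (z + h) = \sum_(i < (size q).+2) q`_i.
  rewrite -[h]scale1r q1 (@horner_coef_wide _ (size q).+2); last by rewrite -addn2 leq_addr.
  by apply: eq_bigr => i _; rewrite expr1n mulr1.
have -> : p (z + h) - p z - rowdot l h = \sum_(i < size q) q`_i.+2.
  have -> : rowdot l h = q`_1 by rewrite q3.
  by rewrite pE 2!big_ord_recl /= q2 /bump /=; set S := \sum_(i < size q) _; ring.
have geo N : \sum_(i < N) B / t ^+ i.+2 <= 2 * B / t ^+ 2.
  have key : forall N, \sum_(i < N) B / t ^+ i.+2 <= 2 * B / t ^+ 2 * (1 - 1 / 2 ^+ N).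
    elim=> [|m IH]; first by rewrite big_ord0 expr0 divr1 subrr mulr0.
    rewrite big_ord_recr /=; apply: le_trans (lerD IH (_ : _ <= B / t ^+ 2 / 2 ^+ m)) _.
      rewrite -[m.+2]addn2 addnC exprD invfM mulrA ler_wpM2l //.
        by rewrite divr_ge0 // exprn_ge0 // ltW.
      by rewrite lef_pV2 ?posrE ?exprn_gt0 // lerXn2r // nnegrE ltW.
    rewrite [2 ^+ m.+1]exprS; have : 2 ^+ m != 0 :> R by rewrite expf_neq0.
    have : t ^+ 2 != 0 by rewrite expf_neq0 // gt_eqF.
    move: (2 ^+ m) (t ^+ 2) => x y y0 x0; apply: eqW.
    by field; exact/andP.
  apply: le_trans (key N) _; rewrite ler_piMr //.
    by apply: divr_ge0; [exact: mulr_ge0|exact: sqr_ge0].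
apply: normc_sum_le.
apply: (le_via (\sum_(i < size q) B / t ^+ i.+2)).
  by apply: ler_sum => i _; exact: qc.
apply: le_trans (geo _) _; rewrite /t expr_div_n; apply: eqW.
have : rho ^+ 2 != 0 by rewrite expf_neq0 // gt_eqF.
have : enorm h ^+ 2 != 0 by rewrite expf_neq0.
by move: (rho ^+ 2) (enorm h ^+ 2) => x y y0 x0; field; exact/andP.
Qed.

Lemma polyapprox_bounded f (r : R) : polyapprox f -> r < 1 ->
  exists2 M : R, 0 <= M & forall z, enorm z <= r -> normc (f z) <= M.
Proof.
move=> hf r1; have [p hp hpf] := hf r 1 r1 ltr01.
have [M hM] := @ball_bounded R n p r (fun w _ => @ispoly_cont R n p hp w).
exists (`|M| + 1) => // z zr; rewrite -(subrK (p z) (f z)) addrC.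
apply: normcD_le; rewrite lerD ?hpf //.
by apply: le_trans (hM _ zr) _; exact: ler_norm.
Qed.

(** The approximants are uniformly bounded on a ball around z, so their gradients have an
    ultrafilter limit and the quadratic estimate passes to f. *)
Lemma polyapprox_analytic f : polyapprox f -> (forall z, ~ cball z -> f z = 0) -> analytic f.
Proof.
move=> hf h0; split=> // z zb.
pose r := (1 + enorm z) / 2; have zb' : enorm z < 1 := zb.
have [r1 zr] : r < 1 /\ enorm z < r by rewrite /r; split; lra.
pose d := r - enorm z; have d0 : 0 < d by rewrite subr_gt0.
have [M M0 hM] := polyapprox_bounded hf r1.
have /choice[p hp] : forall j : nat, exists p : Cfun R n, ispoly p /\
    forall z, enorm z <= r -> normc (f z - p z) <= j.+1%:R^-1.
  move=> j; have [|p h1 h2] := hf r j.+1%:R^-1 r1; first by rewrite invr_gt0.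
  by exists p.
have inb w : enorm (w - z) <= d -> enorm w <= r.
  by move=> wz; rewrite -(subrK z w); apply: le_trans (enormD _ _) _; rewrite /d in wz; lra.
have pB j w : enorm (w - z) <= d -> normc (p j w) <= M + 1.
  move=> /inb wr; rewrite -(subrK (f w) (p j w)) addrC; apply: normcD_le.
  rewrite lerD ?hM // normcB; apply: le_trans ((hp j).2 _ wr) _.
  by rewrite invf_le1 // ler1n.
have /choice[l hl] := fun j => poly_quadratic (hp j).1 d0 (pB j).
have [U [UU hU]] := @ultraFilterLemma nat \oo _.
have /choice[L hL] : forall i : 'I_n, exists L, l k 0 i @[k --> U] ~~> L.
  by move=> i; apply: (@ultra_lim _ _ _ UU _ ((M + 1) / d)) => k; exact: (hl k).1.
have pf w : enorm w <= r -> p k w @[k --> U] ~~> f w.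
  move=> wr; apply/cvgcP => e e0; apply: hU.
  exists (Num.truncn e^-1) => // k /= kk; rewrite normcB.
  apply: le_lt_trans ((hp k).2 _ wr) _; rewrite invf_plt ?posrE //.
  by apply: lt_le_trans (truncnS_gt _) _; rewrite ler_nat ltnS.
apply: (@differentiable_quadratic f z (\row_i L i) (2 * (M + 1) / d ^+ 2) (d / 2)).
- by apply: divr_ge0; [rewrite mulr_ge0 // addr_ge0|exact: sqr_ge0].
- by rewrite divr_gt0.
move=> h hd.
have lim : (p k (z + h) - p k z - rowdot (l k) h) @[k --> U] ~~> (f (z + h) - f z - rowdot (\row_i L i) h).
  have zh : enorm (z + h) <= r by apply: inb; rewrite addrC addKr; lra.
  have z0 : enorm z <= r by exact: ltW.
  have N (x : nat -> R[i]) y : x k @[k --> U] ~~> y ->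
      (- x k) @[k --> U] ~~> (- y).
    move=> /cvgcP hx; apply/cvgcP => e e0; apply: filterS (hx e e0) => k.
    by rewrite -opprD normcN.
  apply: cvgcD; last apply: N.
    by apply: cvgcD; [exact: pf|apply: N; exact: pf].
  rewrite /rowdot; apply: cvgc_sum => i _; rewrite mxE.
  by apply: cvgcM; [exact: hL|exact: cvgc_cst].
apply: (ulim_le lim); apply: filterE => k.
by apply: (hl k).2; lra.
Qed.

Lemma expands_polyapprox f F : expands f F -> polyapprox f.
Proof.
move=> [hF hr] r e r1 e0; pose r' := Num.max r (1 / 2); pose s := (1 + r') / 2.
have r'1 : r' < 1 by rewrite gt_max r1 /=; lra.
have r'2 : 1 / 2 <= r' by rewrite le_max lexx orbT.
have [s0 s1] : 0 < s /\ s < 1 by rewrite /s; split; lra.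
have rs : r' < s by rewrite /s; lra.
have [M M0 [_ hM]] := hr s s0 s1.
pose q := r' / s; have q1 : q < 1 by rewrite ltr_pdivrMr // mul1r.
have q0 : 0 <= q by rewrite divr_ge0 //; lra.
have [K hK] : exists K, M * q ^+ K / (1 - q) <= e.
  have : (q ^+ k : R^o) @[k --> \oo] --> (0 : R^o) by apply: cvg_expr; rewrite ger0_norm.
  have e1 : 0 < e * (1 - q) / (M + 1) by rewrite divr_gt0 ?mulr_gt0 ?subr_gt0 // ltr_wpDl.
  move=> /cvgrPdist_lt/(_ _ e1) [K _ /(_ K (leqnn K))] /=.
  rewrite sub0r normrN ger0_norm ?exprn_ge0 // ltr_pdivlMr ?ltr_wpDl // => h.
  exists K; rewrite ler_pdivrMr ?subr_gt0 //; apply: le_trans (ltW h).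
  by rewrite mulrC ler_wpM2l ?exprn_ge0 // lerDl.
exists (fun z => \sum_(k < K) F k z).
  by apply: ispoly_sum => k _; exact: (hF k).1.
move=> z zr; have zr' : enorm z <= r' by rewrite le_max zr.
apply: le_trans (hM _ _ (le_lt_trans zr' rs)) _; apply: le_trans hK.
have zq : enorm z / s <= q by rewrite ler_wpM2r // invr_ge0 ltW.
have zq0 : 0 <= enorm z / s by rewrite divr_ge0 // ltW.
apply: ler_pM.
- by rewrite mulr_ge0 // exprn_ge0.
- by rewrite invr_ge0 subr_ge0; lra.
- by rewrite ler_wpM2l // lerXn2r // nnegrE.
- by rewrite lef_pV2 ?posrE ?subr_gt0 //; lra.
Qed.

Lemma analytic_polyapprox f : analytic f -> polyapprox f.
Proof. by move=> /analytic_expands[F]; exact: expands_polyapprox. Qed.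

Lemma analytic_criterion f : analytic f <-> (polyapprox f /\ forall z, ~ cball z -> f z = 0).
Proof.
split=> [hf|[h1 h2]]; last exact: polyapprox_analytic.
by split; [exact: analytic_polyapprox|exact: hf.2].
Qed.

Lemma polyapprox_poly p : ispoly p -> polyapprox p.
Proof. by move=> hp r e _ e0; exists p => // z _; rewrite subrr normc0 ltW. Qed.

Lemma polyapproxD f g : polyapprox f -> polyapprox g -> polyapprox (fun z => f z + g z).
Proof.
move=> hf hg r e r1 e0; have e2 := half_gt0 e0.
have [p hp pf] := hf r _ r1 e2; have [q hq qg] := hg r _ r1 e2.
exists (fun z => p z + q z); first exact: ispolyD.
move=> z zr; rewrite opprD addrACA; apply: normcD_le.
by rewrite (splitr e) lerD ?pf ?qg.
Qed.

Lemma polyapproxM f g : polyapprox f -> polyapprox g -> polyapprox (fun z => f z * g z).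
Proof.
move=> hf hg r e r1 e0.
have [M M0 hM] := polyapprox_bounded hf r1; have [N N0 hN] := polyapprox_bounded hg r1.
have e1 : 0 < Num.min 1 (e / (M + N + 1)) by rewrite lt_min ltr01 divr_gt0 // ltr_wpDl ?addr_ge0.
have [p hp pf] := hf r _ r1 e1; have [q hq qg] := hg r _ r1 e1.
exists (fun z => p z * q z); first exact: ispolyM.
move=> z zr; have h1 := pf z zr; have h2 := qg z zr.
have -> : f z * g z - p z * q z = f z * (g z - q z) + (f z - p z) * g z - (f z - p z) * (g z - q z).
  by ring.
move: h1 h2; rewrite !le_min => /andP[a1 a2] /andP[b1 b2].
apply: normcB_le; apply: le_trans (lerD (le_normcD _ _) (lexx _)) _.
rewrite !normcM; set t := e / _ in a2 b2.
have t0 : 0 <= t by rewrite divr_ge0 ?addr_ge0 // ltW.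
have c1 : normc (f z) * normc (g z - q z) <= M * t.
  by apply: ler_pM => //; rewrite ?hM.
have c2 : normc (f z - p z) * normc (g z) <= t * N.
  by apply: ler_pM => //; rewrite ?hN.
have c3 : normc (f z - p z) * normc (g z - q z) <= 1 * t.
  by apply: ler_pM.
apply: le_trans (lerD (lerD c1 c2) c3) _.
have -> : e = t * (M + N + 1) by rewrite /t mulfVK // gt_eqF // ltr_wpDl ?addr_ge0.
by apply: eqW; ring.
Qed.

Definition cut f : Cfun R n := fun z => if enorm z < 1 then f z else 0.

Lemma cut_out f z : ~ cball z -> cut f z = 0.
Proof. by rewrite /cut /cball /=; case: ifP. Qed.
Lemma cut_in f z : cball z -> cut f z = f z.
Proof. by rewrite /cut /cball /= => ->. Qed.

Lemma eq_polyapprox f g : (forall z, cball z -> f z = g z) -> polyapprox f -> polyapprox g.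
Proof.
move=> fg hf r e r1 e0; have [p hp pf] := hf r e r1 e0; exists p => // z zr.
by rewrite -fg ?pf // /cball /= (le_lt_trans zr).
Qed.

Lemma cut_analytic f : polyapprox f -> analytic (cut f).
Proof.
move=> hf; apply: polyapprox_analytic; last exact: cut_out.
by apply: eq_polyapprox hf => z zb; rewrite cut_in.
Qed.

Lemma analyticD f g : analytic f -> analytic g -> analytic (fun z => f z + g z).
Proof.
move=> /analytic_criterion[f1 f2] /analytic_criterion[g1 g2]; apply/analytic_criterion.
by split=> [|z zb]; [exact: polyapproxD|rewrite f2 ?g2 ?addr0].
Qed.

Lemma analyticM f g : polyapprox f -> analytic g -> analytic (fun z => f z * g z).
Proof.
move=> f1 /analytic_criterion[g1 g2]; apply/analytic_criterion.
by split=> [|z zb]; [exact: polyapproxM|rewrite g2 ?mulr0].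
Qed.

Lemma analyticZ (a : R[i]) f : analytic f -> analytic (fun z => a * f z).
Proof. by apply: analyticM; apply: polyapprox_poly; exact: ispoly_cst. Qed.

Lemma one_ballE : one_ball = cut (fun=> 1) :> Cfun R n.
Proof.
apply/funext => z; rewrite /one_ball /cut /patch.
by case: ifPn => [/set_mem|/negP h]; rewrite /cball /=; [move=> ->|case: ifPn => // h'; case: h; apply/mem_set].
Qed.

Lemma analytic_one : analytic (one_ball : Cfun R n).
Proof. by rewrite one_ballE; apply/cut_analytic/polyapprox_poly/ispoly_cst. Qed.
Lemma expands_analytic f F : expands f F -> (forall z, ~ cball z -> f z = 0) -> analytic f.
Proof. by move=> h1 h2; apply: polyapprox_analytic => //; exact: expands_polyapprox h1. Qed.

Lemma expands_cont f F z : expands f F -> cball z ->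
  ((\sum_(k < K) F k z) @[K --> \oo] ~~> f z).
Proof.
move=> [hF hr] zb; apply/cvgcP => e e0.
pose s := (1 + enorm z) / 2; have z1 : enorm z < 1 := zb; have z0 := enorm_ge0 z.
have [s0 s1] : 0 < s /\ s < 1 by rewrite /s; split; lra.
have zs : enorm z < s by rewrite /s; lra.
have [M M0 [_ hM]] := hr s s0 s1.
pose q := enorm z / s; have q1 : q < 1 by rewrite ltr_pdivrMr // mul1r.
have q0 : 0 <= q by rewrite divr_ge0 // ltW.
have : (q ^+ k : R^o) @[k --> \oo] --> (0 : R^o) by apply: cvg_expr; rewrite ger0_norm.
have e1 : 0 < e * (1 - q) / (M + 1) by rewrite divr_gt0 ?mulr_gt0 ?subr_gt0 // ltr_wpDl.
move=> /cvgrPdist_lt/(_ _ e1); apply: filterS => K /=.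
rewrite sub0r normrN ger0_norm ?exprn_ge0 // ltr_pdivlMr ?ltr_wpDl // => h.
rewrite normcB; apply: le_lt_trans (hM _ K zs) _; rewrite -/q ltr_pdivrMr ?subr_gt0 //.
apply: le_lt_trans h; by rewrite mulrC ler_wpM2l ?exprn_ge0 // lerDl.
Qed.

Lemma polyapprox_cont f z : polyapprox f -> cball z -> forall e : R, 0 < e ->
  exists2 d : R, 0 < d & forall w, enorm (w - z) < d -> normc (f w - f z) < e.
Proof.
move=> hf zb e e0; have h := cut_analytic hf; have := analytic_cont h zb.
move=> /contP/(_ e e0)[d d0 hd].
have zb' : enorm z < 1 := zb.
exists (Num.min d (1 - enorm z)); first by rewrite lt_min d0 subr_gt0.
move=> w; rewrite lt_min => /andP[w1 w2]; have := hd w w1; rewrite !cut_in //.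
rewrite /cball /= -(subrK z w); apply: le_lt_trans (enormD _ _) _; lra.
Qed.

End AnalyticCriterion.

(** * Measurability on C^n *)

Section MeasureBasics.
Context {R : realType} {n : nat}.
Implicit Types (u v : Cfun R n) (z w : Cn R n) (p q : Cn R n -> R).

Definition rmeas p := measurable_fun setT (p : CnBorel R n -> R).
Definition cmeas u := rmeas (fun z => Re (u z)) /\ rmeas (fun z => Im (u z)).

Lemma open_meas (A : set (Cn R n)) :
  (forall z, A z -> exists2 d : R, 0 < d & forall w, enorm (w - z) < d -> A w) ->
  measurable (A : set (CnBorel R n)).
Proof.
move=> hA; apply: sub_sigma_algebra; rewrite openE => z Az /=.
by apply/nbhs_enormP; have [d d0 hd] := hA z Az; exists d.
Qed.

Lemma rmeas_cont p : (forall z (e : R), 0 < e ->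
    exists2 d : R, 0 < d & forall w, enorm (w - z) < d -> `|p w - p z| < e) -> rmeas p.
Proof.
move=> hp; apply: (measurability _ (RGenOInfty.measurableE R)).
move=> _ [_ [x ->] <-]; rewrite setTI; apply: open_meas => z /=.
rewrite in_itv /= andbT => xz; have e0 : 0 < p z - x by rewrite subr_gt0.
have [d d0 hd] := hp z _ e0; exists d => // w /hd; rewrite in_itv /= andbT.
by rewrite ltr_norml => /andP[+ _]; lra.
Qed.

Lemma cmeas_cont u : (forall z (e : R), 0 < e ->
    exists2 d : R, 0 < d & forall w, enorm (w - z) < d -> normc (u w - u z) < e) -> cmeas u.
Proof.
move=> hu; split; apply: rmeas_cont => z e e0; have [d d0 hd] := hu z e e0; exists d => // w /hd.
  by apply: le_lt_trans; rewrite -ReN -ReD; exact: Re_le_normc.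
by apply: le_lt_trans; rewrite -ImN -ImD; exact: Im_le_normc.
Qed.

Lemma cmeas_poly f : ispoly f -> cmeas f.
Proof.
move=> hf; apply: cmeas_cont => z e e0.
by have /contP/(_ e e0) := @ispoly_cont R n f hf z.
Qed.

Lemma rmeas_cst (a : R) : rmeas (fun=> a). Proof. exact: measurable_cst. Qed.
Lemma rmeasD p q : rmeas p -> rmeas q -> rmeas (fun z => p z + q z).
Proof. exact: measurable_funD. Qed.
Lemma rmeasB p q : rmeas p -> rmeas q -> rmeas (fun z => p z - q z).
Proof. exact: measurable_funB. Qed.
Lemma rmeasN p : rmeas p -> rmeas (fun z => - p z).
Proof. exact: measurable_funN. Qed.
Lemma rmeasM p q : rmeas p -> rmeas q -> rmeas (fun z => p z * q z).
Proof. exact: measurable_funM. Qed.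
Lemma rmeasX p k : rmeas p -> rmeas (fun z => p z ^+ k).
Proof. exact: measurable_funX. Qed.
Lemma rmeas_max p q : rmeas p -> rmeas q -> rmeas (fun z => Num.max (p z) (q z)).
Proof. exact: measurable_maxr. Qed.
Lemma rmeas_sqrt p : rmeas p -> rmeas (fun z => Num.sqrt (p z)).
Proof.
move=> h; apply: (measurableT_comp _ h); apply: continuous_measurable_fun.
exact: sqrt_continuous.
Qed.
Lemma rmeas_inv p : (forall z, 0 < p z) -> rmeas p -> rmeas (fun z => (p z)^-1).
Proof.
move=> p0 hp; apply: (measurability _ (RGenOInfty.measurableE R)).
move=> _ [_ [x ->] <-]; rewrite setTI.
have [x0|x0] := leP x 0.
  have -> : (fun z => (p z)^-1) @^-1` `]x, +oo[ = setT :> set (CnBorel R n).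
    by apply/seteqP; split=> // z _ /=; rewrite in_itv /= andbT (le_lt_trans x0) // invr_gt0.
  exact: measurableT.
have -> : (fun z => (p z)^-1) @^-1` `]x, +oo[ = p @^-1` `]-oo, x^-1[ :> set (CnBorel R n).
  have E z : (x < (p z)^-1) = (p z < x^-1) by rewrite -{1}(invrK x) ltf_pV2 // posrE ?invr_gt0.
  by apply/seteqP; split=> z /=; rewrite !in_itv /= andbT E.
by rewrite -[X in measurable X]setTI; apply: hp => //; exact: measurable_itv.
Qed.

Lemma cmeas_normc u : cmeas u -> rmeas (fun z => normc (u z)).
Proof.
move=> [h1 h2]; have -> : (fun z => normc (u z)) = (fun z => Num.sqrt (Re (u z) ^+ 2 + Im (u z) ^+ 2)).
  by apply/funext => z; rewrite /normc; case: (u z).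
by apply: rmeas_sqrt; apply: rmeasD; exact: rmeasX.
Qed.

Lemma cmeas_cst (a : R[i]) : cmeas (fun=> a). Proof. by split; exact: rmeas_cst. Qed.
Lemma cmeas_real p : rmeas p -> cmeas (fun z => (p z)%:C).
Proof. by move=> h; split=> //=; exact: rmeas_cst. Qed.
Lemma cmeasD u v : cmeas u -> cmeas v -> cmeas (fun z => u z + v z).
Proof.
move=> [a b] [c d]; split; [under eq_fun do rewrite ReD|under eq_fun do rewrite ImD]; exact: rmeasD.
Qed.
Lemma cmeasN u : cmeas u -> cmeas (fun z => - u z).
Proof.
move=> [a b]; split; [under eq_fun do rewrite ReN|under eq_fun do rewrite ImN]; exact: rmeasN.
Qed.
Lemma cmeasB u v : cmeas u -> cmeas v -> cmeas (fun z => u z - v z).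
Proof. by move=> h1 h2; apply: cmeasD => //; exact: cmeasN. Qed.
Lemma cmeasM u v : cmeas u -> cmeas v -> cmeas (fun z => u z * v z).
Proof.
move=> [a b] [c d]; split.
  by under eq_fun do rewrite ReM; apply: rmeasB; exact: rmeasM.
by under eq_fun do rewrite ImM; apply: rmeasD; exact: rmeasM.
Qed.
Lemma cmeas_conj u : cmeas u -> cmeas (fun z => (u z)^*).
Proof.
move=> [a b]; split; [under eq_fun do rewrite ReJ|under eq_fun do rewrite ImJ] => //; exact: rmeasN.
Qed.
Lemma cmeas_lim (F : nat -> Cfun R n) u : (forall k, cmeas (F k)) ->
  (forall z, F k z @[k --> \oo] ~~> u z) -> cmeas u.
Proof.
move=> hF hl; split; [apply: (@measurable_fun_cvg _ (CnBorel R n) R _ (fun k z => Re (F k z)))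
  |apply: (@measurable_fun_cvg _ (CnBorel R n) R _ (fun k z => Im (F k z)))].
- by move=> m; exact: (hF m).1.
- move=> z _; have /cvgcP h := hl z; apply/cvgrPdist_lt => e e0.
  apply: filterS (h e e0) => k; rewrite distrC; apply: le_lt_trans.
  by rewrite -ReN -ReD; exact: Re_le_normc.
- by move=> m; exact: (hF m).2.
move=> z _; have /cvgcP h := hl z; apply/cvgrPdist_lt => e e0.
apply: filterS (h e e0) => k; rewrite distrC; apply: le_lt_trans.
by rewrite -ImN -ImD; exact: Im_le_normc.
Qed.

Lemma rmeas_le p q : rmeas p -> rmeas q -> measurable ([set z | p z <= q z] : set (CnBorel R n)).
Proof. by move=> hp hq; rewrite -[X in measurable X]setTI; apply: measurable_fun_le. Qed.

Lemma rmeas_lt p q : rmeas p -> rmeas q -> measurable ([set z | p z < q z] : set (CnBorel R n)).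
Proof.
move=> hp hq; have -> : [set z | p z < q z] = ~` [set z | q z <= p z].
  by apply/seteqP; split=> z /=; rewrite ltNge => /negP.
by apply: measurableC; exact: rmeas_le.
Qed.

Lemma rmeas_indic (A : set (Cn R n)) : measurable (A : set (CnBorel R n)) -> rmeas (\1_A).
Proof. by move=> h; exact: measurable_indic. Qed.

Lemma cball_meas (r : R) : measurable ([set z : Cn R n | enorm z < r] : set (CnBorel R n)).
Proof.
apply: open_meas => z /= zr; exists (r - enorm z); first by rewrite subr_gt0.
by move=> w wz; rewrite -(subrK z w); apply: le_lt_trans (enormD _ _) _; lra.
Qed.

Lemma csphere_meas : measurable (csphere : set (CnBorel R n)).
Proof.
have -> : csphere = ~` [set z : Cn R n | enorm z < 1] `&` ~` [set z : Cn R n | 1 < enorm z].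
  apply/seteqP; split=> z /=; first by move=> ->; rewrite ltxx.
  by move=> [/negP + /negP]; rewrite -!leNgt => h1 h2; apply/eqP; rewrite /csphere /= eq_le h1 h2.
apply: measurableI; apply: measurableC; first exact: cball_meas.
apply: open_meas => z /= zr; exists (enorm z - 1); first by rewrite subr_gt0.
by move=> w; rewrite -enormN opprB => wz; have := enormD w (z - w); rewrite addrC subrK; lra.
Qed.

Lemma rotationB (T : Cn R n -> Cn R n) z w : rotation T -> T z - T w = T (z - w).
Proof. by move=> hT; apply/eqP; rewrite subr_eq -hT.1 subrK. Qed.

Lemma rotation_meas (T : Cn R n -> Cn R n) : rotation T ->
  measurable_fun setT (T : CnBorel R n -> CnBorel R n).
Proof.
move=> hT; apply: (@measurability _ _ _ (CnBorel R n) _ _ (@open (Cn R n : normedModType R[i]))) => //.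
move=> _ [A oA <-]; rewrite setTI; apply: open_meas => z /= Az.
move: oA; rewrite openE => /(_ _ Az)/nbhs_enormP[d d0 hd]; exists d => // w wz.
by apply: hd; rewrite rotationB // hT.2.
Qed.

Lemma rmeas_rot p (T : Cn R n -> Cn R n) : rotation T -> rmeas p -> rmeas (p \o T).
Proof. by move=> hT hp; apply: measurableT_comp hp _; exact: rotation_meas. Qed.

End MeasureBasics.

(** * Auxiliary inequalities, exponents and Poisson weights *)

Lemma parallelogram_bound (R : realType) (d p q s t re e e' : R) : p < d + e' -> q < d + e -> e' <= e -> d <= t ->
  s = p - 2 * re + q -> 4 * t = p + 2 * re + q -> s <= 4 * e.
Proof. lra. Qed.

Lemma three_quarters (R : realType) (e : R) : 0 < e -> e / 4 + e / 4 + e / 4 < e.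
Proof. lra. Qed.
Lemma inv_exp4_le (R : realType) i j : (j <= i)%N -> (4 ^+ i)^-1 <= (4 ^+ j)^-1 :> R.
Proof. by move=> ji; rewrite lef_pV2 ?posrE ?exprn_gt0 // ler_eXn2l // ltr1n. Qed.
Lemma sqr_gap (R : realType) (s : R) : s <= 1 -> Num.sqrt (2 - 2 * s) ^+ 2 = 2 - 2 * s.
Proof. by move=> s1; rewrite sqr_sqrtr //; lra. Qed.
Lemma one_sub_le (R : realType) (e s : R) : 0 <= e -> 0 <= s -> e ^+ 2 = 2 - 2 * s -> 1 - s <= e.
Proof. by move=> e0 s0 h; nra. Qed.
Lemma half_gap (R : realType) (a b c d e : R) : a - d < b -> d < e / 2 -> b - c < e / 2 -> a <= c + e.
Proof. lra. Qed.
Lemma Re_scale (R : rcfType) (t : R) (c : R[i]) : Re (t%:C * c) = t * Re c.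
Proof. by case: c => a b /=; rewrite mul0r subr0. Qed.
(** The degree of the peaking polynomials splits into 16 n l, which makes sums over a separated set
    converge, and 2 l, which pays for the approximation error. *)
Lemma peak_degE n l : (2 * l * (8 * n + 1) = 16 * n * l + 2 * l)%N.
Proof. by rewrite mulnDr muln1 -mulnA [(l * _)%N]mulnC !mulnA. Qed.
Lemma peak_deg_sub n l d : (d <= l)%N -> (2 * l * (8 * n + 1) - d = 16 * n * l + (2 * l - d))%N.
Proof. by rewrite peak_degE; lia. Qed.
Lemma peak_deg_gt n l d m k : (d <= l)%N -> (m <= l)%N -> (k < m)%N -> (k + d <= 2 * l * (8 * n + 1))%N /\ k <> (2 * l * (8 * n + 1))%N.
Proof. by rewrite peak_degE; lia. Qed.
Lemma conjcR (R : realType) (t : R) : (t%:C)^* = t%:C :> R[i].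
Proof. by apply: complexP; rewrite ?ReJ ?ImJ //= oppr0. Qed.

(** The Poisson kernel with frequencies folded modulo m: up to normalisation the k-th coefficient is
    the sum of r ^ |j| over j congruent to k. Its values at the roots of unity are nonnegative, so
    dilation by r is imitated by a positive average over finitely many rotations. *)
Lemma poisson_weights (R : realType) (r : R) (m : nat) : 0 < r -> r < 1 -> (0 < m)%N ->
  exists (w : R[i]) (nu : 'I_m -> R), [/\ normc w = 1, forall j, 0 <= nu j &
    forall k, (k < m)%N ->
      \sum_(j < m) (nu j)%:C * w ^+ (j * k) = ((r ^+ k + r ^+ (m - k)) / (1 + r ^+ m))%:C].
Proof.
move=> r0 r1 m0; have [w pw] := @prim_root_exists R m m0.
have wm := prim_expr_order pw; have w1 : normc w = 1 := normc_unity m0 wm.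
have rm0 : 0 < r ^+ m by rewrite exprn_gt0.
have rm1 : r ^+ m < 1 by rewrite exprn_ilt1 ?(ltW r0) // -lt0n.
have mp : 0 < m%:R :> R by rewrite ltr0n.
pose c : R := (m%:R * (1 + r ^+ m))^-1.
pose q j := \sum_(l < m) (r ^+ l + r ^+ (m - l))%:C * w ^+ (j * (m - l)).
pose nu (j : 'I_m) : R := c * ((1 - r ^+ m) * (1 - r ^+ 2) / normc (1 - r%:C * w ^+ j) ^+ 2).
have nuE (j : 'I_m) : (nu j)%:C = c%:C * q j.
  pose x := w ^+ j; have x1 : normc x = 1 by rewrite normcX w1 expr1n.
  have xm : x ^+ m = 1 by rewrite -exprM mulnC exprM wm expr1n.
  have x0 : x != 0 by rewrite -normc_eq0 x1 oner_eq0.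
  have xJ : x^* = x^-1 by apply: (mulfI x0); rewrite mulcJ x1 expr1n mulfV.
  have geo y : normc y = 1 -> y ^+ m = 1 -> 1 - r%:C * y != 0 /\
      \sum_(l < m) (r%:C * y) ^+ l = (1 - r%:C ^+ m) / (1 - r%:C * y).
    move=> y1 ym; have d0 : 1 - r%:C * y != 0.
      apply/eqP => /eqP; rewrite subr_eq0 => /eqP/(congr1 (fun t : R[i] => normc t)).
      by rewrite normc1 normcM y1 normcR mulr1 gtr0_norm // => e; move: r1; rewrite -e ltxx.
    split=> //; apply: (mulfI d0); rewrite mulrCA divff // mulr1.
    by have := subrX1 (r%:C * y) m; rewrite exprMn ym mulr1 -[1 - _ ^+ _]opprB => ->; rewrite -[RHS]mulNr opprB.
  have [d0 hA] := geo x x1 xm.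
  have [e0 hB] : 1 - r%:C * x^-1 != 0 /\ _ := geo x^-1 ltac:(by rewrite normcV x1 invr1) ltac:(by rewrite exprVn xm invr1).
  have qE : q j = \sum_(l < m) (r%:C * x^-1) ^+ l + r%:C * x * \sum_(l < m) (r%:C * x) ^+ l.
    rewrite /q; under eq_bigr do rewrite rmorphD mulrDl; rewrite big_split; congr (_ + _).
      apply: eq_bigr => l _; rewrite exprM -/x exprB ?unitfE ?(ltnW (ltn_ord l)) // xm div1r.
      by rewrite exprMn exprVn rmorphXn.
    rewrite mulr_sumr (reindex_inj rev_ord_inj) /=; apply: eq_bigr => l _.
    by rewrite exprM -/x subKn // -exprS exprMn rmorphXn.
  have e0' : x - r%:C != 0 by apply: contra e0 => /eqP/subr0_eq <-; rewrite mulfV // subrr.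
  have -> : (nu j)%:C = c%:C * ((1 - r%:C ^+ m) * (1 - r%:C ^+ 2) / (normc (1 - r%:C * x) ^+ 2)%:C).
    by rewrite /nu rmorphM; congr (_ * _); rewrite !rmorphM fmorphV !rmorphB !rmorphXn !rmorph1.
  by rewrite -mulcJ conjcB conjcM conjcR rmorph1 xJ qE hA hB; congr (_ * _); field; rewrite x0 d0.
exists w, nu; split=> //.
  move=> j; rewrite /nu mulr_ge0 // ?invr_ge0 ?divr_ge0 ?sqr_ge0 ?mulr_ge0 ?subr_ge0 ?addr_ge0 ?(ltW rm0) ?(ltW rm1) //.
  by rewrite exprn_ile1 // ltW.
move=> k km; under eq_bigr do rewrite nuE -mulrA.
rewrite -mulr_sumr /q; under eq_bigr do rewrite mulr_suml.
rewrite exchange_big /=.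
have E l : (l < m)%N -> \sum_(j < m) (r ^+ l + r ^+ (m - l))%:C * w ^+ (j * (m - l)) * w ^+ (j * k) =
    (r ^+ l + r ^+ (m - l))%:C * (if l == k then m%:R else 0).
  move=> lm; under eq_bigr do rewrite -mulrA -exprD -mulnDr.
  rewrite -mulr_sumr (sum_prim_root _ pw); congr (_ * _).
  have -> : (m %| m - l + k)%N = (l == k) => //.
  have [->|lk] := eqVneq l k; first by rewrite subnK ?dvdnn ?eqxx // ltnW.
  apply/negbTE/negP => /dvdnP[[|[|a]] h].
  - by move: h lm; rewrite mul0n; lia.
  - by move: h lm lk; rewrite mul1n; lia.
  - by move: h lm km; rewrite !mulSn; lia.
under eq_bigr => l _ do rewrite E //.
rewrite (bigD1 (Ordinal km)) //= eqxx big1 ?addr0 => [|l]; last first.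
  by rewrite -val_eqE /= => /negbTE ->; rewrite mulr0.
rewrite -[m%:R]/(m%:R) -(rmorph_nat (real_complex R)) -!rmorphM; congr (_%:C).
by rewrite /c; field; rewrite !gt_eqF // addr_gt0.
Qed.

Import HBNNSimple.

Section Sphere.
Context {R : realType} {n : nat} (sigma : probability (CnBorel R n) R).
Hypothesis hs : normalized_surface_measure sigma.
Local Notation "\ae z , P" := {ae sigma, forall z : CnBorel R n, P}
  (at level 200, z name, P at level 200).
Local Notation homs F := (forall k, hpoly k (F k)).
Local Notation Bo := (CnBorel R n).
Local Notation L2dot := (L2dot sigma).
Local Notation H2dot := (H2dot sigma).
Local Notation H2norm := (H2norm sigma).
Local Notation H2perp := (H2perp sigma).
Local Notation H2S := (H2S sigma).
Local Notation H2proj := (H2proj sigma).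
Local Notation H2 := (H2 sigma).
Local Notation L2 := (L2 sigma).
Local Notation cintegral := (cintegral sigma).
Local Notation pairing := (pairing sigma).
Local Notation MQ := (MQ sigma).
Local Notation closed_subspace := (closed_subspace sigma).
Local Notation cLnorm := (cLnorm sigma).
Implicit Types (u v f g h phi psi : Cfun R n) (z w zeta : Cn R n).
Implicit Types (F G : nat -> Cfun R n) (e B M r s rho t : R) (a : R[i]) (T : Cn R n -> Cn R n).

Section Integration.
Implicit Types p q : Cn R n -> R.

(** * Integration over the sphere *)

Definition rI p := sigma.-integrable setT (EFin \o (p : Bo -> R)).
Definition Rint p : R := \int[sigma]_z p z.

Lemma RintE p : rI p -> (\int[sigma]_z (p z)%:E)%E = (Rint p)%:E.
Proof. by move=> h; rewrite /Rint /Rintegral fineK // integrable_fin_num. Qed.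
Lemma rI_meas p : rI p -> rmeas p.
Proof. by move=> /measurable_int /measurable_EFinP. Qed.

Lemma rI_dom p q : rmeas p -> rI q -> (forall z, `|p z| <= q z) -> rI p.
Proof.
move=> hp hq h; apply: (le_integrable measurableT _ _ hq); first exact/measurable_EFinP.
move=> z _ /=; rewrite lee_fin; apply: le_trans (h z) _; exact: ler_norm.
Qed.

Lemma rI_cst (a : R) : rI (fun=> a).
Proof. by apply: finite_measure_integrable_cst. Qed.
Lemma rI_bnd p M : rmeas p -> (forall z, `|p z| <= M) -> rI p.
Proof. by move=> hp h; apply: (rI_dom hp (rI_cst M)). Qed.
Lemma rI_D p q : rI p -> rI q -> rI (fun z => p z + q z).
Proof. by move=> h1 h2; have := integrableD measurableT h1 h2. Qed.
Lemma rI_Z (a : R) p : rI p -> rI (fun z => a * p z).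
Proof. by move=> h1; have := integrableZl measurableT a h1. Qed.
Lemma rI_N p : rI p -> rI (fun z => - p z).
Proof. by move=> h; have := rI_Z (-1) h; under eq_fun do rewrite mulN1r. Qed.
Lemma rI_B p q : rI p -> rI q -> rI (fun z => p z - q z).
Proof. by move=> h1 h2; apply: rI_D => //; exact: rI_N. Qed.

Lemma Rint_cst (a : R) : Rint (fun=> a) = a.
Proof. transitivity (a * fine (sigma setT)); first exact: Rintegral_cst.
by rewrite (congr1 fine (@probability_setT _ _ _ sigma)) mulr1. Qed.

Lemma RintD p q : rI p -> rI q -> Rint (fun z => p z + q z) = Rint p + Rint q.
Proof. by move=> h1 h2; rewrite /Rint RintegralD. Qed.
Lemma RintZ (a : R) p : rI p -> Rint (fun z => a * p z) = a * Rint p.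
Proof. by move=> h1; rewrite /Rint RintegralZl. Qed.
Lemma RintN p : rI p -> Rint (fun z => - p z) = - Rint p.
Proof. by move=> h; rewrite -[RHS]mulN1r -RintZ //; congr Rint; apply/funext => z; rewrite mulN1r. Qed.
Lemma RintB p q : rI p -> rI q -> Rint (fun z => p z - q z) = Rint p - Rint q.
Proof. by move=> h1 h2; rewrite RintD ?RintN //; exact: rI_N. Qed.

Lemma rI_sum I (r : seq I) (F : I -> Cn R n -> R) :
  (forall i, rI (F i)) -> rI (fun z => \sum_(i <- r) F i z).
Proof.
move=> h; elim: r => [|i r IH].
  by under eq_fun do rewrite big_nil; exact: rI_cst.
by under eq_fun do rewrite big_cons; exact: rI_D.
Qed.

Lemma Rint_sum I (r : seq I) (F : I -> Cn R n -> R) :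
  (forall i, rI (F i)) -> Rint (fun z => \sum_(i <- r) F i z) = \sum_(i <- r) Rint (F i).
Proof.
move=> h; elim: r => [|i r IH].
  by rewrite big_nil; under eq_fun do rewrite big_nil; exact: Rint_cst.
by rewrite big_cons -IH; under eq_fun do rewrite big_cons; rewrite RintD //; exact: rI_sum.
Qed.

Lemma Rint_le p q : rI p -> rI q -> (forall z, p z <= q z) -> Rint p <= Rint q.
Proof. by move=> h1 h2 h; apply: le_Rintegral. Qed.

Lemma Rint_ge0 p : (forall z, 0 <= p z) -> 0 <= Rint p.
Proof.
by move=> h; rewrite /Rint /Rintegral fine_ge0 //; apply: integral_ge0 => z _; rewrite lee_fin.
Qed.

Lemma ae_mono (P P' : Cn R n -> Prop) : (forall z, P z -> P' z) ->
  (\ae z, P z) -> (\ae z, P' z).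
Proof.
by move=> h [N [a b c]]; exists N; split=> // z /= hz; apply: c => /= hz'; apply: hz; exact: h.
Qed.

Lemma ae_and (P P' : Cn R n -> Prop) : (\ae z, P z) ->
  (\ae z, P' z) -> (\ae z, P z /\ P' z).
Proof.
move=> h h'; have := negligibleU h h'; apply: negligibleS => z /= hz.
by apply: contrapT => /not_orP[/contrapT a /contrapT b]; apply: hz.
Qed.

(* No measurability: the upper and lower simple functions of [f] and [g] can be
   compared after being set to 0 on a null set. *)
Lemma ge0_integral_ae (f g : Cn R n -> \bar R) : (forall z, 0 <= f z)%E -> (forall z, 0 <= g z)%E ->
  (\ae z, f z = g z) ->
  (\int[sigma]_z f z = \int[sigma]_z g z)%E.
Proof.
have key (f1 g1 : Cn R n -> \bar R) : (forall z, 0 <= f1 z)%E -> (forall z, 0 <= g1 z)%E ->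
    (\ae z, f1 z = g1 z) -> (\int[sigma]_z f1 z <= \int[sigma]_z g1 z)%E.
  move=> f0 g0 [N [mN N0 hN]]; rewrite (@ge0_integralTE _ Bo R sigma f1 f0) (@ge0_integralTE _ Bo R sigma g1 g0).
  apply: ge_ereal_sup => _ [h /= hh <-].
  have mC : measurable (~` N) by exact: measurableC.
  pose k := (mul_nnsfun h (indic_nnsfun R mC) : {nnsfun Bo >-> R}).
  have kE z : k z = h z * (z \in ~` N)%:R by rewrite /k /= mindicE.
  apply: ereal_sup_ubound; exists k.
    move=> z; rewrite kE; have [zN|zN] := pselect (N z).
      have -> : (z \in ~` N) = false by apply/negbTE/negP => /set_mem; exact.
      by rewrite mulr0; exact: g0.
    have -> : z \in ~` N by exact/mem_set.
    rewrite mulr1.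
    have -> : g1 z = f1 z by apply: contrapT => e; apply: zN; apply: hN => /= e'; apply: e.
    exact: hh.
  apply: (etrans (esym (integralT_nnsfun sigma k))); apply: (etrans _ (integralT_nnsfun sigma h)).
  apply: ge0_ae_eq_integral => //.
  - exact/measurable_EFinP.
  - exact/measurable_EFinP.
  - by move=> z _; rewrite lee_fin.
  - by move=> z _; rewrite lee_fin.
  exists N; split=> // z /= hz; apply: contrapT => zN; apply: hz => _.
  have zC : z \in ~` N by exact/mem_set.
  by rewrite mindicE zC mulr1.
move=> f0 g0 fg; apply/eqP; rewrite eq_le !key //.
by apply: ae_mono fg => z ->.
Qed.

Lemma integral_ae (f g : Cn R n -> \bar R) : (\ae z, f z = g z) ->
  (\int[sigma]_z f z = \int[sigma]_z g z)%E.
Proof.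
move=> fg; rewrite integralE [RHS]integralE; congr (_ - _)%E; apply: ge0_integral_ae => //.
  by apply: ae_mono fg => z; rewrite !funeposE => ->.
by apply: ae_mono fg => z; rewrite !funenegE => ->.
Qed.

Lemma Rint_ae p q : (\ae z, p z = q z) -> Rint p = Rint q.
Proof.
move=> h; rewrite /Rint /Rintegral (_ : (\int[sigma]_x (p x)%:E) = \int[sigma]_x (q x)%:E)%E //.
by apply: integral_ae; apply: ae_mono h => z ->.
Qed.

Lemma Rint0_ae p : rI p -> (forall z, 0 <= p z) -> Rint p = 0 -> (\ae z, p z = 0).
Proof.
move=> hp p0 pi0; have : (\int[sigma]_z `|(p z)%:E| = 0)%E.
  under eq_integral do rewrite gee0_abs ?lee_fin //.
  by rewrite RintE // pi0.
have mp : measurable_fun setT (EFin \o (p : Bo -> R)) by apply/measurable_EFinP; exact: (rI_meas hp).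
by move=> /(ae_eq_integral_abs sigma measurableT mp) ; apply: ae_mono => z /(_ I)[].
Qed.

Lemma rI_of_le p M : rmeas p -> (forall z, 0 <= p z) -> (\int[sigma]_z (p z)%:E <= M%:E)%E -> rI p.
Proof.
move=> hp p0 h; apply/integrableP; split; first exact/measurable_EFinP.
rewrite (_ : (\int[sigma]_x `|(EFin \o p) x|) = \int[sigma]_x (p x)%:E)%E.
  exact: le_lt_trans h (ltry _).
by apply: eq_integral => z _; rewrite /= ger0_norm.
Qed.

Lemma chebyshev p (a : R) : rI p -> (forall z, 0 <= p z) -> 0 < a ->
  (sigma [set z | (a <= p z)%R] <= (Rint p / a)%:E)%E.
Proof.
move=> hp p0 a0; set E := [set z | _].
have mE : measurable (E : set Bo) by apply: rmeas_le; [exact: rmeas_cst|exact: rI_meas].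
have iE : rI (\1_E) by apply: (@rI_bnd _ 1); [exact: rmeas_indic|move=> z; rewrite indicE; case: (_ \in _); rewrite ?normr1 ?normr0].
have <- : (Rint (\1_E))%:E = sigma E.
  by rewrite -RintE // integral_indic // setIT.
rewrite lee_fin ler_pdivlMr // mulrC -RintZ //; apply: Rint_le => //; first exact: rI_Z.
by move=> z; rewrite indicE; have [/set_mem|_] := boolP (z \in E); rewrite ?mulr1 ?mulr0.
Qed.

Lemma ae_sphere : (\ae z, enorm z = 1).
Proof.
exists (~` csphere); split; [by apply: measurableC; exact: csphere_meas| |by move=> z].
by rewrite probability_setC ?hs.1 ?subee //; exact: csphere_meas.
Qed.

Lemma rot_int T (f : Cn R n -> \bar R) : rotation T -> (forall z, 0 <= f z)%E ->
  measurable_fun setT (f : Bo -> \bar R) ->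
  (\int[sigma]_z f (T z) = \int[sigma]_z f z)%E.
Proof.
move=> hT f0 mf; have mT := rotation_meas hT.
have := @ge0_integral_pushforward _ _ Bo Bo R T mT sigma setT f measurableT mf (fun z _ => f0 z).
rewrite preimage_setT => <-; apply: eq_measure_integral => A mA _.
exact: hs.2.
Qed.

Lemma rI_rot p T : rotation T -> rI p -> rI (p \o T).
Proof.
move=> hT hp; apply/integrableP; split; first by apply/measurable_EFinP; apply: (rmeas_rot hT); exact: (rI_meas hp).
have := integrableP _ _ _ hp => -[h1 h2].
rewrite (rot_int (f := fun z => `|(p z)%:E|)%E) //.
by apply: measurableT_comp => //.
Qed.

Lemma Rint_rot p T : rotation T -> rI p -> Rint (p \o T) = Rint p.
Proof.
move=> hT hp; rewrite /Rint /Rintegral integralE [in RHS]integralE.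
have mp : measurable_fun setT (EFin \o (p : Bo -> R)) by apply/measurable_EFinP; exact: (rI_meas hp).
congr (fine (_ - _)%E).
  rewrite -(@rot_int T (EFin \o p)^\+%E) //; first by apply: eq_integral => z _; rewrite !funeposE.
  exact: measurable_funepos.
rewrite -(@rot_int T (EFin \o p)^\-%E) //; first by apply: eq_integral => z _; rewrite !funenegE.
  exact: measurable_funeneg.
Qed.

Lemma rI_abs p : rI p -> rI (fun z => `|p z|).
Proof. by move=> h; have := integrable_abse h. Qed.

Lemma rI_max p q : rI p -> rI q -> rI (fun z => Num.max (p z) (q z)).
Proof.
move=> hp hq; apply: (rI_dom (q := fun z => `|p z| + `|q z|)).
- by apply: rmeas_max; exact: rI_meas.
- by apply: rI_D; exact: rI_abs.
by move=> z; rewrite maxEle; case: ifP => _; rewrite ?lerDl ?lerDr.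
Qed.

Lemma Rint_le_ae p q : rI p -> rI q ->
  (\ae z, p z <= q z) -> Rint p <= Rint q.
Proof.
move=> hp hq h; have -> : Rint q = Rint (fun z => Num.max (p z) (q z)).
  by apply: Rint_ae; apply: ae_mono h => z /max_idPr ->.
by apply: Rint_le => // [|z]; [exact: rI_max|rewrite le_max lexx].
Qed.

Lemma rI_dom_ae p q : rmeas p -> rI q ->
  (\ae z, `|p z| <= q z) -> rI p.
Proof.
move=> hp hq h; apply/integrableP; split; first exact/measurable_EFinP.
have mq := rI_meas hq.
rewrite (@ge0_integral_ae _ (fun z => (Num.min `|p z| `|q z|)%:E)); first last.
- by apply: ae_mono h => z h; rewrite min_l // (le_trans h) // ler_norm.
- by move=> z; rewrite lee_fin le_min !normr_ge0.
- by move=> z; rewrite abse_ge0.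
apply: (@le_lt_trans _ _ (\int[sigma]_z (`|q z|)%:E)%E); last first.
  by rewrite (RintE (rI_abs hq)) ltry.
apply: ge0_le_integral => //.
- apply/measurable_EFinP; apply: measurable_minr; apply: measurableT_comp => //.
- by apply/measurable_EFinP; apply: measurableT_comp.
by move=> z _; rewrite lee_fin ge_min lexx orbT.
Qed.

Definition cI u := rI (fun z => Re (u z)) /\ rI (fun z => Im (u z)).

Lemma cintegralE u : cintegral u =
  Rint (fun z => Re (u z)) +i* Rint (fun z => Im (u z)).
Proof. by []. Qed.

Lemma cI_meas u : cI u -> cmeas u.
Proof. by move=> [h1 h2]; split; [exact: (rI_meas h1)|exact: (rI_meas h2)]. Qed.

Lemma cI_dom_ae u q : cmeas u -> rI q -> (\ae z, normc (u z) <= q z) -> cI u.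
Proof.
move=> [m1 m2] hq h; split; [apply: (rI_dom_ae m1 hq)|apply: (rI_dom_ae m2 hq)].
  by apply: ae_mono h => z; apply: le_trans; exact: Re_le_normc.
by apply: ae_mono h => z; apply: le_trans; exact: Im_le_normc.
Qed.

Lemma ae_all (P : Cn R n -> Prop) : (forall z, P z) -> (\ae z, P z).
Proof. by move=> h; apply: aeW. Qed.

Lemma cI_normc u : cI u -> rI (fun z => normc (u z)).
Proof.
move=> h; apply: (rI_dom (q := fun z => `|Re (u z)| + `|Im (u z)|)).
- by apply: cmeas_normc; exact: (cI_meas h).
- by apply: rI_D; apply: rI_abs; case: h.
by move=> z; rewrite ger0_norm // normc_le_ReIm.
Qed.

Lemma cI_cst a : cI (fun=> a). Proof. by split; exact: rI_cst. Qed.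

Lemma cI_D u v : cI u -> cI v -> cI (fun z => u z + v z).
Proof.
by move=> [a b] [c d]; split; [under eq_fun do rewrite ReD|under eq_fun do rewrite ImD]; exact: rI_D.
Qed.

Lemma cI_Z a u : cI u -> cI (fun z => a * u z).
Proof.
move=> [b c]; split.
  by under eq_fun do rewrite ReM; apply: rI_B; exact: rI_Z.
by under eq_fun do rewrite ImM; apply: rI_D; exact: rI_Z.
Qed.

Lemma cI_sum I (r : seq I) (F : I -> Cfun R n) :
  (forall i, cI (F i)) -> cI (fun z => \sum_(i <- r) F i z).
Proof.
move=> h; elim: r => [|i r IH].
  by under eq_fun do rewrite big_nil; exact: cI_cst.
by under eq_fun do rewrite big_cons; exact: cI_D.
Qed.

Lemma cintegral_cst a : cintegral (fun=> a) = a.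
Proof. by rewrite cintegralE !Rint_cst; case: a. Qed.

Lemma cintegralD u v : cI u -> cI v ->
  cintegral (fun z => u z + v z) = cintegral u + cintegral v.
Proof.
move=> [a b] [c d]; rewrite !cintegralE.
under [in X in X +i* _]eq_fun do rewrite ReD.
under [in X in _ +i* X]eq_fun do rewrite ImD.
by rewrite !RintD.
Qed.

Lemma cintegralZ a u : cI u ->
  cintegral (fun z => a * u z) = a * cintegral u.
Proof.
move=> [b c]; rewrite !cintegralE; apply: complexP; rewrite ?ReM ?ImM /=.
  by under [in LHS]eq_fun do rewrite ReM; rewrite RintB ?RintZ //; exact: rI_Z.
by under [in LHS]eq_fun do rewrite ImM; rewrite RintD ?RintZ //; exact: rI_Z.
Qed.

Lemma cintegral_conj u : cI u -> cintegral (fun z => (u z)^*) = (cintegral u)^*.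
Proof.
move=> [b c]; rewrite !cintegralE; apply: complexP; rewrite ?ReJ ?ImJ /=.
  by under [in LHS]eq_fun do rewrite ReJ.
by under [in LHS]eq_fun do rewrite ImJ; rewrite RintN.
Qed.

Lemma cintegral_sum I (r : seq I) (F : I -> Cfun R n) : (forall i, cI (F i)) ->
  cintegral (fun z => \sum_(i <- r) F i z) = \sum_(i <- r) cintegral (F i).
Proof.
move=> h; elim: r => [|i r IH].
  by rewrite big_nil; under eq_fun do rewrite big_nil; exact: cintegral_cst.
by rewrite big_cons -IH; under eq_fun do rewrite big_cons; rewrite cintegralD //; exact: cI_sum.
Qed.

Lemma cintegral_ae u v : (\ae z, u z = v z) ->
  cintegral u = cintegral v.
Proof.
by move=> h; rewrite !cintegralE; congr (_ +i* _); apply: Rint_ae; apply: ae_mono h => z ->.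
Qed.

(** Multiplying u by the conjugate of its integral makes the integral a squared modulus, and only
    real parts have to be compared. *)
Lemma le_cintegral u : cI u -> normc (cintegral u) <= Rint (fun z => normc (u z)).
Proof.
move=> hu; set a := cintegral u; set M := Rint _.
have M0 : 0 <= M by apply: Rint_ge0 => z; exact: normc_ge0.
have [/eqP a0|a0] := eqVneq (normc a) 0; first by rewrite (eqP a0).
have ap : 0 < normc a by rewrite lt_def a0 normc_ge0.
have E : normc a ^+ 2 = Rint (fun z => Re (a^* * u z)).
  have : Re (cintegral (fun z => a^* * u z)) = normc a ^+ 2.
    by rewrite cintegralZ // mulrC mulcJ.
  by move=> <-.
rewrite -(ler_pM2l ap) -expr2 E -RintZ; last exact: cI_normc.
apply: Rint_le; [exact: (cI_Z a^* hu).1|apply: rI_Z; exact: cI_normc|].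
move=> z; apply: le_trans (ler_norm _) _; apply: le_trans (Re_le_normc _) _.
by rewrite normcM normcJ'.
Qed.

Lemma cintegral_rot u T : rotation T ->
  cI u -> cintegral (u \o T) = cintegral u.
Proof.
move=> hT [h1 h2]; rewrite !cintegralE.
by rewrite -(Rint_rot hT h1) -(Rint_rot hT h2).
Qed.

End Integration.

(** * The space L^2 of the sphere *)

Definition sqn u : R := Rint (fun z => normc (u z) ^+ 2).
Definition l2 u : R := Num.sqrt (sqn u).

Lemma cLnorm2_int u : cLnorm 2%:E u = ((\int[sigma]_z (normc (u z) ^+ 2)%:E) `^ 2^-1)%E.
Proof.
rewrite /cLnorm Lnorm.unlock; congr (_ `^ _)%E; apply: eq_integral => z _.
by rewrite /= ger0_norm // powR_mulrn.
Qed.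

Lemma L2P u : L2 u <-> cmeas u /\ rI (fun z => normc (u z) ^+ 2).
Proof.
have p0 z : 0 <= normc (u z) ^+ 2 by exact: sqr_ge0.
split=> [[h1 h2 h3]|[[h1 h2] h3]].
  have m : cmeas u by [].
  split=> //; apply/integrableP; split; first by apply/measurable_EFinP; apply: rmeasX; exact: cmeas_normc.
  move: h3; rewrite cLnorm2_int => /lty_poweRy h; have h' : 2^-1 != 0 :> R by rewrite invr_eq0 pnatr_eq0.
  move: (h h'); rewrite (_ : (\int[sigma]_x `|(EFin \o _) x|)%E = (\int[sigma]_x (normc (u x) ^+ 2)%:E)%E) //.
  by apply: eq_integral => z _; rewrite /= ger0_norm.
by split=> //; rewrite cLnorm2_int poweR_lty // (RintE h3) ltry.
Qed.

Lemma L2_cmeas u : L2 u -> cmeas u. Proof. by move=> /L2P[]. Qed.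
Lemma L2_rI u : L2 u -> rI (fun z => normc (u z) ^+ 2). Proof. by move=> /L2P[]. Qed.

Lemma sqn_ge0 u : 0 <= sqn u. Proof. by apply: Rint_ge0 => z; exact: sqr_ge0. Qed.
Lemma l2_ge0 u : 0 <= l2 u. Proof. exact: sqrtr_ge0. Qed.

#[local] Hint Extern 0 (is_true (_ <= sqn _)) => exact: sqn_ge0 : core.
#[local] Hint Extern 0 (is_true (_ <= l2 _)) => exact: l2_ge0 : core.
Lemma l2_sqr u : l2 u ^+ 2 = sqn u. Proof. by rewrite sqr_sqrtr // sqn_ge0. Qed.

Lemma cLnorm2E u : L2 u -> cLnorm 2%:E u = (l2 u)%:E.
Proof. by move=> /L2_rI h; rewrite cLnorm2_int (RintE h) poweR_EFin powR12_sqrt // sqn_ge0. Qed.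

Lemma cLnorm1E u : cI u -> cLnorm 1%:E u = (Rint (fun z => normc (u z)))%:E.
Proof.
move=> h; rewrite /cLnorm Lnorm1 -(RintE (cI_normc h)); apply: eq_integral => z _.
by rewrite /= ger0_norm // normc_ge0.
Qed.

Lemma cLnorm_ae u v (p : \bar R) : (p = 1%:E \/ p = 2%:E) -> (\ae z, u z = v z) ->
  cLnorm p u = cLnorm p v.
Proof.
move=> [->|->] h; rewrite ?cLnorm2_int /cLnorm ?Lnorm1.
  by apply: integral_ae; apply: ae_mono h => z ->.
by congr (_ `^ _)%E; apply: integral_ae; apply: ae_mono h => z ->.
Qed.

Lemma L2_dom_ae u q : cmeas u -> rI q ->
  (\ae z, normc (u z) ^+ 2 <= q z) -> L2 u.
Proof.
move=> m hq h; apply/L2P; split=> //; apply: (rI_dom_ae _ hq); first by apply: rmeasX; exact: cmeas_normc.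
by apply: ae_mono h => z; rewrite ger0_norm // sqr_ge0.
Qed.

Lemma L2_bnd_ae u M : cmeas u ->
  (\ae z, normc (u z) <= M) -> L2 u.
Proof.
move=> m h; apply: (L2_dom_ae m (rI_cst (M ^+ 2))); apply: ae_mono h => z h.
by rewrite lerXn2r ?nnegrE // (le_trans (normc_ge0 _) h).
Qed.

Lemma L2_cst a : L2 (fun=> a).
Proof. by apply: (@L2_bnd_ae _ (normc a)); [exact: cmeas_cst|exact: ae_all]. Qed.

Lemma L2D u v : L2 u -> L2 v -> L2 (fun z => u z + v z).
Proof.
move=> /L2P[mu iu] /L2P[mv iv].
apply: (L2_dom_ae (q := fun z => 2 * normc (u z) ^+ 2 + 2 * normc (v z) ^+ 2)); first exact: cmeasD.
  by apply: rI_D; exact: rI_Z.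
apply: ae_all => z; have h := le_normcD (u z) (v z).
apply: (le_via ((normc (u z) + normc (v z)) ^+ 2)).
  by rewrite lerXn2r ?nnegrE // addr_ge0.
move: (normc _) (normc (v z)) => a b; have := sqr_ge0 (a - b); rewrite -subr_ge0; nra.
Qed.

Lemma L2M_bnd u v M : cmeas u -> L2 v ->
  (\ae z, normc (u z) <= M) -> L2 (fun z => u z * v z).
Proof.
move=> mu /L2P[mv iv] h.
apply: (L2_dom_ae (q := fun z => M ^+ 2 * normc (v z) ^+ 2)); first exact: cmeasM.
  exact: rI_Z.
apply: ae_mono h => z h; rewrite normcM exprMn ler_wpM2r ?sqr_ge0 //.
by rewrite lerXn2r ?nnegrE // (le_trans (normc_ge0 _) h).
Qed.

Lemma L2Z a u : L2 u -> L2 (fun z => a * u z).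
Proof. by move=> h; apply: (L2M_bnd (M := normc a)) => //; [exact: cmeas_cst|exact: ae_all]. Qed.
Lemma L2N u : L2 u -> L2 (fun z => - u z).
Proof. by move=> h; have := L2Z (-1) h; under eq_fun do rewrite mulN1r. Qed.
Lemma L2B u v : L2 u -> L2 v -> L2 (fun z => u z - v z).
Proof. by move=> hu hv; apply: L2D => //; exact: L2N. Qed.

Lemma L2_conj u : L2 u -> L2 (fun z => (u z)^*).
Proof.
move=> /L2P[mu iu]; apply/L2P; split; first exact: cmeas_conj.
by under eq_fun do rewrite normcJ'.
Qed.

Lemma L2_sum I (r : seq I) (F : I -> Cfun R n) :
  (forall i, L2 (F i)) -> L2 (fun z => \sum_(i <- r) F i z).
Proof.
move=> h; elim: r => [|i r IH].
  by under eq_fun do rewrite big_nil; exact: L2_cst.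
by under eq_fun do rewrite big_cons; exact: L2D.
Qed.

Lemma L2_mulI u v : L2 u -> L2 v -> cI (fun z => u z * v z).
Proof.
move=> /L2P[mu iu] /L2P[mv iv].
apply: (cI_dom_ae (q := fun z => normc (u z) ^+ 2 + normc (v z) ^+ 2)); first exact: cmeasM.
  exact: rI_D.
apply: ae_all => z; rewrite normcM; move: (normc_ge0 (u z)) (normc_ge0 (v z)).
move: (normc _) (normc (v z)) => a b a0 b0; have := sqr_ge0 (a - b); nra.
Qed.

Lemma L2dot_I u v : L2 u -> L2 v -> cI (fun z => u z * (v z)^*).
Proof. by move=> hu hv; apply: L2_mulI => //; exact: L2_conj. Qed.
Lemma L2_cI u : L2 u -> cI u.
Proof. by move=> h; have := L2_mulI h (L2_cst 1); under eq_fun do rewrite mulr1. Qed.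

Notation "<< u , v >>" := (L2dot u v) (at level 0, u at level 69).

Lemma dotDl u v h : L2 u -> L2 v -> L2 h ->
  <<(fun z => u z + v z), h>> = <<u, h>> + <<v, h>>.
Proof.
move=> hu hv hw; rewrite /L2dot -cintegralD; [|exact: L2dot_I|exact: L2dot_I].
by congr cintegral; apply/funext => z; rewrite mulrDl.
Qed.

Lemma dotZl a u (w : Cfun R n) : L2 u -> L2 w -> <<(fun z => a * u z), w>> = a * <<u, w>>.
Proof.
move=> hu hw; rewrite /L2dot -cintegralZ; last exact: L2dot_I.
by congr cintegral; apply/funext => z; rewrite mulrA.
Qed.

Lemma dotC u h : L2 u -> L2 h -> <<h, u>> = <<u, h>>^*.
Proof.
move=> hu hw; rewrite /L2dot -cintegral_conj; last exact: L2dot_I.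
by congr cintegral; apply/funext => z; rewrite conjcM conjcK' mulrC.
Qed.

Lemma dotDr u v h : L2 u -> L2 v -> L2 h ->
  <<h, (fun z => u z + v z)>> = <<h, u>> + <<h, v>>.
Proof. by move=> hu hv hw; rewrite dotC ?dotDl ?conjcD -?dotC //; exact: L2D. Qed.

Lemma dotZr a u (w : Cfun R n) : L2 u -> L2 w -> <<w, (fun z => a * u z)>> = a^* * <<w, u>>.
Proof. by move=> hu hw; rewrite dotC ?dotZl ?conjcM -?dotC //; exact: L2Z. Qed.
Lemma dotNl u h : L2 u -> L2 h -> <<(fun z => - u z), h>> = - <<u, h>>.
Proof.
by move=> hu hw; under eq_fun do rewrite -mulN1r; rewrite (dotZl (-1) hu hw) mulN1r.
Qed.

Lemma dotBl u v h : L2 u -> L2 v -> L2 h ->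
  <<(fun z => u z - v z), h>> = <<u, h>> - <<v, h>>.
Proof. by move=> hu hv hw; rewrite dotDl ?dotNl //; exact: L2N. Qed.

Lemma dotBr u v h : L2 u -> L2 v -> L2 h ->
  <<h, (fun z => u z - v z)>> = <<h, u>> - <<h, v>>.
Proof. by move=> hu hv hw; rewrite dotC ?dotBl ?conjcB -?dotC //; exact: L2B. Qed.

Lemma dot_suml I (r : seq I) (F : I -> Cfun R n) (w : Cfun R n) : (forall i, L2 (F i)) -> L2 w ->
  <<(fun z => \sum_(i <- r) F i z), w>> = \sum_(i <- r) <<F i, w>>.
Proof.
move=> hF hw; rewrite /L2dot -cintegral_sum; last by move=> i; exact: L2dot_I.
by congr cintegral; apply/funext => z; rewrite mulr_suml.
Qed.

Lemma dot_sumr I (r : seq I) (F : I -> Cfun R n) (w : Cfun R n) : (forall i, L2 (F i)) -> L2 w ->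
  <<w, (fun z => \sum_(i <- r) F i z)>> = \sum_(i <- r) <<w, F i>>.
Proof.
move=> hF hw; rewrite dotC ?dot_suml ?conjc_sum //; last exact: L2_sum.
by apply: eq_bigr => i _; rewrite -dotC.
Qed.

Lemma dot_ae u u' v v' : (\ae z, u z = u' z) ->
  (\ae z, v z = v' z) -> <<u, v>> = <<u', v'>>.
Proof. by move=> h h'; apply: cintegral_ae; apply: ae_mono (ae_and h h') => z [-> ->]. Qed.

Lemma sqn_ae u v : (\ae z, u z = v z) -> sqn u = sqn v.
Proof. by move=> h; apply: Rint_ae; apply: ae_mono h => z ->. Qed.
Lemma l2_ae u v : (\ae z, u z = v z) -> l2 u = l2 v.
Proof. by move=> h; rewrite /l2 (sqn_ae h). Qed.

Lemma dot_sqn u : <<u, u>> = (sqn u)%:C.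
Proof.
rewrite /L2dot cintegralE; under [in X in X +i* _]eq_fun do rewrite mulcJ.
under [in X in _ +i* X]eq_fun do rewrite mulcJ.
by rewrite /= Rint_cst.
Qed.

Lemma sqnZ a u : L2 u -> sqn (fun z => a * u z) = normc a ^+ 2 * sqn u.
Proof.
move=> h; rewrite /sqn -RintZ; last exact: L2_rI.
by congr Rint; apply/funext => z; rewrite normcM exprMn.
Qed.

Lemma sqnN u : sqn (fun z => - u z) = sqn u.
Proof. by congr Rint; apply/funext => z; rewrite normcN. Qed.

Lemma sqnD u v : L2 u -> L2 v ->
  sqn (fun z => u z + v z) = sqn u + 2 * Re <<u, v>> + sqn v.
Proof.
move=> hu hv; have hD := L2D hu hv.
have : <<(fun z => u z + v z), (fun z => u z + v z)>> = <<u, u>> + <<u, v>> + (<<u, v>>^* + <<v, v>>).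
  by rewrite dotDl // !dotDr // -dotC.
rewrite !dot_sqn => /(congr1 (@Re R)); rewrite !ReD ReJ /= => ->.
by ring.
Qed.

Lemma sqnB u v : L2 u -> L2 v ->
  sqn (fun z => u z - v z) = sqn u - 2 * Re <<u, v>> + sqn v.
Proof.
move=> hu hv; rewrite sqnD ?sqnN; [|by []|exact: L2N].
by rewrite dotC ?dotNl ?ReJ ?ReN -?mulrN //; [rewrite dotC // ReJ|exact: L2N].
Qed.

(** The square norm of u - s c v is nonnegative for every real s; s is the inverse of [sqn v], or
    arbitrarily large if [sqn v] is 0. *)
Lemma CS_sqn u v : L2 u -> L2 v -> normc <<u, v>> ^+ 2 <= sqn u * sqn v.
Proof.
move=> hu hv; set c := <<u, v>>.
have key s : 0 <= sqn u - 2 * s * normc c ^+ 2 + s ^+ 2 * normc c ^+ 2 * sqn v.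
  have := sqn_ge0 (fun z => u z - (s%:C * c) * v z).
  rewrite sqnB //; last exact: L2Z.
  have -> : <<u, (fun z => (s%:C * c) * v z)>> = (s%:C * c)^* * c by exact: dotZr.
  rewrite sqnZ // normcM normcR exprMn real_normK ?num_real // conjcM.
  have -> : Re ((s%:C)^* * c^* * c) = s * normc c ^+ 2.
    by rewrite -mulrA [c^* * c]mulrC mulcJ ReM ReJ ImJ /= oppr0 mul0r subr0.
  by rewrite -!mulrA.
have [v0|v0] := eqVneq (sqn v) 0.
  rewrite v0 mulr0; move: key; rewrite v0; have : 0 <= normc c ^+ 2 by exact: sqr_ge0.
  move: (normc c ^+ 2) (sqn u) => a b a0 key; rewrite leNgt; apply/negP => ap.
  have := key ((b + 1) / a); rewrite mulr0 addr0 -mulrA mulfVK ?gt_eqF //.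
  have : 0 <= b by have := key 0; rewrite mulr0 mul0r subr0 mulr0 addr0.
  by lra.
have vp : 0 < sqn v by rewrite lt_def v0 sqn_ge0.
have := key (sqn v)^-1; move: (normc c ^+ 2) (sqn u) => a b.
have -> : b - 2 * (sqn v)^-1 * a + (sqn v)^-1 ^+ 2 * a * sqn v = b - a / sqn v by field.
by rewrite subr_ge0 ler_pdivrMr.
Qed.

Lemma CS_l2 u v : L2 u -> L2 v -> normc <<u, v>> <= l2 u * l2 v.
Proof.
move=> hu hv; rewrite -[_ <= _]ler_sqr ?nnegrE ?mulr_ge0 //.
by rewrite exprMn !l2_sqr CS_sqn.
Qed.

Lemma l2D u v : L2 u -> L2 v -> l2 (fun z => u z + v z) <= l2 u + l2 v.
Proof.
move=> hu hv; rewrite -[_ <= _]ler_sqr ?nnegrE ?addr_ge0 //.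
rewrite l2_sqr sqnD // sqrrD !l2_sqr lerD2r lerD2l -[leRHS]mulr_natl ler_pM2l //.
by apply: le_trans (ler_norm _) _; apply: le_trans (Re_le_normc _) _; exact: CS_l2.
Qed.

Lemma l2N u : l2 (fun z => - u z) = l2 u. Proof. by rewrite /l2 sqnN. Qed.

Lemma l2B u v : L2 u -> L2 v -> l2 (fun z => u z - v z) <= l2 u + l2 v.
Proof. by move=> hu hv; rewrite -(l2N v); apply: l2D => //; exact: L2N. Qed.
Lemma l2Z a u : L2 u -> l2 (fun z => a * u z) = normc a * l2 u.
Proof. by move=> h; rewrite /l2 sqnZ // sqrtrM ?sqr_ge0 // sqrtr_sqr ger0_norm. Qed.
Lemma l2_distC u v : l2 (fun z => u z - v z) = l2 (fun z => v z - u z).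
Proof. by rewrite -l2N; congr l2; apply/funext => z; rewrite opprB. Qed.

Lemma l2_tri u v h : L2 u -> L2 v -> L2 h ->
  l2 (fun z => u z - h z) <= l2 (fun z => u z - v z) + l2 (fun z => v z - h z).
Proof.
move=> hu hv hw; have -> : (fun z => u z - h z) = (fun z => (u z - v z) + (v z - h z)).
  by apply/funext => z; rewrite addrA subrK.
by apply: l2D; exact: L2B.
Qed.

Lemma sqn0_ae u : L2 u -> sqn u = 0 -> (\ae z, u z = 0).
Proof.
move=> /L2_rI h h0; have := Rint0_ae h (fun z => sqr_ge0 _) h0.
by apply: ae_mono => z /eqP; rewrite expf_eq0 /= normc_eq0 => /eqP.
Qed.

Lemma norm1_le_l2 u : L2 u -> Rint (fun z => normc (u z)) <= l2 u.
Proof.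
move=> hu; have hm : cmeas (fun z => (normc (u z))%:C) by apply: cmeas_real; apply: cmeas_normc; exact: (L2_cmeas hu).
have h : L2 (fun z => (normc (u z))%:C).
  by apply: (L2_dom_ae hm (L2_rI hu)); apply: ae_all => z; rewrite normcR real_normK ?num_real.
have := CS_l2 h (L2_cst 1).
have -> : l2 (fun=> 1) = 1 by rewrite /l2 /sqn Rint_cst normc1 expr1n sqrtr1.
have -> : l2 (fun z => (normc (u z))%:C) = l2 u.
  by rewrite /l2 /sqn; congr (Num.sqrt (Rint _)); apply/funext => z; rewrite normcR real_normK ?num_real.
rewrite mulr1; apply: le_trans; apply: le_trans (Re_le_normc _).
apply: le_trans (ler_norm _); rewrite /L2dot cintegralE /=.
by under [in leRHS]eq_fun do rewrite mulr1 mul0r subr0.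
Qed.

Lemma L2_poly f : ispoly f -> L2 f.
Proof.
move=> hf; have [M hM] := @ball_bounded R n f 1 (fun z _ => @ispoly_cont R n f hf z).
apply: (@L2_bnd_ae _ M); first exact: cmeas_poly.
by apply: ae_mono ae_sphere => z z1; apply: hM; rewrite /cballr /= z1.
Qed.

(** * Orthogonality of homogeneous polynomials *)

Lemma scale_rotation a : normc a = 1 -> rotation (fun z : Cn R n => a *: z).
Proof. by move=> a1; split=> [z w|z]; [exact: scalerDr|rewrite enormZ a1 mul1r]. Qed.
Lemma hpoly_L2 k f : hpoly k f -> L2 f.
Proof. by move=> h; exact: L2_poly h.1. Qed.

(** A rotation by a unimodular scalar a multiplies the product by a ^ (k - l); a root of unity of
    exact order k - l + 1 makes this factor different from 1. *)
Lemma hpoly_orth k l f g : hpoly k f -> hpoly l g -> k <> l -> L2dot f g = 0.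
Proof.
have key k1 l1 f1 g1 : hpoly k1 f1 -> hpoly l1 g1 -> (l1 < k1)%N -> L2dot f1 g1 = 0.
  move=> hf hg lk; have [a pa] := @prim_root_exists R (k1 - l1).+1 isT.
  have a1 : normc a = 1 by exact: (@normc_unity R (k1 - l1).+1 a isT (prim_expr_order pa)).
  have aa : a * a^* = 1 by rewrite mulcJ a1 expr1n.
  have : L2dot f1 g1 = a ^+ (k1 - l1) * L2dot f1 g1.
    have hi := L2dot_I (hpoly_L2 hf) (hpoly_L2 hg).
    rewrite {1}/L2dot -(cintegral_rot (scale_rotation a1) hi) -cintegralZ //.
    congr cintegral; apply/funext => z /=; rewrite hf.2 hg.2 conjcM rmorphXn.
    have -> : a ^+ k1 = a ^+ (k1 - l1) * a ^+ l1 by rewrite -exprD subnK // ltnW.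
    have : a ^+ l1 * a^* ^+ l1 = 1 by rewrite -exprMn aa expr1n.
    by move: (a ^+ l1) (a^* ^+ l1) => x y xy; rewrite mulrACA -[_ * x * y]mulrA xy mulr1 mulrA.
  move=> /eqP; rewrite -subr_eq0 -{1}[L2dot _ _]mul1r -mulrBl mulf_eq0 subr_eq0 => /orP[|/eqP //].
  by rewrite eq_sym -(prim_order_dvd pa) gtnNdvd // subn_gt0.
move=> hf hg kl; have [lk|kl'|/esym//] := ltngtP l k; first exact: key hf hg lk.
by rewrite dotC ?(key _ _ _ _ hg hf kl') ?conjC0 //; [exact: hpoly_L2 hg|exact: hpoly_L2 hf].
Qed.

Lemma dot_hsum F G (r s : seq nat) : homs F ->
  (forall k, hpoly k (G k)) -> uniq s ->
  L2dot (fun z => \sum_(k <- r) F k z) (fun z => \sum_(k <- s) G k z) =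
  \sum_(k <- r | k \in s) L2dot (F k) (G k).
Proof.
move=> hF hG us; have LF k := hpoly_L2 (hF k); have LG k := hpoly_L2 (hG k).
rewrite dot_suml //; last exact: L2_sum.
rewrite [RHS]big_mkcond; apply: eq_bigr => k _; rewrite dot_sumr //.
have [ks|ks] := boolP (k \in s).
  by rewrite (bigD1_seq k) //= big1 ?addr0 // => j jk; apply: hpoly_orth (hF k) (hG j) _; apply/eqP; rewrite eq_sym.
rewrite big_seq big1 // => j js; apply: hpoly_orth (hF k) (hG j) _ => kj.
by move: ks; rewrite kj js.
Qed.

Lemma sqn_hsum F (r : seq nat) : homs F -> uniq r ->
  sqn (fun z => \sum_(k <- r) F k z) = \sum_(k <- r) sqn (F k).
Proof.
move=> hF ur; have := dot_hsum r hF hF ur; rewrite dot_sqn => /(congr1 (@Re R)) /= ->.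
rewrite big_seq_cond (eq_bigl (fun k => (k \in r) && true)); last by move=> k; rewrite andbb andbT.
by rewrite -big_seq_cond raddf_sum; apply: eq_bigr => k _; rewrite dot_sqn.
Qed.

Lemma cintegral_hpoly k f : hpoly k f -> (0 < k)%N -> cintegral f = 0.
Proof.
move=> hf k0; have h1 : hpoly 0 ((fun=> 1) : Cfun R n).
  by split=> [|a z]; [exact: ispoly_cst|rewrite expr0 mul1r].
have := hpoly_orth hf h1; rewrite /L2dot; under eq_fun do rewrite rmorph1 mulr1.
by apply=> k'; rewrite k' in k0.
Qed.

(** The mean value property: components of positive degree are orthogonal to constants and vanish at
    0. *)
Lemma cintegral_poly f : ispoly f -> cintegral f = f 0.
Proof.
move=> /ispoly_decomp[d [F [hF fE]]].
have F0 k : (0 < k)%N -> F k 0 = 0.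
  by move=> k0; have := (hF k).2 0 0; rewrite scale0r expr0n gtn_eqF // mul0r.
have -> : cintegral f = cintegral (fun z => \sum_(k < d) F k z).
  by congr cintegral; apply/funext => z.
rewrite cintegral_sum; last by move=> i; exact/L2_cI/(hpoly_L2 (hF i)).
rewrite fE; apply: eq_bigr => -[[|k] kd] _ /=; last by rewrite F0 // (cintegral_hpoly (hF k.+1)).
have -> : F 0%N = fun=> F 0%N 0.
  by apply/funext => z; have := (hF 0%N).2 0 z; rewrite scale0r expr0 mul1r.
by rewrite cintegral_cst.
Qed.

(** * Caps, and the sup norm of homogeneous polynomials *)

Lemma hdotNr z w : hdot z (- w) = - hdot z w.
Proof. by rewrite hdotC -scaleN1r hdotZl mulN1r conjcN -hdotC. Qed.

(** The Householder reflection of R^{2n}. Only the real part of the Hermitian product enters, so it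
    is orthogonal but not complex linear; it exchanges two given points of equal norm. *)
Definition refl (u : Cn R n) z : Cn R n := z - (2 * Re (hdot z u) / enorm u ^+ 2)%:C *: u.

Lemma refl_rotation (u : Cn R n) : u != 0 -> rotation (refl u).
Proof.
move=> u0; have e0 : enorm u != 0 by apply: contra u0 => /eqP/enorm_eq0 ->.
split=> [z w|z].
  by rewrite /refl hdotDl ReD mulrDr mulrDl rmorphD scalerDl opprD addrACA.
apply/eqP; rewrite -(@eqrXn2 _ 2) //; apply/eqP.
rewrite /refl; set t := 2 * _ / _; rewrite enormD_sqr enormN enormZ normcR exprMn real_normK ?num_real //.
have -> : Re (hdot z (- (t%:C *: u))) = - (t * Re (hdot z u)).
  by rewrite hdotNr hdotZr conjcR ReN ReM /= mul0r subr0.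
by rewrite /t; field.
Qed.

Lemma refl_swap (a b : Cn R n) : enorm a = enorm b -> a != b -> refl (a - b) a = b.
Proof.
move=> ab ne; have d0 : a - b != 0 by rewrite subr_eq0.
have e0 : enorm (a - b) != 0 by apply: contra d0 => /eqP/enorm_eq0 ->.
rewrite /refl (_ : 2 * Re (hdot a (a - b)) / enorm (a - b) ^+ 2 = 1).
  by rewrite scale1r opprB addrC subrK.
have -> : 2 * Re (hdot a (a - b)) = enorm (a - b) ^+ 2.
  have -> : hdot a (a - b) = hdot a a - hdot a b.
    by rewrite hdotDr hdotNr.
  rewrite enormD_sqr enormN -ab ReD ReN hdotzz /=.
  have -> : Re (hdot a (- b)) = - Re (hdot a b).
    by rewrite hdotNr ReN.
  by ring.
by rewrite divff // expf_neq0.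
Qed.

Definition capm e (a : Cn R n) : R := Rint (\1_[set z | enorm (z - a) < e]).

Lemma cap_meas e (a : Cn R n) : measurable ([set z | enorm (z - a) < e] : set Bo).
Proof.
apply: open_meas => z /= ze; exists (e - enorm (z - a)); first by rewrite subr_gt0.
by move=> w wz; have := enormD (w - z) (z - a); rewrite addrA subrK; lra.
Qed.

Lemma rI_indic (A : set (Cn R n)) : measurable (A : set Bo) -> rI (\1_A).
Proof.
move=> mA; apply: (@rI_bnd _ 1); first exact: rmeas_indic.
by move=> z; rewrite indicE; case: (_ \in _); rewrite ?normr1 ?normr0.
Qed.

Lemma capm_eq e (a b : Cn R n) : enorm a = enorm b -> capm e a = capm e b.
Proof.
move=> ab; have [->//|ne] := eqVneq a b.
have hT : rotation (refl (a - b)) by apply: refl_rotation; rewrite subr_eq0.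
rewrite /capm -(Rint_rot hT (rI_indic (cap_meas e b))); congr Rint.
apply/funext => z /=; rewrite !indicE.
have -> : (refl (a - b) z \in [set z | enorm (z - b) < e]) = (z \in [set z | enorm (z - a) < e]) => //.
apply/idP/idP => /set_mem /= h; apply/mem_set => /=; move: h.
  by rewrite -{2}(refl_swap ab ne) rotationB // hT.2.
by rewrite -{2}(refl_swap ab ne) rotationB // hT.2.
Qed.

(** Pigeonhole: rounding the 2 n real coordinates at scale 1 / K sorts the sphere into at most (2 K
    + 1) ^ (2 n) classes, each inside one cap, and all the caps have the same measure. *)
Lemma capm_lower e (K : nat) (a : Cn R n) : enorm a = 1 -> (0 < K)%N -> 2 * n%:R < K%:R * e ->
  1 <= ((2 * K).+1 ^ (2 * n))%:R * capm e a.
Proof.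
move=> a1 K0 Ke; have Kp : 0 < K%:R :> R by rewrite ltr0n.
pose J := {ffun 'I_n -> 'I_(2 * K).+1 * 'I_(2 * K).+1}.
pose q (x : R) : 'I_(2 * K).+1 := inord (Num.truncn (K%:R * (x + 1))).
have qP x y : `|x| <= 1 -> `|y| <= 1 -> q x = q y -> `|x - y| <= K%:R^-1.
  have r0 t : `|t| <= 1 -> 0 <= K%:R * (t + 1) /\ (Num.truncn (K%:R * (t + 1))%R < (2 * K).+1)%N.
    rewrite ler_norml => /andP[t1 t2]; have p : 0 <= K%:R * (t + 1) by rewrite mulr_ge0 //; lra.
    split=> //; rewrite ltnS -(ler_nat R) (le_via (K%:R * (t + 1))) ?truncn_le //.
    by rewrite natrM mulrC ler_wpM2r //; lra.
  move=> /r0[px sx] /r0[py sy] /(congr1 val); rewrite /= !inordK // => E.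
  have [x1 x2] : (Num.truncn (K%:R * (x + 1)))%:R <= K%:R * (x + 1) /\ K%:R * (x + 1) < (Num.truncn (K%:R * (x + 1)))%:R + 1.
    by split; [by rewrite truncn_le|rewrite natr1; exact: truncnS_gt].
  have [y1 y2] : (Num.truncn (K%:R * (y + 1)))%:R <= K%:R * (y + 1) /\ K%:R * (y + 1) < (Num.truncn (K%:R * (y + 1)))%:R + 1.
    by split; [by rewrite truncn_le|rewrite natr1; exact: truncnS_gt].
  rewrite -(ler_pM2l Kp) mulfV ?gt_eqF // -[X in X * _](gtr0_norm Kp) -normrM.
  by move: x1 x2 y1 y2; rewrite E; set t := _%:R; rewrite ler_norml mulrBr; clear -hs; lra.
pose c (z : Cn R n) : J := [ffun i => (q (Re (z 0 i)), q (Im (z 0 i)))].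
have cP z w : enorm z = 1 -> enorm w = 1 -> c z = c w -> enorm (z - w) < e.
  move=> z1 w1 /ffunP E; apply: le_lt_trans (enorm_lt_sum _) _.
  have h1 (z' : Cn R n) i : enorm z' = 1 -> `|Re (z' 0 i)| <= 1 /\ `|Im (z' 0 i)| <= 1.
    move=> e1; have := normc_le_enorm z' i; rewrite e1 => e2.
    by split; apply: le_trans e2; [exact: Re_le_normc|exact: Im_le_normc].
  apply: (@le_lt_trans _ _ (\sum_(i < n) (K%:R^-1 + K%:R^-1))).
    apply: ler_sum => i _; have := E i; rewrite !ffunE => -[/qP E1 /qP E2].
    have [z2 z3] := h1 z i z1; have [w2 w3] := h1 w i w1.
    apply: le_trans (normc_le_ReIm _) _; rewrite !mxE ReD ReN ImD ImN.
    by apply: lerD; [exact: E1|exact: E2].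
  rewrite sumr_const card_ord -mulr_natl -(ltr_pM2l Kp); apply: le_lt_trans Ke.
  by apply: eqW; field; rewrite gt_eqF.
(* An empty class gets the representative a, so that every cap is centred on the sphere. *)
pose rep (j : J) : Cn R n := xget a [set z | enorm z = 1 /\ c z = j].
have repP j : enorm (rep j) = 1 /\ (forall z, enorm z = 1 -> c z = j -> c (rep j) = j).
  rewrite /rep; have [[z [z1 zj]]|h] := pselect (exists z, enorm z = 1 /\ c z = j).
    by have [r1 r2] := @xgetPex _ a [set z | enorm z = 1 /\ c z = j] (ex_intro _ z (conj z1 zj)); split.
  case: xgetP => [y _ [y1 y2]|_]; first by split.
  by split=> // z z1 zj; case: h; exists z.
have : Rint (fun=> 1) <= Rint (fun z => \sum_(j : J) \1_[set z | enorm (z - rep j) < e] z).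
  apply: Rint_le_ae; first exact: rI_cst.
    by apply: rI_sum => j; apply: rI_indic; exact: cap_meas.
  apply: ae_mono ae_sphere => z z1; rewrite (bigD1 (c z)) //= indicE.
  have [r1 r2] := repP (c z).
  have -> : z \in [set z0 | enorm (z0 - rep (c z)) < e].
    by apply/mem_set => /=; apply: cP => //; rewrite (r2 z).
  by rewrite lerDl; apply: sumr_ge0 => j _; rewrite indicE.
rewrite Rint_cst Rint_sum; last by move=> j; apply: rI_indic; exact: cap_meas.
move=> h; apply: le_trans h _.
under eq_bigr do rewrite -/(capm e _) (@capm_eq e (rep _) a (etrans (repP _).1 (esym a1))).
rewrite sumr_const card_ffun card_prod !card_ord -[leLHS]mulr_natl; apply: eqW.
by rewrite expnM mulnn.
Qed.

Lemma capm_gt0 e (a : Cn R n) : enorm a = 1 -> 0 < e -> 0 < capm e a.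
Proof.
move=> a1 e0; pose K := (Num.truncn (2 * n%:R / e)).+1.
have : 2 * n%:R < K%:R * e by rewrite -ltr_pdivrMr // truncnS_gt.
move=> /(@capm_lower e K a a1 isT) h; rewrite lt_def; apply/andP; split.
  by apply/eqP => c0; move: h; rewrite c0 mulr0 ler10.
by apply: Rint_ge0 => z; rewrite indicE.
Qed.

(** A violation at one point would by continuity hold on a cap, and caps have positive measure. *)
Lemma ae_sphere_all (p : Cn R n -> R) M : (forall z, enorm z = 1 -> forall e, 0 < e ->
    exists2 d : R, 0 < d & forall w, enorm (w - z) < d -> `|p w - p z| < e) ->
  (\ae z, p z <= M) -> forall z, enorm z = 1 -> p z <= M.
Proof.
move=> hp h z z1; rewrite leNgt; apply/negP => pz.
have e0 : 0 < p z - M by rewrite subr_gt0.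
have [d d0 hd] := hp z z1 _ e0.
have := capm_gt0 z1 d0; suff -> : capm d z = 0 by rewrite ltxx.
transitivity (Rint (fun=> 0)); last exact: Rint_cst.
apply: Rint_ae; apply: ae_mono h => w pw; rewrite indicE.
have [/set_mem /= /hd|//] := boolP (w \in _).
by rewrite ltr_norml => /andP[+ _]; move: pw; lra.
Qed.

Lemma bernoulli_pow (x : R) k : 0 <= x -> k%:R * x <= 1 / 2 -> (1 + x) ^+ k <= 2.
Proof.
move=> x0 kx; have : (1 + x) ^+ k * (1 - k%:R * x) <= 1.
  elim: k {kx} => [|k IH]; first by rewrite expr0 mul0r subr0 mul1r.
  apply: le_trans IH; rewrite exprSr -mulrA ler_wpM2l ?exprn_ge0 ?addr_ge0 // -natr1.
  have : 0 <= k%:R :> R by []. by nra.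
have : 0 <= (1 + x) ^+ k by rewrite exprn_ge0 // addr_ge0.
by move: ((1 + x) ^+ k) kx => y kx y0; nra.
Qed.

(** Only its polynomial growth in k matters. The 4 comes from points where half the maximum is
    reached, the power from [capm_lower], with 2 K + 1 at most 129 (n + 1)^2 (k + 1). *)
Definition supc k : R := 4 * ((129 * n.+1 ^ 2 * k.+1) ^ (2 * n))%:R.

(** Take a point where |p| nearly reaches its maximum A. Within distance 1 / (2 (k + 1)) of it |w| ^
    k is at most 2, so |p| <= 2 A there, and Cauchy estimates keep |p| above A / 2 on a cap of
    radius comparable to 1 / (k + 1), whose measure is at least a power of that radius. *)
Lemma hpoly_sup k p zeta : hpoly k p -> enorm zeta = 1 -> normc (p zeta) ^+ 2 <= supc k * sqn p.
Proof.
move=> hp z1; pose S := [set normc (p z) | z in (csphere : set (Cn R n))].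
have [M hM] := @ball_bounded R n p 1 (fun w _ => @ispoly_cont R n p hp.1 w).
have hS : has_sup S.
  by split; [exists (normc (p zeta)), zeta|exists M => _ [z zs <-]; apply: hM; rewrite /cballr zs].
pose A := sup S; have hA z : enorm z = 1 -> normc (p z) <= A.
  by move=> zs; apply: sup_upper_bound => //; exists z.
have A0 : 0 <= A by apply: le_trans (normc_ge0 (p zeta)) (hA _ z1).
suff H : A ^+ 2 <= supc k * sqn p.
  apply: le_trans H; rewrite lerXn2r ?nnegrE //; exact: hA.
have [->|Ane] := eqVneq A 0.
  by rewrite expr0n /= mulr_ge0 // mulr_ge0.
have Ap : 0 < A by rewrite lt_def Ane.
have [_ [eta es <-] eA] : exists2 y, S y & A - A / 4 < y by apply: sup_adherent; rewrite ?divr_gt0.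
have hB w : normc (p w) <= A * enorm w ^+ k.
  have [v v1 wE] : exists2 v, enorm v = 1 & w = (enorm w)%:C *: v.
    have [w0|w0] := eqVneq (enorm w) 0.
      by exists zeta => //; rewrite w0 scale0r; exact: enorm_eq0.
    exists ((enorm w)^-1%:C *: w); first by rewrite enormZR ?invr_ge0 // mulVf.
    by rewrite scalerA -rmorphM divff // scale1r.
  rewrite wE hp.2 normcM normcX normcR enormZR // v1 mulr1 ger0_norm //.
  by rewrite mulrC ler_wpM2r ?exprn_ge0 // hA.
pose rho : R := (2 * k.+1%:R)^-1; have k0 : 0 < k.+1%:R :> R by [].
have rho0 : 0 < rho by rewrite invr_gt0 mulr_gt0.
have hB2 w : enorm (w - eta) <= rho -> normc (p w) <= 2 * A.
  move=> we; apply: le_trans (hB w) _; rewrite mulrC ler_wpM2r //.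
  have kr : k%:R * rho <= 1 / 2.
    rewrite /rho ler_pdivrMr ?mulr_gt0 // -[k.+1%:R]natr1; move: (k%:R : R); clear -hs; move=> x; lra.
  apply: le_trans (bernoulli_pow (ltW rho0) kr); rewrite lerXn2r ?nnegrE ?addr_ge0 ?(ltW rho0) //.
  by rewrite -(subrK eta w); apply: le_trans (enormD _ _) _; rewrite es addrC lerD2l.
have [l [l1 l2]] := poly_quadratic hp.1 rho0 hB2.
(* The factor 16 (n + 1) keeps the linear term, a sum over n coordinates, and the quadratic term
   together below A / 4. *)
pose e := rho / (16 * n.+1%:R); have n0 : 0 < n.+1%:R :> R by [].
have e0 : 0 < e by rewrite divr_gt0 // mulr_gt0.
have near z : enorm (z - eta) < e -> A / 2 <= normc (p z).
  set h := z - eta => he; have zE : z = eta + h by rewrite /h addrC subrK.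
  pose t := enorm h / rho; have t0 : 0 <= t by rewrite divr_ge0 // ltW.
  have tn : t * n.+1%:R <= 1 / 16.
    rewrite /t mulrAC ler_pdivrMr //; apply: le_trans (ltW (_ : _ < e * n.+1%:R)) _.
      by rewrite ltr_pM2r.
    by apply: eqW; rewrite /e; field; rewrite gt_eqF.
  have hr : 2 * enorm h <= rho.
    have : t <= 1 / 16 by apply: le_trans tn; rewrite ler_peMr // ler1n.
    by rewrite /t ler_pdivrMr //; move: rho0; clear -hs; lra.
  have q1 := l2 h hr; have q2 : normc (rowdot l h) <= n%:R * (2 * A * t).
    rewrite /rowdot; apply: normc_sum_le.
    apply: (le_via (\sum_(i < n) 2 * A * t)); last by rewrite sumr_const card_ord -[leLHS]mulr_natl.
    apply: ler_sum => i _; rewrite normcM /t mulrA mulrAC; apply: ler_pM; rewrite ?l1 //.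
    exact: normc_le_enorm.
  have q3 : normc (p eta) <= normc (p z) + (n%:R * (2 * A * t) + 2 * (2 * A) / rho ^+ 2 * enorm h ^+ 2).
    have -> : p eta = p z - (rowdot l h + (p (eta + h) - p eta - rowdot l h)) by rewrite zE; ring.
    apply: normcB_le; rewrite lerD2l; apply: normcD_le.
    exact: lerD.
  have E : 2 * (2 * A) / rho ^+ 2 * enorm h ^+ 2 = 4 * A * t ^+ 2.
    by rewrite /t; field; rewrite gt_eqF.
  rewrite E in q3; have nn : n.+1%:R = n%:R + 1 :> R by rewrite natr1.
  rewrite nn in tn; have nn0 : 0 <= n%:R :> R by [].
  have tt : t ^+ 2 <= t / 16.
    rewrite expr2 ler_wpM2l //; apply: (le_via (1 / 16)); last by rewrite div1r.
    by apply: le_trans tn; rewrite ler_peMr // lerDr.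
  move: q3 tn tt eA t0 nn0 Ap; move: (normc (p eta)) (normc (p z)) => a b.
  clear -hs; move: (n%:R : R) => N q3 tn tt eA t0 N0 A0.
  have : A * (t * N) <= A * (1 / 16 - t) by rewrite ler_pM2l //; lra.
  have : A * t ^+ 2 <= A * (t / 16) by rewrite ler_pM2l.
  have : 0 <= A * t by rewrite mulr_ge0 // ltW.
  by nra.
have ce : A ^+ 2 / 4 * capm e eta <= sqn p.
  rewrite /capm -RintZ; last by apply: rI_indic; exact: cap_meas.
  apply: Rint_le; [by apply: rI_Z; apply: rI_indic; exact: cap_meas|exact: (L2_rI (hpoly_L2 hp))|].
  move=> z; rewrite indicE; have [/set_mem /= /near h|_] := boolP (z \in _); last by rewrite mulr0 sqr_ge0.
  rewrite mulr1; have -> : A ^+ 2 / 4 = (A / 2) ^+ 2 by field.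
  by rewrite lerXn2r ?nnegrE // divr_ge0.
pose K := (64 * n.+1 ^ 2 * k.+1)%N.
have Ke : 2 * n%:R < K%:R * e.
  rewrite /K !natrM /e /rho; have -> : 64 * (n.+1%:R * n.+1%:R) * k.+1%:R * ((2 * k.+1%:R)^-1 / (16 * n.+1%:R)) = 2 * n.+1%:R :> R.
    by move: (gt_eqF k0) (gt_eqF n0); move: (k.+1%:R : R) (n.+1%:R : R) => x y x0 y0; field; rewrite x0 y0.
  by rewrite ltr_pM2l // ltr_nat.
have K0 : (0 < K)%N by rewrite /K !muln_gt0.
have c1 := capm_lower es K0 Ke.
have c2 : ((2 * K).+1 ^ (2 * n))%:R <= ((129 * n.+1 ^ 2 * k.+1) ^ (2 * n))%:R :> R.
  rewrite ler_nat; have [->|n1] := posnP n; [by rewrite muln0|rewrite leq_exp2r ?muln_gt0 //]; rewrite /K; have : (0 < n.+1 ^ 2 * k.+1)%N by rewrite !muln_gt0.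
  by rewrite -!mulnA; move: (n.+1 ^ 2 * k.+1)%N; clear -hs; move=> x; lia.
have c0 : 0 <= capm e eta by apply: Rint_ge0 => z; rewrite indicE.
have N20 : 0 <= ((129 * n.+1 ^ 2 * k.+1) ^ (2 * n))%:R :> R by [].
have a0 := sqr_ge0 A; rewrite /supc; move: c1 c2 ce c0 N20 a0.
move: (capm _ _) (sqn _) (((2 * K).+1 ^ (2 * n))%:R : R) => c s N1.
move: (((129 * n.+1 ^ 2 * k.+1) ^ (2 * n))%:R : R) (A ^+ 2) => N2 a.
clear -hs; move=> h1 h2 h3 h4 N20 a0.
have h6 : 1 <= N2 * c by apply: le_trans h1 _; rewrite ler_wpM2r.
have : N2 * (a / 4 * c) <= N2 * s by rewrite ler_wpM2l.
have : a <= a * (N2 * c) by rewrite ler_peMr.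
have -> : N2 * (a / 4 * c) = a * (N2 * c) / 4 by field.
by lra.
Qed.

Lemma polyexp m (a : R) : 0 <= a -> a < 1 ->
  exists2 M, 0 <= M & forall k, k.+1%:R ^+ m * a ^+ k <= M.
Proof.
elim: m a => [|m IH] a a0 a1.
  by exists 1 => // k; rewrite expr0 mul1r exprn_ile1 // ltW.
pose b := Num.sqrt a; have b0 : 0 <= b by exact: sqrtr_ge0.
have b1 : b < 1 by rewrite -sqrtr1 ltr_sqrt.
have [M M0 hM] := IH b b0 b1; exists (M / (1 - b)); first by rewrite divr_ge0 // subr_ge0 ltW.
move=> k; have -> : a ^+ k = b ^+ k * b ^+ k by rewrite -exprMn -expr2 sqr_sqrtr.
rewrite exprSr mulrACA; apply: ler_pM => //; try by rewrite mulr_ge0 // exprn_ge0.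
rewrite -[_^-1]mul1r ler_pdivlMr ?subr_gt0 //.
have key : forall j, (j <= k.+1)%N -> j%:R * b ^+ k * (1 - b) <= 1 - b ^+ j.
  elim=> [_|j IHj jk]; first by rewrite !mul0r expr0 subrr.
  rewrite -natr1 2!mulrDl mul1r exprS; apply: le_trans (lerD (IHj (ltnW jk)) (lexx _)) _.
  have : b ^+ k * (1 - b) <= b ^+ j * (1 - b).
    by rewrite ler_wpM2r ?subr_ge0 ?(ltW b1) // ler_wiXn2l // ltW.
  by move: (b ^+ k) (b ^+ j); clear -hs; move=> x y; nra.
apply: le_trans (key k.+1 (leqnn _)) _; by rewrite lerBlDr lerDl exprn_ge0.
Qed.

Lemma sphere_ex : exists z : Cn R n, enorm z = 1.
Proof.
have [//|h] := pselect (exists z : Cn R n, enorm z = 1).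
have : csphere = set0 :> set (Cn R n) by rewrite -subset0 => z hz; apply: h; exists z.
by have := hs.1 => + E; rewrite E measure0 => -[] /eqP; rewrite eq_sym oner_eq0.
Qed.

Lemma polar w : exists2 v, enorm v = 1 & w = (enorm w)%:C *: v.
Proof.
have [w0|w0] := eqVneq (enorm w) 0.
  by have [z z1] := sphere_ex; exists z => //; rewrite w0 scale0r; exact: enorm_eq0.
exists ((enorm w)^-1%:C *: w); first by rewrite enormZR ?invr_ge0 // mulVf.
by rewrite scalerA -rmorphM divff // scale1r.
Qed.

(** With s a square root of the radius, |z| ^ k gives two factors s ^ k: one absorbs the polynomial
    growth of [supc], the other remains as decay. The maximum with 1 / 4 only keeps the radius
    positive. *)
Lemma hpoly_eval r : r < 1 -> exists (M s : R), [/\ 0 <= M, 0 < s, s < 1 &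
  forall k p z, hpoly k p -> enorm z <= r -> normc (p z) <= M * s ^+ k * l2 p].
Proof.
move=> r1; pose r' := Num.max r (1 / 4).
have [r'1 r'0 rr] : [/\ r' < 1, 0 < r' & r <= r'].
  rewrite /r' gt_max lt_max le_max lexx r1 /=; split => //; last by apply/orP; right; lra.
  by lra.
pose s := Num.sqrt r'; have s0 : 0 < s by rewrite sqrtr_gt0.
have s1 : s < 1 by rewrite -sqrtr1 ltr_sqrt.
have [M M0 hM] := @polyexp (2 * n) s (ltW s0) s1.
pose D : R := 4 * ((129 * n.+1 ^ 2) ^ (2 * n))%:R.
have D0 : 0 <= D by rewrite mulr_ge0.
exists (D * M), s; split=> //; first exact: mulr_ge0.
move=> k p z hp zr; have [v v1 zE] := polar z.
have D1 : 1 <= supc k by rewrite /supc -natrM ler1n muln_gt0 expn_gt0 !muln_gt0.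
have sp : 0 <= supc k by exact: le_trans ler01 D1.
have h1 : normc (p v) <= supc k * l2 p.
  rewrite -[_ <= _]ler_sqr ?nnegrE ?mulr_ge0 //.
  rewrite exprMn l2_sqr; apply: le_trans (hpoly_sup hp v1) _.
  by rewrite ler_wpM2r // expr2 ler_peMr.
have E : supc k = D * k.+1%:R ^+ (2 * n).
  by rewrite /supc /D expnMn natrM mulrA; congr (_ * _); exact: natrX.
rewrite zE hp.2 normcM normcX normcR ger0_norm //.
apply: (le_via (r' ^+ k * (supc k * l2 p))).
  apply: ler_pM; rewrite ?exprn_ge0 //.
  by rewrite lerXn2r ?nnegrE ?(ltW r'0) // (le_trans zr).
have -> : r' ^+ k = s ^+ k * s ^+ k by rewrite -exprMn -expr2 sqr_sqrtr // ltW.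
have -> : s ^+ k * s ^+ k * (supc k * l2 p) = D * (k.+1%:R ^+ (2 * n) * s ^+ k) * s ^+ k * l2 p.
  by rewrite E; ring.
by rewrite ler_wpM2r // ler_wpM2r ?exprn_ge0 ?(ltW s0) // ler_wpM2l.
Qed.

Lemma scale_cmeas u a : cmeas u -> cmeas (fun z => u (a *: z)).
Proof.
have [->|a0] := eqVneq a 0.
  by under eq_fun do rewrite scale0r; move=> _; exact: cmeas_cst.
have mS : measurable_fun setT ((fun z => a *: z) : Bo -> Bo).
  apply: (@measurability _ _ _ Bo _ _ (@open (Cn R n : normedModType R[i]))) => //.
  move=> _ [A oA <-]; rewrite setTI; apply: open_meas => z /= Az.
  have ap : 0 < normc a by rewrite normc_gt0.
  move: oA; rewrite openE => /(_ _ Az)/nbhs_enormP[d d0 hd]; exists (d / normc a).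
    by rewrite divr_gt0.
  by move=> w wz; apply: hd; rewrite -scalerBr enormZ mulrC -ltr_pdivlMr.
by move=> [h1 h2]; split; [exact: measurableT_comp h1 mS|exact: measurableT_comp h2 mS].
Qed.

(** * Dilations and coefficients: H^2 as square summable series *)

Definition psum F K : Cfun R n := fun z => \sum_(k < K) F k z.

Lemma psum_nat F K : psum F K = (fun z => \sum_(k <- index_iota 0 K) F k z).
Proof. by apply/funext => z; rewrite /psum big_mkord. Qed.
Lemma psum_poly F K : homs F -> ispoly (psum F K).
Proof. by move=> h; apply: ispoly_sum => k _; exact: (h k).1. Qed.
Lemma psum_L2 F K : homs F -> L2 (psum F K).
Proof. by move=> h; apply: L2_poly _; exact: psum_poly. Qed.
Lemma sqn_psum F K : homs F -> sqn (psum F K) = \sum_(k < K) sqn (F k).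
Proof. by move=> h; rewrite psum_nat sqn_hsum ?iota_uniq // big_mkord. Qed.

Lemma psumB F K L : (K <= L)%N -> (fun z => psum F L z - psum F K z) = (fun z => \sum_(k <- index_iota K L) F k z).
Proof.
move=> KL; apply/funext => z; by rewrite !psum_nat (@big_cat_nat _ _ _ K 0 L) //= addrAC subrr add0r.
Qed.

Lemma sqn_psumB F K L : homs F -> (K <= L)%N ->
  sqn (fun z => psum F L z - psum F K z) = \sum_(K <= k < L) sqn (F k).
Proof. by move=> h KL; rewrite psumB // sqn_hsum ?iota_uniq. Qed.

Lemma expands_psum f F z : expands f F -> cball z -> psum F K z @[K --> \oo] ~~> f z.
Proof. exact: expands_cont. Qed.

Lemma analytic_cmeas f : analytic f -> cmeas f.
Proof.
move=> hf; have [F hF] := analytic_expands hf.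
apply: (@cmeas_lim _ _ (fun K z => (\1_[set z : Cn R n | enorm z < 1] z)%:C * psum F K z)).
  move=> K; apply: cmeasM; last exact/cmeas_poly/psum_poly/hF.1.
  by apply: cmeas_real; apply: rmeas_indic; exact: cball_meas.
move=> z; rewrite indicE; have [/set_mem /= zb|/negP zb] := boolP (z \in _).
  by under eq_fun do rewrite mul1r; exact: expands_psum.
rewrite hf.2; first by under eq_fun do rewrite mul0r; exact: cvgc_cst.
by move=> zb'; apply: zb; exact/mem_set.
Qed.

Lemma expands_unif f F r e : expands f F -> r < 1 -> 0 < e ->
  exists K0, forall K, (K0 <= K)%N -> forall z, enorm z <= r -> normc (f z - psum F K z) <= e.
Proof.
move=> [hF hr] r1 e0; pose r' := Num.max r (1 / 2); pose s := (1 + r') / 2.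
have r'1 : r' < 1 by rewrite gt_max r1 /=; lra.
have r'2 : 1 / 2 <= r' by rewrite le_max lexx orbT.
have [s0 s1] : 0 < s /\ s < 1 by rewrite /s; split; lra.
have rs : r' < s by rewrite /s; lra.
have [M M0 [_ hM]] := hr s s0 s1.
pose q := r' / s; have q1 : q < 1 by rewrite ltr_pdivrMr // mul1r.
have q0 : 0 <= q by rewrite divr_ge0 //; lra.
have : (q ^+ k : R^o) @[k --> \oo] --> (0 : R^o) by apply: cvg_expr; rewrite ger0_norm.
have e1 : 0 < e * (1 - q) / (M + 1) by rewrite divr_gt0 ?mulr_gt0 ?subr_gt0 // ltr_wpDl.
move=> /cvgrPdist_lt/(_ _ e1) [K0 _ hK]; exists K0 => K KK z zr.
have := hK K KK; rewrite /= sub0r normrN ger0_norm ?exprn_ge0 // ltr_pdivlMr ?ltr_wpDl // => h.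
have zr' : enorm z <= r' by rewrite le_max zr.
apply: le_trans (hM _ _ (le_lt_trans zr' rs)) _.
have zq : enorm z / s <= q by rewrite ler_wpM2r // invr_ge0 ltW.
have zq0 : 0 <= enorm z / s by rewrite divr_ge0 // ltW.
apply: (le_via (M * q ^+ K / (1 - q))).
  apply: ler_pM.
  - by rewrite mulr_ge0 // exprn_ge0.
  - by rewrite invr_ge0 subr_ge0; apply: le_trans zq (ltW q1).
  - by rewrite ler_wpM2l // lerXn2r // nnegrE.
  - by rewrite lef_pV2 ?posrE ?subr_gt0 ?lerD2l ?lerN2 // (le_lt_trans zq).
rewrite ler_pdivrMr ?subr_gt0 //; apply: le_trans (ltW h).
by rewrite mulrC ler_wpM2l ?exprn_ge0 // lerDl.
Qed.

Definition dil r f : Cfun R n := fun z => f (r%:C *: z).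

Lemma dil_hpoly r k f : hpoly k f -> dil r f = fun z => (r ^+ k)%:C * f z.
Proof. by move=> h; apply/funext => z; rewrite /dil h.2 rmorphXn. Qed.
Lemma dil_psum r F K : homs F -> dil r (psum F K) = psum (fun k z => (r ^+ k)%:C * F k z) K.
Proof. by move=> h; apply/funext => z; apply: eq_bigr => k _; have := congr1 (@^~ z) (dil_hpoly r (h k)). Qed.
Lemma hpolyZ k f a : hpoly k f -> hpoly k (fun z => a * f z).
Proof. by move=> h; split=> [|b z]; [exact: ispolyZ h.1|rewrite h.2 mulrCA]. Qed.

Lemma dil_L2 r f : 0 < r -> r < 1 -> analytic f -> L2 (dil r f).
Proof.
move=> r0 r1 hf; have [M _ hM] := polyapprox_bounded (analytic_polyapprox hf) r1.
apply: (@L2_bnd_ae _ M); first exact/scale_cmeas/analytic_cmeas.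
by apply: ae_mono ae_sphere => z z1; apply: hM; rewrite enormZR ?z1 ?mulr1 // ltW.
Qed.

Lemma sqn_dil_psum r F K : 0 <= r -> homs F ->
  sqn (dil r (psum F K)) = \sum_(k < K) r ^+ (2 * k) * sqn (F k).
Proof.
move=> r0 h; rewrite dil_psum // sqn_psum; last by move=> k; exact: hpolyZ.
apply: eq_bigr => k _; rewrite sqnZ; last exact: hpoly_L2 (h k).
by rewrite normcR ger0_norm ?exprn_ge0 // -exprM mulnC.
Qed.

Lemma l2_le_sup u M : cmeas u -> (forall z, enorm z = 1 -> normc (u z) <= M) -> l2 u <= M.
Proof.
move=> mu h; have M0 : 0 <= M by have [z /h] := sphere_ex; apply: le_trans; exact: normc_ge0.
have ha : (\ae z, normc (u z) <= M) by apply: ae_mono ae_sphere => z /h.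
have hu := L2_bnd_ae mu ha.
rewrite -[_ <= _]ler_sqr ?nnegrE // l2_sqr -[leRHS]Rint_cst.
apply: Rint_le_ae; [exact: L2_rI|exact: rI_cst|].
by apply: ae_mono ha => z hz; rewrite lerXn2r ?nnegrE.
Qed.

Lemma dil_approx f F r e : analytic f -> expands f F -> 0 < r -> r < 1 -> 0 < e ->
  exists K0, forall K, (K0 <= K)%N -> l2 (fun z => dil r f z - dil r (psum F K) z) <= e.
Proof.
move=> hf hF r0 r1 e0; have [K0 hK] := expands_unif hF r1 e0.
exists K0 => K KK; apply: l2_le_sup.
  apply: cmeasB; first exact/scale_cmeas/analytic_cmeas.
  exact/scale_cmeas/cmeas_poly/psum_poly/hF.1.
by move=> z z1; apply: hK => //; rewrite enormZR ?z1 ?mulr1 // ltW.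
Qed.

Lemma l2_sub_le u v e : L2 u -> L2 v -> l2 (fun z => u z - v z) <= e -> l2 u <= l2 v + e.
Proof.
move=> hu hv h; have -> : u = (fun z => v z + (u z - v z)) by apply/funext => z; rewrite addrC subrK.
by apply: le_trans (l2D hv (L2B hu hv)) _; rewrite lerD2l.
Qed.

(** The limit r -> 1, by Bernoulli's inequality at one r close enough to 1. *)
Lemma pow_lim (A B : R) m : 0 <= A -> (forall r, 0 < r -> r < 1 -> r ^+ m * A <= B) -> A <= B.
Proof.
move=> A0 h; rewrite leNgt; apply/negP => BA.
have B0 : 0 <= B by apply: le_trans (h (1 / 2) _ _); rewrite ?mulr_ge0 ?exprn_ge0; lra.
have bern (x : R) : 0 <= x -> x <= 1 -> 1 - m%:R * x <= (1 - x) ^+ m.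
  move=> x0 x1; elim: m {h} => [|m IH]; first by rewrite mul0r subr0 expr0.
  rewrite exprS; apply: le_trans (_ : (1 - x) * (1 - m%:R * x) <= _); last by rewrite ler_wpM2l // subr_ge0.
  have m0 : 0 <= m%:R :> R by []. rewrite -natr1; nra.
have Ap : 0 < A by apply: le_lt_trans BA.
have d0 : 0 < A - B by rewrite subr_gt0.
pose x := (A - B) / (2 * A * m.+1%:R); have m0 : 0 < m.+1%:R :> R by [].
have x0 : 0 < x by rewrite divr_gt0 // !mulr_gt0.
have xE : x * (A * m.+1%:R) = (A - B) / 2 by rewrite /x; field; rewrite !gt_eqF.
have m1 : 1 <= m.+1%:R :> R by rewrite ler1n.
have x1 : x < 1.
  rewrite /x ltr_pdivrMr ?mulr_gt0 // mul1r; apply: lt_le_trans (_ : 2 * A <= _); first by lra.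
  by rewrite ler_peMr // mulr_ge0 // ltW.
have := h (1 - x); rewrite subr_gt0 x1 ltrBlDr ltrDl x0 => /(_ isT isT).
have := bern x (ltW x0) (ltW x1) => h1 h2.
have : (1 - m%:R * x) * A <= B by apply: le_trans h2; rewrite ler_wpM2r.
have xA : 0 < x * A by rewrite mulr_gt0.
have -> : (1 - m%:R * x) * A = A - ((A - B) / 2 - x * A) by rewrite -xE -[m.+1%:R]natr1; ring.
by move: xA d0; clear -hs; lra.
Qed.

Lemma dil_bound f F B : analytic f -> expands f F ->
  (forall K, \sum_(k < K) sqn (F k) <= B) -> forall r, 0 < r -> r < 1 -> sqn (dil r f) <= B.
Proof.
move=> hf hF hB r r0 r1; have B0 : 0 <= B by have := hB 0%N; rewrite big_ord0.
rewrite -l2_sqr -[B]sqr_sqrtr // lerXn2r ?nnegrE ?sqrtr_ge0 //.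
apply/ler_addgt0Pr => e e0; have [K0 /(_ K0 (leqnn _)) hK] := dil_approx hf hF r0 r1 e0.
have hp : L2 (dil r (psum F K0)) by rewrite dil_psum; [apply: psum_L2 => k; apply: hpolyZ|]; exact: hF.1.
apply: le_trans (l2_sub_le (dil_L2 r0 r1 hf) hp hK) _; rewrite lerD2r /l2 ler_wsqrtr //.
rewrite sqn_dil_psum; [|exact: ltW|exact: hF.1]; apply: le_trans (hB K0); apply: ler_sum => k _.
by rewrite ler_piMl // exprn_ile1 // ltW.
Qed.

(** Dilation multiplies the k-th square norm by r ^ (2 k), which is at least r ^ (2 K) for k < K;
    longer truncations approach the dilated f, and then r tends to 1. *)
Lemma coef_bound f F B : analytic f -> expands f F ->
  (forall r, 0 < r -> r < 1 -> sqn (dil r f) <= B) -> forall K, \sum_(k < K) sqn (F k) <= B.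
Proof.
move=> hf hF hB K; apply: (@pow_lim _ _ (2 * K)).
  by apply: sumr_ge0 => k _; exact: sqn_ge0.
move=> r r0 r1; have B0 : 0 <= B by apply: le_trans (hB r r0 r1); exact: sqn_ge0.
apply: (le_via (sqn (dil r (psum F K)))).
  rewrite sqn_dil_psum; [|exact: ltW|exact: hF.1]; rewrite mulr_sumr; apply: ler_sum => k _.
  by rewrite ler_wpM2r // ler_wiXn2l ?(ltW r0) ?(ltW r1) // leq_mul2l /= ltnW.
rewrite -l2_sqr -[B]sqr_sqrtr // lerXn2r ?nnegrE ?sqrtr_ge0 //.
apply/ler_addgt0Pr => e e0; have [K0 hK] := dil_approx hf hF r0 r1 e0.
pose L := maxn K0 K; have hp j : L2 (dil r (psum F j)) by rewrite dil_psum; [apply: psum_L2 => k; apply: hpolyZ|]; exact: hF.1.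
apply: (le_via (l2 (dil r (psum F L)))).
  rewrite /l2 ler_wsqrtr // !sqn_dil_psum ?(ltW r0) //; [|exact: hF.1|exact: hF.1].
  rewrite -!(big_mkord xpredT (fun k => r ^+ (2 * k) * sqn (F k))).
  rewrite (@big_cat_nat _ _ _ K 0 L) ?leq_maxr //= lerDl sumr_ge0 // => k _.
  by rewrite mulr_ge0 // exprn_ge0 // ltW.
have hL : l2 (fun z => dil r (psum F L) z - dil r f z) <= e by rewrite l2_distC; apply: hK; exact: leq_maxl.
apply: le_trans (l2_sub_le (hp L) (dil_L2 r0 r1 hf) hL) _; rewrite lerD2r.
by rewrite /l2 ler_wsqrtr // hB.
Qed.

Lemma H2normsq_int f r : analytic f -> 0 < r -> r < 1 ->
  (\int[sigma]_z ((normc (f (r%:C *: z)%R) ^+ 2)%R%:E))%E = (sqn (dil r f))%:E.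
Proof. by move=> hf r0 r1; rewrite -RintE //; exact: L2_rI (dil_L2 r0 r1 hf). Qed.

Lemma H2_bound f F B : analytic f -> expands f F ->
  (H2normsq sigma f <= B%:E)%E <-> (forall K, \sum_(k < K) sqn (F k) <= B).
Proof.
move=> hf hF; split=> h.
  apply: (coef_bound hf hF) => r r0 r1; rewrite -lee_fin -(H2normsq_int hf r0 r1).
  by apply: le_trans h; apply: ereal_sup_ubound; exists r => //=; rewrite r0 r1.
apply: ge_ereal_sup => _ [r /= /andP[r0 r1] <-]; rewrite (H2normsq_int hf r0 r1) lee_fin.
exact: (dil_bound hf hF h).
Qed.

Lemma H2normsq_ge0 f : (0 <= H2normsq sigma f)%E.
Proof.
apply: le_trans (ereal_sup_ubound _); last by exists (1 / 2) => //=; apply/andP; split; lra.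
by apply: integral_ge0 => z _; rewrite lee_fin sqr_ge0.
Qed.

Lemma H2normE f : H2 f -> H2normsq sigma f = (H2norm f ^+ 2)%:E.
Proof.
move=> [_ h]; rewrite /H2norm sqr_sqrtr ?fine_ge0 ?H2normsq_ge0 // fineK //.
by rewrite ge0_fin_numE // H2normsq_ge0.
Qed.

Lemma H2_coef f F : H2 f -> expands f F -> forall K, \sum_(k < K) sqn (F k) <= H2norm f ^+ 2.
Proof. by move=> hf hF; apply/(H2_bound _ hf.1 hF); rewrite H2normE. Qed.

Lemma H2_of_coef f F B : analytic f -> expands f F -> (forall K, \sum_(k < K) sqn (F k) <= B) ->
  H2 f /\ H2norm f ^+ 2 <= B.
Proof.
move=> hf hF hB; have h : (H2normsq sigma f <= B%:E)%E by apply/(H2_bound _ hf hF).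
have h2 : H2 f by split=> //; apply: le_lt_trans h (ltry _).
by split=> //; rewrite -lee_fin -H2normE.
Qed.

Lemma H2norm_ge0 f : 0 <= H2norm f. Proof. exact: sqrtr_ge0. Qed.

#[local] Hint Extern 0 (is_true (_ <= H2norm _)) => exact: H2norm_ge0 : core.

(** * The maximal inequality for averages over rotations *)

Section Average.
Variables (m : nat) (w : R[i]) (nu : 'I_m -> R).
Hypotheses (w1 : normc w = 1) (nu0 : forall j, 0 <= nu j) (nu1 : \sum_j nu j = 1).

Definition avg p : Cn R n -> R := fun z => \sum_(j < m) nu j * p (w ^+ j *: z).
Definition cavg u : Cfun R n := fun z => \sum_(j < m) (nu j)%:C * u (w ^+ j *: z).

Lemma wj_rotation (j : nat) : rotation (fun z : Cn R n => w ^+ j *: z).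
Proof. by apply: scale_rotation; rewrite normcX w1 expr1n. Qed.
Lemma avg_rI p : rI p -> rI (avg p).
Proof. by move=> h; apply: rI_sum => j; apply: rI_Z; exact: (rI_rot (wj_rotation j) h). Qed.

Lemma Rint_avg p : rI p -> Rint (avg p) = Rint p.
Proof.
move=> h; rewrite Rint_sum; last by move=> j; apply: rI_Z; exact: (rI_rot (wj_rotation j) h).
transitivity (\sum_j nu j * Rint p); last by rewrite -mulr_suml nu1 mul1r.
apply: eq_bigr => j _; rewrite RintZ; last exact: (rI_rot (wj_rotation j) h).
by rewrite -[in RHS](Rint_rot (wj_rotation j) h).
Qed.

Lemma le_avg p q z : (forall z, p z <= q z) -> avg p z <= avg q z.
Proof. by move=> h; apply: ler_sum => j _; rewrite ler_wpM2l. Qed.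
Lemma avg_ge0 p z : (forall z, 0 <= p z) -> 0 <= avg p z.
Proof. by move=> h; apply: sumr_ge0 => j _; rewrite mulr_ge0. Qed.

Lemma avgD_cst p (a : R) z : avg (fun z => p z + a) z = avg p z + a.
Proof.
rewrite /avg; under eq_bigr do rewrite mulrDr.
by rewrite big_split /= -mulr_suml nu1 mul1r.
Qed.

Lemma normc_cavg u z : normc (cavg u z) <= avg (fun z => normc (u z)) z.
Proof.
apply: normc_sum_le; apply: ler_sum => j _.
by rewrite normcM normcR ger0_norm.
Qed.

(** With T the average, a majorant of 0 and of the partial sums p + T p + ... of at most N terms,
    because T of a maximum dominates the maximum of the images. *)
Fixpoint garsia p N : Cn R n -> R :=
  if N is N'.+1 then fun z => Num.max 0 (p z + avg (garsia p N') z) else fun=> 0.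

Lemma garsia_rI p N : rI p -> rI (garsia p N).
Proof.
move=> hp; elim: N => [|N IH] /=; first exact: rI_cst.
by apply: rI_max; [exact: rI_cst|apply: rI_D => //; exact: avg_rI].
Qed.

Lemma garsia_ge0 p N z : 0 <= garsia p N z.
Proof. by case: N => [|N] //=; rewrite le_max lexx. Qed.

Lemma garsia_mono p N z : garsia p N z <= garsia p N.+1 z.
Proof.
elim: N z => [|N IH] z; first by rewrite /= le_max lexx.
rewrite [leLHS]/= [leRHS]/= ge_max !le_max lexx /= lerD2l (le_avg _ IH) orbT //.
Qed.

(** Garsia's proof of the maximal ergodic lemma. Where g, the majorant, is positive, g <= p + T g by
    monotonicity in N; elsewhere g is 0 <= T g; and T preserves the integral. *)
Lemma garsia_int p N : rI p ->
  0 <= Rint (fun z => \1_[set z | 0 < garsia p N z] z * p z).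
Proof.
move=> hp; case: N => [|N].
  rewrite (_ : (fun z => \1_[set z | 0 < garsia p 0 z] z * p z) = (fun=> 0)) ?Rint_cst //.
  by apply/funext => z; rewrite indicE /= (_ : (z \in _) = false) ?mul0r //; apply/negbTE/negP => /set_mem /=; rewrite ltxx.
set E := [set z | _]; have hg K := garsia_rI K hp.
have mE : measurable (E : set Bo) by apply: rmeas_lt; [exact: rmeas_cst|exact: rI_meas (hg _)].
have hE : rI (fun z => \1_E z * p z).
  apply: (rI_dom (q := fun z => `|p z|)); [by apply: rmeasM; [exact: rmeas_indic|exact: rI_meas hp]|exact: rI_abs|].
  by move=> z; rewrite indicE; case: (z \in E); rewrite ?mul1r // mul0r normr0.
have : Rint (garsia p N.+1) <= Rint (fun z => \1_E z * p z + avg (garsia p N.+1) z).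
  apply: Rint_le => //; first by apply: rI_D => //; exact: avg_rI.
  move=> z; rewrite indicE; have [/set_mem Ez|/negP Ez] := boolP (z \in E).
    have -> : garsia p N.+1 z = p z + avg (garsia p N) z.
      by move: Ez; rewrite /E /= lt_max ltxx /= => h; rewrite max_r // ltW.
    rewrite mul1r lerD2l; apply: le_avg => y; exact: garsia_mono.
  rewrite mul0r add0r; apply: (le_via 0); last by apply: avg_ge0 => y; exact: garsia_ge0.
  by rewrite leNgt; apply/negP => h; apply: Ez; exact/mem_set.
rewrite RintD //; last exact: avg_rI.
by rewrite Rint_avg // -lerBlDr subrr.
Qed.

(** The sum u + T u + ... + T ^ (K - 1) u for the average T, in Horner form. *)
Fixpoint erg u K : Cfun R n := if K is K'.+1 then fun z => u z + cavg (erg u K') z else fun=> 0.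

(** [garsia_int] for p = |u| - a: the subtraction of a at each step becomes the bound K a on the sum
    of K iterates. *)
Lemma maximal_erg u (a : R) N : cI u -> 0 < a -> exists G : set (Cn R n),
  [/\ measurable (G : set Bo), Rint (\1_G) <= Rint (fun z => normc (u z)) / a &
    forall z, ~ G z -> forall K, (K <= N)%N -> normc (erg u K z) <= K%:R * a].
Proof.
move=> hu a0; pose p z := normc (u z) - a; have hn := cI_normc hu.
have hp : rI p by apply: rI_B => //; exact: rI_cst.
pose G := [set z | 0 < garsia p N z]; exists G.
have mG : measurable (G : set Bo).
  by apply: rmeas_lt; [exact: rmeas_cst|exact: rI_meas (garsia_rI N hp)].
have iG : rI (\1_G) by exact: rI_indic.
split=> //.
  have := garsia_int N hp; rewrite -/G => h.
  have hG : rI (fun z => \1_G z * normc (u z)).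
    apply: (rI_dom (q := fun z => normc (u z))) => //; first by apply: rmeasM; [exact: rmeas_indic|exact: rI_meas hn].
    by move=> z; rewrite indicE; case: (z \in G); rewrite ?mul1r ?mul0r ?normr0 ?ger0_norm.
  rewrite ler_pdivlMr // mulrC -RintZ //.
  apply: (le_via (Rint (fun z => \1_G z * normc (u z)))).
    rewrite -subr_ge0 -RintB //; last exact: rI_Z.
    by apply: le_trans h _; apply: eqW; congr Rint; apply/funext => z; rewrite /p; ring.
  by apply: Rint_le => // z; rewrite indicE; case: (z \in G); rewrite ?mul1r ?mul0r.
have key K z : normc (erg u K z) <= garsia p K z + K%:R * a.
  elim: K z => [|K IH] z /=; first by rewrite normc0 mul0r addr0.
  apply: normcD_le.
  have h : normc (cavg (erg u K) z) <= avg (garsia p K) z + K%:R * a.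
    by apply: le_trans (normc_cavg _ _) _; rewrite -avgD_cst; exact: le_avg.
  apply: le_trans (lerD (lexx _) h) _; rewrite -[K.+1%:R]natr1 mulrDl mul1r.
  have : p z + avg (garsia p K) z <= Num.max 0 (p z + avg (garsia p K) z) by rewrite le_max lexx orbT.
  by rewrite /p; move: (avg _ _) (Num.max _ _) => x y; lra.
move=> z Gz K KN; apply: le_trans (key K z) _; rewrite gerDr.
have mono : garsia p K z <= garsia p N z.
  by rewrite -(subnK KN); elim: (N - K)%N => [|j IH] //; rewrite addSn; apply: le_trans IH (garsia_mono _ _ _).
by apply: le_trans mono _; rewrite leNgt; apply/negP.
Qed.

Lemma cavg_hpoly k f rho : \sum_(j < m) (nu j)%:C * w ^+ (j * k) = rho%:C ->
  hpoly k f -> cavg f = fun z => rho%:C * f z.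
Proof.
move=> hr hf; apply/funext => z; rewrite /cavg -hr mulr_suml; apply: eq_bigr => j _.
by rewrite hf.2 -exprM mulrA.
Qed.

Lemma cavg_sum I (r : seq I) (F : I -> Cfun R n) z :
  cavg (fun z => \sum_(i <- r) F i z) z = \sum_(i <- r) cavg (F i) z.
Proof. by rewrite /cavg exchange_big; apply: eq_bigr => j _; rewrite mulr_sumr. Qed.

Lemma erg_psum F d (rho : nat -> R) K :
  (forall k, (k < d)%N -> \sum_(j < m) (nu j)%:C * w ^+ (j * k) = (rho k)%:C) ->
  homs F ->
  forall z, erg (psum F d) K z = \sum_(i < K) \sum_(k < d) (rho k ^+ i)%:C * F k z.
Proof.
move=> hr hF z; elim: K z => [|K IH] z /=; first by rewrite big_ord0.
rewrite big_ord_recl; congr (_ + _).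
  by apply: eq_bigr => k _; rewrite expr0 mul1r.
rewrite exchange_big /=.
have -> : cavg (erg (psum F d) K) z = cavg (fun z => \sum_(k < d) (\sum_(i < K) rho k ^+ i)%:C * F k z) z.
  apply: eq_bigr => j _; rewrite IH exchange_big /=; congr (_ * _); apply: eq_bigr => k _.
  by rewrite rmorph_sum mulr_suml.
rewrite (cavg_sum (index_enum 'I_d)); apply: eq_bigr => k _.
rewrite (cavg_hpoly (hr k (ltn_ord k)) (hpolyZ _ (hF k))) mulrA -rmorphM mulr_sumr rmorph_sum mulr_suml.
by apply: eq_bigr => i _; rewrite -exprS.
Qed.

End Average.

Lemma stein_sum (x : R) N : 0 <= x -> x <= 1 -> (1 - x) ^+ 2 * \sum_(i < N) i.+1%:R * (x ^+ i) ^+ 2 <= 1.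
Proof.
move=> x0 x1; apply: (le_via ((1 - x) ^+ 2 * \sum_(i < N) i.+1%:R * x ^+ i)).
  rewrite ler_wpM2l ?sqr_ge0 //; apply: ler_sum => i _; rewrite ler_wpM2l // expr2 ler_piMl ?exprn_ge0 //.
  by rewrite exprn_ile1.
have -> : (1 - x) ^+ 2 * \sum_(i < N) i.+1%:R * x ^+ i = 1 - x ^+ N * (1 + N%:R * (1 - x)).
  elim: N => [|N IH]; first by rewrite big_ord0 expr0; ring.
  by rewrite big_ord_recr /= mulrDr IH [x ^+ N.+1]exprS -[N.+1%:R]natr1; ring.
by rewrite gerBl mulr_ge0 ?exprn_ge0 // addr_ge0 // mulr_ge0 // subr_ge0.
Qed.

(** Stein's summation by parts. It passes from the Cesaro means of the powers of T to the powers
    themselves; the weighted differences are controlled in L^2 by [stein_sum], since T acts on each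
    component as a number in [0, 1]. *)
Lemma stein_identity (a : nat -> R[i]) N :
  N%:R * a N = \sum_(i < N) a i + \sum_(i < N) i.+1%:R * (a i.+1 - a i).
Proof.
elim: N => [|N IH]; first by rewrite !big_ord0 mul0r addr0.
rewrite !big_ord_recr /= addrACA -IH -[N.+1%:R]natr1; ring.
Qed.

Lemma sum_le_sqr N : (N > 0)%N -> \sum_(i < N) i.+1%:R <= N%:R ^+ 2 :> R.
Proof.
move=> _; elim: N => [|N IH]; first by rewrite big_ord0 sqr_ge0.
rewrite big_ord_recr /=; apply: le_trans (lerD IH (lexx _)) _.
by rewrite -[N.+1%:R]natr1; have : 0 <= N%:R :> R by []; nra.
Qed.

Lemma weighted_CS (b : nat -> R[i]) N :
  normc (\sum_(i < N) i.+1%:R * b i) ^+ 2 <= N%:R ^+ 2 * \sum_(i < N) i.+1%:R * normc (b i) ^+ 2.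
Proof.
case: N => [|N]; first by rewrite !big_ord0 normc0 expr0n mulr0.
have sq (i : nat) : Num.sqrt i.+1%:R * Num.sqrt i.+1%:R = i.+1%:R :> R by rewrite -expr2 sqr_sqrtr.
have h : normc (\sum_(i < N.+1) i.+1%:R * b i) <= \sum_(i < N.+1) Num.sqrt i.+1%:R * (Num.sqrt i.+1%:R * normc (b i)).
  apply: normc_sum_le; apply: ler_sum => i _.
  by rewrite mulrA sq normcM -[i.+1%:R]/(i.+1%:R) -(rmorph_nat (real_complex R)) normcR ger0_norm.
apply: (le_via ((\sum_(i < N.+1) Num.sqrt i.+1%:R * (Num.sqrt i.+1%:R * normc (b i))) ^+ 2)).
  by rewrite lerXn2r ?nnegrE // (le_trans (normc_ge0 _) h).
apply: le_trans (CauchySchwarz_sum _ _) _; apply: ler_pM.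
- by apply: sumr_ge0 => i _; exact: sqr_ge0.
- by apply: sumr_ge0 => i _; exact: sqr_ge0.
- apply: le_trans (sum_le_sqr (ltn0Sn N)); apply: ler_sum => i _; by rewrite expr2 sq.
- by apply: ler_sum => i _; rewrite exprMn expr2 sq.
Qed.

Lemma sigma_indic (A : set (Cn R n)) : measurable (A : set Bo) -> sigma A = (Rint (\1_A))%:E.
Proof. by move=> mA; rewrite -RintE ?integral_indic ?setIT //; exact: rI_indic. Qed.

(** There are two exceptional sets, one for the Cesaro means and one where the square function [g2]
    reaches a^2. Off both, K T^K f is a sum of two terms of modulus at most K a. *)
Lemma maximal_avg F d (a r : R) N m : homs F -> 0 < a -> 0 < r -> r < 1 -> (0 < m)%N -> (d <= m)%N ->
  exists G : set (Cn R n),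
  [/\ measurable (G : set Bo),
    Rint (\1_G) <= l2 (psum F d) / a + sqn (psum F d) / a ^+ 2 &
    forall z, ~ G z -> forall K, (0 < K)%N -> (K <= N)%N ->
      normc (\sum_(k < d) (((r ^+ k + r ^+ (m - k)) / (1 + r ^+ m)) ^+ K)%:C * F k z) <= 2 * a].
Proof.
move=> hF a0 r0 r1 m0 dm; have [w [nu [w1 nu0 hnu]]] := poisson_weights r0 r1 m0.
pose rho k := (r ^+ k + r ^+ (m - k)) / (1 + r ^+ m); set f := psum F d.
have rm0 : 0 < r ^+ m by rewrite exprn_gt0.
have rm1 : 0 < 1 + r ^+ m by rewrite addr_gt0.
have nu1 : \sum_j nu j = 1.
  have := hnu 0%N m0; under eq_bigr do rewrite muln0 expr0 mulr1.
  rewrite expr0 subn0 divff ?gt_eqF // -rmorph_sum => /(congr1 (@Re R)) //.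
have rho0 k : 0 <= rho k by rewrite divr_ge0 ?(ltW rm1) // addr_ge0 // exprn_ge0 // ltW.
have rho1 k : (k < d)%N -> rho k <= 1.
  move=> kd; rewrite ler_pdivrMr // mul1r -subr_ge0.
  have km : (k <= m)%N by rewrite ltnW // (leq_trans kd).
  have E : r ^+ m = r ^+ k * r ^+ (m - k) by rewrite -exprD subnKC.
  have h1 : r ^+ k <= 1 by rewrite exprn_ile1 // ltW.
  have h2 : r ^+ (m - k) <= 1 by rewrite exprn_ile1 // ltW.
  rewrite E; move: (r ^+ k) (r ^+ (m - k)) h1 h2; clear -hs; move=> x y; nra.
have hf : L2 f by apply: psum_L2 _ _ _.
have [G1 [mG1 G1s hG1]] := maximal_erg w1 nu0 nu1 N (L2_cI hf) a0.
pose T i : Cfun R n := fun z => \sum_(k < d) (rho k ^+ i)%:C * F k z.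
pose D i : Cfun R n := fun z => T i.+1 z - T i z.
have DE i : D i = psum (fun k z => (rho k ^+ i * (rho k - 1))%:C * F k z) d.
  apply/funext => z; rewrite /D /T -sumrB; apply: eq_bigr => k _.
  by rewrite -mulrBl -rmorphB exprSr mulrBr mulr1.
have hD i : L2 (D i) by rewrite DE; apply: psum_L2 _ _ _ => k; exact: hpolyZ.
pose g2 z := \sum_(i < N) i.+1%:R * normc (D i z) ^+ 2.
have ig2 : rI g2 by apply: rI_sum => i; apply: rI_Z; exact: L2_rI (hD i).
have g20 z : 0 <= g2 z by apply: sumr_ge0 => i _; rewrite mulr_ge0 // sqr_ge0.
have Eg2 : Rint g2 <= sqn f.
  rewrite /g2 Rint_sum; last by move=> i; apply: rI_Z; exact: L2_rI (hD i).
  under eq_bigr => i _ do rewrite RintZ ?(L2_rI (hD i)) // -/(sqn (D i)) DE.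
  have E (i : 'I_N) : sqn (psum (fun k z => (rho k ^+ i * (rho k - 1))%:C * F k z) d) =
      \sum_(k < d) (rho k ^+ i) ^+ 2 * (1 - rho k) ^+ 2 * sqn (F k).
    rewrite sqn_psum //; last by move=> k; exact: hpolyZ.
    apply: eq_bigr => k _; rewrite sqnZ; last exact: hpoly_L2 (hF k).
    by rewrite normcR real_normK ?num_real // exprMn -[rho k - 1]opprB sqrrN.
  under eq_bigr => i _ do rewrite E mulr_sumr.
  rewrite exchange_big /f sqn_psum //=; apply: ler_sum => k _.
  have -> : \sum_(i < N) i.+1%:R * ((rho k ^+ i) ^+ 2 * (1 - rho k) ^+ 2 * sqn (F k)) =
      (1 - rho k) ^+ 2 * (\sum_(i < N) i.+1%:R * (rho k ^+ i) ^+ 2) * sqn (F k).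
    by rewrite mulr_sumr mulr_suml; apply: eq_bigr => i _; ring.
  rewrite ler_piMl //; apply: stein_sum; [exact: rho0|exact: rho1 (ltn_ord k)].
pose G2 := [set z | a ^+ 2 <= g2 z].
have a20 : 0 < a ^+ 2 by rewrite exprn_gt0.
have mG2 : measurable (G2 : set Bo) by apply: rmeas_le; [exact: rmeas_cst|exact: rI_meas ig2].
have G2s : Rint (\1_G2) <= sqn f / a ^+ 2.
  have := chebyshev ig2 g20 a20; rewrite -/G2 (sigma_indic mG2) lee_fin => h; apply: le_trans h _.
  by rewrite ler_wpM2r // invr_ge0 ltW.
exists (G1 `|` G2); split.
- exact: measurableU.
- apply: (le_via (Rint (fun z => \1_G1 z + \1_G2 z))).
    apply: Rint_le; [by apply: rI_indic; exact: measurableU|by apply: rI_D; exact: rI_indic|].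
    move=> z; rewrite !indicE in_setU; case: (z \in G1); case: (z \in G2) => //=; lra.
  rewrite RintD ?lerD //; try exact: rI_indic.
  by apply: le_trans G1s _; rewrite ler_wpM2r ?invr_ge0 ?(ltW a0) // norm1_le_l2.
move=> z /not_orP[zG1 zG2] K K0 KN; have Kp : 0 < K%:R :> R by rewrite ltr0n.
have e1 : \sum_(i < K) T i z = erg w nu f K z.
  by rewrite (@erg_psum m w nu F d rho) // => k kd; apply: hnu; exact: leq_trans kd dm.
have := stein_identity (fun i => T i z) K; rewrite e1 => e2.
have h1 := hG1 z zG1 K KN.
have h2 : normc (\sum_(i < K) i.+1%:R * D i z) <= K%:R * a.
  rewrite -[_ <= _]ler_sqr ?nnegrE ?mulr_ge0 ?(ltW a0) //.
  apply: le_trans (weighted_CS (fun i => D i z) K) _; rewrite exprMn ler_wpM2l ?sqr_ge0 //.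
  apply: (le_via (g2 z)); last by apply: ltW; rewrite ltNge; apply/negP.
  rewrite /g2 -!(big_mkord xpredT (fun i => i.+1%:R * normc (D i z) ^+ 2)).
  rewrite (@big_cat_nat _ _ _ K 0 N) //= lerDl sumr_ge0 // => i _.
  by rewrite mulr_ge0 // sqr_ge0.
have : normc (K%:R * T K z) <= K%:R * (2 * a).
  rewrite e2; apply: normcD_le; apply: le_trans (lerD h1 h2) _.
  by apply: eqW; ring.
by rewrite normcM -(rmorph_nat (real_complex R)) normcR ger0_norm // ler_pM2l.
Qed.

(** Consecutive powers of r differ by at most 1 - r, so they form a mesh of the radii above r ^
    N. *)
Lemma geometric_mesh (r d : R) N s : 0 < r -> r < 1 -> 1 - r <= d -> (0 < N)%N -> r ^+ N <= s -> s <= 1 ->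
  exists2 K, (0 < K <= N)%N & `|s - r ^+ K| <= d.
Proof.
move=> r0 r1 rd; elim: N => [//|N IH] _ sN s1.
have [N0|N0] := posnP N.
  exists 1%N => //; move: sN; rewrite N0 expr1 => sr; rewrite ger0_norm ?subr_ge0 //.
  by apply: le_trans rd; rewrite lerD2r.
have [rs|rs] := leP (r ^+ N) s.
  by have [K /andP[K0 KN] hK] := IH N0 rs s1; exists K => //; rewrite K0 leqW.
exists N; first by rewrite N0 leqnSn.
rewrite distrC ger0_norm ?subr_ge0 ?(ltW rs) //; apply: le_trans rd.
apply: (le_via (r ^+ N * (1 - r))).
  by rewrite mulrBr mulr1 -exprSr lerD2l lerN2.
by rewrite ler_piMl ?subr_ge0 ?(ltW r1) // exprn_ile1 // ltW.
Qed.

Lemma pow_diff (x y : R) k : 0 <= x -> x <= 1 -> 0 <= y -> y <= 1 -> `|x ^+ k - y ^+ k| <= k%:R * `|x - y|.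
Proof.
move=> x0 x1 y0 y1; elim: k => [|k IH]; first by rewrite !expr0 subrr normr0 mul0r.
have -> : x ^+ k.+1 - y ^+ k.+1 = x * (x ^+ k - y ^+ k) + (x - y) * y ^+ k by rewrite !exprS; ring.
apply: le_trans (ler_normD _ _) _; have -> : k.+1%:R * `|x - y| = k%:R * `|x - y| + `|x - y| by rewrite -[k.+1%:R]natr1 mulrDl mul1r.
rewrite !normrM; apply: lerD.
  by rewrite (ger0_norm x0); apply: le_trans IH; rewrite ler_piMl.
by rewrite (ger0_norm (exprn_ge0 k y0)) ler_piMr // exprn_ile1.
Qed.

Lemma expr_small r e : 0 <= r -> r < 1 -> 0 < e -> exists2 N, (0 < N)%N & r ^+ N <= e.
Proof.
move=> r0 r1 e0; have : (r ^+ k : R^o) @[k --> \oo] --> (0 : R^o) by apply: cvg_expr; rewrite ger0_norm.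
move=> /cvgrPdist_lt/(_ _ e0) [K _ hK]; exists K.+1 => //.
by have := hK K.+1 (leqnSn K); rewrite /= sub0r normrN ger0_norm ?exprn_ge0 // => /ltW.
Qed.

Lemma sphere_bounded p : ispoly p -> exists2 M, 0 <= M & forall z, enorm z = 1 -> normc (p z) <= M.
Proof.
move=> hp; have [M hM] := @ball_bounded R n p 1 (fun z _ => @ispoly_cont R n p hp z).
exists `|M| => // z z1; by apply: le_trans (ler_norm M); apply: hM; rewrite /cballr z1.
Qed.

Lemma hpoly_bounds F : homs F ->
  exists B : nat -> R, forall k, 0 <= B k /\ forall z, enorm z = 1 -> normc (F k z) <= B k.
Proof.
move=> hF; suff /choice[B hB] : forall k, exists B, 0 <= B /\ forall z, enorm z = 1 -> normc (F k z) <= B by exists B.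
by move=> k; have [M M0 hM] := sphere_bounded (hF k).1; exists M.
Qed.

Lemma poisson_multiplier r (d q k : nat) : 0 < r -> r < 1 -> (k < d)%N ->
  let rho := (r ^+ k + r ^+ (d + q - k)) / (1 + r ^+ (d + q)) in
  [/\ 0 <= rho, rho <= 1 & `|rho - r ^+ k| <= r ^+ q].
Proof.
move=> r0 r1 kd rho; have km : (k <= d + q)%N by rewrite ltnW // (leq_trans kd) // leq_addr.
have pw j : 0 <= r ^+ j /\ r ^+ j <= 1 by rewrite exprn_ge0 ?exprn_ile1 // ltW.
have yq : r ^+ (d + q - k) <= r ^+ q by rewrite ler_wiXn2l ?(ltW r0) ?(ltW r1) // -addnBAC ?leq_addl // ltnW.
have E : r ^+ (d + q) = r ^+ k * r ^+ (d + q - k) by rewrite -exprD subnKC.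
have [x0 x1] := pw k; have [y0 y1] := pw (d + q - k)%N; move: x0 x1 y0 y1 yq; rewrite /rho E.
move: (r ^+ k) (r ^+ (d + q - k)) (r ^+ q) => x y t x0 x1 y0 y1 yt.
have xy : 0 <= x * y by rewrite mulr_ge0.
have D0 : 0 < 1 + x * y by rewrite ltr_wpDr.
split; first by rewrite divr_ge0 ?(ltW D0) // addr_ge0.
  by rewrite ler_pdivrMr // mul1r; nra.
have -> : (x + y) / (1 + x * y) - x = y * (1 - x * x) / (1 + x * y) by field; rewrite gt_eqF.
rewrite ger0_norm; last by rewrite divr_ge0 ?(ltW D0) // mulr_ge0 // subr_ge0; nra.
by apply: le_trans yt; rewrite ler_pdivrMr //; nra.
Qed.

(** The K-th power of the average acts nearly as the dilation by r ^ K, and these radii form a mesh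
    of [0, 1]. For one polynomial the mesh and the folding can be made as fine as needed, so the
    radial maximal inequality holds with constants independent of the degree. *)
Lemma maximal_poly F d (a : R) : homs F -> 0 < a ->
  exists G : set (Cn R n),
  [/\ measurable (G : set Bo),
    Rint (\1_G) <= l2 (psum F d) / a + sqn (psum F d) / a ^+ 2 &
    forall z, enorm z = 1 -> ~ G z -> forall s, 0 <= s -> s <= 1 ->
      normc (psum F d (s%:C *: z)) <= 3 * a].
Proof.
move=> hF a0.
have [B hB] := hpoly_bounds hF.
pose C : R := 1 + \sum_(k < d) k.+1%:R * B k.
have C1 : 1 <= C by rewrite lerDl sumr_ge0 // => k _; rewrite mulr_ge0 // (hB k).1.
have C0 : 0 < C by apply: lt_le_trans C1.
(* [C] dominates the change of psum F d (s z) per unit of s, so a mesh of width [de] costs at most a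
   / 2. *)
pose de : R := Num.min (a / (2 * C)) (1 / 2).
have de0 : 0 < de by rewrite lt_min; apply/andP; split; [rewrite divr_gt0 // mulr_gt0|lra].
have de1 : de <= 1 / 2 by rewrite ge_min lexx orbT.
have de2 : de * C <= a / 2.
  apply: (le_via (a / (2 * C) * C)); first by rewrite ler_wpM2r ?(ltW C0) // ge_min lexx.
  by apply: eqW; field; rewrite gt_eqF.
pose r := 1 - de; have [r0 r1] : 0 < r /\ r < 1 by rewrite /r; move: de0 de1; clear -hs; split; lra.
have [N N0 rN] := expr_small (ltW r0) r1 de0.
have Np : 0 < N%:R :> R by rewrite ltr0n.
have e0 : 0 < a / (2 * N%:R * C) by rewrite divr_gt0 // !mulr_gt0.
(* The folding error r ^ q accumulates over at most N powers and is weighted by [C]; it costs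
   another a / 2. *)
have [q q0 rq] := expr_small (ltW r0) r1 e0.
pose m := (d + q)%N; have m0 : (0 < m)%N by rewrite addn_gt0 q0 orbT.
have dm : (d <= m)%N by rewrite leq_addr.
have [G [mG Gs hG]] := maximal_avg N hF a0 r0 r1 m0 dm.
exists G; split=> // z z1 Gz s s0 s1.
have [K /andP[K0 KN] sK] : exists2 K, (0 < K <= N)%N & `|s - r ^+ K| <= de.
  have [rs|rs] := leP (r ^+ N) s.
    by apply: (geometric_mesh r0 r1 _ N0 rs s1); rewrite /r opprB addrC subrK.
  exists N; first by rewrite N0 leqnn.
  rewrite distrC ger0_norm ?subr_ge0 ?(ltW rs) //; apply: le_trans rN.
  by rewrite gerBl.
pose rho k := (r ^+ k + r ^+ (m - k)) / (1 + r ^+ m).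
have pw k : 0 <= r ^+ k /\ r ^+ k <= 1 by rewrite exprn_ge0 ?exprn_ile1 // ltW.
have hz : normc (\sum_(k < d) (rho k ^+ K)%:C * F k z) <= 2 * a by exact: hG.
have -> : psum F d (s%:C *: z) = \sum_(k < d) (rho k ^+ K)%:C * F k z + \sum_(k < d) (s ^+ k - rho k ^+ K)%:C * F k z.
  rewrite -big_split; apply: eq_bigr => k _ /=.
  by rewrite (hF k).2 -mulrDl -rmorphD addrC subrK rmorphXn.
apply: normcD_le; have -> : 3 * a = 2 * a + a by ring.
rewrite lerD //; apply: normc_sum_le.
have rqE : N%:R * r ^+ q * C <= a / 2.
  apply: (le_via (N%:R * (a / (2 * N%:R * C)) * C)); first by rewrite ler_wpM2r ?(ltW C0) // ler_wpM2l.
  by apply: eqW; field; rewrite !gt_eqF.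
apply: (le_via (\sum_(k < d) (de + N%:R * r ^+ q) * (k.+1%:R * B k))).
  apply: ler_sum => k _; rewrite normcM normcR mulrA; apply: ler_pM; rewrite ?normr_ge0 ?(hB k).2 //.
  have -> : s ^+ k - rho k ^+ K = (s ^+ k - (r ^+ K) ^+ k) + ((r ^+ k) ^+ K - rho k ^+ K).
    by rewrite -!exprM [(k * K)%N]mulnC; ring.
  have [rho0 h1 h2] := poisson_multiplier q r0 r1 (ltn_ord k).
  have [p1 p2] := pw k; have [p3 p4] := pw K.
  have a1 := pow_diff k s0 s1 p3 p4; have a2 := pow_diff K p1 p2 rho0 h1.
  have k0 : 0 <= k%:R :> R by []. have q00 := (pw q).1.
  have b1 : k%:R * `|s - r ^+ K| <= k%:R * de by rewrite ler_wpM2l.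
  have b2 : K%:R * `|r ^+ k - rho k| <= N%:R * r ^+ q.
    by apply: ler_pM => //; [rewrite ler_nat|rewrite distrC].
  apply: le_trans (ler_normD _ _) _; apply: le_trans (lerD (le_trans a1 b1) (le_trans a2 b2)) _.
  rewrite -[k.+1%:R]natr1; have n0 : 0 <= N%:R * r ^+ q by rewrite mulr_ge0 // ltW.
  rewrite -subr_ge0; have -> : (de + N%:R * r ^+ q) * (k%:R + 1) - (k%:R * de + N%:R * r ^+ q) = de + N%:R * r ^+ q * k%:R by ring.
  by rewrite addr_ge0 ?(ltW de0) // mulr_ge0.
rewrite -mulr_sumr; apply: (le_via ((de + N%:R * r ^+ q) * C)).
  by rewrite ler_wpM2l ?lerDr // addr_ge0 ?(ltW de0) // mulr_ge0 ?(pw q).1 // ltW.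
by rewrite mulrDl; move: de2 rqE; clear -hs; lra.
Qed.

(** * Existence of radial limits *)

Lemma fatou_sqn (V : nat -> Cfun R n) v B : (forall j, L2 (V j)) ->
  (forall z, V j z @[j --> \oo] ~~> v z) -> (forall j, sqn (V j) <= B) ->
  L2 v /\ sqn v <= B.
Proof.
move=> hV hl hB; have mv : cmeas v by apply: cmeas_lim hl => k; exact: L2_cmeas (hV k).
pose h j z : \bar R := (normc (V j z) ^+ 2)%:E.
have mh j : measurable_fun setT (h j : Bo -> \bar R).
  by apply/measurable_EFinP; exact: rI_meas (L2_rI (hV j)).
have h0 j z : (0 <= h j z)%E by rewrite lee_fin sqr_ge0.
have lim z : limn_einf (fun j => h j z) = (normc (v z) ^+ 2)%:E.
  apply: (cvg_limn_einf_sup _).1; apply: cvg_EFin; first by apply: filterE.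
  have : (normc (V j z) : R^o) @[j --> \oo] --> (normc (v z) : R^o).
    apply/cvgrPdist_lt => e e0; have /cvgcP/(_ e e0) := hl z; apply: filterS => j.
    by apply: le_lt_trans; rewrite normcB; exact: ler_dist_normc.
  by move=> hc; rewrite expr2; exact: (cvgM hc hc).
have le : (\int[sigma]_z (normc (v z) ^+ 2)%:E <= B%:E)%E.
  rewrite (_ : (\int[sigma]_z (normc (v z) ^+ 2)%:E)%E = \int[sigma]_z limn_einf (fun j => h j z))%E; last first.
    by apply: eq_integral => z _; rewrite lim.
  apply: le_trans (@fatou _ Bo R sigma setT measurableT h mh (fun j z _ => h0 j z)) _.
  rewrite limn_einf_lim; apply: lime_le; first exact: is_cvg_einfs.
  apply: filterE => j; apply: (le_via (\int[sigma]_z h j z)%E).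
    by apply: ereal_inf_lbound; exists j => //=.
  by rewrite (RintE (L2_rI (hV j))) lee_fin; exact: hB.
have iv : rI (fun z => normc (v z) ^+ 2).
  by apply: rI_of_le le; [by apply: rmeasX; exact: cmeas_normc|move=> z; exact: sqr_ge0].
by split; [apply/L2P|rewrite -lee_fin -(RintE iv)].
Qed.

Lemma tail_small (a : nat -> R) (A e : R) : (forall k, 0 <= a k) -> (forall K, \sum_(k < K) a k <= A) -> 0 < e ->
  exists N, forall K L, (N <= K)%N -> \sum_(K <= k < L) a k <= e.
Proof.
move=> a0 hA e0; pose S := [set \sum_(k < K) a k | K in setT].
have hS : has_sup S by split; [exists (\sum_(k < 0) a k), 0%N|exists A => _ [K _ <-]].
have [_ [N _ <-] hN] : exists2 y, S y & sup S - e < y by apply: sup_adherent.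
exists N => K L NK; have [LK|KL] := leqP L K; first by rewrite big_geq // ltW.
have h : \sum_(k < L) a k <= sup S by apply: sup_upper_bound => //; exists L.
move: hN h; rewrite -!(big_mkord xpredT a) (@big_cat_nat _ _ _ K 0 L) ?(ltnW KL) //=.
rewrite (@big_cat_nat _ _ _ N 0 K) //=; have : 0 <= \sum_(N <= k < K) a k by apply: sumr_ge0.
lra.
Qed.

Lemma cauchy_rate (x : nat -> R[i]) (C : R) J :
  (forall i j, (J <= j)%N -> (j <= i)%N -> normc (x i - x j) <= C / 2 ^+ j) ->
  exists l, forall j, (J <= j)%N -> normc (x j - l) <= C / 2 ^+ j.
Proof.
move=> h; have [U [UU hU]] := @ultraFilterLemma nat \oo _.
have hb (i : nat) : normc (x (i + J)%N) <= normc (x J) + C / 2 ^+ J.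
  rewrite -(subrK (x J) (x _)) addrC; apply: normcD_le.
  by rewrite lerD2l h // leq_addl.
have [l hl] := @ultra_lim _ _ U UU (fun i => x (i + J)%N) _ hb.
exists l => j Jj; have hl' : (x j - x (i + J)%N) @[i --> U] ~~> (x j - l).
  apply/cvgcP => e e0; have /cvgcP/(_ e e0) := hl; apply: filterS => i.
  have -> : x j - x (i + J)%N - (x j - l) = - (x (i + J)%N - l) by ring.
  by rewrite normcN.
apply: (ulim_le hl'); apply: hU; exists j => // i /= ji; rewrite normcB; apply: h => //.
by rewrite (leq_trans ji) // leq_addr.
Qed.

Lemma half_sum (a b : nat) : (a <= b)%N -> \sum_(a <= i < b) (2 ^+ i)^-1 <= 2 / 2 ^+ a :> R.
Proof.
move=> ab; have E : \sum_(a <= i < b) (2 ^+ i)^-1 = 2 / 2 ^+ a - 2 / 2 ^+ b :> R.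
  rewrite -(subnKC ab); elim: (b - a)%N => [|j IH]; first by rewrite addn0 big_geq // subrr.
  rewrite addnS big_nat_recr ?leq_addr //= IH exprS; field; by rewrite !expf_neq0.
by rewrite E gerBl divr_ge0 // exprn_ge0.
Qed.

(** Cut the series into blocks of square norm at most 16 ^ (- j) and apply [maximal_poly] to block j
    at height 2 ^ (- j). The exceptional sets are summable, so by Borel-Cantelli almost every radius
    meets finitely many of them; on such a radius the series of blocks converges uniformly in s, up
    to s = 1. *)
Lemma fatou_radial f F : H2 f -> expands f F -> exists u : Cfun R n,
  [/\ L2 u,
    (\ae z, (f (r%:C *: z)) @[r --> (1 : R)^'-] ~~> u z) &
    forall K B, (forall L, \sum_(K <= k < L) sqn (F k) <= B) ->
      sqn (fun z => u z - psum F K z) <= B].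
Proof.
move=> hf hF; have hp := hF.1; have hc := H2_coef hf hF.
have s0 k : 0 <= sqn (F k) by exact: sqn_ge0.
have /choice[N hN] : forall j, exists N, forall K L, (N <= K)%N -> \sum_(K <= k < L) sqn (F k) <= (2 ^+ (4 * j))^-1.
  by move=> j; apply: (tail_small s0 hc); rewrite invr_gt0 exprn_gt0.
pose M := fix M j := if j is i.+1 then maxn (M i).+1 (N i.+1) else N 0%N.
have MN j : (N j <= M j)%N by case: j => [|j] //=; exact: leq_maxr.
have MS j : (M j <= M j.+1)%N by rewrite /= leq_max leqnSn.
have Mmono i j : (i <= j)%N -> (M i <= M j)%N.
  by move=> ij; rewrite -(subnKC ij); elim: (j - i)%N => [|q IH]; rewrite ?addn0 // addnS; exact: leq_trans IH (MS _).
have Mj j : (j <= M j)%N by elim: j => [|j IH] //=; rewrite leq_max ltnS IH.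
(* Block j as a family of homogeneous polynomials, as [maximal_poly] requires: the components below
   [M j] are erased. *)
pose H j k : Cfun R n := if (k < M j)%N then (fun=> 0) else F k.
have hH j k : hpoly k (H j k).
  rewrite /H; case: ifP => _ //; split=> [|a z]; [exact: ispoly_cst|by rewrite mulr0].
pose D i j z := psum F (M i) z - psum F (M j) z.
have HE j : psum (H j) (M j.+1) = D j.+1 j.
  apply/funext => z; rewrite /D !psum_nat (@big_cat_nat _ _ _ (M j) 0 (M j.+1)) //=.
  rewrite [X in _ = X - _](@big_cat_nat _ _ _ (M j) 0 (M j.+1)) //= addrAC subrr add0r big_nat_cond big1 ?add0r.
    by rewrite big_nat_cond [RHS]big_nat_cond; apply: eq_bigr => k /andP[/andP[k1 _] _]; rewrite /H ltnNge k1.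
  by move=> k /andP[/andP[_ k1] _]; rewrite /H k1.
have Hs j : sqn (psum (H j) (M j.+1)) <= (2 ^+ (4 * j))^-1.
  by rewrite HE sqn_psumB //; exact: hN.
have p2 (j : nat) : 0 < 2 ^+ j :> R by rewrite exprn_gt0.
have Hl j : l2 (psum (H j) (M j.+1)) <= (2 ^+ (2 * j))^-1.
  rewrite -[_ <= _]ler_sqr ?nnegrE ?invr_ge0 ?(ltW (p2 _)) // l2_sqr; apply: le_trans (Hs j) _.
  by rewrite exprVn -exprM mulnAC.
have /choice[G hG] : forall j, exists G : set (Cn R n),
  [/\ measurable (G : set Bo), Rint (\1_G) <= 4 / 2 ^+ j.+1 &
    forall z, enorm z = 1 -> ~ G z -> forall s, 0 <= s -> s <= 1 ->
      normc (D j.+1 j (s%:C *: z)) <= 3 / 2 ^+ j].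
  move=> j; have aj : 0 < (2 ^+ j)^-1 :> R by rewrite invr_gt0.
  have [G [g1 g2 g3]] := maximal_poly (M j.+1) (hH j) aj; exists G; split=> //.
    apply: le_trans g2 _; rewrite [2 ^+ j.+1]exprS.
    have -> : 4 / (2 * 2 ^+ j) = (2 ^+ j)^-1 + (2 ^+ j)^-1 :> R by field; rewrite gt_eqF.
    apply: lerD; rewrite ler_pdivrMr ?exprn_gt0 //.
      by apply: le_trans (Hl j) _; rewrite -invfM -exprD addnn mul2n.
    apply: le_trans (Hs j) _; rewrite exprVn -invfM -exprM -exprD lef_pV2 ?posrE // ler_eXn2l ?ltr1n //; lia.
  by move=> z z1 Gz s s1 s2; have := g3 z z1 Gz s s1 s2; rewrite HE.
pose Bad := lim_sup_set (G : nat -> set Bo).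
have mG j : measurable (G j : set Bo) by have [] := hG j.
have mBad : measurable (Bad : set Bo).
  by apply: bigcap_measurable => [|k _]; [exists 0%N|apply: bigcup_measurable => j _].
have Bad0 : sigma Bad = 0%E.
  apply: lim_sup_set_cvg0 => //.
  apply: (@le_lt_trans _ _ (\big[+%E/0%R]_(0 <= i <oo) (0 + (4 / (2 ^ i.+1)%:R : R)%:E))%E).
    apply: lee_nneseries => [j _ _|j _]; first exact: measure_ge0.
    rewrite add0e; apply: (le_via (Rint (\1_(G j)))%:E).
      by apply: eqW; exact: sigma_indic.
    by rewrite lee_fin natrX; have [] := hG j.
  apply: le_lt_trans (epsilon_trick xpredT (fun=> lexx _) _) _ => //.
  by rewrite eseries0 // add0e ltry.
pose good z := enorm z = 1 /\ ~ Bad z.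
have mgood : measurable ([set z | good z] : set Bo).
  have -> : [set z | good z] = csphere `&` ~` Bad by [].
  by apply: measurableI; [exact: csphere_meas|exact: measurableC].
have aegood : (\ae z, good z).
  apply: ae_and; first exact: ae_sphere.
  by exists Bad; split=> // z /= /contrapT.
have rate z : good z -> exists J, forall s, 0 <= s -> s <= 1 -> forall i j, (J <= j)%N -> (j <= i)%N ->
    normc (D i j (s%:C *: z)) <= 6 / 2 ^+ j.
  move=> [z1 zB]; have [J hJ] : exists J, forall j, (J <= j)%N -> ~ G j z.
    apply: contrapT => h; apply: zB => J _; apply: contrapT => h'; apply: h; exists J => j Jj Gj.
    by apply: h'; exists j.
  exists J => s s1 s2 i j Jj ji.
  have -> : D i j (s%:C *: z) = \sum_(j <= q < i) D q.+1 q (s%:C *: z) by rewrite /D telescope_sumr.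
  rewrite big_nat_cond; apply: normc_sum_le.
  apply: (le_via (\sum_(j <= q < i) 3 / 2 ^+ q)).
    rewrite [leRHS]big_nat_cond; apply: ler_sum => q /andP[/andP[jq _] _].
    by have [_ _ hq] := hG q; apply: hq => //; apply: hJ; exact: leq_trans jq.
  by rewrite -mulr_sumr; have := half_sum ji; lra.
have /choice[u hu] : forall z, exists l, good z -> exists J, forall j, (J <= j)%N -> normc (psum F (M j) z - l) <= 6 / 2 ^+ j.
  move=> z; have [gz|gz] := pselect (good z); last by exists 0.
  have [J hJ] := rate z gz; have [i j Jj ji|l hl] := @cauchy_rate (fun j => psum F (M j) z) 6 J.
    by have := hJ 1 ler01 (lexx 1) i j Jj ji; rewrite /D scale1r.
  by exists l => _; exists J.
(* Off the good set the chosen u is arbitrary; multiplying by the indicator makes it a pointwise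
   limit of measurable functions everywhere. *)
pose ind z : R[i] := (\1_[set z | good z] z)%:C.
have ind1 z : good z -> ind z = 1 by move=> gz; rewrite /ind indicE (_ : z \in _) //; exact/mem_set.
have ind0 z : ~ good z -> ind z = 0.
  by move=> gz; rewrite /ind indicE (_ : (z \in _) = false) //; apply/negbTE/negP => /set_mem.
have indn z : normc (ind z) <= 1.
  by have [/ind1 ->|/ind0 ->] := pselect (good z); rewrite ?normc1 ?normc0.
have mind : cmeas ind by apply: cmeas_real; exact: rmeas_indic.
have half_small e : 0 < e -> exists J, forall j, (J <= j)%N -> 6 / 2 ^+ j < e.
  move=> e0; have [J _ hJ] := @expr_small (1 / 2) (e / 12) ltac:(lra) ltac:(lra) ltac:(lra).
  exists J => j Jj; have : (1 / 2) ^+ j <= (1 / 2) ^+ J :> R by rewrite ler_wiXn2l //; lra.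
  rewrite div1r exprVn in hJ *; lra.
have psumcv z : good z -> (psum F (M j) z) @[j --> \oo] ~~> u z.
  move=> gz; have [J hJ] := hu z gz; apply/cvgcP => e e0; have [J' hJ'] := half_small e e0.
  exists (maxn J J') => // j /=; rewrite geq_max => /andP[j1 j2].
  by apply: le_lt_trans (hJ j j1) (hJ' j j2).
pose v : Cfun R n := fun z => ind z * u z.
have aev : (\ae z, v z = u z).
  by apply: ae_mono aegood => z gz; rewrite /v ind1 // mul1r.
have LV K i : L2 (fun z => ind z * (psum F i z - psum F K z)).
  by apply: (L2M_bnd mind (L2B (psum_L2 i hp) (psum_L2 K hp))); exact: ae_all.
have key K B : (forall L, \sum_(K <= k < L) sqn (F k) <= B) ->
    L2 (fun z => ind z * (u z - psum F K z)) /\ sqn (fun z => ind z * (u z - psum F K z)) <= B.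
  move=> hB; apply: (@fatou_sqn (fun j z => ind z * (psum F (M (j + K)) z - psum F K z))) => //.
    move=> z; have [gz|gz] := pselect (good z); last first.
      by rewrite ind0 // mul0r; under eq_fun do rewrite mul0r; exact: cvgc_cst.
    apply: cvgcM; first exact: cvgc_cst.
    apply/cvgcP => e e0; have /cvgcP/(_ e e0) [J _ hJ] := psumcv z gz.
    exists J => // j /= Jj; rewrite opprB addrA subrK; apply: hJ => /=; exact: leq_trans Jj (leq_addr _ _).
  move=> j; rewrite (@sqn_ae _ (fun z => psum F (M (j + K)) z - psum F K z)); last first.
    by apply: ae_mono aegood => z gz; rewrite ind1 // mul1r.
  rewrite sqn_psumB //; exact: leq_trans (leq_addl j K) (Mj _).
exists v; split.
- have hB L : \sum_(0 <= k < L) sqn (F k) <= H2norm f ^+ 2 by rewrite big_mkord.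
  have [h1 _] := key 0%N _ hB.
  have -> : v = (fun z => ind z * (u z - psum F 0 z)) => //.
  by apply/funext => z; rewrite /v /psum big_ord0 subr0.
- apply: ae_mono aegood => z gz; rewrite /v ind1 // mul1r.
  have [J1 hJ1] := rate z gz; have [J2 hJ2] := hu z gz.
  apply/cvgcP => e e0; have [J3 hJ3] := half_small (e / 3) ltac:(lra).
  pose j := maxn J1 (maxn J2 J3).
  have [j1 [j2 j3]] : (J1 <= j)%N /\ (J2 <= j)%N /\ (J3 <= j)%N by rewrite /j; lia.
  have z1 : enorm z = 1 by case: gz.
  have /contP/(_ (e / 3) ltac:(lra)) [d d0 hd] := @ispoly_cont R n _ (psum_poly (M j) hp) z.
  have nb : \forall r \near (1 : R)^'-, (0 < r /\ 1 - d < r) /\ r < 1.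
    near=> r; split; last by near: r; exact: nbhs_left_lt.
    by split; near: r; apply: nbhs_left_gt; rewrite ?ltr01 // ltrBlDr ltrDl.
  apply: filterS nb => r [[r0 rd] r1].
  have rz : enorm (r%:C *: z) < 1 by rewrite enormZR ?(ltW r0) // z1 mulr1.
  have a1 : normc (f (r%:C *: z) - psum F (M j) (r%:C *: z)) <= 6 / 2 ^+ j.
    have hl : D i j (r%:C *: z) @[i --> \oo] ~~> (f (r%:C *: z) - psum F (M j) (r%:C *: z)).
      apply/cvgcP => e' e'0; have /cvgcP/(_ e' e'0) [K0 _ hK0] := expands_psum hF rz.
      by exists K0 => // i /= iK; rewrite /D opprB addrA subrK; apply: hK0; exact: leq_trans iK (Mj i).
    apply: (ulim_le hl); exists j => // i /= ji; apply: hJ1 => //; exact: ltW.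
  have a2 : normc (psum F (M j) (r%:C *: z) - psum F (M j) z) < e / 3.
    apply: hd; have -> : r%:C *: z - z = (r - 1)%:C *: z by rewrite rmorphB scalerBl scale1r.
    by rewrite enormZ z1 mulr1 normcR distrC gtr0_norm ?subr_gt0 // ltrBlDr addrC -ltrBlDr.
  have a3 := hJ2 j j2; have a4 := hJ3 j j3.
  have -> : f (r%:C *: z) - u z = (f (r%:C *: z) - psum F (M j) (r%:C *: z)) + (psum F (M j) (r%:C *: z) - psum F (M j) z) + (psum F (M j) z - u z) by ring.
  apply: normcD_lt; apply: le_lt_trans (lerD (le_normcD _ _) (lexx _)) _.
  by move: a1 a2 a3 a4; clear -hs; lra.
move=> K B hB; have [h1 h2] := key K B hB; apply: le_trans h2; apply: eqW.
by apply: sqn_ae; apply: ae_mono aegood => z gz; rewrite /v ind1 // !mul1r.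
Unshelve. all: by end_near. Qed.

(** * The Hardy space and its boundary functions *)

(* [bdry f] need not be measurable as a function on C^n; this representative is. *)
Definition bdfun f : Cfun R n :=
  xget (fun=> 0) [set u | L2 u /\ (\ae z, (f (r%:C *: z)) @[r --> (1 : R)^'-] ~~> u z)].
Local Notation bd := bdfun.

Definition radlim f (z : Cn R n) (l : R[i]) := (f (r%:C *: z)) @[r --> (1 : R)^'-] ~~> l.

Lemma radlim_uniq f z l l' : radlim f z l -> radlim f z l' -> l = l'.
Proof. exact: cvgc_unique. Qed.
Lemma radlimM f g z l l' : radlim f z l -> radlim g z l' -> radlim (fun z => f z * g z) z (l * l').
Proof. exact: (@cvgcM _ _ _ _ (fun r => f (r%:C *: z)) (fun r => g (r%:C *: z)) l l'). Qed.
Lemma bdryE f z l : radlim f z l -> bdry f z = l.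
Proof. by move=> h; apply: cvg_lim h; exact: norm_hausdorff. Qed.

Lemma H2_analytic f : H2 f -> analytic f. Proof. by case. Qed.

Lemma H2_out f z : H2 f -> ~ cball z -> f z = 0. Proof. by case=> [[_ h] _] /h. Qed.

Lemma H2_expands f : H2 f -> exists F, expands f F.
Proof. by move=> h; exact: (analytic_expands h.1). Qed.

Lemma bdP f : H2 f -> L2 (bd f) /\ (\ae z, radlim f z (bd f z)).
Proof.
move=> hf; have [F hF] := H2_expands hf; have [u [u1 u2 _]] := fatou_radial hf hF.
exact: (@xgetPex _ (fun=> 0) [set u | L2 u /\ (\ae z, (f (r%:C *: z)) @[r --> (1 : R)^'-] ~~> u z)] (ex_intro _ u (conj u1 u2))).
Qed.

Lemma bd_L2 f : H2 f -> L2 (bd f). Proof. by move=> /bdP[]. Qed.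
Lemma bd_radlim f : H2 f -> (\ae z, radlim f z (bd f z)).
Proof. by move=> /bdP[]. Qed.
Lemma bd_bdry f : H2 f -> (\ae z, bdry f z = bd f z).
Proof. by move=> /bd_radlim; apply: ae_mono => z; exact: bdryE. Qed.

Lemma bd_tail f F K B : H2 f -> expands f F ->
  (forall L, \sum_(K <= k < L) sqn (F k) <= B) -> sqn (fun z => bd f z - psum F K z) <= B.
Proof.
move=> hf hF hB; have [u [u1 u2 u3]] := fatou_radial hf hF; apply: le_trans (u3 K B hB).
apply: eqW; apply: sqn_ae.
by apply: ae_mono (ae_and u2 (bd_radlim hf)) => z [h1 h2]; rewrite (radlim_uniq h1 h2).
Qed.

Lemma bd_approx f F e : H2 f -> expands f F -> 0 < e ->
  exists K0, forall K, (K0 <= K)%N -> l2 (fun z => bd f z - psum F K z) <= e.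
Proof.
move=> hf hF e0; have e2 : 0 < e ^+ 2 by rewrite exprn_gt0.
have [N hN] := tail_small (fun k => sqn_ge0 (F k)) (H2_coef hf hF) e2.
exists N => K NK; rewrite -[_ <= _]ler_sqr ?nnegrE ?(ltW e0) // l2_sqr.
by apply: bd_tail hf hF _ => L; exact: hN.
Qed.

Lemma bd_of_radlim f u : H2 f -> (\ae z, radlim f z (u z)) ->
  (\ae z, bd f z = u z).
Proof.
by move=> hf hu; apply: ae_mono (ae_and hu (bd_radlim hf)) => z [h1 h2]; rewrite (radlim_uniq h1 h2).
Qed.

Lemma expandsD f g F G : expands f F -> expands g G ->
  expands (fun z => f z + g z) (fun k z => F k z + G k z).
Proof.
move=> [hF rF] [hG rG]; split=> [k|r r0 r1].
  split=> [|a z]; first exact: ispolyD (hF k).1 (hG k).1.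
  by rewrite (hF k).2 (hG k).2 mulrDr.
have [M M0 [M1 M2]] := rF r r0 r1; have [N N0 [N1 N2]] := rG r r0 r1.
exists (M + N); first exact: addr_ge0.
split=> [k z|z K zr].
  rewrite mulrDl; apply: le_trans (lerD (M1 k z) (N1 k z)); rewrite -mulrDl ler_wpM2r ?exprn_ge0 ?(ltW r0) //.
  exact: le_normcD.
rewrite big_split /= opprD addrACA !mulrDl; apply: normcD_le.
exact: (lerD (M2 z K zr) (N2 z K zr)).
Qed.

Lemma expandsZ a f F : expands f F -> expands (fun z => a * f z) (fun k z => a * F k z).
Proof.
move=> [hF rF]; split=> [k|r r0 r1]; first exact: hpolyZ.
have [M M0 [M1 M2]] := rF r r0 r1; exists (normc a * M); first by rewrite mulr_ge0.
split=> [k z|z K zr]; first by rewrite normcM -!mulrA ler_wpM2l // M1.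
by rewrite -mulr_sumr -mulrBr normcM -!mulrA ler_wpM2l // mulrA M2.
Qed.

Lemma H2Z a f : H2 f -> H2 (fun z => a * f z).
Proof.
move=> hf; have [F hF] := H2_expands hf.
have [|h _] := H2_of_coef (analyticZ a hf.1) (expandsZ a hF) (B := normc a ^+ 2 * H2norm f ^+ 2) => //.
move=> K; have E k : sqn (fun z => a * F k z) = normc a ^+ 2 * sqn (F k).
  by rewrite sqnZ //; exact: (hpoly_L2 (hF.1 k)).
under eq_bigr => k _ do rewrite E.
by rewrite -mulr_sumr ler_wpM2l ?sqr_ge0 // (H2_coef hf hF).
Qed.

Lemma H2D f g : H2 f -> H2 g -> H2 (fun z => f z + g z).
Proof.
move=> hf hg; have [F hF] := H2_expands hf; have [G hG] := H2_expands hg.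
have [|h _] := H2_of_coef (analyticD hf.1 hg.1) (expandsD hF hG) (B := 2 * H2norm f ^+ 2 + 2 * H2norm g ^+ 2) => //.
move=> K; apply: (le_via (\sum_(k < K) (2 * sqn (F k) + 2 * sqn (G k)))).
  apply: ler_sum => k _; have LF := hpoly_L2 (hF.1 k); have LG := hpoly_L2 (hG.1 k).
  have := sqn_ge0 (fun z => F k z - G k z); rewrite sqnB // sqnD //; lra.
rewrite big_split /= -!mulr_sumr; apply: lerD; rewrite ler_wpM2l //.
  exact: (H2_coef hf hF).
exact: (H2_coef hg hG).
Qed.

Lemma H2N f : H2 f -> H2 (fun z => - f z).
Proof. by move=> h; have := H2Z (-1) h; under eq_fun do rewrite mulN1r. Qed.
Lemma H2B f g : H2 f -> H2 g -> H2 (fun z => f z - g z).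
Proof. by move=> hf hg; exact: (H2D hf (H2N hg)). Qed.

Lemma bdD f g : H2 f -> H2 g ->
  (\ae z, bd (fun z => f z + g z) z = bd f z + bd g z).
Proof.
move=> hf hg; apply: bd_of_radlim; first exact: H2D.
by apply: ae_mono (ae_and (bd_radlim hf) (bd_radlim hg)) => z [h1 h2]; exact: (cvgcD h1 h2).
Qed.

Lemma bdZ a f : H2 f -> (\ae z, bd (fun z => a * f z) z = a * bd f z).
Proof.
move=> hf; apply: bd_of_radlim; first exact: H2Z.
apply: ae_mono (bd_radlim hf) => z h1.
exact: (@radlimM (fun=> a) f z a _ (@cvgc_cst _ _ _ _ a) h1).
Qed.

Lemma bdB f g : H2 f -> H2 g ->
  (\ae z, bd (fun z => f z - g z) z = bd f z - bd g z).
Proof.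
move=> hf hg; have hN := H2Z (-1) hg.
have -> : (fun z => f z - g z) = (fun z => f z + -1 * g z) by apply/funext => z; rewrite mulN1r.
by apply: ae_mono (ae_and (bdD hf hN) (bdZ (-1) hg)) => z [-> ->]; rewrite mulN1r.
Qed.

(** The truncations converge to [bd f] in L^2, and their square norms are the partial sums that
    determine the norm of f. *)
Lemma H2norm_bd f : H2 f -> H2norm f = l2 (bd f).
Proof.
move=> hf; have [F hF] := H2_expands hf; apply/eqP; rewrite -(@eqrXn2 _ 2) //.
rewrite l2_sqr eq_le; apply/andP; split.
  rewrite -lee_fin -H2normE //; apply/(H2_bound _ hf.1 hF) => K.
  rewrite -sqn_psum; [|exact: hF.1]; rewrite -!l2_sqr lerXn2r ?nnegrE //.
  apply/ler_addgt0Pr => e e0; have [K0 hK] := bd_approx hf hF e0.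
  pose L := maxn K0 K; apply: (le_via (l2 (psum F L))).
    rewrite /l2 ler_wsqrtr // !sqn_psum ?hF.1 //; try exact: hF.1.
    rewrite -!(big_mkord xpredT (fun k => sqn (F k))).
    by rewrite (@big_cat_nat _ _ _ K 0 L) ?leq_maxr //= lerDl sumr_ge0 // => k _; exact: sqn_ge0.
  apply: l2_sub_le; [exact: (psum_L2 _ hF.1)|exact: bd_L2|].
  by rewrite l2_distC; apply: hK; exact: leq_maxl.
have := @bd_tail f F 0 (H2norm f ^+ 2) hf hF.
have -> : (fun z => bd f z - psum F 0 z) = bd f by apply/funext => z; rewrite /psum big_ord0 subr0.
by apply => L; rewrite big_mkord; exact: H2_coef.
Qed.

Lemma H2dotE f g : H2 f -> H2 g -> H2dot f g = L2dot (bd f) (bd g).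
Proof. by move=> hf hg; apply: dot_ae; exact: bd_bdry. Qed.

Lemma bd_dot_hpoly f F k p : H2 f -> expands f F -> hpoly k p ->
  L2dot (bd f) p = L2dot (F k) p.
Proof.
move=> hf hF hp; have Lp := hpoly_L2 hp; apply/eqP; rewrite -subr_eq0 -normc_eq0 eq_le normc_ge0 andbT.
apply/ler_addgt0Pr => e e0; rewrite add0r.
have e1 : 0 < e / (l2 p + 1) by rewrite divr_gt0 // ltr_wpDl // l2_ge0.
have [K0 hK] := bd_approx hf hF e1; pose L := maxn K0 k.+1.
have -> : L2dot (F k) p = L2dot (psum F L) p.
  rewrite psum_nat dot_suml //; last by move=> j; exact: (hpoly_L2 (hF.1 j)).
  rewrite (bigD1_seq k) /= ?iota_uniq ?mem_index_iota ?leq_maxr //.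
  by rewrite big1 ?addr0 // => j /eqP jk; exact: (hpoly_orth (hF.1 j) hp jk).
have LL := psum_L2 L hF.1; rewrite -dotBl //; last exact: bd_L2.
apply: le_trans (CS_l2 (L2B (bd_L2 hf) LL) Lp) _.
apply: le_trans (ler_wpM2r (l2_ge0 _) (hK L (leq_maxl _ _))) _.
by rewrite mulrAC ler_pdivrMr ?ltr_wpDl // ler_pM2l // lerDl.
Qed.

Lemma coef_l2_le f F k : H2 f -> expands f F -> l2 (F k) <= H2norm f.
Proof.
move=> hf hF; rewrite -[_ <= _]ler_sqr ?nnegrE // l2_sqr.
apply: le_trans (H2_coef hf hF k.+1); rewrite big_ord_recr /= lerDr.
by apply: sumr_ge0 => j _; exact: sqn_ge0.
Qed.

Lemma geo_le s K : 0 < s -> s < 1 -> \sum_(k < K) s ^+ k <= (1 - s)^-1.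
Proof.
move=> s0 s1; rewrite -[(1 - s)^-1]mul1r ler_pdivlMr ?subr_gt0 // mulrC.
have := subrX1 s K; rewrite -opprB -[s - 1]opprB mulNr => /oppr_inj <-.
by rewrite gerBl exprn_ge0 // ltW.
Qed.

(** The constants depend on r alone and the tail only on a bound of the coefficients, so a bounded
    family in H^2 can be truncated at one index. *)
Lemma psum_tail r : r < 1 -> exists (C s : R), [/\ 0 <= C, 0 < s, s < 1 &
  forall F B K L z, homs F -> (forall k, l2 (F k) <= B) -> enorm z <= r ->
    (K <= L)%N -> normc (psum F L z - psum F K z) <= C * B * s ^+ K].
Proof.
move=> r1; have [M [s [M0 s0 s1 hM]]] := hpoly_eval r1.
exists (M / (1 - s)), s; split=> //; first by rewrite divr_ge0 // subr_ge0 ltW.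
move=> F B K L z hF hB zr KL.
have B0 : 0 <= B by apply: le_trans (l2_ge0 (F 0%N)) (hB 0%N).
have := congr1 (@^~ z) (psumB F KL) => /= ->.
apply: normc_sum_le.
apply: (le_via (\sum_(K <= k < L) M * B * s ^+ k)).
  apply: ler_sum => k _; apply: le_trans (hM k (F k) z (hF k) zr) _.
  by rewrite mulrAC ler_wpM2r ?exprn_ge0 ?(ltW s0) // ler_wpM2l.
rewrite -mulr_sumr -{1}[K]add0n big_addn big_mkord.
under eq_bigr do rewrite exprD; rewrite -mulr_suml.
have -> : M / (1 - s) * B * s ^+ K = M * B * ((1 - s)^-1 * s ^+ K) by ring.
by rewrite ler_wpM2l ?mulr_ge0 // ler_wpM2r ?exprn_ge0 ?(ltW s0) // geo_le.
Qed.

Lemma expands_tail r : r < 1 -> exists (C s : R), [/\ 0 <= C, 0 < s, s < 1 &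
  forall f F B K z, expands f F -> (forall k, l2 (F k) <= B) -> enorm z <= r ->
    normc (f z - psum F K z) <= C * B * s ^+ K].
Proof.
move=> r1; have [C [s [C0 s0 s1 hC]]] := psum_tail r1; exists C, s; split=> // f F B K z hF hB zr.
have zb : cball z by exact: (le_lt_trans zr r1).
have hl : (psum F L z - psum F K z) @[L --> \oo] ~~> (f z - psum F K z).
  apply/cvgcP => e e0; have /cvgcP/(_ e e0) := expands_psum hF zb.
  by apply: filterS => L; rewrite opprB addrA subrK.
by apply: (ulim_le hl); exists K => // L /= KL; apply: hC => //; exact: hF.1.
Qed.

Lemma H2_eval r : r < 1 -> exists2 C : R, 0 <= C & forall f z, H2 f -> enorm z <= r ->
  normc (f z) <= C * H2norm f.
Proof.
move=> r1; have [C [s [C0 s0 s1 hC]]] := expands_tail r1; exists C => // f z hf zr.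
have [F hF] := H2_expands hf; have := hC f F _ 0%N z hF (fun k => coef_l2_le k hf hF) zr.
by rewrite expr0 mulr1 /psum big_ord0 subr0.
Qed.

Lemma H2_eq0 f : H2 f -> H2norm f = 0 -> f = fun=> 0.
Proof.
move=> hf h0; apply/funext => z; have [zb|zb] := pselect (cball z); last exact: hf.1.2.
have [C _ hC] := H2_eval zb; have := hC f z hf (lexx _); rewrite h0 mulr0 => h.
by apply/eqP; rewrite -normc_eq0 eq_le h normc_ge0.
Qed.

Lemma H2_ext f g : H2 f -> H2 g -> (\ae z, bd f z = bd g z) -> f = g.
Proof.
move=> hf hg fg; have hB := H2B hf hg; have : H2norm (fun z => f z - g z) = 0.
  rewrite H2norm_bd // /l2 (@sqn_ae _ (fun=> 0)); last first.
    by apply: ae_mono (ae_and fg (bdB hf hg)) => z [-> ->]; rewrite subrr.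
  by rewrite /sqn; under eq_fun do rewrite normc0 expr0n; rewrite Rint_cst sqrtr0.
move=> /(H2_eq0 hB) h; apply/funext => z; have := congr1 (@^~ z) h => /= /eqP.
by rewrite subr_eq0 => /eqP.
Qed.

Lemma schur_le f z : schur_class f -> normc (f z) <= 1.
Proof.
move=> [[hf _] h]; have [zb|zb] := pselect (cball z); last by rewrite hf.2 // normc0.
by rewrite -lee_fin; apply: le_trans h; apply: ereal_sup_ubound; exists z.
Qed.

Lemma schurP f : analytic f -> (forall z, cball z -> normc (f z) <= 1) -> schur_class f.
Proof.
move=> hf h; have hle : (supnorm f <= 1%:E)%E by apply: ge_ereal_sup => _ [z zb <-]; rewrite lee_fin h.
by split=> //; split=> //; apply: le_lt_trans hle (ltry _).
Qed.

Lemma HinftyP phi : Hinfty phi -> exists2 M, 0 <= M & forall z, normc (phi z) <= M.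
Proof.
move=> [hf h]; have c0 : cball (0 : Cn R n) by rewrite /cball /= enorm0.
have s0 : (0 <= supnorm phi)%E.
  by apply: le_trans (ereal_sup_ubound _); last (by exists 0); rewrite lee_fin normc_ge0.
have sE : (fine (supnorm phi))%:E = supnorm phi by rewrite fineK // ge0_fin_numE.
exists (fine (supnorm phi)); first by rewrite fine_ge0.
move=> z; have [zb|zb] := pselect (cball z); last by rewrite hf.2 // normc0 fine_ge0.
by rewrite -lee_fin sE; apply: ereal_sup_ubound; exists z.
Qed.

Lemma H2_of_dil f B : analytic f -> (forall r, 0 < r -> r < 1 -> sqn (dil r f) <= B) ->
  H2 f /\ H2norm f ^+ 2 <= B.
Proof.
move=> hf hB; have [F hF] := analytic_expands hf; apply: (H2_of_coef hf hF).
exact: (coef_bound hf hF hB).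
Qed.

Lemma H2_dil f r : H2 f -> 0 < r -> r < 1 -> sqn (dil r f) <= H2norm f ^+ 2.
Proof.
move=> hf r0 r1; have [F hF] := H2_expands hf.
exact: (dil_bound hf.1 hF (H2_coef hf hF) r0 r1).
Qed.

Lemma H2M phi f M : analytic phi -> (forall z, normc (phi z) <= M) -> H2 f ->
  H2 (fun z => phi z * f z) /\ H2norm (fun z => phi z * f z) <= M * H2norm f.
Proof.
move=> hphi hM hf; have M0 : 0 <= M by apply: le_trans (hM 0); exact: normc_ge0.
have ha : analytic (fun z => phi z * f z) by apply: analyticM; [exact: analytic_polyapprox|exact: hf.1].
have [|h1 h2] := @H2_of_dil _ (M ^+ 2 * H2norm f ^+ 2) ha.
  move=> r r0 r1; apply: (le_via (M ^+ 2 * sqn (dil r f))); last first.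
    by rewrite ler_wpM2l ?sqr_ge0 // H2_dil.
  have i1 := L2_rI (dil_L2 r0 r1 ha); have i2 := L2_rI (dil_L2 r0 r1 hf.1).
  rewrite /sqn -RintZ //; apply: Rint_le => //; first exact: rI_Z.
  move=> z; rewrite /dil normcM exprMn ler_wpM2r ?sqr_ge0 // lerXn2r ?nnegrE //.
split=> //; rewrite -[_ <= _]ler_sqr ?nnegrE ?mulr_ge0 // exprMn //.
Qed.

Lemma one_H2 : H2 one_ball.
Proof.
have [|h _] := @H2_of_dil one_ball 1 (@analytic_one R n) => //.
move=> r r0 r1; have i1 := L2_rI (dil_L2 r0 r1 (@analytic_one R n)).
rewrite /sqn -[leRHS]Rint_cst; apply: Rint_le => //; first exact: rI_cst.
move=> z; rewrite /dil one_ballE /cut; case: ifP => _; rewrite ?normc0 ?normc1 ?expr0n ?expr1n //.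
Qed.

Lemma Hinfty_H2 phi M : analytic phi -> (forall z, normc (phi z) <= M) -> H2 phi.
Proof.
move=> h1 h2; have [h _] := H2M h1 h2 one_H2.
have -> : phi = (fun z => phi z * one_ball z) => //.
apply/funext => z; rewrite one_ballE /cut; case: ifPn => [_|/negP zb]; first by rewrite mulr1.
by rewrite mulr0 h1.2.
Qed.

Lemma schur_H2 phi : schur_class phi -> H2 phi.
Proof. by move=> h; apply: (Hinfty_H2 h.1.1) => z; exact: schur_le. Qed.

Lemma bdM phi f M : analytic phi -> (forall z, normc (phi z) <= M) -> H2 f ->
  (\ae z, bd (fun z => phi z * f z) z = bd phi z * bd f z).
Proof.
move=> h1 h2 hf; have [hM _] := H2M h1 h2 hf; apply: bd_of_radlim => //.
by apply: ae_mono (ae_and (bd_radlim (Hinfty_H2 h1 h2)) (bd_radlim hf)) => z [a b]; exact: (radlimM a b).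
Qed.

Lemma bd_le phi M : analytic phi -> (forall z, normc (phi z) <= M) ->
  (\ae z, normc (bd phi z) <= M).
Proof.
move=> h1 h2; apply: ae_mono (bd_radlim (Hinfty_H2 h1 h2)) => z h.
by apply: (ulim_le h); apply: filterE => r; exact: h2.
Qed.

Lemma bd_cont f u : H2 f -> (forall z, enorm z = 1 -> radlim f z (u z)) ->
  (\ae z, bd f z = u z).
Proof. by move=> hf h; apply: bd_of_radlim => //; apply: ae_mono ae_sphere => z; exact: h. Qed.

Lemma radlim_eq f g z l : enorm z = 1 -> (forall w, cball w -> f w = g w) -> radlim g z l -> radlim f z l.
Proof.
move=> z1 fg /cvgcP h; apply/cvgcP => e e0.
have hr : \forall r \near (1 : R)^'-, 0 < r /\ r < 1.
  by near=> r; split; near: r; [apply: nbhs_left_gt; exact: ltr01|exact: nbhs_left_lt].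
apply: filterS2 hr (h e e0) => r [r0 r1]; rewrite fg // /cball /= enormZR ?(ltW r0) // z1 mulr1.
exact: r1.
Unshelve. all: by end_near. Qed.

Lemma poly_radlim p z : ispoly p -> radlim p z (p z).
Proof.
move=> hp; apply/cvgcP => e e0; have /contP/(_ e e0)[d d0 hd] := @ispoly_cont R n p hp z.
have h1 : 0 < enorm z + 1 by rewrite ltr_wpDl // enorm_ge0.
have hr : \forall r \near (1 : R)^'-, 1 - d / (enorm z + 1) < r /\ r < 1.
  near=> r; split; near: r; last exact: nbhs_left_lt.
  by apply: nbhs_left_gt; rewrite ltrBlDr ltrDl divr_gt0.
apply: filterS hr => r [r0 r1]; apply: hd.
have -> : r%:C *: z - z = (r - 1)%:C *: z by rewrite rmorphB scalerBl scale1r.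
rewrite enormZ normcR distrC gtr0_norm ?subr_gt0 //.
move: r0; rewrite ltrBlDr addrC -ltrBlDr ltr_pdivlMr //; apply: le_lt_trans.
by rewrite ler_wpM2l ?subr_ge0 ?(ltW r1) // lerDl.
Unshelve. all: by end_near. Qed.

Lemma cut_poly_H2 p : ispoly p -> H2 (cut p).
Proof.
move=> hp; have [M hM] := @ball_bounded R n p 1 (fun z _ => @ispoly_cont R n p hp z).
apply: (@Hinfty_H2 _ `|M|); first exact/cut_analytic/polyapprox_poly.
move=> z; rewrite /cut; case: ifP => [zb|_]; last by rewrite normc0.
by apply: le_trans (hM z (ltW zb)) _; exact: ler_norm.
Qed.

Lemma bd_poly p : ispoly p -> (\ae z, bd (cut p) z = p z).
Proof.
move=> hp; apply: bd_cont; first exact: cut_poly_H2.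
move=> z z1; apply: (radlim_eq (g := p)) => //; last exact: poly_radlim.
by move=> w wb; rewrite cut_in.
Qed.

(** Uniqueness of the expansion: the coefficients agree when tested against homogeneous polynomials,
    so their difference has norm 0, and [hpoly_sup] makes it vanish at every point. *)
Lemma expands_poly F d : homs F ->
  expands (cut (psum F d)) (fun k => if (k < d)%N then F k else fun=> 0).
Proof.
move=> hF; have hp := psum_poly d hF.
have [F' hF'] := analytic_expands (cut_analytic (polyapprox_poly hp)).
suff -> : (fun k => if (k < d)%N then F k else fun=> 0) = F' by [].
apply/funext => k; have hc := cut_poly_H2 hp.
pose F'' k : Cfun R n := if (k < d)%N then F k else fun=> 0.
have hF'' j : hpoly j (F'' j).
  by rewrite /F''; case: ifP => _ //; split=> [|a z]; [exact: ispoly_cst|rewrite mulr0].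
have E q : hpoly k q -> L2dot (F' k) q = L2dot (F'' k) q.
  move=> hq; rewrite -(bd_dot_hpoly hc hF' hq) (dot_ae (bd_poly hp) (ae_all (fun z => erefl (q z)))).
  rewrite psum_nat dot_suml //; [|by move=> j; exact: (hpoly_L2 (hF j))|exact: (hpoly_L2 hq)].
  rewrite /F''; case: ltnP => kd.
    rewrite (bigD1_seq k) /= ?iota_uniq ?mem_index_iota //.
    by rewrite big1 ?addr0 // => j /eqP jk; exact: (hpoly_orth (hF j) hq jk).
  rewrite big_nat_cond big1 => [|j /andP[/andP[_ jd] _]]; last first.
    by apply: (hpoly_orth (hF j) hq) => jk; move: kd; rewrite -jk leqNgt jd.
  by rewrite /L2dot; under eq_fun do rewrite mul0r; rewrite cintegral_cst.
have hD : hpoly k (fun z => F' k z - F'' k z).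
  split=> [|a z]; last by rewrite (hF'.1 k).2 (hF'' k).2 mulrBr.
  apply: ispolyD; first exact: (hF'.1 k).1.
  by have := ispolyZ (-1) (hF'' k).1; under eq_fun do rewrite mulN1r.
have L1 := hpoly_L2 (hF'.1 k); have L3 := hpoly_L2 (hF'' k); have LD := hpoly_L2 hD.
have s0 : sqn (fun z => F' k z - F'' k z) = 0.
  have := dot_sqn (fun z => F' k z - F'' k z); rewrite dotBl // E // subrr.
  by move=> /(congr1 (@Re R)).
apply/esym/funext => z; have [v v1 ->] := polar z.
rewrite (hF'.1 k).2 -/(F'' k) (hF'' k).2; congr (_ * _); apply/eqP; rewrite -subr_eq0 -normc_eq0.
by have := hpoly_sup hD v1; rewrite s0 mulr0 => h; rewrite -sqrf_eq0 eq_le h sqr_ge0.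
Qed.

Opaque Defs.H2 Defs.L2.

(** * Weak compactness, completeness and projections in H^2 *)

Lemma hpoly_ulim_l2 (U : set_system nat) (UU : ProperFilter U) k (Fs : nat -> Cfun R n) p e :
  (forall j, hpoly k (Fs j)) -> (forall z, Fs j z @[j --> U] ~~> p z) -> 0 < e ->
  \forall j \near U, l2 (fun z => Fs j z - p z) <= e.
Proof.
move=> hF hl e0; have hp := @hpoly_lim _ _ _ U UU k Fs p hF hl.
have [A [nd [L [h1 h2]]]] := @seppoly_interp R n k.
have /choice[B hB] : forall a : A, exists B, 0 <= B /\ forall z, enorm z = 1 -> normc (L a z) <= B.
  by move=> a; have [M M0 hM] := sphere_bounded (h1 a); exists M.
pose C := \sum_a B a + 1; have C0 : 0 < C by rewrite ltr_wpDl // sumr_ge0 // => a _; exact: (hB a).1.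
have d0 : 0 < e / C by rewrite divr_gt0.
have near : \forall j \near U, forall a : A, normc (Fs j (nd a) - p (nd a)) < e / C.
  by apply: filter_forall => a; have /cvgcP := hl (nd a); apply.
apply: filterS near => j hj; apply: l2_le_sup.
  by apply: cmeasB; apply: cmeas_poly; [exact: (hF j).1|exact: hp.1].
move=> z z1; rewrite (h2 _ (hpoly_seppoly (hF j))) (h2 _ (hpoly_seppoly hp)) -sumrB.
apply: normc_sum_le; apply: (le_via (\sum_a e / C * B a)).
  apply: ler_sum => a _; rewrite -mulrBl normcM; apply: ler_pM; rewrite ?(ltW (hj a)) //.
  exact: (hB a).2.
rewrite -mulr_sumr mulrAC ler_pdivrMr // ler_pM2l // lerDl //.
Qed.

Lemma expands_of_bounds F : homs F ->
  (forall r, 0 < r -> r < 1 -> exists2 M, 0 <= M & forall k z, normc (F k z) * r ^+ k <= M * enorm z ^+ k) ->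
  exists f, expands (cut f) F.
Proof.
move=> hF hb.
have tail r M z K L : 0 < r -> 0 <= M -> (forall k, normc (F k z) * r ^+ k <= M * enorm z ^+ k) ->
    enorm z < r -> (K <= L)%N -> normc (psum F L z - psum F K z) <= M * (enorm z / r) ^+ K / (1 - enorm z / r).
  move=> r0 M0 hM zr KL; pose q := enorm z / r.
  have q0 : 0 <= q by rewrite divr_ge0 // ltW.
  have q1 : q < 1 by rewrite ltr_pdivrMr // mul1r.
  have := congr1 (@^~ z) (psumB F KL) => /= ->; apply: normc_sum_le.
  apply: (le_via (\sum_(K <= k < L) M * q ^+ k)).
    apply: ler_sum => k _; rewrite /q expr_div_n mulrA ler_pdivlMr ?exprn_gt0 //; exact: hM.
  rewrite -mulr_sumr -mulrA ler_wpM2l // -{1}[K]add0n big_addn big_mkord.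
  under eq_bigr do rewrite exprD; rewrite -mulr_suml mulrC ler_wpM2l ?exprn_ge0 //.
  have [q00|qn] := eqVneq q 0; last by apply: geo_le => //; rewrite lt_def qn.
  rewrite -/q q00 subr0 invr1; case: (L - K)%N => [|j]; first by rewrite big_ord0.
  by rewrite big_ord_recl expr0 big1 ?addr0 // => i _; rewrite expr0n.
have [U [UU hU]] := @ultraFilterLemma nat \oo _.
have /choice[f hf] : forall z, exists l, cball z -> psum F K z @[K --> U] ~~> l.
  move=> z; have [zb|zb] := pselect (cball z); last by exists 0.
  pose r := (1 + enorm z) / 2; have z1 : enorm z < 1 := zb; have z0 := enorm_ge0 z.
  have [r0 r1] : 0 < r /\ r < 1 by rewrite /r; split; lra.
  have zr : enorm z < r by rewrite /r; lra.
  have [M M0 hM] := hb r r0 r1.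
  have [|l hl] := @ultra_lim _ _ U UU (fun K => psum F K z) (M / (1 - enorm z / r)).
    move=> K; have := tail r M z 0%N K r0 M0 (fun k => hM k z) zr (leq0n K).
    by rewrite expr0 mulr1 /psum big_ord0 subr0.
  by exists l.
exists f; split=> // r r0 r1; have [M M0 hM] := hb r r0 r1; exists M => //; split=> // z K zr.
have zb : cball z by exact: (lt_trans zr r1).
have hl : (psum F L z - psum F K z) @[L --> U] ~~> (f z - psum F K z).
  apply/cvgcP => e e0; have /cvgcP/(_ e e0) := hf z zb.
  by apply: filterS => L; rewrite opprB addrA subrK.
rewrite cut_in //; apply: (ulim_le hl); apply: hU; exists K => // L /= KL.
exact: tail.
Qed.

(** Riesz-Fischer: [hpoly_eval] turns bounds on square norms into the growth bounds that [expands]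
    asks for. *)
Lemma H2_of_series F B : homs F -> (forall K, \sum_(k < K) sqn (F k) <= B) ->
  exists f, [/\ H2 f, expands f F & H2norm f ^+ 2 <= B].
Proof.
move=> hF hB; have B0 : 0 <= B by have := hB 0%N; rewrite big_ord0.
have hl2 k : l2 (F k) <= Num.sqrt B.
  rewrite /l2 ler_wsqrtr //; apply: le_trans (hB k.+1); rewrite big_ord_recr /= lerDr.
  by apply: sumr_ge0 => j _; exact: sqn_ge0.
have [|f hf] := expands_of_bounds hF.
  move=> r r0 r1; have [M [s [M0 s0 s1 hM]]] := hpoly_eval r1.
  exists (M * Num.sqrt B); first by rewrite mulr_ge0 // sqrtr_ge0.
  move=> k z; have [v v1 zE] := polar z.
  have -> : normc (F k z) = enorm z ^+ k * normc (F k v).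
    by rewrite {1}zE (hF k).2 normcM normcX normcR ger0_norm // enorm_ge0.
  have -> : enorm z ^+ k * normc (F k v) * r ^+ k = (normc (F k v) * r ^+ k) * enorm z ^+ k by ring.
  rewrite ler_wpM2r ?exprn_ge0 // mulrC.
  have := hM k (F k) (r%:C *: v) (hF k); rewrite enormZR ?(ltW r0) // v1 mulr1 => /(_ (lexx _)).
  rewrite (hF k).2 normcM normcX normcR gtr0_norm // => h; apply: le_trans h _.
  by apply: ler_pM; rewrite ?mulr_ge0 ?exprn_ge0 ?(ltW s0) // ler_piMr // exprn_ile1 // ltW.
have [|h1 h2] := H2_of_coef (_ : analytic (cut f)) hf hB.
  by apply: (expands_analytic hf) => z; exact: cut_out.
by exists (cut f).
Qed.

Lemma l2_psum F K : (forall k, L2 (F k)) -> l2 (psum F K) <= \sum_(k < K) l2 (F k).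
Proof.
move=> hF; elim: K => [|K IH].
  by rewrite /psum big_ord0 /l2 /sqn; under eq_fun do rewrite big_ord0 normc0 expr0n; rewrite Rint_cst sqrtr0.
have -> : psum F K.+1 = (fun z => psum F K z + F K z) by apply/funext => z; rewrite /psum big_ord_recr.
rewrite big_ord_recr /=; apply: le_trans (l2D _ (hF K)) (lerD IH (lexx _)).
by apply: L2_sum => k; exact: hF.
Qed.

(** In a fixed degree the coefficients live in a finite dimensional space, where the limits are
    limits in norm. Tails are uniformly small at each point of the ball and, against a fixed g, by
    the tail of g; so one limit serves both pointwise and weakly. *)
Lemma ulim_H2 (U : set_system nat) (UU : UltraFilter U) (fs : nat -> Cfun R n) B :
  (forall j, H2 (fs j)) -> (forall j, H2norm (fs j) <= B) ->
  exists f, [/\ H2 f, H2norm f <= B,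
    forall z, fs j z @[j --> U] ~~> f z &
    forall g, H2 g -> (H2dot (fs j) g) @[j --> U] ~~> H2dot f g].
Proof.
move=> hfs hB; have B0 : 0 <= B by apply: le_trans (hB 0%N); exact: H2norm_ge0.
have /choice[Fs hFs] : forall j, exists F, expands (fs j) F by move=> j; exact: (H2_expands (hfs j)).
have hl2 j k : l2 (Fs j k) <= B by apply: le_trans (hB j); exact: (coef_l2_le k (hfs j) (hFs j)).
have /choice[F hF] : forall k, exists p : Cfun R n, forall z, Fs j k z @[j --> U] ~~> p z.
  move=> k; have [M [s [M0 s0 s1 hM]]] := @hpoly_eval (1 / 2) ltac:(lra).
  have /choice[p hp] : forall z, exists l, Fs j k z @[j --> U] ~~> l.
    move=> z; apply: (@ultra_lim _ _ U UU _ ((2 * enorm z) ^+ k * (M * s ^+ k * B))) => j.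
    have [v v1 zE] := polar z.
    have zE2 : z = (2 * enorm z)%:C *: ((1 / 2)%:C *: v).
      by rewrite scalerA -rmorphM {1}zE; congr (_%:C *: _); field.
    rewrite {1}zE2 ((hFs j).1 k).2 normcM normcX normcR ger0_norm ?mulr_ge0 //.
    rewrite ler_wpM2l ?exprn_ge0 ?mulr_ge0 //.
    apply: le_trans (hM k _ _ ((hFs j).1 k) _) _; first by rewrite enormZR ?v1 ?mulr1 //; lra.
    by rewrite ler_wpM2l // mulr_ge0 // exprn_ge0 // ltW.
  by exists p.
have hFk k : hpoly k (F k) by apply: hpoly_lim (hF k) => j; exact: (hFs j).1.
have near k e : 0 < e -> \forall j \near U, l2 (fun z => Fs j k z - F k z) <= e.
  by move=> e0; apply: hpoly_ulim_l2 e0 => [j|z]; [exact: (hFs j).1|exact: hF].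
have LF k := hpoly_L2 (hFk k); have LFs j k := hpoly_L2 ((hFs j).1 k).
have hsum K : \sum_(k < K) sqn (F k) <= B ^+ 2.
  rewrite -sqn_psum // -l2_sqr lerXn2r ?nnegrE //; apply/ler_addgt0Pr => e e0.
  have e1 : 0 < e / K.+1%:R by rewrite divr_gt0.
  have /filter_ex[j hj] : \forall j \near U, forall k : 'I_K, l2 (fun z => Fs j k z - F k z) <= e / K.+1%:R.
    by apply: filter_forall => k; exact: near.
  have h1 : l2 (psum (Fs j) K) <= B.
    rewrite -[_ <= _]ler_sqr ?nnegrE // l2_sqr sqn_psum //; last exact: (hFs j).1.
    by apply: le_trans (H2_coef (hfs j) (hFs j) K) _; rewrite lerXn2r ?nnegrE.
  have h2 : l2 (fun z => psum F K z - psum (Fs j) K z) <= e.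
    have -> : (fun z => psum F K z - psum (Fs j) K z) = psum (fun k z => F k z - Fs j k z) K.
      by apply/funext => z; rewrite /psum -sumrB.
    apply: le_trans (l2_psum K (fun k => L2B (LF k) (LFs j k))) _; apply: (le_via (\sum_(k < K) e / K.+1%:R)).
      by apply: ler_sum => k _; rewrite l2_distC; exact: hj.
    rewrite sumr_const card_ord -[leLHS]mulr_natl mulrA ler_pdivrMr // mulrC ler_pM2l //.
    by rewrite ler_nat.
  exact: le_trans (l2_sub_le (psum_L2 K hFk) (psum_L2 K (hFs j).1) h2) (lerD h1 (lexx _)).
have [f [hf fF fB]] := H2_of_series hFk hsum.
have fB' : H2norm f <= B by rewrite -[_ <= _]ler_sqr ?nnegrE.
have hl2F k : l2 (F k) <= B by apply: le_trans fB'; exact: (coef_l2_le k hf fF).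
exists f; split=> // [z|g hg].
  have [zb|zb] := pselect (cball z); last first.
    rewrite (H2_out hf zb); under eq_fun do rewrite (H2_out (hfs _) zb); exact: cvgc_cst.
  apply/cvgcP => e e0; have [C [s [C0 s0 s1 hC]]] := expands_tail zb.
  have e3 : 0 < e / 3 / (C * B + 1) by rewrite !divr_gt0 // ltr_wpDl // mulr_ge0.
  have [K _ hK] := expr_small (ltW s0) s1 e3.
  have tl : C * B * s ^+ K < e / 3.
    have h1 : C * B * s ^+ K <= C * B * (e / 3 / (C * B + 1)) by rewrite ler_wpM2l // mulr_ge0.
    apply: le_lt_trans h1 _; rewrite mulrCA; have e33 : 0 < e / 3 by rewrite divr_gt0.
    rewrite -[ltRHS]mulr1 ltr_pM2l // ltr_pdivrMr ?mul1r ?ltrDl // ltr_wpDl // mulr_ge0 //.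
  have hps : (psum (Fs j) K z) @[j --> U] ~~> psum F K z.
    by apply: cvgc_sum => k _; exact: hF.
  have /cvgcP/(_ (e / 3)) := hps; have e33 : 0 < e / 3 by rewrite divr_gt0.
  move=> /(_ e33); apply: filterS => j hj.
  have a1 := hC (fs j) (Fs j) B K z (hFs j) (hl2 j) (lexx _).
  have a2 := hC f F B K z fF hl2F (lexx _).
  have -> : fs j z - f z = (fs j z - psum (Fs j) K z) + (psum (Fs j) K z - psum F K z) - (f z - psum F K z) by ring.
  apply: le_lt_trans (le_normcB _ _) _; apply: le_lt_trans (lerD (le_normcD _ _) (lexx _)) _.
  by move: a1 a2 hj tl; clear -hs; lra.
apply/cvgcP => e e0; have [G hG] := H2_expands hg.
have Bp : 0 < 4 * (B + 1) by rewrite mulr_gt0 // ltr_wpDl.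
have e1 : 0 < e / (4 * (B + 1)) by rewrite divr_gt0.
have [K0 /(_ K0 (leqnn _)) hK] := bd_approx hg hG e1.
have gK0 k := l2_ge0 (G k).
pose D := \sum_(k < K0) l2 (G k) + 1.
have D0 : 0 < D by rewrite ltr_wpDl // sumr_ge0.
have e2 : 0 < e / 4 / D by rewrite !divr_gt0.
have nr : \forall j \near U, forall k : 'I_K0, l2 (fun z => Fs j k z - F k z) <= e / 4 / D.
  by apply: filter_forall => k; exact: near.
apply: filterS nr => j hj; rewrite !H2dotE //.
have Lf := bd_L2 hf; have Lj := bd_L2 (hfs j); have Lg := bd_L2 hg.
have LG k := hpoly_L2 (hG.1 k); have LP := psum_L2 K0 hG.1.
pose r z := bd g z - psum G K0 z; have Lr : L2 r by exact: L2B.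
have gE : bd g = (fun z => r z + psum G K0 z) by apply/funext => z; rewrite /r subrK.
have dE (w : Cfun R n) : L2 w -> L2dot w (bd g) = L2dot w r + L2dot w (psum G K0).
  by move=> Lw; rewrite gE dotDr.
rewrite !dE //.
have sE q Q : H2 q -> expands q Q -> L2dot (bd q) (psum G K0) = \sum_(k < K0) L2dot (Q k) (G k).
  move=> hq hQ; rewrite /psum dot_sumr //; last exact: (bd_L2 hq).
  by apply: eq_bigr => k _; exact: (bd_dot_hpoly hq hQ (hG.1 k)).
rewrite (sE _ _ (hfs j) (hFs j)) (sE _ _ hf fF).
have -> (a b c d : R[i]) : a + b - (c + d) = a - c + (b - d) by ring.
have b1 : normc (L2dot (bd (fs j)) r) <= B * (e / (4 * (B + 1))).
  apply: le_trans (CS_l2 Lj Lr) _; apply: ler_pM => //.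
  by rewrite -(H2norm_bd (hfs j)); exact: hB.
have b2 : normc (L2dot (bd f) r) <= B * (e / (4 * (B + 1))).
  by apply: le_trans (CS_l2 Lf Lr) _; apply: ler_pM => //; rewrite -H2norm_bd.
have b3 : normc (\sum_(k < K0) L2dot (Fs j k) (G k) - \sum_(k < K0) L2dot (F k) (G k)) <= e / 4.
  rewrite -sumrB; apply: normc_sum_le.
  apply: (le_via (\sum_(k < K0) e / 4 / D * l2 (G k))).
    apply: ler_sum => k _; rewrite -dotBl //; apply: le_trans (CS_l2 (L2B (LFs j k) (LF k)) (LG k)) _.
    by rewrite ler_wpM2r.
  by rewrite -mulr_sumr mulrAC ler_pdivrMr // ler_pM2l ?divr_gt0 // lerDl.
have b4 : B * (e / (4 * (B + 1))) <= e / 4.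
  have -> : e / (4 * (B + 1)) = e / 4 / (B + 1) by field; rewrite gt_eqF // ltr_wpDl.
  by rewrite mulrCA -[leRHS]mulr1 ler_pM2l ?divr_gt0 // ler_pdivrMr ?mul1r ?lerDl // ltr_wpDl.
apply: normcD_lt; apply: le_lt_trans (lerD (le_normcB _ _) b3) _.
apply: le_lt_trans (lerD (lerD (le_trans b1 b4) (le_trans b2 b4)) (lexx _)) _.
exact: three_quarters.
Qed.

Lemma H2norm_tri f g : H2 f -> H2 g -> H2norm (fun z => f z + g z) <= H2norm f + H2norm g.
Proof.
move=> hf hg; rewrite (H2norm_bd hf) (H2norm_bd hg) (H2norm_bd (H2D hf hg)).
rewrite (l2_ae (bdD hf hg)); exact: (l2D (bd_L2 hf) (bd_L2 hg)).
Qed.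

Lemma H2norm_B f g : H2 f -> H2 g -> H2norm (fun z => f z - g z) = l2 (fun z => bd f z - bd g z).
Proof. by move=> hf hg; rewrite (H2norm_bd (H2B hf hg)) (l2_ae (bdB hf hg)). Qed.
Lemma H2norm_distC f g : H2 f -> H2 g -> H2norm (fun z => f z - g z) = H2norm (fun z => g z - f z).
Proof. by move=> hf hg; rewrite (H2norm_B hf hg) (H2norm_B hg hf) l2_distC. Qed.

(** The norm estimate is the lower semicontinuity contained in [ulim_H2], applied to differences. *)
Lemma H2_complete (fs : nat -> Cfun R n) (C : R) : 0 <= C -> (forall j, H2 (fs j)) ->
  (forall i j, (j <= i)%N -> H2norm (fun z => fs i z - fs j z) <= C / 2 ^+ j) ->
  exists f, H2 f /\ forall j, H2norm (fun z => fs j z - f z) <= C / 2 ^+ j.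
Proof.
move=> C0 hfs hC; have [U [UU hU]] := @ultraFilterLemma nat \oo _.
have [|f [hf _ fl _]] := @ulim_H2 U UU fs (C + H2norm (fs 0%N)) hfs.
  move=> j; have -> : fs j = (fun z => (fs j z - fs 0%N z) + fs 0%N z) by apply/funext => z; rewrite subrK.
  apply: le_trans (H2norm_tri (H2B (hfs j) (hfs 0%N)) (hfs 0%N)) _; rewrite lerD2r.
  by apply: le_trans (hC j 0%N (leq0n j)) _; rewrite expr0 divr1.
exists f; split=> // j.
(* The index [maxn i j] makes the bound hold for every i, not only for large i. *)
have [|g [hg gB gl _]] := @ulim_H2 U UU (fun i z => fs (maxn i j) z - fs j z) (C / 2 ^+ j) (fun i => H2B (hfs _) (hfs j)).
  by move=> i; apply: hC; exact: leq_maxr.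
rewrite (H2norm_distC (hfs j) hf); suff -> : (fun z => f z - fs j z) = g by exact: gB.
apply/funext => z; apply/esym; apply: (cvgc_unique (gl z)).
have fl' : (fs i z - fs j z) @[i --> U] ~~> (f z - fs j z).
  apply/cvgcP => e e0; have /cvgcP/(_ e e0) := fl z.
  by apply: filterS => i; rewrite opprB addrA subrK.
apply/cvgcP => e e0; have /cvgcP/(_ e e0) h := fl'.
have hj : U [set i | (j <= i)%N] by apply: hU; exists j.
by apply: filterS2 h hj => i /= + ji; rewrite (maxn_idPl ji).
Qed.

(** Minimality is tested at c = s <f, x> with s = 1 / (|x|^2 + 1); the 1 covers x = 0. *)
Lemma min_orth f x : L2 f -> L2 x ->
  (forall c : R[i], sqn f <= sqn (fun z => f z - c * x z)) -> L2dot f x = 0.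
Proof.
move=> hw hx hm; set D := L2dot f x; set N := sqn x.
have N0 : 0 <= N by exact: sqn_ge0.
pose s := (N + 1)^-1; have s0 : 0 < s by rewrite invr_gt0 ltr_wpDl.
have := hm (s%:C * D); rewrite sqnB //; last exact: L2Z.
rewrite sqnZ // dotZr // -/D -/N normcM normcR exprMn real_normK ?num_real // conjcM conjcR.
have -> : Re (s%:C * D^* * D) = s * normc D ^+ 2.
  by rewrite -mulrA [D^* * D]mulrC mulcJ ReM /= mul0r subr0.
move=> h; apply/eqP; rewrite -normc_eq0 -sqrf_eq0 eq_le sqr_ge0 andbT leNgt; apply/negP => Dp.
have sN : s * N <= 1 by rewrite /s mulrC ler_pdivrMr ?mul1r ?lerDl // ltr_wpDl.
have sD : 0 < s * normc D ^+ 2 by rewrite mulr_gt0.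
have : s ^+ 2 * normc D ^+ 2 * N <= s * normc D ^+ 2.
  have -> : s ^+ 2 * normc D ^+ 2 * N = s * normc D ^+ 2 * (s * N) by ring.
  by rewrite ler_piMr // ltW.
by move: h sD; clear -hs; lra.
Qed.

Lemma closed_sub_H2 V f : closed_subspace V -> V f -> H2 f.
Proof. by move=> [h _ _ _]; exact: h. Qed.
Lemma closed_lin V a f g : closed_subspace V -> V f -> V g -> V (fun z => a * f z + g z).
Proof. by move=> [_ _ h _]; exact: h. Qed.

(** The parallelogram law makes a minimising sequence Cauchy. Here u is any L^2 function, not only a
    boundary function: this yields adjoints, projections onto Q and the projections of conjugates in
    [MQ_of_orth]. *)
Lemma H2_projection V u : closed_subspace V -> L2 u ->
  exists v, V v /\ forall h, V h -> L2dot (fun z => u z - bd v z) (bd h) = 0.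
Proof.
move=> hV hu; have VH f := @closed_sub_H2 V f hV.
pose S := [set sqn (fun z => u z - bd v z) | v in V].
have V0 : V (fun=> 0) by case: hV.
have hS : has_inf S.
  split; first by exists (sqn (fun z => u z - bd (fun=> 0) z)), (fun=> 0).
  by exists 0 => _ [v _ <-]; exact: sqn_ge0.
pose d := inf S; have dS v : V v -> d <= sqn (fun z => u z - bd v z).
  by move=> Vv; apply: inf_lbound; [exact: hS.2|exists v].
have LB v : V v -> L2 (bd v) by move=> /VH; exact: bd_L2.
have /choice[v hv] : forall j : nat, exists v, V v /\ sqn (fun z => u z - bd v z) < d + (4 ^+ j)^-1.
  move=> j; have e0 : 0 < (4 ^+ j)^-1 :> R by rewrite invr_gt0 exprn_gt0.
  have [_ [w Vw <-] hw] := inf_adherent e0 hS; by exists w.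
have key i j : (j <= i)%N -> H2norm (fun z => v i z - v j z) <= 2 / 2 ^+ j.
  move=> ji; have [Vi hi] := hv i; have [Vj hj] := hv j.
  rewrite H2norm_B; [|exact: VH|exact: VH].
  rewrite -[_ <= _]ler_sqr ?nnegrE ?divr_ge0 ?exprn_ge0 // l2_sqr.
  pose m : Cfun R n := fun z => (1 / 2)%:C * v i z + (fun z => (1 / 2)%:C * v j z + (fun=> 0) z) z.
  have Vm : V m by apply: closed_lin => //; apply: closed_lin.
  pose a z := u z - bd (v i) z; pose b z := u z - bd (v j) z.
  have La : L2 a by exact: (L2B hu (LB _ Vi)). have Lb : L2 b by exact: (L2B hu (LB _ Vj)).
  have e1 : sqn (fun z => a z + b z) = 4 * sqn (fun z => u z - bd m z).
    have -> : 4 = normc (2 : R[i]) ^+ 2 :> R.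
      by rewrite -(rmorph_nat (real_complex R)) normcR ger0_norm //; ring.
    rewrite -sqnZ; last exact: (L2B hu (LB _ Vm)).
    apply: sqn_ae.
    have h1 := bdZ (1 / 2)%:C (VH _ Vi).
    have h2 := bdZ (1 / 2)%:C (VH _ Vj).
    have h3 := bdD (H2Z (1 / 2)%:C (VH _ Vi)) (H2Z (1 / 2)%:C (VH _ Vj)).
    have mE : m = (fun z => (1 / 2)%:C * v i z + (1 / 2)%:C * v j z) by apply/funext => z; rewrite /m addr0.
    rewrite mE; apply: ae_mono (ae_and h1 (ae_and h2 h3)) => z [E1 [E2 E3]].
    rewrite E3 E1 E2 /a /b; have -> : (1 / 2)%:C = 2^-1 :> R[i] by rewrite div1r fmorphV rmorph_nat.
    by field.
  have e2 : sqn (fun z => bd (v i) z - bd (v j) z) = sqn (fun z => a z - b z).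
    by rewrite -sqnN; congr sqn; apply/funext => z; rewrite /a /b; ring.
  rewrite e2; have sD := sqnD La Lb; have sB := sqnB La Lb; rewrite e1 in sD.
  have dm := dS m Vm; have pij : (4 ^+ i)^-1 <= (4 ^+ j)^-1 :> R.
    exact: inv_exp4_le.
  have -> : (2 / 2 ^+ j) ^+ 2 = 4 * (4 ^+ j)^-1 :> R.
    have -> : 4 = 2 ^+ 2 :> R by ring.
    by rewrite expr_div_n -!exprM mulnC.
  exact: (parallelogram_bound hi hj pij dm sB sD).
have c2 : 0 <= 2 :> R by [].
have [f [hf fl]] := H2_complete c2 (fun j => VH _ (hv j).1) key.
have small e : 0 < e -> exists J, forall j, (J <= j)%N -> 2 / 2 ^+ j <= e.
  move=> e0; have e2 := half_gt0 e0.
  have [J _ hJ] := @expr_small (1 / 2) (e / 2) ltac:(lra) ltac:(lra) e2.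
  exists J => j Jj; have : (1 / 2) ^+ j <= (1 / 2) ^+ J :> R by rewrite ler_wiXn2l //; lra.
  by rewrite div1r !exprVn in hJ *; lra.
have Vf : V f.
  case: (hV) => _ _ _; apply; [exact: (fun j => (hv j).1)|exact: hf|].
  apply/cvgrPdist_le => e e0; have [J hJ] := small e e0; exists J => // j /= Jj.
  by rewrite sub0r normrN ger0_norm //; apply: le_trans (fl j) (hJ j Jj).
have fd : sqn (fun z => u z - bd f z) <= d.
  have d0 : 0 <= d by apply: lb_le_inf; [exact: hS.1|move=> _ [w _ <-]; exact: sqn_ge0].
  rewrite -l2_sqr -[d]sqr_sqrtr // lerXn2r ?nnegrE ?sqrtr_ge0 //.
  apply/ler_addgt0Pr => e e0; have e3 : 0 < e / 3 by rewrite divr_gt0.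
  have [J hJ] := small _ e3; have := hJ J (leqnn J) => hJJ.
  have [VJ hvJ] := hv J; apply: le_trans (l2_tri hu (LB _ VJ) (LB _ Vf)) _.
  have -> : e = e / 3 + e / 3 + e / 3 by field.
  rewrite !addrA; apply: lerD; last first.
    by have := fl J; rewrite (H2norm_B (VH _ VJ) (VH _ Vf)) => h; exact: (le_trans h hJJ).
  have h4 : Num.sqrt ((4 ^+ J)^-1) <= e / 3 :> R.
    have -> : (4 ^+ J)^-1 = ((2 ^+ J)^-1) ^+ 2 :> R.
      by rewrite exprVn -exprM mulnC exprM; congr ((_ ^+ _)^-1); ring.
    rewrite sqrtr_sqr ger0_norm ?invr_ge0 ?exprn_ge0 //; apply: le_trans hJJ; rewrite ler_peMl ?invr_ge0 ?exprn_ge0 //.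
    by rewrite ler1n.
  apply: (le_via (Num.sqrt d + Num.sqrt ((4 ^+ J)^-1))); last by lra.
  rewrite -[_ <= _]ler_sqr ?nnegrE ?addr_ge0 ?sqrtr_ge0 //.
  rewrite l2_sqr sqrrD !sqr_sqrtr // ?invr_ge0 ?exprn_ge0 //; apply: le_trans (ltW hvJ) _.
  rewrite -addrA lerD2l lerDr -[leRHS]mulr_natl mulr_ge0 // mulr_ge0 // sqrtr_ge0.
exists f; split=> // h Vh; apply: min_orth; [exact: (L2B hu (LB _ Vf))|exact: LB|].
move=> c; apply: le_trans fd _; pose f' : Cfun R n := fun z => c * h z + f z.
have Vf' : V f' by apply: closed_lin.
apply: le_trans (dS _ Vf') _; apply: eqW; apply: sqn_ae.
have := ae_and (bdD (H2Z c (VH _ Vh)) (VH _ Vf)) (bdZ c (VH _ Vh)).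
by apply: ae_mono => z [E1 E2]; rewrite /f' E1 E2; ring.
Qed.

(** * The maximum principle from boundary values *)

Definition excess (x : R) : R := Num.max 0 (x - 1).

Lemma excess_ge0 x : 0 <= excess x. Proof. by rewrite /excess le_max lexx. Qed.

Lemma excess_le x : x - 1 <= excess x. Proof. by rewrite /excess le_max lexx orbT. Qed.

Lemma excess_lip x y d : x <= y + d -> 0 <= d -> excess x <= excess y + d.
Proof.
move=> xy d0; rewrite {1}/excess ge_max addr_ge0 ?excess_ge0 //=.
by have := excess_le y; lra.
Qed.

Lemma rmeas_excess p : rmeas p -> rmeas (fun z : Cn R n => excess (p z)).
Proof. by move=> h; apply: rmeas_max; [exact: rmeas_cst|apply: rmeasB => //; exact: rmeas_cst]. Qed.

Lemma rI_excess u : L2 u -> rI (fun z => excess (normc (u z))).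
Proof.
move=> hu; apply: (rI_dom (q := fun z => normc (u z))); [|exact: (cI_normc (L2_cI hu))|].
  by apply: rmeas_excess; apply: cmeas_normc; exact: (L2_cmeas hu).
move=> z; rewrite ger0_norm ?excess_ge0 // /excess ge_max normc_ge0 /=.
by have := normc_ge0 (u z); lra.
Qed.

Lemma poisson_dil F d r e : homs F -> 0 < r -> r < 1 -> 0 < e ->
  exists (m : nat) (w : R[i]) (nu : 'I_m -> R), [/\ normc w = 1, forall j, 0 <= nu j, \sum_j nu j = 1 &
    forall z, enorm z = 1 -> normc (psum F d (r%:C *: z) - cavg w nu (psum F d) z) <= e].
Proof.
move=> hF r0 r1 e0.
have [B hB] := hpoly_bounds hF.
pose C : R := \sum_(k < d) B k + 1.
have C0 : 0 < C by rewrite ltr_wpDl // sumr_ge0 // => k _; exact: (hB k).1.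
have eC : 0 < e / C by rewrite divr_gt0.
have [q q0 rq] := expr_small (ltW r0) r1 eC.
pose m := (d + q)%N; have m0 : (0 < m)%N by rewrite addn_gt0 q0 orbT.
have [w [nu [w1 nu0 hnu]]] := poisson_weights r0 r1 m0; exists m, w, nu.
have rm0 : 0 < r ^+ m by rewrite exprn_gt0.
have rm1 : 0 < 1 + r ^+ m by rewrite addr_gt0.
split=> //.
  have := hnu 0%N m0; under eq_bigr do rewrite muln0 expr0 mulr1.
  by rewrite expr0 subn0 divff ?gt_eqF // -rmorph_sum => /(congr1 (@Re R)).
move=> z z1; pose rho k := (r ^+ k + r ^+ (m - k)) / (1 + r ^+ m).
have -> : cavg w nu (psum F d) z = \sum_(k < d) (rho k)%:C * F k z.
  rewrite (cavg_sum _ _ (index_enum 'I_d)); apply: eq_bigr => k _.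
  rewrite (cavg_hpoly (rho := rho k) _ (hF k)) //; apply: hnu.
  by apply: leq_trans (ltn_ord k) _; exact: leq_addr.
have -> : psum F d (r%:C *: z) - \sum_(k < d) (rho k)%:C * F k z = \sum_(k < d) (r ^+ k - rho k)%:C * F k z.
  by rewrite /psum -sumrB; apply: eq_bigr => k _; rewrite (hF k).2 -rmorphXn -mulrBl -rmorphB.
apply: normc_sum_le; apply: (le_via (\sum_(k < d) e / C * B k)); last first.
  by rewrite -mulr_sumr mulrAC ler_pdivrMr // ler_pM2l // lerDl.
apply: ler_sum => k _; rewrite normcM normcR; apply: ler_pM; rewrite ?normr_ge0 ?(hB k).2 //.
rewrite distrC; have [_ _ h] := poisson_multiplier q r0 r1 (ltn_ord k).
exact: le_trans h rq.
Qed.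

(** Up to small errors in mean, a dilation of f is an average of rotated boundary functions.
    Averaging preserves integrals and does not create excess over 1, so the excess of |f (r z)| has
    integral 0; continuity then removes the exceptional set. *)
Lemma max_principle f : H2 f -> (\ae z, normc (bd f z) <= 1) -> schur_class f.
Proof.
move=> hf h1; have fa := H2_analytic hf; have [F hF] := H2_expands hf.
have key r : 0 < r -> r < 1 -> forall v : Cn R n, enorm v = 1 -> normc (f (r%:C *: v)) <= 1.
  move=> r0 r1; have Lr := dil_L2 r0 r1 fa; have Lb := bd_L2 hf.
  have iE := rI_excess Lr.
  have E0 : Rint (fun z => excess (normc (dil r f z))) = 0.
    apply/eqP; rewrite eq_le; apply/andP; split; last by apply: Rint_ge0 => z; exact: excess_ge0.
    apply/ler_addgt0Pr => e e0; rewrite add0r; have e3 : 0 < e / 3 by rewrite divr_gt0.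
    have [K1 hK1] := bd_approx hf hF e3; have [K2 hK2] := dil_approx fa hF r0 r1 e3.
    pose d := maxn K1 K2; have k1 := hK1 d (leq_maxl _ _); have k2 := hK2 d (leq_maxr _ _).
    have [m [w [nu [w1 nu0 nu1 hP]]]] := poisson_dil d hF.1 r0 r1 e3.
    have Lp := psum_L2 d hF.1.
    have Lpr : L2 (dil r (psum F d)).
      by rewrite dil_psum; [apply: psum_L2 => k; apply: hpolyZ|]; exact: hF.1.
    have cIr := L2_cI Lr; have cIpr := L2_cI Lpr; have cIp := L2_cI Lp; have cIb := L2_cI Lb.
    pose q z := excess (normc (bd f z)); have iq : rI q by exact: rI_excess.
    have q0 : Rint q = 0.
      rewrite -(Rint_cst 0); apply: Rint_ae; apply: ae_mono h1 => z hz.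
      by rewrite /q /excess max_l // subr_le0.
    pose t1 z := normc (dil r f z - dil r (psum F d) z).
    pose t3 z := normc (bd f z - psum F d z).
    have it1 : rI t1 by apply: cI_normc; exact: (L2_cI (L2B Lr Lpr)).
    have it3 : rI t3 by apply: cI_normc; exact: (L2_cI (L2B Lb Lp)).
    have ia := avg_rI nu w1 iq; have ia3 := avg_rI nu w1 it3.
    apply: (le_via (Rint (fun z => avg w nu q z + (t1 z + (e / 3 + avg w nu t3 z))))).
      apply: Rint_le_ae => //.
        by apply: rI_D => //; apply: rI_D => //; apply: rI_D => //; exact: rI_cst.
      apply: ae_mono ae_sphere => z z1.
      have a0 : normc (cavg w nu (bd f) z) - 1 <= avg w nu q z.
        rewrite lerBlDr; apply: le_trans (normc_cavg w nu0 _ _) _; rewrite -(avgD_cst w nu1 q 1 z).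
        by apply: (le_avg w nu0) => y; rewrite -lerBlDr; exact: excess_le.
      have a3 : normc (cavg w nu (fun z => bd f z - psum F d z) z) <= avg w nu t3 z by exact: (normc_cavg w nu0).
      have E3 : cavg w nu (fun z => bd f z - psum F d z) z = cavg w nu (bd f) z - cavg w nu (psum F d) z.
        by rewrite /cavg -sumrB; apply: eq_bigr => j _; rewrite mulrBr.
      have a2 := hP z z1; have a5 : 0 <= avg w nu t3 z by apply: avg_ge0 => // y; exact: normc_ge0.
      have tot : normc (dil r f z) <= normc (cavg w nu (bd f) z) + (t1 z + (e / 3 + avg w nu t3 z)).
        have -> : dil r f z = cavg w nu (bd f) z + ((dil r f z - dil r (psum F d) z) +
            ((dil r (psum F d) z - cavg w nu (psum F d) z) - cavg w nu (fun z => bd f z - psum F d z) z)).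
          by rewrite E3; ring.
        apply: normcD_le; rewrite lerD2l; apply: normcD_le.
        rewrite lerD2l; apply: normcB_le; exact: lerD.
      have t0 : 0 <= t1 z + (e / 3 + avg w nu t3 z) by rewrite addr_ge0 ?normc_ge0 // addr_ge0 // ltW.
      apply: le_trans (excess_lip tot t0) _; rewrite lerD2r.
      by rewrite /excess ge_max a0 andbT; apply: avg_ge0 => // y; exact: excess_ge0.
    rewrite RintD // ?RintD ?Rint_cst //; last 3 first.
    - exact: rI_cst.
    - by apply: rI_D => //; exact: rI_cst.
    - by apply: rI_D => //; apply: rI_D => //; exact: rI_cst.
    rewrite (Rint_avg w1 nu1 iq) q0 add0r (Rint_avg w1 nu1 it3).
    have b1 : Rint t1 <= e / 3 by apply: le_trans k2; exact: (norm1_le_l2 (L2B Lr Lpr)).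
    have b3 : Rint t3 <= e / 3 by apply: le_trans k1; exact: (norm1_le_l2 (L2B Lb Lp)).
    by move: b1 b3; clear -hs; lra.
  have ae1 : (\ae z, normc (dil r f z) <= 1).
    apply: ae_mono (Rint0_ae iE (fun z => excess_ge0 _) E0) => z hz.
    by have := excess_le (normc (dil r f z)); rewrite hz; lra.
  apply: (ae_sphere_all _ ae1) => z z1 e e0.
  have rb : cball (r%:C *: z) by rewrite /cball /= enormZR ?(ltW r0) // z1 mulr1.
  have [d d0 hd] := polyapprox_cont (analytic_polyapprox fa) rb e0.
  exists (d / r); first by rewrite divr_gt0.
  move=> y yz; apply: le_lt_trans (ler_dist_normc _ _) _; apply: hd.
  by rewrite -scalerBr enormZR ?(ltW r0) // mulrC -ltr_pdivlMr.
apply: schurP => // z zb; have [v v1 zE] := polar z.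
(* The centre is not of the form r v with r > 0 and is reached by continuity. *)
have [z0|z0] := eqVneq (enorm z) 0; last first.
  by rewrite zE; apply: key => //; rewrite lt_def z0 enorm_ge0.
rewrite (enorm_eq0 z0); apply/ler_addgt0Pr => e e0.
have c0 : cball (0 : Cn R n) by rewrite /cball /= enorm0.
have [d d0 hd] := polyapprox_cont (analytic_polyapprox fa) c0 e0.
pose r := Num.min (d / 2) (1 / 2).
have [r0 r1 rd] : [/\ 0 < r, r < 1 & r < d].
  by rewrite /r; split; rewrite ?lt_min ?gt_min; [apply/andP; split|apply/orP; right|apply/orP; left]; lra.
have h2 := hd (r%:C *: v); rewrite subr0 enormZR ?(ltW r0) // v1 mulr1 in h2.
have h3 := h2 rd; have h4 := key r r0 r1 v v1.
have -> : f 0 = f (r%:C *: v) - (f (r%:C *: v) - f 0) by ring.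
by apply: normcB_le; apply: lerD => //; exact: ltW.
Qed.

(** * Multipliers, adjoints and the complement of Q *)

Lemma cut_mul p f : H2 f -> (fun z => p z * f z) = (fun z => cut p z * f z).
Proof.
move=> hf; apply/funext => z; have [zb|zb] := pselect (cball z); first by rewrite cut_in.
by rewrite (H2_out hf zb) !mulr0.
Qed.

Lemma cut_poly_bounded p : ispoly p -> exists M, forall z, normc (cut p z) <= M.
Proof.
move=> hp; have [M hM] := @ball_bounded R n p 1 (fun z _ => @ispoly_cont R n p hp z).
exists `|M| => z; rewrite /cut; case: ifP => [zb|_]; last by rewrite normc0.
by apply: le_trans (hM z (ltW zb)) _; exact: ler_norm.
Qed.

Lemma H2_pmul p f : ispoly p -> H2 f -> H2 (fun z => p z * f z) /\
  (\ae z, bd (fun z => p z * f z) z = p z * bd f z).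
Proof.
move=> hp hf; have [M hM] := cut_poly_bounded hp; rewrite (cut_mul p hf).
have ha := cut_analytic (polyapprox_poly hp); split; first by have [] := H2M ha hM hf.
apply: ae_mono (ae_and (bdM ha hM hf) (bd_poly hp)) => z [-> ->] //.
Qed.

Lemma H2_zero : H2 (fun=> 0).
Proof. by have := H2Z 0 one_H2; under eq_fun do rewrite mul0r. Qed.

Lemma H2_closed : closed_subspace H2.
Proof.
split=> [f //||a f g hf hg|F f _ hf _]; [exact: H2_zero| |exact: hf].
exact: (H2D (H2Z a hf) hg).
Qed.

Lemma bd_lin a f g : H2 f -> H2 g ->
  (\ae z, bd (fun z => a * f z + g z) z = a * bd f z + bd g z).
Proof.
move=> hf hg; have h1 := bdD (H2Z a hf) hg; have h2 := bdZ a hf.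
by apply: ae_mono (ae_and h1 h2) => z [-> ->].
Qed.

(** The adjoint of a coordinate is the H^2 projection of the conjugate coordinate times f; its
    existence gives the [xget] in [adjoint] its meaning. *)
Lemma adjoint_spec (i : 'I_n) f : H2 f -> H2 (adjoint sigma (multop (coordf i)) f) /\
  forall g, H2 g -> H2dot (multop (coordf i) g) f = H2dot g (adjoint sigma (multop (coordf i)) f).
Proof.
move=> hf; apply: (@xgetPex _ (fun=> 0) [set h | H2 h /\ forall g, H2 g ->
  H2dot (multop (coordf i) g) f = H2dot g h]).
have pc : ispoly (coordf i : Cfun R n) by exact: ispoly_coord.
pose u z := (coordf i z)^* * bd f z; have Lf := bd_L2 hf.
have Lu : L2 u.
  apply: (L2M_bnd (M := 1)) => //; first by apply: cmeas_conj; exact: cmeas_poly.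
  by apply: ae_mono ae_sphere => z z1; rewrite normcJ' -z1; exact: normc_le_enorm.
have [h [hh ho]] := H2_projection H2_closed Lu; exists h; split; first exact: hh.
move=> g hg.
have Lg := bd_L2 hg; have Lh := bd_L2 hh; have [hp ap] := H2_pmul pc hg.
rewrite (H2dotE hp hf) (H2dotE hg hh).
transitivity (L2dot (bd g) u).
  rewrite (dot_ae ap (ae_all (fun z => erefl (bd f z)))) /L2dot; congr cintegral.
  by apply/funext => z; rewrite /u conjcM conjcK' mulrCA mulrA.
have := ho g hg; rewrite dotBl // => /eqP; rewrite subr_eq0 => /eqP e.
rewrite (dotC Lu Lg) e; exact: (esym (dotC Lh Lg)).
Qed.

Lemma dotB0 f g h : H2 f -> H2 g -> H2 h ->
  H2dot (f - g) h = 0 <-> L2dot (bd f) (bd h) = L2dot (bd g) (bd h).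
Proof.
move=> hf hg hh; have Lh := bd_L2 hh.
rewrite (H2dotE (H2B hf hg) hh) (dot_ae (bdB hf hg) (ae_all (fun z => erefl (bd h z)))).
rewrite (dotBl (bd_L2 hf) (bd_L2 hg) Lh); split=> [h0|->]; last exact: subrr.
by apply/eqP; rewrite -subr_eq0 h0.
Qed.

Lemma H2proj_spec V f : closed_subspace V -> H2 f ->
  V (H2proj V f) /\ forall h, V h -> L2dot (bd f) (bd h) = L2dot (bd (H2proj V f)) (bd h).
Proof.
move=> hV hf; have VH g := @closed_sub_H2 V g hV.
have Lf := bd_L2 hf; have [v [Vv hv]] := H2_projection hV Lf.
have ex : exists g, [set g | V g /\ forall h, V h -> H2dot (f - g) h = 0] g.
  exists v; split=> // h Vh; apply: (dotB0 hf (VH _ Vv) (VH _ Vh)).2.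
  have := hv h Vh; rewrite (dotBl Lf (bd_L2 (VH _ Vv)) (bd_L2 (VH _ Vh))) => h0.
  by apply/eqP; rewrite -subr_eq0 h0.
have [h1 h2] : V (H2proj V f) /\ forall h, V h -> H2dot (f - H2proj V f) h = 0 :=
  @xgetPex _ (fun=> 0) _ ex.
split; first exact: h1.
by move=> h Vh; exact: ((dotB0 hf (VH _ h1) (VH _ Vh)).1 (h2 h Vh)).
Qed.

Lemma H2perpP V f : closed_subspace V -> H2perp V f <->
  H2 f /\ forall h, V h -> L2dot (bd f) (bd h) = 0.
Proof.
move=> hV; split=> -[hf h]; (split; first exact: hf); move=> g Vg; have hg := closed_sub_H2 hV Vg.
  by rewrite -(H2dotE hf hg); exact: h.
by rewrite (H2dotE hf hg); exact: h.
Qed.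

Lemma H2perp_lin V a f g : closed_subspace V -> H2perp V f -> H2perp V g ->
  H2perp V (fun z => a * f z + g z).
Proof.
move=> hV /(H2perpP _ hV)[hf pf] /(H2perpP _ hV)[hg pg]; apply: (H2perpP _ hV).2.
have hl := H2D (H2Z a hf) hg; split; first exact: hl.
move=> h Vh; have Lh := bd_L2 (closed_sub_H2 hV Vh).
rewrite (dot_ae (bd_lin a hf hg) (ae_all (fun z => erefl (bd h z)))).
rewrite (dotDl (L2Z a (bd_L2 hf)) (bd_L2 hg) Lh) (dotZl a (bd_L2 hf) Lh) pf // pg //.
by rewrite mulr0 addr0.
Qed.

Lemma H2perp_zero V : closed_subspace V -> H2perp V (fun=> 0).
Proof.
move=> hV; apply: (H2perpP _ hV).2; have h0 := H2_zero; split; first exact: h0.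
move=> h Vh; have Lh := bd_L2 (closed_sub_H2 hV Vh).
have b0 : (\ae z, bd (fun=> 0) z = 0 * bd h z).
  have := bdZ 0 h0; under [X in bdfun X]eq_fun do rewrite mul0r.
  by apply: ae_mono => z ->; rewrite !mul0r.
by rewrite (dot_ae b0 (ae_all (fun z => erefl (bd h z)))) (dotZl 0 Lh Lh) mul0r.
Qed.

(** Stability of Q under the adjoints of the coordinates is stability of Q^perp under the
    coordinates, which generate the polynomials. *)
Lemma perp_pmul Q p f : quotient_module sigma Q -> ispoly p -> H2perp Q f ->
  H2perp Q (fun z => p z * f z).
Proof.
move=> [hQ _ hadj] hp; move: p hp f; apply: ispoly_ind => [c|i|p q IHp IHq|p q IHp IHq] f hf.
- have := H2perp_lin c hQ hf (H2perp_zero hQ).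
  by under eq_fun do rewrite addr0.
- have [h0 h1] := (H2perpP f hQ).1 hf; apply: (H2perpP _ hQ).2.
  have [hm _] := H2_pmul (ispoly_coord i) h0; split; first exact: hm.
  move=> g Qg; have hg := closed_sub_H2 hQ Qg; have [ha e] := adjoint_spec i hg.
  rewrite -(H2dotE hm hg) (e f h0) (H2dotE h0 ha); apply: h1; exact: hadj.
- have -> : (fun z => (p z + q z) * f z) = (fun z => 1 * (p z * f z) + q z * f z).
    by apply/funext => z; rewrite mul1r mulrDl.
  exact: (H2perp_lin 1 hQ (IHp f hf) (IHq f hf)).
- have -> : (fun z => (p z * q z) * f z) = (fun z => p z * (q z * f z)).
    by apply/funext => z; rewrite mulrA.
  by apply: IHp; exact: IHq.
Qed.

(** Dilate by r, truncate with error 1 - r and multiply by r: the modulus on the closed ball is at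
    most r (2 - r) = 1 - (1 - r)^2 < 1. *)
Lemma schur_poly_seq phi : schur_class phi -> exists (P : nat -> Cfun R n) (rho : nat -> R),
  [/\ forall j, ispoly (P j), forall j, rho j < 1, forall j z, enorm z <= 1 -> normc (P j z) <= rho j &
    forall z, cball z -> P j z @[j --> \oo] ~~> phi z].
Proof.
move=> sp; have ha := sp.1.1; have [F hF] := analytic_expands ha.
pose dl (j : nat) : R := j.+2%:R^-1; pose r j : R := 1 - dl j.
have d0 j : 0 < dl j by rewrite invr_gt0 ltr0n.
have d1 j : dl j < 1 by rewrite invf_lt1 ?ltr0n // ltr1n.
have r0 j : 0 < r j by rewrite subr_gt0.
have r1 j : r j < 1 by rewrite ltrBlDr ltrDl.
have /choice[K hK] : forall j, exists K, forall z, enorm z <= r j -> normc (phi z - psum F K z) <= dl j.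
  by move=> j; have [K h] := expands_unif hF (r1 j) (d0 j); exists K; apply: h.
have in_r j z : enorm z <= 1 -> enorm ((r j)%:C *: z) <= r j.
  by move=> z1; rewrite (enormZR _ (ltW (r0 j))) (ler_piMr (ltW (r0 j))).
exists (fun j z => (r j)%:C * dil (r j) (psum F (K j)) z), (fun j => r j * (1 + dl j)); split=> [j|j|j z z1|z zb].
- by apply: ispolyZ; rewrite dil_psum; [apply: psum_poly => k; apply: hpolyZ|]; exact: hF.1.
- by rewrite /r; move: (d0 j); nra.
- rewrite normcM normcR gtr0_norm // ler_pM2l //.
  have -> : dil (r j) (psum F (K j)) z = phi ((r j)%:C *: z) - (phi ((r j)%:C *: z) - psum F (K j) ((r j)%:C *: z)).
    by rewrite /dil; ring.
  by apply: normcB_le; apply: lerD; [exact: schur_le|exact: (hK _ _ (in_r j z z1))].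
apply/cvgcP => e e1; have e2 := half_gt0 e1.
have [d dd hd] := polyapprox_cont (analytic_polyapprox ha) zb e2.
have m0 : 0 < Num.min d (e / 4) by rewrite lt_min dd divr_gt0.
have inf := near_infty_natSinv_lt (PosNum m0).
near=> j; have : dl j < Num.min d (e / 4).
  apply: (@le_lt_trans _ _ (j.+1%:R^-1)); last by near: j; exact: inf.
  by rewrite lef_pV2 ?posrE ?ltr0n // ler_nat.
rewrite lt_min => /andP[jd je].
pose y := (r j)%:C *: z.
have rj : r j - 1 = - dl j by rewrite /r addrAC subrr add0r.
have h1 : normc (phi y - phi z) < e / 2.
  apply: hd; rewrite /y -[X in _ - X]scale1r -scalerBl enormZ -rmorphB normcR rj normrN gtr0_norm //.
  by apply: le_lt_trans jd; rewrite ler_piMr ?ltW.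
have h2 := hK j _ (in_r j z (ltW zb)); have h3 := schur_le y sp.
have -> : (r j)%:C * psum F (K j) y - phi z = (phi y - phi z) +
    ((- dl j)%:C * phi y - (r j)%:C * (phi y - psum F (K j) y)).
  have -> : (- dl j)%:C = (r j)%:C - 1 :> R[i] by rewrite -(rmorph1 (real_complex R)) -rmorphB rj.
  by ring.
apply: normcD_lt; rewrite [e]splitr; apply: ltr_leD h1 _.
apply: normcB_le; rewrite !normcM !normcR normrN (gtr0_norm (d0 j)) (gtr0_norm (r0 j)).
apply: (le_via (dl j + dl j)); last by move: je; lra.
apply: lerD; first by rewrite ler_piMr // ltW.
by apply: le_trans h2; rewrite ler_piMl // ltW.
Unshelve. all: by end_near.
Qed.

(** Otherwise some g keeps a subsequence away from the limit; its ultrafilter limit agrees with f on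
    D, hence is f. D is the whole ball for inner functions and a countable dense set for extremal
    ones. *)
Lemma bounded_seq_weak_on (D : set (Cn R n)) fs f B : (forall j, H2 (fs j)) -> (forall j, H2norm (fs j) <= B) -> H2 f ->
  (forall z, D z -> fs j z @[j --> \oo] ~~> f z) ->
  (forall g, H2 g -> (forall z, D z -> g z = f z) -> g = f) ->
  forall g, H2 g -> (H2dot (fs j) g) @[j --> \oo] ~~> H2dot f g.
Proof.
move=> hfs hB hf hz hD g hg; apply: contrapT => nc.
have [e e0 he] : exists2 e, 0 < e & forall N : nat, exists j : nat, (N <= j)%N /\ e <= normc (H2dot (fs j) g - H2dot f g).
  apply: contrapT => ne; apply: nc; apply/cvgcP => e e0.
  apply: contrapT => hN; apply: ne; exists e => // N; apply: contrapT => hj; apply: hN.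
  near=> j; rewrite ltNge; apply/negP => ej; apply: hj; exists j; split=> //.
  by near: j; exact: nbhs_infty_ge.
have /choice[s hs'] := he.
have [U [UU hU]] := @ultraFilterLemma nat \oo _.
have [f' [hf' _ p1 w1]] := ulim_H2 UU (fun j => hfs (s j)) (fun j => hB (s j)).
have s_oo (P : set nat) : \oo P -> \forall j \near U, P (s j).
  move=> -[N _ hN]; apply: hU; exists N => // j /= Nj; apply: hN => /=.
  exact: (leq_trans Nj (hs' j).1).
have ff : f' = f.
  apply: hD => [|z zb]; first exact: hf'.
  have c2 : (fs (s j) z) @[j --> U] ~~> f z.
    by apply/cvgcP => d d0; have /cvgcP/(_ d d0) := hz z zb; exact: s_oo.
  exact: (cvg_unique _ (p1 z) c2).
have /cvgcP/(_ e e0) := w1 g hg.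
move=> /filter_ex[j]; rewrite ff ltNge => /negP; apply; exact: (hs' j).2.
Unshelve. all: by end_near.
Qed.

Lemma bounded_seq_weak fs f B : (forall j, H2 (fs j)) -> (forall j, H2norm (fs j) <= B) -> H2 f ->
  (forall z, cball z -> fs j z @[j --> \oo] ~~> f z) ->
  forall g, H2 g -> (H2dot (fs j) g) @[j --> \oo] ~~> H2dot f g.
Proof.
move=> hfs hB hf hz; apply: (bounded_seq_weak_on hfs hB hf hz) => g hg gf.
apply/funext => z; have [zb|zb] := pselect (cball z); first exact: gf.
by rewrite (H2_out hf zb) (H2_out hg zb).
Qed.

Lemma perp_cvg V fs f B : closed_subspace V ->
  (forall j, H2perp V (fs j)) -> (forall j, H2norm (fs j) <= B) -> H2 f ->
  (forall z, cball z -> fs j z @[j --> \oo] ~~> f z) -> H2perp V f.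
Proof.
move=> hV hp hB hf hz; have h1 j := (H2perpP (fs j) hV).1 (hp j).
split; first exact: hf.
move=> g Vg; have hg := closed_sub_H2 hV Vg.
have c := bounded_seq_weak (fun j => (h1 j).1) hB hf hz hg.
apply/eqP; rewrite -normc_eq0 eq_le normc_ge0 andbT; apply: (ulim_le c).
by apply: filterE => j; rewrite ((hp j).2 g Vg) normc0.
Qed.

Lemma perp_mul Q phi f : quotient_module sigma Q -> schur_class phi ->
  H2perp Q f -> H2perp Q (fun z => phi z * f z).
Proof.
move=> hQ sp hf; have ha := sp.1.1; have hM z := schur_le z sp; have [cQ _ _] := hQ; have [h0 _] := (H2perpP f cQ).1 hf.
have [P [rho [hP rM bP cP]]] := schur_poly_seq sp; have [hm _] := H2M ha hM h0.
apply: (@perp_cvg _ (fun j z => P j z * f z) _ (1 * H2norm f) cQ _ _ hm).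
- by move=> j; exact: perp_pmul.
- move=> j; rewrite (cut_mul (P j) h0); have hc := cut_analytic (polyapprox_poly (hP j)).
  have hb z : normc (cut (P j) z) <= 1.
    have [zb|zb] := pselect (cball z); last first.
      by rewrite cut_out // normc0 ler01.
    by rewrite cut_in //; apply: le_trans (bP j z (ltW zb)) (ltW (rM j)).
  by have [_] := H2M hc hb h0.
- by move=> z zb; apply: cvgM; [exact: cP|exact: cvg_cst].
Qed.

(** * M_Q as an annihilator *)

Lemma bd_H2S f : H2 f -> H2S (bd f).
Proof.
move=> hf; have Lf := bd_L2 hf; split; first exact: Lf.
move=> e e0; have [F hF] := H2_expands hf; have e2 := half_gt0 e0.
have [K hK] := bd_approx hf hF e2; have [p pE] := psum_poly K hF.1; exists p.
rewrite -pE (cLnorm2E (L2B Lf (psum_L2 K hF.1))) lte_fin.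
by apply: le_lt_trans (hK K (leqnn _)) _; rewrite ltr_pdivrMr // ltr_pMr // ltr1n.
Qed.

Lemma H2S_cst c : H2S (fun=> c).
Proof.
split; first exact: L2_cst.
move=> e e0; exists (mpoly.mpolyC n c).
have -> : ((fun=> c) - mpolyf (mpoly.mpolyC n c) : Cfun R n) = (fun=> 0).
  apply/funext => z; rewrite -[LHS]/(c - mpoly.meval _ (mpoly.mpolyC n c)).
  by rewrite mpoly.mevalC subrr.
by rewrite (cLnorm2E (L2_cst 0)) lte_fin /l2 /sqn normc0 expr0n /= Rint_cst sqrtr0.
Qed.

Lemma H2S_orth u f : H2S u -> L2 f -> (forall p, ispoly p -> L2dot p f = 0) -> L2dot u f = 0.
Proof.
move=> [Lu hu] Lw h; apply: eqc_small => e e0; rewrite subr0.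
have l1 : 0 < l2 f + 1 by rewrite ltr_wpDl // l2_ge0.
have [p hp] := hu (e / (l2 f + 1)) (divr_gt0 e0 l1).
have pp : ispoly (mpolyf p) by exists p.
have Lp := L2_poly pp; have Ld := L2B Lu Lp.
move: hp; rewrite (cLnorm2E Ld) lte_fin => hp.
have -> : L2dot u f = L2dot (fun z => u z - mpolyf p z) f by rewrite (dotBl Lu Lp Lw) (h _ pp) subr0.
apply: le_trans (CS_l2 Ld Lw) _; apply: (le_via (e / (l2 f + 1) * (l2 f + 1))); last by rewrite divfK // gt_eqF.
by apply: ler_pM; rewrite ?lerDl ?ler01 //; exact: ltW.
Qed.

(** For polynomials the integrals are values at 0; the factors are then replaced one at a time, by
    density. *)
Lemma H2S_mult u v : H2S u -> H2S v ->
  cintegral (fun z => u z * v z) = cintegral u * cintegral v.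
Proof.
have key f g : H2S f -> L2 g ->
    (forall p, ispoly p -> cintegral (fun z => p z * g z) = cintegral p * cintegral g) ->
    cintegral (fun z => f z * g z) = cintegral f * cintegral g.
  move=> hf Lg h; pose c := cintegral g.
  have E y : L2 y -> L2dot y (fun z => (g z)^* - c^*) = cintegral (fun z => y z * g z) - cintegral y * c.
    move=> Ly; rewrite (dotBr (L2_conj Lg) (L2_cst c^*) Ly); congr (_ - _).
      by rewrite /L2dot; under eq_fun do rewrite conjcK'.
    rewrite /L2dot; under eq_fun do rewrite conjcK' mulrC.
    by rewrite (cintegralZ _ (L2_cI Ly)) mulrC.
  have Lw := L2B (L2_conj Lg) (L2_cst c^*).
  have := H2S_orth hf Lw; rewrite (E f hf.1) => h0; apply/eqP; rewrite -subr_eq0; apply/eqP; apply: h0 => p pp.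
  by rewrite (E p (L2_poly pp)) h // subrr.
move=> hu hv; apply: (key u v hu hv.1) => p pp.
under eq_fun do rewrite mulrC; rewrite mulrC; apply: (key v p hv (L2_poly pp)) => q qq.
by rewrite (cintegral_poly (ispolyM qq pp)) (cintegral_poly pp) (cintegral_poly qq).
Qed.

Lemma int_bd_MS f m : H2 f -> MS sigma m -> cintegral (fun z => bd f z * m z) = 0.
Proof.
move=> hf [Lm h]; rewrite -[RHS](h (fun z => (bd f z)^*)).
  by rewrite /L2dot; congr cintegral; apply/funext => z; rewrite conjcK' mulrC.
exists (fun=> 0); first exact: H2S_cst.
exists (fun z => (bd f z)^*); first by exists (bd f) => //; exact: bd_H2S.
by apply/funext => z; rewrite fctE /= add0r.
Qed.

Lemma int_H2S0 h : H2S0 sigma h -> cintegral h = 0.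
Proof.
move=> [_ /(_ (fun=> 1) (erefl _)) e]; rewrite -e /L2dot; congr cintegral.
by apply/funext => z; rewrite rmorph1 mulr1.
Qed.

Lemma int_bd_H2S0 f h : H2 f -> H2S0 sigma h -> cintegral (fun z => bd f z * h z) = 0.
Proof. by move=> hf h0; rewrite (H2S_mult (bd_H2S hf) h0.1) (int_H2S0 h0) mulr0. Qed.

(** M(S) is orthogonal to conjugates of Hardy functions and H^2_0 has mean 0, so an analytic
    function sees only the component in Q^conj. *)
Lemma pairingE phi u m h : H2 phi -> L2 u -> MS sigma m -> H2S0 sigma h ->
  pairing phi (fun z => (u z)^* + (m z + h z)) = L2dot (bd phi) u.
Proof.
move=> hp Lu hm h0; have Lp := bd_L2 hp; have Lm := hm.1; have Lh := h0.1.1.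
have i1 := L2_mulI Lp Lm; have i2 := L2_mulI Lp Lh; have i3 := L2_mulI Lp (L2_conj Lu).
have i4 : cI (fun z => bd phi z * m z + bd phi z * h z) by exact: cI_D.
rewrite /pairing (@cintegral_ae _ (fun z => bd phi z * (u z)^* + (bd phi z * m z + bd phi z * h z))); last first.
  by apply: ae_mono (bd_bdry hp) => z ->; rewrite !mulrDr.
by rewrite (cintegralD i3 i4) (cintegralD i1 i2) (int_bd_MS hp hm) (int_bd_H2S0 hp h0) !addr0.
Qed.

Lemma perp_perp Q f : closed_subspace Q -> H2 f ->
  (forall g, H2perp Q g -> L2dot (bd f) (bd g) = 0) -> Q f.
Proof.
move=> cQ hf h; have [Qp pp] := H2proj_spec cQ hf; set q := H2proj Q f in Qp pp *.
have hq := closed_sub_H2 cQ Qp; have Lf := bd_L2 hf; have Lq := bd_L2 hq.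
have hd := H2B hf hq; have Ld := bd_L2 hd; have ad := bdB hf hq.
have pd : H2perp Q (fun z => f z - q z).
  apply: (H2perpP _ cQ).2; split; first exact: hd.
  move=> g Qg; have Lg := bd_L2 (closed_sub_H2 cQ Qg).
  by rewrite (dot_ae ad (ae_all (fun z => erefl (bd g z)))) (dotBl Lf Lq Lg) (pp _ Qg) subrr.
have s0 : sqn (bd (fun z => f z - q z)) = 0.
  have : (sqn (bd (fun z => f z - q z)))%:C = 0.
    rewrite -dot_sqn (dot_ae ad (ae_all (fun z => erefl _))) (dotBl Lf Lq Ld) (h _ pd) sub0r.
    rewrite (dotC Ld Lq) ((H2perpP _ cQ).1 pd).2 //.
    by rewrite rmorph0 oppr0.
  by move=> /(congr1 (@Re R)).
suff -> : f = q by [].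
apply: (H2_ext hf hq); apply: ae_mono (ae_and ad (sqn0_ae Ld s0)) => z [-> /eqP].
by rewrite subr_eq0 => /eqP.
Qed.

(** The H^2 projection q of h is orthogonal to Q^perp, hence in Q. The conjugate y of h - q is
    orthogonal to conjugates of Hardy functions, in particular to 1; so its own projection p has
    mean 0, and y - p is orthogonal to Hardy functions and to their conjugates. *)
Lemma MQ_of_orth Q h : closed_subspace Q -> L2 h ->
  (forall g, H2perp Q g -> L2dot h (bd g) = 0) -> MQ Q (fun z => (h z)^*).
Proof.
move=> cQ Lw hw; have [q [hq oq]] := H2_projection H2_closed Lw; have Lq := bd_L2 hq.
have Qq : Q q.
  apply: (perp_perp cQ hq) => g pg; have Lg := bd_L2 pg.1.
  by have := oq g pg.1; rewrite (dotBl Lw Lq Lg) (hw _ pg) sub0r => /eqP; rewrite oppr_eq0 => /eqP.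
pose y z := (h z)^* - (bd q z)^*; have Ly : L2 y by apply: L2B; exact: L2_conj.
have [p [hp op]] := H2_projection H2_closed Ly; have Lp := bd_L2 hp.
have Lm := L2B Ly Lp.
have y_conj g : H2S g -> L2dot y (fun z => (g z)^*) = 0.
  move=> Sg; have Lc := L2_conj Ly.
  have -> : L2dot y (fun z => (g z)^*) = L2dot g (fun z => (y z)^*).
    by rewrite /L2dot; congr cintegral; apply/funext => z; rewrite !conjcK' mulrC.
  apply: (H2S_orth Sg Lc) => r pr; have hr := cut_poly_H2 pr; have Lr := L2_poly pr.
  have Ld := L2B Lw Lq; have yE : (fun z => (y z)^*) = (fun z => h z - bd q z).
    by apply/funext => z; rewrite /y conjcB !conjcK'.
  rewrite yE (dotC Ld Lr) -(dot_ae (ae_all (fun z => erefl (h z - bd q z))) (bd_poly pr)).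
  by rewrite (oq _ hr) rmorph0.
have p0 : cintegral (bd p) = 0.
  have H1 := H2S_cst 1.
  have L1 := L2_cst (1 : R[i]).
  have h1 := y_conj _ H1; have p1 : ispoly ((fun=> 1) : Cfun R n) by exact: ispoly_cst.
  have := op _ (cut_poly_H2 p1).
  rewrite (dot_ae (ae_all (fun z => erefl (y z - bd p z))) (bd_poly p1)) (dotBl Ly Lp L1).
  move: h1; under [X in L2dot _ X]eq_fun do rewrite rmorph1; move=> ->.
  rewrite sub0r /L2dot => /eqP; rewrite oppr_eq0 => /eqP.
  by under [X in cintegral X]eq_fun do rewrite rmorph1 mulr1.
have Sp := bd_H2S hp.
exists (fun z => (bd q z)^*).
  exists (bd q) => //; split; first exact: Lq.
  by exists q => //; apply: ae_mono (bd_bdry hq) => z ->.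
exists (fun z => (y z - bd p z) + bd p z); last first.
  by apply/funext => z; rewrite fctE /= /y subrK addrC subrK.
exists (fun z => y z - bd p z); last first.
  exists (bd p); last by [].
  split; first exact: Sp.
  move=> _ ->; rewrite -[RHS]p0 /L2dot; congr cintegral.
  by apply/funext => z; rewrite rmorph1 mulr1.
split; first exact: Lm.
move=> v [a Sa [b [g Sg <-]] <-]; have La := Sa.1; have Lg := L2_conj Sg.1.
rewrite (dotDr La Lg Lm); apply/eqP; rewrite addrC; apply/eqP.
have -> : L2dot (fun z => y z - bd p z) a = 0.
  rewrite (dotC La Lm) (H2S_orth Sa Lm) ?rmorph0 // => r pr; have Lr := L2_poly pr.
  rewrite (dotC Lm Lr) -(dot_ae (ae_all (fun z => erefl (y z - bd p z))) (bd_poly pr)).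
  by rewrite (op _ (cut_poly_H2 pr)) rmorph0.
rewrite addr0 (dotBl Ly Lp Lg) (y_conj _ Sg) sub0r.
have -> : L2dot (bd p) (fun z => (g z)^*) = cintegral (fun z => bd p z * g z).
  by rewrite /L2dot; congr cintegral; apply/funext => z; rewrite conjcK'.
by rewrite (H2S_mult Sp Sg) p0 mul0r oppr0.
Qed.

(** * Inner functions are dense *)

Lemma sum_inv_sq (B : nat) : \sum_(k < B.+1) (1 + k%:R ^+ 2)^-1 <= 4 - 2 / B.+1%:R :> R.
Proof.
elim: B => [|B IH]; first by rewrite big_ord1 expr0n addr0 invr1; lra.
rewrite big_ord_recr /=; have step : (1 + B.+1%:R ^+ 2)^-1 <= 2 / B.+1%:R - 2 / B.+2%:R :> R.
  have b0 : 0 < B.+1%:R :> R by rewrite ltr0n.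
  rewrite -[B.+2%:R]natr1; move: (B.+1%:R) b0 => b b0.
  have b1 : 0 < b + 1 by lra.
  have -> : 2 / b - 2 / (b + 1) = 2 / (b * (b + 1)) by field; rewrite !gt_eqF.
  have c0 : 0 < 1 + b ^+ 2 by nra.
  rewrite -[leLHS]mul1r ler_pdivrMr // mulrAC ler_pdivlMr ?mulr_gt0 //; nra.
by apply: le_trans (lerD IH step) _; rewrite addrA subrK.
Qed.

Definition recoord z (p : 'I_n * bool) : R := if p.2 then Re (z 0 p.1) else Im (z 0 p.1).

Lemma enorm_recoord z : enorm z ^+ 2 = \sum_p recoord z p ^+ 2.
Proof.
rewrite enorm_sqr -(pair_bigA _ (fun i b => recoord z (i, b) ^+ 2)) /=; apply: eq_bigr => i _.
by rewrite big_bool /recoord /= normc_sqr.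
Qed.

Definition gridk (K : nat) (x : R) : nat := Num.truncn (K%:R * `|x|).

Lemma inv_sq_le (a y k : R) : 1 <= a -> 0 <= k -> k <= a * y -> (1 + y ^+ 2)^-1 <= a ^+ 2 * (1 + k ^+ 2)^-1.
Proof.
move=> a1 k0 ky.
have c0 : 0 < 1 + y ^+ 2 by nra.
have d0 : 0 < 1 + k ^+ 2 by nra.
rewrite -[leLHS]mul1r ler_pdivrMr // mulrAC ler_pdivlMr // mul1r.
have ay : 0 <= a * y := le_trans k0 ky.
have : k ^+ 2 <= (a * y) ^+ 2 by rewrite ler_sqr ?nnegrE.
by nra.
Qed.

Lemma gridk_le K x : (0 < K)%N -> (1 + x ^+ 2)^-1 <= K%:R ^+ 2 * (1 + (gridk K x)%:R ^+ 2)^-1.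
Proof.
move=> K0; have h0 : 0 <= K%:R * `|x| by rewrite mulr_ge0.
have := truncn_itv h0; rewrite -/(gridk K x) => /andP[h1 _].
have e : x ^+ 2 = `|x| ^+ 2 by rewrite real_normK // num_real.
by rewrite e; apply: inv_sq_le => //; rewrite ler1n.
Qed.

Lemma gridk_close K x y : (0 < K)%N -> (0 <= x) = (0 <= y) -> gridk K x = gridk K y -> `|x - y| < K%:R^-1.
Proof.
move=> K0 sg g; have hx : 0 <= K%:R * `|x| by rewrite mulr_ge0.
have hy : 0 <= K%:R * `|y| by rewrite mulr_ge0.
have := truncn_itv hx; have := truncn_itv hy; rewrite -/(gridk K x) -/(gridk K y) g -natr1.
move: (gridk K y)%:R => k /andP[h1 h2] /andP[h3 h4].
have kp : 0 < K%:R :> R by rewrite ltr0n.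
rewrite -[K%:R^-1]mul1r ltr_pdivlMr // mulrC.
have -> : `|x - y| = `| `|x| - `|y| |.
  move: sg; have [x0|x0] := leP 0 x; have [y0|y0] := leP 0 y => // _.
    by rewrite (ger0_norm x0) (ger0_norm y0).
  by rewrite (ltr0_norm x0) (ltr0_norm y0) -opprD normrN.
rewrite -[K%:R in ltLHS]gtr0_norm // -normrM mulrBr ltr_norml; apply/andP; split; lra.
Qed.

(** Cells of side 1 / K with K = 2 n have diameter below 1, so each holds at most one point. The sum
    over all cells factors over the 2 n real coordinates because the kernel is a product. *)
Lemma lattice_sum : (0 < n)%N -> exists2 W : R, 0 < W & forall (J : nat) (w : 'I_J -> Cn R n),
  (forall i j, i != j -> 1 <= enorm (w i - w j)) -> \sum_j \prod_p (1 + recoord (w j) p ^+ 2)^-1 <= W.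
Proof.
move=> n0; pose K := n.*2; have K0 : (0 < K)%N by rewrite double_gt0.
(* Two signs, at most 4 for the sum over the cell index, and K^2 for replacing a coordinate by its
   cell index. *)
pose c : R := 8 * K%:R ^+ 2; have kp : 0 < K%:R :> R by rewrite ltr0n.
have c0 : 0 < c by rewrite /c mulr_gt0 // exprn_gt0.
exists (c ^+ #|{: 'I_n * bool}|); first by rewrite exprn_gt0.
move=> J w hw.
pose B := \max_j \max_p gridk K (recoord (w j) p).
have gB j p : (gridk K (recoord (w j) p) < B.+1)%N.
  rewrite ltnS; apply: leq_trans (leq_bigmax (F := fun j => \max_p gridk K (recoord (w j) p)) j).
  exact: (leq_bigmax (F := fun p => gridk K (recoord (w j) p)) p).
pose kap (j : 'I_J) : {ffun 'I_n * bool -> bool * 'I_B.+1} :=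
  [ffun p => (0 <= recoord (w j) p, Ordinal (gB j p))].
pose G (y : bool * 'I_B.+1) : R := K%:R ^+ 2 * (1 + (y.2)%:R ^+ 2)^-1.
have G0 y : 0 <= G y by rewrite mulr_ge0 ?sqr_ge0 // invr_ge0 addr_ge0 // sqr_ge0.
have inj : injective kap.
  move=> i j /ffunP e; apply/eqP/negPn/negP => ij; have := hw i j ij; rewrite leNgt => /negP; apply.
  rewrite -[ltRHS](expr1n _ 1%N) expr1 -(@ltr_pXn2r _ 2) ?nnegrE // expr1n enorm_recoord.
  have h p : recoord (w i - w j) p ^+ 2 <= (K%:R ^+ 2)^-1.
    have := e p; rewrite !ffunE => -[sg g].
    have rE : recoord (w i - w j) p = recoord (w i) p - recoord (w j) p.
      by rewrite /recoord !mxE; case: p.2; case: (w i 0 _) => ? ?; case: (w j 0 _) => ? ?.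
    have := gridk_close K0 sg g; rewrite -rE => h.
    by rewrite -(real_normK (num_real (recoord (w i - w j) p))) -exprVn ler_sqr ?nnegrE ?invr_ge0 // ltW.
  apply: (@le_lt_trans _ _ (\sum_(p : 'I_n * bool) (K%:R ^+ 2)^-1)); first by apply: ler_sum => p _; exact: h.
  rewrite sumr_const card_prod card_ord card_bool muln2 -/K -[_ *+ K]mulr_natl expr2 invfM mulrA mulfV ?gt_eqF //.
  by rewrite mul1r invf_lt1 // ltr1n /K -addnn; case: (n) n0 => // m _; rewrite addSn addnS.
apply: (le_via (\sum_j \prod_p G (kap j p))).
  apply: ler_sum => j _; apply: ler_prod => p _; rewrite invr_ge0 addr_ge0 ?sqr_ge0 //=.
  by rewrite ffunE /G /=; exact: gridk_le.
apply: (le_via (\sum_(k : {ffun 'I_n * bool -> bool * 'I_B.+1}) \prod_p G (k p))).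
  pose A : {set {ffun 'I_n * bool -> bool * 'I_B.+1}} := [set kap j | j in [set: 'I_J]%SET]%SET.
  apply: (le_via (\sum_(k in A) \prod_p G (k p))).
    rewrite /A big_imset /=; last by move=> i j _ _; exact: inj.
    by under [leRHS]eq_bigl do rewrite finset.in_setT.
  rewrite [leRHS](bigID (fun k => k \in A)) /= lerDl.
  by apply: sumr_ge0 => k _; apply: prodr_ge0.
rewrite -(bigA_distr_bigA (fun=> G)) prodr_const; apply: lerXn2r; rewrite ?nnegrE ?(ltW c0) ?sumr_ge0 //.
rewrite -(pair_bigA _ (fun b (k : 'I_B.+1) => K%:R ^+ 2 * (1 + k%:R ^+ 2)^-1)) /= big_bool /= -mulr_sumr.
have := sum_inv_sq B; have : 0 <= 2 / B.+1%:R :> R by [].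
have : 0 <= K%:R ^+ 2 :> R by rewrite sqr_ge0.
rewrite /c; move: (K%:R ^+ 2) (\sum_(k < B.+1) _) (2 / _) => a S b a0 b0 Sb; nra.
Qed.

(** Unimodular factors are ignored, as they are by the moduli of powers of [hdot]: a separation in
    projective space, at scale l ^ (-1/2). *)
Definition separated (l J : nat) (zeta : nat -> Cn R n) :=
  (forall j, enorm (zeta j) = 1) /\
  forall i j, (i < J)%N -> (j < J)%N -> i != j -> normc (hdot (zeta i) (zeta j)) ^+ 2 < 1 - (2 * l%:R)^-1.

Lemma unit_phase (x : R[i]) : exists2 u : R[i], normc u = 1 & x = (normc x)%:C * u.
Proof.
have [->|x0] := eqVneq x 0; first by exists 1; rewrite ?normc1 // normc0 mul0r.
have nx : normc x != 0 by rewrite normc_eq0.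
have cx : (normc x)%:C != 0 :> R[i] by rewrite -normc_eq0 normcR normr_eq0.
exists (x / (normc x)%:C); last by rewrite mulrC divfK.
have := congr1 (fun t : R[i] => normc t) (divfK cx x); rewrite normcM normcR ger0_norm // => e.
by apply: (mulIf nx); rewrite e mul1r.
Qed.

Lemma sep_dist (l : nat) (z w : Cn R n) (u v : R[i]) : (0 < l)%N -> enorm z = 1 -> enorm w = 1 -> normc u = 1 -> normc v = 1 ->
  normc (hdot z w) ^+ 2 < 1 - (2 * l%:R)^-1 -> (2 * l%:R)^-1 <= enorm (u *: z - v *: w) ^+ 2.
Proof.
move=> l0 z1 w1 u1 v1 h; rewrite enormD_sqr enormN !enormZ u1 v1 z1 w1 !mul1r expr1n.
rewrite -scaleNr hdotZl hdotZr.
have c : normc (u * ((- v)^* * hdot z w)) = normc (hdot z w) by rewrite !normcM normcJ' normcN u1 v1 !mul1r.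
have := Re_le_normc (u * ((- v)^* * hdot z w)); rewrite c ler_norml => /andP[h1 _].
have := normc_ge0 (hdot z w); have := normc_hdot_le z w; rewrite z1 w1 mulr1.
move: h h1; move: (Re _) (normc _) (_^-1) => a b d; nra.
Qed.

Lemma enormZ_sqrt (l : nat) z : enorm ((Num.sqrt (2 * l%:R))%:C *: z) ^+ 2 = 2 * l%:R * enorm z ^+ 2.
Proof. by rewrite enormZ normcR exprMn real_normK ?num_real // sqr_sqrtr // mulr_ge0. Qed.

Lemma sep_dist1 (l : nat) z : (0 < l)%N -> (2 * l%:R)^-1 <= enorm z ^+ 2 -> 1 <= enorm ((Num.sqrt (2 * l%:R))%:C *: z).
Proof.
move=> l0 h; rewrite -(@ler_pXn2r _ 2) ?nnegrE ?ler01 // expr1n enormZ_sqrt.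
by rewrite -ler_pdivrMl ?mulr1 // mulr_gt0 // ltr0n.
Qed.

Lemma bernoulli_inv t (k : nat) : 0 <= t -> t <= 1 -> (1 - t) ^+ k * (1 + k%:R * t) <= 1.
Proof.
move=> t0 t1; elim: k => [|k IH]; first by rewrite expr0 mul0r addr0 mulr1.
have p0 : 0 <= (1 - t) ^+ k by rewrite exprn_ge0 // subr_ge0.
apply: le_trans IH; rewrite [(1 - t) ^+ k.+1]exprSr -mulrA ler_wpM2l // -[k.+1%:R]natr1.
by have k0 : 0 <= k%:R :> R by []; move: (k%:R) k0 => a a0; nra.
Qed.

Lemma recoord_sqr_le z p : recoord z p ^+ 2 <= enorm z ^+ 2.
Proof.
rewrite enorm_recoord (bigD1 p) //= lerDl; apply: sumr_ge0 => q _; exact: sqr_ge0.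
Qed.

Lemma prod_recoord (a : R) : \prod_(p : 'I_n * bool) a = a ^+ (n * 2).
Proof. by rewrite prodr_const card_prod card_ord card_bool. Qed.

(** With s = |<z, w>| and a suitable phase u, |u w - z|^2 = 2 - 2 s. The exponent 16 n l allots
    (s^2) ^ (4 l) to each of the 2 n real coordinates, and Bernoulli's inequality compares this with
    one factor of the kernel at scale sqrt (2 l). *)
Lemma sep_term (l : nat) z w : enorm z = 1 -> enorm w = 1 -> exists2 u : R[i], normc u = 1 &
  normc (hdot z w) ^+ (16 * n * l) <= \prod_p (1 + recoord ((Num.sqrt (2 * l%:R))%:C *: (u *: w - z)) p ^+ 2)^-1.
Proof.
move=> z1 w1; have [u u1 uE] := unit_phase (hdot z w); exists u => //.
set s := normc (hdot z w) in uE *; have s0 : 0 <= s := normc_ge0 _.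
have s1 : s <= 1 by have := normc_hdot_le z w; rewrite z1 w1 mulr1.
have E : enorm (u *: w - z) ^+ 2 = 2 - 2 * s.
  rewrite enormB enormD_sqr enormN enormZ u1 mul1r z1 w1 expr1n hdotNr hdotZr uE mulrCA.
  by rewrite [u^* * u]mulrC mulcJ u1 expr1n mulr1 ReN /=; ring.
have t0 : 0 <= 1 - s ^+ 2 by nra.
have t1 : 1 - s ^+ 2 <= 1 by nra.
have -> : (16 * n * l = 2 * (4 * l * (n * 2)))%N by lia.
rewrite exprM; have -> : s ^+ 2 = 1 - (1 - s ^+ 2) by ring.
rewrite exprM -prod_recoord.
apply: ler_prod => p _; rewrite exprn_ge0 ?subr_ge0 //=.
have h := bernoulli_inv (4 * l) t0 t1; have hr := recoord_sqr_le ((Num.sqrt (2 * l%:R))%:C *: (u *: w - z)) p.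
rewrite enormZ_sqrt E in hr; set x := recoord _ p in hr *.
have l0 : 0 <= l%:R :> R by [].
have q0 : 0 < 1 + x ^+ 2 by rewrite ltr_wpDr ?sqr_ge0.
rewrite -[leRHS]mul1r ler_pdivlMr //; apply: le_trans h; rewrite ler_wpM2l ?exprn_ge0 ?subr_ge0 //.
rewrite lerD2l; apply: le_trans hr _; rewrite natrM.
have s2 : 0 <= 1 - s by rewrite subr_ge0.
have := mulr_ge0 l0 (mulr_ge0 s0 s2); move: (l%:R) l0 => a a0; nra.
Qed.

(** W does not depend on l: however high the degree, the peaks that act at one point have a bounded
    sum. The bound on J serves the existence of maximal separated sets. *)
Lemma sep_sum : (0 < n)%N -> exists2 W : R, 0 < W & forall (l J : nat) (zeta : nat -> Cn R n), (0 < l)%N ->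
  separated l J zeta ->
  (forall z, enorm z = 1 -> \sum_(j < J) normc (hdot z (zeta j)) ^+ (16 * n * l) <= W) /\
  J%:R <= W * (1 + 2 * l%:R) ^+ (n * 2).
Proof.
move=> n0; have [W W0 hW] := lattice_sum n0; exists W => // l J zeta l0 [z1 hz]; split=> [z zz|].
  have /choice[u hu] : forall j : 'I_J, exists u : R[i], normc u = 1 /\ normc (hdot z (zeta j)) ^+ (16 * n * l) <=
      \prod_p (1 + recoord ((Num.sqrt (2 * l%:R))%:C *: (u *: zeta j - z)) p ^+ 2)^-1.
    by move=> j; have [u u1 h] := sep_term l zz (z1 j); exists u.
  apply: le_trans (hW J (fun j => (Num.sqrt (2 * l%:R))%:C *: (u j *: zeta j - z)) _).
    by apply: ler_sum => j _; exact: (hu j).2.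
  move=> i j ij; rewrite -scalerBr; apply: sep_dist1 => //.
  rewrite opprB addrA subrK; apply: sep_dist => //; [exact: (hu i).1|exact: (hu j).1|].
  by apply: hz.
have := hW J (fun j => (Num.sqrt (2 * l%:R))%:C *: zeta j) _.
have A : 0 < 1 + 2 * l%:R :> R by rewrite ltr_wpDr // mulr_ge0.
have B : 0 < (1 + 2 * l%:R) ^+ (n * 2) :> R by rewrite exprn_gt0.
rewrite -ler_pdivrMr //; move=> h; apply: le_trans (h _).
  rewrite -[leLHS]/(J%:R * _) mulr_natl -[in leLHS](card_ord J) -sumr_const; apply: ler_sum => j _.
  rewrite -exprVn -prod_recoord.
  apply: ler_prod => p _; rewrite invr_ge0 (ltW A) /= lef_pV2 ?posrE // ?ltr_wpDr ?sqr_ge0 //.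
  by rewrite lerD2l; apply: le_trans (recoord_sqr_le _ _) _; rewrite enormZ_sqrt z1 expr1n mulr1.
move=> i j ij; rewrite -scalerBr; apply: sep_dist1 => //.
by rewrite -[zeta i]scale1r -[zeta j]scale1r; apply: sep_dist; rewrite ?normc1 // hz.
Qed.

(** If no separated set were maximal, one could be prolonged beyond the bound on J. *)
Lemma max_sep (l : nat) : (0 < n)%N -> (0 < l)%N -> exists (J : nat) (zeta : nat -> Cn R n), separated l J zeta /\
  forall z, enorm z = 1 -> exists2 j, (j < J)%N & 1 - (2 * l%:R)^-1 <= normc (hdot z (zeta j)) ^+ 2.
Proof.
move=> n0 l0; have [W W0 hW] := sep_sum n0; apply: contrapT => no.
have all J : exists zeta : nat -> Cn R n, separated l J zeta.
  elim: J => [|J [zeta hz]]; first by exists (fun=> delta_mx 0 (Ordinal n0)); split=> // j; rewrite enorm_delta.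
  have [z [z1 hzz]] : exists z, enorm z = 1 /\ forall j, (j < J)%N -> normc (hdot z (zeta j)) ^+ 2 < 1 - (2 * l%:R)^-1.
    apply: contrapT => nz; apply: no; exists J, zeta; split=> // z z1; apply: contrapT => nj; apply: nz.
    exists z; split=> // j jJ; rewrite ltNge; apply/negP => h; apply: nj; by exists j.
  have [h1 h2] := hz; exists (fun j => if (j < J)%N then zeta j else z); split=> [j|i j iJ jJ ij]; first by case: ifP.
  case: ltnP => iJ'; case: ltnP => jJ'; [exact: h2|by rewrite hdotC normcJ'; exact: hzz|exact: hzz|].
  by move: ij; rewrite (_ : i = j) ?eqxx //; lia.
pose J := (Num.truncn (W * (1 + 2 * l%:R) ^+ (n * 2))).+1; have [zeta hz] := all J.
have [_] := hW l J zeta l0 hz; rewrite leNgt => /negP; apply; exact: truncnS_gt.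
Qed.

Lemma poly_lipschitz p : ispoly p -> exists2 K : R, 0 <= K & forall z (w : Cn R n), enorm z <= 1 -> enorm w <= 1 ->
  normc (p z - p w) <= K * enorm (z - w).
Proof.
move=> hp; suff [K [B [K0 B0 h1 h2]]] : exists K B : R, [/\ 0 <= K, 0 <= B, forall z, enorm z <= 1 -> normc (p z) <= B &
    forall z (w : Cn R n), enorm z <= 1 -> enorm w <= 1 -> normc (p z - p w) <= K * enorm (z - w)] by exists K.
move: p hp; apply: ispoly_ind => [c|i|f g [K [B [K0 B0 h1 h2]]] [L [D [L0 D0 h3 h4]]]|f g [K [B [K0 B0 h1 h2]]] [L [D [L0 D0 h3 h4]]]].
- by exists 0, (normc c); split=> // z w _ _; rewrite subrr normc0 mul0r.
- exists 1, 1; split=> // [z z1|z w _ _]; first by apply: le_trans z1; exact: normc_le_enorm.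
  by rewrite mul1r /coordf; have := normc_le_enorm (z - w) i; rewrite !mxE.
- exists (K + L), (B + D); split=> [||z z1|z w z1 w1]; rewrite ?addr_ge0 //.
    by apply: normcD_le; apply: lerD; [exact: h1|exact: h3].
  rewrite opprD addrACA mulrDl; apply: normcD_le; apply: lerD; [exact: h2|exact: h4].
- exists (B * L + K * D), (B * D); split=> [||z z1|z w z1 w1]; rewrite ?addr_ge0 ?mulr_ge0 //.
    by rewrite normcM; apply: ler_pM => //; [exact: h1|exact: h3].
  have -> : f z * g z - f w * g w = f z * (g z - g w) + (f z - f w) * g w by ring.
  rewrite [leRHS]mulrDl; apply: normcD_le; rewrite !normcM; apply: lerD.
    by rewrite -mulrA; apply: ler_pM => //; [exact: h1|exact: h4].
  by rewrite mulrAC; apply: ler_pM => //; [exact: h2|exact: h3].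
Qed.

(* Choosing the signs one after the other, the parallelogram law lets every new term increase the square norm by at least its own. *)
Lemma greedy_signs (P : nat -> Cfun R n) (J : nat) : (forall j, L2 (P j)) ->
  exists2 e : nat -> R[i], forall j, normc (e j) = 1 &
    \sum_(j < J) sqn (P j) <= sqn (fun z => \sum_(j < J) e j * P j z).
Proof.
move=> hP; elim: J => [|J [e e1 he]].
  by exists (fun=> 1) => [j|]; rewrite ?normc1 // big_ord0 sqn_ge0.
pose A z := \sum_(j < J) e j * P j z.
have LA : L2 A by apply: L2_sum => j; exact: L2Z.
have [t t1 ht] : exists2 t : R[i], normc t = 1 & sqn A + sqn (P J) <= sqn (fun z => A z + t * P J z).
  have hD := sqnD LA (hP J); have hB := sqnB LA (hP J).
  have [d0|d0] := leP 0 (Re (L2dot A (P J))).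
    exists 1; rewrite ?normc1 //; under [X in _ <= sqn X]eq_fun do rewrite mul1r.
    by rewrite hD; move: d0; clear -hs; lra.
  exists (-1); rewrite ?normcN ?normc1 //; under [X in _ <= sqn X]eq_fun do rewrite mulN1r.
  by rewrite hB; move: d0; clear -hs; lra.
exists (fun j => if (j < J)%N then e j else t) => [j|]; first by case: ifP.
rewrite big_ord_recr /=; apply: le_trans (lerD he (lexx _)) _; apply: le_trans ht _.
apply: eqW; congr sqn; apply/funext => z.
rewrite big_ord_recr /= ltnn /A; congr (_ + _); apply: eq_bigr => j _; by rewrite ltn_ord.
Qed.

(** The room left for a perturbation: |f| + gap f = 1 - (1 - |f|)^2 / 2, which is below 1 when |f| <
    1. *)
Definition gap f z : R := (1 - normc (f z) ^+ 2) / 2.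

(** The gap of f is not analytic, but on the circle of the u zeta it is a trigonometric polynomial
    in u; times u ^ N it has only positive powers once N >= d, and replacing u by <z, zeta> gives a
    polynomial in z whose modulus is close to |<z, zeta>| ^ N gap f. *)
Definition peak F d N zeta z : R[i] := (2^-1)%:C * (hdot z zeta ^+ N -
  \sum_(a < d) \sum_(b < d) hdot z zeta ^+ (N + a - b) * (F a zeta * (F b zeta)^*)).

Lemma hdot_pow_hpoly zeta k : hpoly k (fun z => hdot z zeta ^+ k).
Proof.
split=> [|a z]; last by rewrite hdotZl exprMn.
apply: ispolyX; rewrite /hdot; apply: ispoly_sum => i _.
have -> : (fun z : Cn R n => z 0 i * (zeta 0 i)^*) = (fun z => (zeta 0 i)^* * coordf i z).
  by apply/funext => z; rewrite mulrC.
by apply: ispolyZ; exact: ispoly_coord.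
Qed.

Lemma peak_poly F d N zeta : ispoly (peak F d N zeta).
Proof.
apply: ispolyZ; apply: ispolyB; first exact: (hdot_pow_hpoly zeta N).1.
apply: ispoly_sum => a _; apply: ispoly_sum => b _; apply: ispolyM; last exact: ispoly_cst.
exact: (hdot_pow_hpoly zeta _).1.
Qed.

(** All the degrees N and N + a - b that occur exceed N - d. *)
Lemma peak_orth F d N zeta k q : (k + d <= N)%N -> (0 < d)%N -> hpoly k q -> L2dot (peak F d N zeta) q = 0.
Proof.
move=> kN d0 hq; have Lq := hpoly_L2 hq.
have Lp j := hpoly_L2 (hdot_pow_hpoly zeta j).
have o j : (k < j)%N -> L2dot (fun z => hdot z zeta ^+ j) q = 0.
  by move=> kj; apply: (hpoly_orth (hdot_pow_hpoly zeta j) hq); lia.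
have Lab (a b : 'I_d) : L2 (fun z => hdot z zeta ^+ (N + a - b) * (F a zeta * (F b zeta)^*)).
  have -> : (fun z => hdot z zeta ^+ (N + a - b) * (F a zeta * (F b zeta)^*)) = (fun z => (F a zeta * (F b zeta)^*) * hdot z zeta ^+ (N + a - b)).
    by apply/funext => z; rewrite mulrC.
  exact: L2Z.
have LS (a : 'I_d) : L2 (fun z => \sum_(b < d) hdot z zeta ^+ (N + a - b) * (F a zeta * (F b zeta)^*)).
  by apply: L2_sum => b; exact: Lab.
have LSS : L2 (fun z => \sum_(a < d) \sum_(b < d) hdot z zeta ^+ (N + a - b) * (F a zeta * (F b zeta)^*)).
  by apply: L2_sum => a; exact: LS.
rewrite /peak (dotZl _ (L2B (Lp N) LSS) Lq) (dotBl (Lp N) LSS Lq) o; last by lia.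
rewrite (dot_suml _ LS Lq) big1 ?subr0 ?mulr0 // => a _; rewrite (dot_suml _ (Lab a) Lq) big1 // => b _.
have -> : (fun z => hdot z zeta ^+ (N + a - b) * (F a zeta * (F b zeta)^*)) = (fun z => (F a zeta * (F b zeta)^*) * hdot z zeta ^+ (N + a - b)).
  by apply/funext => z; rewrite mulrC.
by rewrite (dotZl _ (Lp _) Lq) o ?mulr0 //; have := ltn_ord b; lia.
Qed.

Lemma expr_diff_le s (p q d : nat) : 0 <= s -> s <= 1 -> (p <= q + d)%N -> (q <= p + d)%N ->
  `|s ^+ p - s ^+ q| <= d%:R * (1 - s).
Proof.
move=> s0 s1; wlog pq : p q / (p <= q)%N.
  move=> h pd qd; have [pq|qp] := leqP p q; first exact: h.
  by rewrite distrC; apply: h => //; exact: ltnW.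
move=> _ qd; have -> : s ^+ p - s ^+ q = s ^+ p * (1 ^+ (q - p) - s ^+ (q - p)).
  by rewrite mulrBr expr1n mulr1 -exprD subnKC.
rewrite normrM ger0_norm ?exprn_ge0 //; have := pow_diff (q - p) ler01 (lexx 1) s0 s1.
have n0 := normr_ge0 (1 ^+ (q - p) - s ^+ (q - p)); rewrite [`|1 - s|]ger0_norm ?subr_ge0 // => h.
apply: (le_via (`|1 ^+ (q - p) - s ^+ (q - p)|)).
  by rewrite ler_piMl // exprn_ile1.
apply: le_trans h _; apply: ler_wpM2r; first by rewrite subr_ge0.
by rewrite ler_nat; lia.
Qed.

(** Write <z, zeta> = s u. The two expressions differ only in the exponents N + a - b and N of s,
    and s ^ N - s ^ (N + a - b) is at most d (1 - s) s ^ (N - d) in modulus. *)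
Lemma peak_diff F d N zeta z (u : R[i]) (s B : R) : homs F -> (forall k, (k < d)%N -> normc (F k zeta) <= B) ->
  (d <= N)%N -> normc u = 1 -> 0 <= s -> s <= 1 -> hdot z zeta = s%:C * u ->
  normc (peak F d N zeta z - (s ^+ N)%:C * u ^+ N * (gap (psum F d) (u *: zeta))%:C)
    <= d%:R ^+ 3 * B ^+ 2 * (s ^+ (N - d) * (1 - s)).
Proof.
move=> hF hB dN u1 s0 s1 lE.
have uu : u^* * u = 1 by rewrite mulrC mulcJ u1 expr1n.
pose X (a b : nat) : R[i] := u ^+ N * ((u ^+ a * F a zeta) * (u ^+ b * F b zeta)^*).
have E1 : peak F d N zeta z = (2^-1)%:C * ((s ^+ N)%:C * u ^+ N - \sum_(a < d) \sum_(b < d) (s ^+ (N + a - b))%:C * X a b).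
  rewrite /peak lE exprMn -rmorphXn; congr (_ * (_ - _)); apply: eq_bigr => a _; apply: eq_bigr => b _.
  rewrite exprMn -rmorphXn -[LHS]mulrA /X; congr (_ * _); have bd := ltn_ord b.
  have -> : u ^+ (N + a - b) = u ^+ N * u ^+ a * (u^*) ^+ b.
    rewrite -exprD -{2}(@subnK b (N + a)); last by lia.
    by rewrite exprD -mulrA -exprMn [u * _]mulrC uu expr1n mulr1.
  by rewrite conjcM rmorphXn /=; ring.
have E2 : (s ^+ N)%:C * u ^+ N * (gap (psum F d) (u *: zeta))%:C =
    (2^-1)%:C * ((s ^+ N)%:C * u ^+ N - \sum_(a < d) \sum_(b < d) (s ^+ N)%:C * X a b).
  have -> : (gap (psum F d) (u *: zeta))%:C = (2^-1)%:C * (1 - \sum_(a < d) \sum_(b < d) (u ^+ a * F a zeta) * (u ^+ b * F b zeta)^*).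
    rewrite /gap mulrC rmorphM rmorphB; congr (_ * (_ - _)).
    rewrite -[LHS]/((normc (psum F d (u *: zeta)) ^+ 2)%:C) -mulcJ /psum mulr_suml; apply: eq_bigr => a _.
    rewrite conjc_sum mulr_sumr; apply: eq_bigr => b _; by rewrite !(hF _).2.
  rewrite mulrCA mulrBr mulr1; congr (_ * (_ - _)).
  rewrite mulr_sumr; apply: eq_bigr => a _; rewrite mulr_sumr; apply: eq_bigr => b _; by rewrite /X mulrA.
rewrite E1 E2 -mulrBr opprB addrC addrA subrK -sumrB normcM normcR gtr0_norm ?invr_gt0 //.
apply: (le_via (normc (\sum_(a < d) (\sum_(b < d) (s ^+ N)%:C * X a b - \sum_(b < d) (s ^+ (N + a - b))%:C * X a b)))).
  by rewrite ler_piMl // invf_le1 // ler1n.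
have -> : d%:R ^+ 3 * B ^+ 2 * (s ^+ (N - d) * (1 - s)) = \sum_(a < d) \sum_(b < d) (s ^+ (N - d) * (d%:R * (1 - s))) * (B * B).
  have E (x : R) : \sum_(a < d) x = d%:R * x by rewrite sumr_const card_ord mulr_natl.
  by rewrite !E; move: (d%:R) (s ^+ (N - d)); clear -hs; move=> D S; ring.
apply: normc_sum_le; apply: ler_sum => a _; rewrite -sumrB.
apply: normc_sum_le; apply: ler_sum => b _.
rewrite -mulrBl -rmorphB normcM normcR; have bd := ltn_ord b; have ad := ltn_ord a.
apply: ler_pM; rewrite ?normr_ge0 //; last first.
  rewrite /X !normcM normcJ' !normcM !normcX u1 !expr1n !mul1r; apply: ler_pM => //; exact: hB.
have -> : s ^+ N - s ^+ (N + a - b) = s ^+ (N - d) * (s ^+ d - s ^+ (d + a - b)).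
  by rewrite mulrBr -!exprD; congr (s ^+ _ - s ^+ _); lia.
rewrite normrM ger0_norm ?exprn_ge0 // ler_wpM2l ?exprn_ge0 //.
by apply: expr_diff_le => //; lia.
Qed.

Lemma gap_diff f z (w : Cn R n) e : normc (f z) <= 1 -> normc (f w) <= 1 -> normc (f z - f w) <= e ->
  `|gap f z - gap f w| <= e.
Proof.
move=> z1 w1 h; have h1 := ler_dist_normc (f z) (f w).
have -> : gap f z - gap f w = - ((normc (f z) - normc (f w)) * ((normc (f z) + normc (f w)) / 2)) by rewrite /gap; field.
rewrite normrN normrM; apply: le_trans (le_trans h1 h); rewrite ler_piMr //.
have := normc_ge0 (f z); have := normc_ge0 (f w) => a b.
by rewrite ger0_norm; lra.
Qed.

(** After [peak_diff] the gap is moved from u zeta to z, at distance sqrt (2 - 2 s), by the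
    Lipschitz bound of f; the error 1 - s is itself at most this distance. *)
Lemma peak_bounds F d : homs F -> (forall z, enorm z = 1 -> normc (psum F d z) <= 1) ->
  exists2 C : R, 0 <= C & forall N zeta z, (d <= N)%N -> enorm zeta = 1 -> enorm z = 1 ->
    `|normc (peak F d N zeta z) - normc (hdot z zeta) ^+ N * gap (psum F d) z| <=
      C * (normc (hdot z zeta) ^+ (N - d) * Num.sqrt (2 - 2 * normc (hdot z zeta))).
Proof.
move=> hF f1; have [K K0 hK] := poly_lipschitz (psum_poly d hF).
have [B hB] := hpoly_bounds hF.
pose D := \sum_(k < d) B k; have D0 : 0 <= D by apply: sumr_ge0 => k _; exact: (hB k).1.
pose C1 := d%:R ^+ 3 * D ^+ 2; have C10 : 0 <= C1 by rewrite mulr_ge0 ?exprn_ge0.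
exists (K + C1); first by rewrite addr_ge0.
move=> N zeta z dN zeta1 z1; have [u u1 uE] := unit_phase (hdot z zeta).
set s := normc (hdot z zeta) in uE *; have s0 : 0 <= s := normc_ge0 _.
have s1 : s <= 1 by have := normc_hdot_le z zeta; rewrite z1 zeta1 mulr1.
have FB k : (k < d)%N -> normc (F k zeta) <= D.
  move=> kd; apply: le_trans ((hB k).2 zeta zeta1) _; rewrite /D (bigD1 (Ordinal kd)) //= lerDl.
  by apply: sumr_ge0 => j _; exact: (hB j).1.
have pd := peak_diff hF FB dN u1 s0 s1 uE; rewrite -/C1 in pd.
have uz1 : enorm (u *: zeta) = 1 by rewrite enormZ u1 zeta1 mulr1.
set e := Num.sqrt (2 - 2 * s).
have e0 : 0 <= e := sqrtr_ge0 _.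
have e2 : e ^+ 2 = 2 - 2 * s := sqr_gap s1.
have eE : enorm (z - u *: zeta) = e.
  apply/eqP; rewrite -(@eqrXn2 _ 2) // e2; apply/eqP.
  rewrite enormD_sqr enormN uz1 z1 expr1n hdotNr hdotZr uE mulrCA.
  by rewrite [u^* * u]mulrC mulcJ u1 expr1n mulr1 ReN /=; ring.
have gd : `|gap (psum F d) (u *: zeta) - gap (psum F d) z| <= K * e.
  rewrite distrC -eE; apply: gap_diff; [exact: f1|exact: f1|].
  by apply: hK; rewrite ?z1 ?uz1.
set g := gap (psum F d) z in gd *; set g' := gap (psum F d) (u *: zeta) in gd pd.
set p := peak F d N zeta z in pd *.
have g'0 : 0 <= g' by rewrite /g' /gap divr_ge0 // subr_ge0 expr_le1 // f1.
have h1 : `|normc p - s ^+ N * g'| <= C1 * (s ^+ (N - d) * (1 - s)).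
  apply: le_trans pd; have := ler_dist_normc p ((s ^+ N)%:C * u ^+ N * g'%:C).
  by rewrite !normcM !normcR normcX u1 expr1n mulr1 [`|s ^+ N|]ger0_norm ?exprn_ge0 // [`|g'|]ger0_norm.
have -> : normc p - s ^+ N * g = (normc p - s ^+ N * g') + s ^+ N * (g' - g) by ring.
apply: le_trans (ler_normD _ _) _.
have sN : s ^+ N <= s ^+ (N - d) by apply: ler_wiXn2l => //; exact: leq_subr.
have p0 : 0 <= s ^+ (N - d) by rewrite exprn_ge0.
have h2 : `|s ^+ N * (g' - g)| <= K * (s ^+ (N - d) * e).
  rewrite normrM ger0_norm ?exprn_ge0 // mulrCA; apply: ler_pM => //; by rewrite exprn_ge0.
have se : 1 - s <= e := one_sub_le e0 s0 e2.
apply: le_trans (lerD h1 h2) _; rewrite mulrDl addrC lerD2l ler_wpM2l // ler_wpM2l //.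
Qed.

Lemma bernoulli_le (x : R) k : 0 <= x -> x <= 1 -> 1 - k%:R * x <= (1 - x) ^+ k.
Proof.
move=> x0 x1; elim: k => [|k IH]; first by rewrite mul0r subr0 expr0.
rewrite exprS -[k.+1%:R]natr1; have p0 : 0 <= 1 - x by rewrite subr_ge0.
apply: le_trans (ler_wpM2l p0 IH); have : 0 <= k%:R * x ^+ 2 by rewrite mulr_ge0 ?sqr_ge0.
by move: (k%:R) => a; nra.
Qed.

(** By Bernoulli's inequality s ^ l sqrt (2 - 2 s) is at most l ^ (-1/2), which beats C / c for
    large l. *)
Lemma peak_small (s C c : R) (l d : nat) : 0 <= s -> s <= 1 -> 0 <= C -> 0 <= c -> (0 < l)%N -> (d <= l)%N ->
  C ^+ 2 <= l%:R * c ^+ 2 -> C * (s ^+ (2 * l - d) * Num.sqrt (2 - 2 * s)) <= c.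
Proof.
move=> s0 s1 C0 c0 l0 dl hC; set e := Num.sqrt _; have e0 : 0 <= e := sqrtr_ge0 _.
have e2 : e ^+ 2 = 2 - 2 * s := sqr_gap s1.
have lp : 0 < l%:R :> R by rewrite ltr0n.
have h1 : (s ^+ l * e) ^+ 2 <= l%:R^-1.
  have t0 : 0 <= 1 - s by rewrite subr_ge0.
  have t1 : 1 - s <= 1 by move: s0; clear -hs; lra.
  have := bernoulli_inv (2 * l) t0 t1; have -> : 1 - (1 - s) = s by ring.
  rewrite exprMn e2 -[(s ^+ l) ^+ 2]exprM [(l * 2)%N]mulnC -[l%:R^-1]mul1r ler_pdivlMr //; have : 0 <= s ^+ (2 * l) by rewrite exprn_ge0.
  by rewrite natrM; move: (l%:R) lp (s ^+ (2 * l)); clear -hs; move=> L lp S h0 h; nra.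
have sl : s ^+ (2 * l - d) <= s ^+ l by apply: ler_wiXn2l => //; lia.
apply: (le_via (C * (s ^+ l * e))); first by rewrite ler_wpM2l // ler_wpM2r.
have se0 : 0 <= s ^+ l * e by rewrite mulr_ge0 ?exprn_ge0.
rewrite -(@ler_pXn2r _ 2) ?nnegrE // ?(mulr_ge0 C0) // exprMn.
apply: le_trans (ler_pM (sqr_ge0 _) (sqr_ge0 _) hC h1) _.
by rewrite mulrAC divff ?gt_eqF // mul1r.
Qed.

(** Close to zeta the factor sqrt (2 - 2 s) alone is at most l ^ (-1/2). *)
Lemma peak_large (s C c : R) (l k : nat) : 0 <= s -> s <= 1 -> 0 <= C -> 0 <= c -> (0 < l)%N ->
  1 - (2 * l%:R)^-1 <= s ^+ 2 -> C ^+ 2 <= l%:R * c ^+ 2 -> C * (s ^+ k * Num.sqrt (2 - 2 * s)) <= c.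
Proof.
move=> s0 s1 C0 c0 l0 hcap hC; set e := Num.sqrt _; have e0 : 0 <= e := sqrtr_ge0 _.
have e2 : e ^+ 2 = 2 - 2 * s := sqr_gap s1.
have lp : 0 < l%:R :> R by rewrite ltr0n.
have h1 : e ^+ 2 <= l%:R^-1.
  move: hcap; rewrite invfM e2; move: (l%:R^-1); clear -s0 s1; move=> L; nra.
have sk : s ^+ k * e <= e by rewrite ler_piMl // exprn_ile1.
apply: (le_via (C * e)); first by rewrite ler_wpM2l.
rewrite -(@ler_pXn2r _ 2) ?nnegrE // ?(mulr_ge0 C0) // exprMn.
apply: le_trans (ler_pM (sqr_ge0 _) (sqr_ge0 _) hC h1) _.
by rewrite mulrAC divff ?gt_eqF // mul1r.
Qed.

Lemma cap_pow s (l q : nat) : 0 <= s -> (0 < l)%N -> 1 - (2 * l%:R)^-1 <= s ^+ 2 -> 2^-1 ^+ q <= s ^+ (2 * l * q).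
Proof.
move=> s0 l0 h; have lp : 1 <= l%:R :> R by rewrite ler1n.
have x0 : 0 <= (2 * l%:R)^-1 :> R by rewrite invr_ge0 mulr_ge0.
have x1 : (2 * l%:R)^-1 <= 1 :> R by rewrite invf_le1; move: lp; clear -hs; lra.
rewrite exprM; apply: lerXn2r; rewrite ?nnegrE ?exprn_ge0 //.
have := bernoulli_le l x0 x1; have -> : 1 - l%:R * (2 * l%:R)^-1 = 2^-1 :> R.
  by field; rewrite gt_eqF // (lt_le_trans ltr01).
move=> h2; apply: le_trans h2 _; rewrite exprM; apply: lerXn2r; rewrite ?nnegrE ?sqr_ge0 //.
by rewrite subr_ge0.
Qed.

(** What matters is that delta does not depend on f. Every point of the sphere is near one zeta j,
    whose peak has modulus at least a gap f there, while all the peaks together stay below 2 W gap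
    f; hence delta = c^2 a^2 with c = 1 / (2 W). *)
Lemma inner_step : exists2 delta : R, 0 < delta & forall f rho m, ispoly f -> rho < 1 ->
  (forall z, enorm z = 1 -> normc (f z) <= rho) -> exists h, [/\ ispoly h,
    forall k q, (k < m)%N -> hpoly k q -> L2dot h q = 0,
    forall z, enorm z = 1 -> normc (h z) <= gap f z &
    delta * Rint (fun z => gap f z ^+ 2) <= sqn h].
Proof.
have [y0 y1] := sphere_ex.
have n0 : (0 < n)%N.
  rewrite lt0n; apply/eqP => n0; move: y1; rewrite /enorm big1 ?sqrtr0 => [/eqP|i _]; first by rewrite eq_sym oner_eq0.
  by exfalso; have := ltn_ord i; move: (nat_of_ord i) => i1; rewrite n0.
(* 2 ^ (- q) bounds |<z, zeta>| ^ N from below near zeta; half of it is given up to the error, which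
   leaves [a]. *)
have [W W0 hW] := sep_sum n0; pose q := (8 * n + 1)%N; pose a : R := 2^-1 ^+ q / 2.
have a0 : 0 < a by rewrite /a divr_gt0 // exprn_gt0 // invr_gt0.
have a1 : a <= 1.
  rewrite /a ler_pdivrMr // mul1r; apply: (le_via 1); last by rewrite ler1n.
  by rewrite exprn_ile1 ?invr_ge0 // invf_le1 // ler1n.
have W2 : 0 < 2 * W by rewrite mulr_gt0.
pose c : R := (2 * W)^-1; have c0 : 0 < c by rewrite invr_gt0.
exists (c ^+ 2 * a ^+ 2); first by rewrite mulr_gt0 // exprn_gt0.
move=> f rho m hf rho1 frho; have [d [F [hF fE]]] := ispoly_decomp hf.
have fp : f = psum F d by apply/funext => z; rewrite fE.
have rho0 : 0 <= rho := le_trans (normc_ge0 _) (frho y0 y1).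
have f1 z : enorm z = 1 -> normc (psum F d z) <= 1.
  by move=> z1; rewrite -fp; apply: le_trans (frho z z1) _; exact: ltW.
pose gam := (1 - rho ^+ 2) / 2; have gam0 : 0 < gam by rewrite divr_gt0 // subr_gt0 expr_lt1.
have gg z : enorm z = 1 -> gam <= gap f z.
  move=> z1; rewrite /gap /gam ler_pM2r ?invr_gt0 // lerD2l lerN2 ler_sqr ?nnegrE //; exact: frho.
have [C C0 hC] := peak_bounds hF f1.
(* l will be so large that the error of a peak is at most a gam. This needs the gap to be bounded
   below by gam > 0, that is rho < 1. *)
pose b := a * gam; have b0 : 0 < b by rewrite mulr_gt0.
have [l [l0 dl ml lC]] : exists l, [/\ (0 < l)%N, (d <= l)%N, (m <= l)%N & C ^+ 2 <= l%:R * b ^+ 2].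
  pose k := (Num.truncn (C ^+ 2 / b ^+ 2)).+1; exists (k + (d + m))%N; split; [by []|exact: (leq_trans (leq_addr m d) (leq_addl k _))|exact: (leq_trans (leq_addl d m) (leq_addl k _))|].
  rewrite -ler_pdivrMr ?exprn_gt0 //; apply: ltW; apply: lt_le_trans (truncnS_gt _) _.
  by rewrite ler_nat -/k leq_addr.
have [J [zeta [sep cov]]] := @max_sep l n0 l0; have [z1 _] := sep.
pose N := (2 * l * q)%N; have dN : (d <= N)%N by rewrite /N /q peak_degE; apply: leq_trans dl _; rewrite mul2n -addnn addnA leq_addl.
pose P j := peak F d N (zeta j).
have pP j : ispoly (P j) by exact: peak_poly.
have LP j : L2 (P j) := L2_poly (pP j).
have up j z : enorm z = 1 -> normc (P j z) <= 2 * normc (hdot z (zeta j)) ^+ (16 * n * l) * gap f z.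
  move=> zz; have := hC N (zeta j) z dN (z1 j) zz; rewrite -/(P j) -fp.
  set s := normc (hdot z (zeta j)); have s0 : 0 <= s := normc_ge0 _.
  have s1 : s <= 1 by have := normc_hdot_le z (zeta j); rewrite zz z1 mulr1.
  rewrite ler_norml => /andP[_]; rewrite lerBlDr => h; apply: le_trans h _.
  have NE : (N = 16 * n * l + 2 * l)%N by exact: peak_degE.
  have -> : s ^+ (N - d) = s ^+ (16 * n * l) * s ^+ (2 * l - d).
    by rewrite -exprD -(peak_deg_sub n dl).
  have h2 := peak_small s0 s1 C0 (ltW b0) l0 dl lC.
  have g0 : 0 <= gap f z := le_trans (ltW gam0) (gg z zz).
  have bg : b <= gap f z by apply: le_trans (gg z zz); rewrite /b ler_piMl // ltW.
  have S0 : 0 <= s ^+ (16 * n * l) by rewrite exprn_ge0.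
  have sN : s ^+ N <= s ^+ (16 * n * l) by apply: ler_wiXn2l => //; rewrite NE leq_addr.
  set S := s ^+ (16 * n * l) in S0 sN *; move: (s ^+ (2 * l - d)) (Num.sqrt _) h2 => T e h2.
  have -> : C * (S * T * e) = S * (C * (T * e)) by rewrite -mulrA mulrCA.
  have -> : 2 * S * gap f z = S * gap f z + S * gap f z by rewrite -mulrA mulr_natl mulr2n.
  by apply: lerD; [rewrite ler_wpM2l // (le_trans h2)|rewrite ler_wpM2r].
have lo z : enorm z = 1 -> exists2 j, (j < J)%N & a * gap f z <= normc (P j z).
  move=> zz; have [j jJ hj] := cov z zz; exists j => //.
  have := hC N (zeta j) z dN (z1 j) zz; rewrite -/(P j) -fp.
  move: hj; set s := normc (hdot z (zeta j)) => hj; have s0 : 0 <= s := normc_ge0 _.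
  have s1 : s <= 1 by have := normc_hdot_le z (zeta j); rewrite zz z1 mulr1.
  have h1 := cap_pow q s0 l0 hj; have h2 := peak_large (N - d) s0 s1 C0 (ltW b0) l0 hj lC.
  have g0 : 0 <= gap f z := le_trans (ltW gam0) (gg z zz).
  have bg : b <= a * gap f z by rewrite /b ler_pM2l // gg.
  have h3 : 2 * a * gap f z <= s ^+ N * gap f z.
    by rewrite ler_wpM2r //; apply: le_trans h1; rewrite /a mulrC divfK.
  by rewrite ler_norml => /andP[h4 _]; move: h2 bg h3 h4; clear -hs; lra.
have [e e1 he] := greedy_signs J LP.
pose T z := \sum_(j < J) e j * P j z.
have pT : ispoly T by apply: ispoly_sum => j _; exact: ispolyZ.
have LT := L2_poly pT.
exists (fun z => c%:C * T z); split.
- exact: ispolyZ.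
- move=> k p km hp; have [kdN kN] := peak_deg_gt n dl ml km; have Lp := hpoly_L2 hp; rewrite (dotZl _ LT Lp).
  have LeP j : L2 (fun z => e j * P j z) by exact: L2Z.
  rewrite (dot_suml _ (fun j : 'I_J => LeP j) Lp) big1 ?mulr0 // => j _.
  (* For d = 0, not covered by [peak_orth], f is 0 and the peak is a single power of degree N. *)
  have [d0|d0] := posnP d; last first.
    by rewrite (dotZl _ (LP _) Lp) (peak_orth _ _ kdN d0 hp) mulr0.
  have -> : P j = fun z => (2^-1)%:C * hdot z (zeta j) ^+ N.
    apply/funext => z; rewrite /P /peak big1 ?subr0 // => i _; by exfalso; have := ltn_ord i; move: (nat_of_ord i) => i1; rewrite d0.
  have Lh := hpoly_L2 (hdot_pow_hpoly (zeta j) N).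
  rewrite (dotZl _ (L2Z _ Lh) Lp) (dotZl _ Lh Lp) (hpoly_orth (hdot_pow_hpoly (zeta j) N) hp) ?mulr0 // => e'; by apply: kN.
- move=> z zz; rewrite normcM normcR gtr0_norm //.
  have g0 : 0 <= gap f z := le_trans (ltW gam0) (gg z zz).
  apply: (le_via (c * \sum_(j < J) (normc (hdot z (zeta j)) ^+ (16 * n * l)) * (2 * gap f z))).
    rewrite ler_pM2l //; apply: normc_sum_le; apply: ler_sum => j _.
    by rewrite normcM e1 mul1r; apply: le_trans (up j z zz) _; rewrite [leRHS]mulrCA [leRHS]mulrA.
  have [h _] := hW l J zeta l0 sep; rewrite -mulr_suml; have := h z zz.
  set S := \sum_(j < J) _ => hS; rewrite /c mulrC ler_pdivrMr //.
  by have := ler_wpM2r g0 hS; clear -hs; move: (gap f z) => g; lra.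
- rewrite (sqnZ _ LT) normcR gtr0_norm // -mulrA ler_wpM2l ?sqr_ge0 //; apply: le_trans he.
  rewrite /sqn -Rint_sum; last by move=> j; exact: L2_rI.
  have rg : rI (fun z => gap f z ^+ 2).
    apply: (rI_dom_ae (q := fun=> 1)); [|exact: rI_cst|].
      apply: rmeasX; apply: rmeasM; last exact: rmeas_cst.
      by apply: rmeasB; [exact: rmeas_cst|apply: rmeasX; apply: cmeas_normc; exact: cmeas_poly].
    apply: ae_mono ae_sphere => z zz.
    have g0 : 0 <= gap f z := le_trans (ltW gam0) (gg z zz).
    rewrite ger0_norm ?sqr_ge0 // expr_le1 // /gap.
    by have := sqr_ge0 (normc (f z)); clear -hs; lra.
  rewrite -RintZ //; apply: Rint_le_ae; [exact: rI_Z|by apply: rI_sum => j; exact: L2_rI|].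
  apply: ae_mono ae_sphere => z zz; have [j jJ hj] := lo z zz.
  rewrite (bigD1 (Ordinal jJ)) //= -[leLHS]addr0; apply: lerD; last by apply: sumr_ge0 => i _; exact: sqr_ge0.
  have g0 : 0 <= gap f z := le_trans (ltW gam0) (gg z zz).
  by rewrite -exprMn ler_sqr ?nnegrE // mulr_ge0 // ltW.
Qed.

Definition lowdeg m f := exists2 F, forall k, hpoly k (F k) & f = psum F m.

Lemma lowdeg_poly m f : lowdeg m f -> ispoly f.
Proof. by move=> [F hF ->]; exact: psum_poly. Qed.

Lemma lowdeg_of_poly f m : ispoly f -> exists2 d, (m <= d)%N & lowdeg d f.
Proof.
move=> /ispoly_decomp[d [F [hF fE]]]; exists (m + d)%N; first exact: leq_addr.
exists (fun k => if (k < d)%N then F k else fun=> 0).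
  move=> k; case: ifP => _; first exact: hF.
  by split=> [|a z]; rewrite ?mulr0 //; exact: ispoly_cst.
apply/funext => z; rewrite fE /psum (big_ord_widen (m + d) (fun k => F k z)) ?leq_addl // big_mkcond /=.
by apply: eq_bigr => k _; case: ifP.
Qed.

Lemma lowdeg_orth m d f h : lowdeg d f -> (d <= m)%N -> L2 h ->
  (forall k q, (k < m)%N -> hpoly k q -> L2dot h q = 0) -> L2dot h f = 0.
Proof.
move=> [F hF ->] dm Lh ho; have LF k := hpoly_L2 (hF k).
rewrite /psum (dot_sumr _ (fun k : 'I_d => LF k) Lh) big1 // => k _; apply: (ho k) => //.
exact: (leq_trans (ltn_ord k) dm).
Qed.

(** Each step is orthogonal to all that precedes it, so the square norm x_j grows by at least delta
    ((1 - x_j) / 2)^2; as it is bounded by 1, the limit has norm 1, and a Schur function of norm 1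
    is inner. Coefficients of degree below m never change. *)
Lemma inner_near f m rho : lowdeg m f -> rho < 1 -> (forall z, enorm z = 1 -> normc (f z) <= rho) ->
  exists phi, [/\ schur_class phi, inner_functions sigma phi &
    forall k q, (k < m)%N -> hpoly k q -> L2dot (bd phi) q = L2dot f q].
Proof.
move=> fm rho1 frho; have [delta d0 hd] := inner_step.
pose ok (s : Cfun R n * R * nat) := [/\ lowdeg s.2 s.1.1, s.1.2 < 1 & forall z, enorm z = 1 -> normc (s.1.1 z) <= s.1.2].
pose nxt (s t : Cfun R n * R * nat) := [/\ (s.2 <= t.2)%N, L2 (fun z => t.1.1 z - s.1.1 z),
  forall k q, (k < s.2)%N -> hpoly k q -> L2dot (fun z => t.1.1 z - s.1.1 z) q = 0 &
  delta * Rint (fun z => gap s.1.1 z ^+ 2) <= sqn (fun z => t.1.1 z - s.1.1 z)].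
have [y y1] := sphere_ex.
have step (s : {s | ok s}) : exists t : {s | ok s}, nxt (sval s) (sval t).
  case: s => -[[g r] d] /= [gd r1 gr]; have gp := lowdeg_poly gd.
  have [h [hp ho hg hdel]] := hd g r d gp r1 gr.
  have r0 : 0 <= r := le_trans (normc_ge0 _) (gr y y1).
  have [d' dd' hd'] := lowdeg_of_poly d (ispolyD gp hp).
  have E : (fun z => (g z + h z) - g z) = h by apply/funext => z; rewrite addrC addKr.
  (* |g| + gap g = 1 - (1 - |g|)^2 / 2 increases with |g|, so the new bound is its value at r. *)
  have okt : ok (fun z => g z + h z, 1 - (1 - r) ^+ 2 / 2, d').
    split=> //=; first by rewrite ltrBlDr ltrDl divr_gt0 // exprn_gt0 // subr_gt0.
    move=> z z1; apply: normcD_le; apply: le_trans (lerD (lexx _) (hg z z1)) _.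
    have xr : normc (g z) <= r := gr z z1; have rr : r < 1 := r1; have := normc_ge0 (g z); rewrite /gap; move: rr xr; clear -hs.
    by move: (normc (g z)) => x r1 xr x0; nra.
  exists (exist _ _ okt); split=> //=; rewrite E //; exact: (L2_poly hp).
have /choice[next hnext] := step.
have ok0 : ok (f, rho, m) by [].
pose st j := iter j next (exist _ _ ok0); pose fs j := (sval (st j)).1.1; pose ms j := (sval (st j)).2.
have okj j : ok (sval (st j)) := svalP (st j).
have nj j : nxt (sval (st j)) (sval (st j.+1)) by exact: hnext.
have pj j : ispoly (fs j) by have [h _ _] := okj j; exact: (lowdeg_poly h).
have Lj j := L2_poly (pj j).
have msm : {homo ms : i j / (i <= j)%N} by apply: homo_leq => [//|i j k|i]; [exact: leq_trans|have [] := nj i].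
have f1 j z : enorm z = 1 -> normc (fs j z) <= 1.
  by move=> z1; have [_ r1 h] := okj j; apply: le_trans (h z z1) _; exact: ltW.
have orth j i q k : (j <= i)%N -> (k < ms j)%N -> hpoly k q -> L2dot (fs i) q = L2dot (fs j) q.
  move=> ji kj hq; have Lq := hpoly_L2 hq; elim: i ji => [|i IH]; first by rewrite leqn0 => /eqP ->.
  rewrite leq_eqVlt => /predU1P[->//|]; rewrite ltnS => ji; rewrite -IH //.
  have [_ _ ho _] := nj i; have := ho k q (leq_trans kj (msm _ _ ji)) hq.
  by rewrite (dotBl (Lj i.+1) (Lj i) Lq) => /eqP; rewrite subr_eq0 => /eqP.
have orthf j i : (j <= i)%N -> L2dot (fs i) (fs j) = (sqn (fs j))%:C.
  move=> ji; have [low _ _] := okj j; have := lowdeg_orth low (leqnn _) (L2B (Lj i) (Lj j)).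
  rewrite -/(fs j) (dotBl (Lj i) (Lj j) (Lj j)) dot_sqn => h; apply/eqP; rewrite -subr_eq0; apply/eqP; apply: h.
  move=> k q kj hq; rewrite (dotBl (Lj i) (Lj j) (hpoly_L2 hq)) (orth j i q k) ?subrr //.
pose x j := sqn (fs j).
have x1 j : x j <= 1.
  have h : l2 (fs j) <= 1 by apply: l2_le_sup => [|z z1]; [exact: cmeas_poly|exact: f1].
  by rewrite /x -l2_sqr expr_le1 // l2_ge0.
have gapx j : Rint (gap (fs j)) = (1 - x j) / 2.
  rewrite /gap /x /sqn; have i1 := L2_rI (Lj j).
  under [X in Rint X]eq_fun do rewrite mulrC.
  by rewrite RintZ ?RintB ?Rint_cst 1?mulrC //; [exact: rI_cst|apply: rI_B => //; exact: rI_cst].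
have Lgap j : L2 (fun z => (gap (fs j) z)%:C).
  have pc : cmeas (fun z => (gap (fs j) z)%:C).
    apply: cmeas_real; apply: rmeasM; last exact: rmeas_cst.
    by apply: rmeasB; [exact: rmeas_cst|apply: rmeasX; apply: cmeas_normc; exact: cmeas_poly].
  apply: (L2_bnd_ae (M := 1) pc); apply: ae_mono ae_sphere => z z1.
  rewrite normcR ger0_norm /gap; have := f1 j z z1; have := normc_ge0 (fs j z); move: (normc _) => t t0 t1; nra.
have grow j : delta * ((1 - x j) / 2) ^+ 2 <= x j.+1 - x j.
  have [_ _ ho hg] := nj j.
  have E : sqn (fun z => fs j.+1 z - fs j z) = x j.+1 - x j.
    rewrite (sqnB (Lj j.+1) (Lj j)) (orthf j j.+1) // -/(x j) -/(x j.+1) /=; ring.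
  rewrite -E; apply: le_trans hg; rewrite ler_pM2l // -gapx.
  (* The mean of the squared gap is at least the square of its mean, and that mean is (1 - x j) /
     2. *)
  have h1 := norm1_le_l2 (Lgap j).
  have a1 : (\ae z, gap (fs j) z = normc (gap (fs j) z)%:C).
    apply: ae_mono ae_sphere => z z1; rewrite normcR ger0_norm // divr_ge0 // subr_ge0 expr_le1 //; exact: f1.
  rewrite (Rint_ae a1); apply: (le_via (l2 (fun z => (gap (fs j) z)%:C) ^+ 2)).
    by rewrite ler_sqr ?nnegrE //; apply: Rint_ge0 => z; exact: normc_ge0.
  rewrite l2_sqr /sqn; apply: eqW; congr Rint; apply/funext => z.
  by rewrite normcR real_normK // num_real.
have [U [UU hU]] := @ultraFilterLemma nat \oo _.
have Hj j : H2 (cut (fs j)) := cut_poly_H2 (pj j).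
have Bj j : H2norm (cut (fs j)) <= 1.
  rewrite (H2norm_bd (Hj j)) (l2_ae (bd_poly (pj j))) -(expr_le1 (n := 2)) // l2_sqr; exact: x1.
have [phi [hphi nphi pphi wphi]] := ulim_H2 UU Hj Bj.
have Lphi := bd_L2 hphi.
have dotphi q : ispoly q -> (L2dot (fs j) q) @[j --> U] ~~> (L2dot (bd phi) q).
  move=> hq; have Hq := cut_poly_H2 hq; have := wphi _ Hq.
  rewrite (H2dotE hphi Hq) (dot_ae (ae_all (fun z => erefl (bd phi z))) (bd_poly hq)).
  under eq_fun => j do rewrite (H2dotE (Hj j) Hq) (dot_ae (bd_poly (pj j)) (bd_poly hq)).
  by [].
have evc (c : R[i]) q j : ispoly q -> (forall i, (j <= i)%N -> L2dot (fs i) q = c) -> L2dot (bd phi) q = c.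
  move=> hq hc; have h1 := dotphi q hq.
  have h2 : (L2dot (fs i) q) @[i --> U] ~~> c.
    apply/cvgcP => e e0; apply: hU; exists j => // i /= ji; by rewrite hc // subrr normc0.
  exact: (cvg_unique _ h1 h2).
have bf j z : normc (cut (fs j) z) <= 1.
  apply: schur_le; apply: (max_principle (Hj j)); apply: ae_mono (ae_and ae_sphere (bd_poly (pj j))) => w [w1 ->].
  exact: f1.
have bphi z : normc (phi z) <= 1 by apply: (ulim_le (pphi z)); apply: filterE => j; exact: bf.
have sphi : schur_class phi by apply: (schurP (H2_analytic hphi)) => z _; exact: bphi.
pose X := sqn (bd phi).
have xX j : x j <= X.
  have := CS_sqn Lphi (Lj j); rewrite (evc _ _ j (pj j) (orthf j)) normcR ger0_norm // -/(x j) -/X.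
  have : 0 <= x j := sqn_ge0 _; have := sqn_ge0 (bd phi); rewrite -/X; move: (x j) X; clear -hs.
  by move=> a b b0 a0; have [->|an] := eqVneq a 0; [|rewrite expr2 ler_pM2r // lt_def an].
have X1 : X <= 1 by rewrite /X -l2_sqr -(H2norm_bd hphi) expr_le1.
have X1' : 1 <= X.
  rewrite leNgt; apply/negP => Xl; pose eta := delta * ((1 - X) / 2) ^+ 2.
  have eta0 : 0 < eta by rewrite mulr_gt0 // exprn_gt0 // divr_gt0 // subr_gt0.
  have lin j : j%:R * eta <= x j.
    elim: j => [|j IH]; first by rewrite mul0r; exact: sqn_ge0.
    rewrite -[j.+1%:R]natr1 mulrDl mul1r; apply: (le_via (x j + (x j.+1 - x j))); last by rewrite addrC subrK.
    apply: lerD => //; apply: le_trans (grow j); rewrite ler_pM2l //.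
    by have := xX j; move: Xl; clear -hs; move: (x j) X => a b; nra.
  have := le_trans (lin (Num.truncn eta^-1).+1) (x1 _); rewrite -ler_pdivlMr // mul1r leNgt => /negP; apply.
  exact: truncnS_gt.
exists phi; split; first exact: sphi.
  split; first exact: sphi.1.
  have rb : rI (fun z => Num.max 0 (1 - normc (bd phi z) ^+ 2)).
    apply: rI_max; [exact: rI_cst|apply: rI_B; [exact: rI_cst|exact: L2_rI]].
  have bl := bd_le (H2_analytic hphi) bphi.
  have m1 : (\ae z, Num.max 0 (1 - normc (bd phi z) ^+ 2) = 1 - normc (bd phi z) ^+ 2).
    by apply: ae_mono bl => z h; rewrite max_r // subr_ge0 expr_le1.
  have i0 : Rint (fun z => Num.max 0 (1 - normc (bd phi z) ^+ 2)) = 0.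
    rewrite (Rint_ae m1) RintB ?Rint_cst; [|exact: rI_cst|exact: L2_rI].
    by apply/eqP; rewrite subr_eq0 eq_sym eq_le X1.
  have mz z : 0 <= Num.max 0 (1 - normc (bd phi z) ^+ 2) by rewrite le_max lexx.
  apply: ae_mono (ae_and (bd_bdry hphi) (ae_and m1 (Rint0_ae rb mz i0))) => z [-> [-> h]].
  by apply/eqP; rewrite -(@eqrXn2 _ 2) // expr1n; apply/eqP; move: h; clear -hs; lra.
move=> k q km hq; apply: (evc _ _ 0%N hq.1) => i _; exact: (orth 0%N i q k).
Qed.

Lemma schur_norm phi : schur_class phi -> H2norm phi <= 1.
Proof.
move=> sk; have hk := schur_H2 sk; rewrite (H2norm_bd hk); have Lb := bd_L2 hk.
have bl := bd_le (H2_analytic hk) (fun z => schur_le z sk).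
rewrite -(expr_le1 (n := 2)) // l2_sqr -(Rint_cst 1); apply: Rint_le_ae; [exact: L2_rI|exact: rI_cst|].
by apply: ae_mono bl => y hy; rewrite expr_le1.
Qed.

(** [phis k] and the polynomial [f k] share all coefficients of degree below some m >= k, so they
    differ by a tail of [phis k], geometrically small at z uniformly over the unit ball of H^2. *)
Lemma inner_dense phi : schur_class phi -> exists phis : nat -> Cfun R n,
  [/\ forall k, schur_class (phis k), forall k, inner_functions sigma (phis k) &
    forall z, cball z -> phis k z @[k --> \oo] ~~> phi z].
Proof.
move=> sp; have [f [rho [fp rk fb0 cf]]] := schur_poly_seq sp.
have fb k z : enorm z = 1 -> normc (f k z) <= rho k by move=> z1; apply: fb0; rewrite z1.
have /choice[m hm] : forall k, exists m, (k <= m)%N /\ lowdeg m (f k).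
  by move=> k; have [m km hk] := lowdeg_of_poly k (fp k); exists m.
have /choice[phis hphis] := fun k => inner_near (hm k).2 (rk k) (fb k).
exists phis; split=> [k|k|z zb]; [by case: (hphis k)|by case: (hphis k)|].
have [C [s [C0 s0 s1 hC]]] := expands_tail (zb : enorm z < 1).
have [M [t [M0 t0 t1 hM]]] := hpoly_eval (zb : enorm z < 1).
have close k : normc (phis k z - f k z) <= C * 1 * s ^+ k.
  have [km [F hF fE]] := hm k; have [sk _ ok] := hphis k; have hk := schur_H2 sk; have [G hG] := H2_expands hk.
  have LG j := hpoly_L2 (hG.1 j); have LF j := hpoly_L2 (hF j).
  have Hf := cut_poly_H2 (fp k).
  have n1 : H2norm (phis k) <= 1 := schur_norm sk.
  have GF j : (j < m k)%N -> G j z = F j z.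
    move=> jm; have hd : hpoly j (fun z => G j z - F j z).
      by split=> [|a w]; [exact: ispolyB (hG.1 j).1 (hF j).1|rewrite (hG.1 j).2 (hF j).2 mulrBr].
    have Ld := hpoly_L2 hd.
    have e1 : L2dot (f k) (fun z => G j z - F j z) = L2dot (F j) (fun z => G j z - F j z).
      have := bd_dot_hpoly Hf _ hd; rewrite fE => /(_ _ (expands_poly (m k) hF)); rewrite jm => <-.
      rewrite -fE; apply: dot_ae; last exact: ae_all.
      by apply: ae_mono (bd_poly (fp k)) => y ->.
    have e2 := ok j _ jm hd; rewrite (bd_dot_hpoly hk hG hd) e1 in e2.
    have s0' : sqn (fun z => G j z - F j z) = 0.
      have : (sqn (fun z => G j z - F j z))%:C = 0.
        by rewrite -dot_sqn (dotBl (LG j) (LF j) Ld) e2 subrr.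
      by move=> /(congr1 (@Re R)).
    have := hM j _ z hd (lexx _); rewrite /l2 s0' sqrtr0 mulr0 => h.
    by apply/eqP; rewrite -subr_eq0 -normc_eq0 eq_le h normc_ge0.
  have -> : f k z = psum G (m k) z by rewrite fE /psum; apply: eq_bigr => j _; rewrite GF.
  apply: le_trans (hC _ _ 1 (m k) z hG (fun j => le_trans (coef_l2_le j hk hG) n1) (lexx _)) _.
  by rewrite ler_wpM2l ?mulr_ge0 //; apply: ler_wiXn2l => //; exact: ltW.
apply/cvgcP => e e0; have e2 := half_gt0 e0.
have C1 : 0 < C * 1 + 1 by rewrite ltr_wpDl // mulr1.
have [q _ hq] := expr_small (ltW s0) s1 (divr_gt0 e2 C1).
have /cvgcP/(_ (e / 2) e2) near1 := cf z zb.
near=> k.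
have h1 : normc (phis k z - f k z) < e / 2.
  apply: le_lt_trans (close k) _; have qk : (q <= k)%N by near: k; exact: nbhs_infty_ge.
  have h : s ^+ k <= e / 2 / (C * 1 + 1) by apply: le_trans hq; apply: ler_wiXn2l => //; exact: ltW.
  have sk0 : 0 < s ^+ k by rewrite exprn_gt0.
  apply: (@lt_le_trans _ _ ((C * 1 + 1) * s ^+ k)); first by rewrite ltr_pM2r // ltrDl.
  by rewrite mulrC -ler_pdivlMr.
have h2 : normc (f k z - phi z) < e / 2 by near: k.
have -> : phis k z - phi z = (phis k z - f k z) + (f k z - phi z) by ring.
by apply: normcD_lt; rewrite [e]splitr; exact: ltrD.
Unshelve. all: by end_near.
Qed.

Lemma inner_weak phi : schur_class phi -> exists phis : nat -> Cfun R n,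
  [/\ forall k, schur_class (phis k), forall k, inner_functions sigma (phis k) &
    forall g, H2 g -> (H2dot (phis k) g) @[k --> \oo] ~~> H2dot phi g].
Proof.
move=> sp; have [phis [s1 i1 c1]] := inner_dense sp; exists phis; split=> //.
exact: (bounded_seq_weak (fun k => schur_H2 (s1 k)) (fun k => schur_norm (s1 k)) (schur_H2 sp) c1).
Qed.

(** * Extremal functions are dense *)

(** A countable dense set of interpolation nodes, enumerated through [pickle]. *)
Definition ratpt (r : 'rV[rat * rat]_n) : Cn R n := \row_i (ratr (r 0 i).1 +i* ratr (r 0 i).2).

Lemma rat_near (a d : R) : 0 < d -> exists2 q : rat, (ratr q : R) != 0 & `|ratr q - a| < d.
Proof.
move=> d0; have [a0|a0] := leP 0 a.
  have [|q] := @rat_in_itvoo R a (a + d); first by rewrite ltrDl.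
  rewrite in_itv /= => /andP[h1 h2]; exists q; first by rewrite gt_eqF // (le_lt_trans a0).
  by rewrite gtr0_norm ?subr_gt0 // ltrBlDl.
have [|q] := @rat_in_itvoo R a (Num.min (a + d) 0); first by rewrite lt_min ltrDl d0.
rewrite in_itv /= lt_min => /andP[h1 /andP[h2 h3]]; exists q; first by rewrite lt_eqF.
by rewrite gtr0_norm ?subr_gt0 // ltrBlDl.
Qed.

Lemma ratpt_dense z (d : R) : (0 < n)%N -> 0 < d -> exists2 r, ratpt r != 0 & enorm (ratpt r - z) < d.
Proof.
move=> n0 d0; have np : 0 < n%:R :> R by rewrite ltr0n.
have e0 : 0 < d / 4 / n%:R by rewrite !divr_gt0.
have /choice[q hq] : forall i : 'I_n, exists q : rat * rat, [/\ (ratr q.1 : R) != 0,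
    `|ratr q.1 - Re (z 0 i)| < d / 4 / n%:R & `|ratr q.2 - Im (z 0 i)| < d / 4 / n%:R].
  move=> i; have [q1 a1 b1] := rat_near (Re (z 0 i)) e0; have [q2 _ b2] := rat_near (Im (z 0 i)) e0.
  by exists (q1, q2).
exists (\row_i q i).
  apply/eqP => /matrixP/(_ 0 (Ordinal n0)); rewrite !mxE => /(congr1 (@Re R)) /= /eqP.
  by apply/negP; have [] := hq (Ordinal n0).
apply: le_lt_trans (enorm_lt_sum _) _; apply: (@le_lt_trans _ _ (\sum_(i < n) (d / 4 / n%:R + d / 4 / n%:R))).
  apply: ler_sum => i _; apply: le_trans (normc_le_ReIm _) _; have [_ h1 h2] := hq i.
  by rewrite !mxE ReD ReN ImD ImN /=; apply: lerD; exact: ltW.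
have -> : \sum_(i < n) (d / 4 / n%:R + d / 4 / n%:R) = d / 2.
  by rewrite sumr_const card_ord -[LHS]mulr_natr; field; rewrite gt_eqF.
by move: d0; clear -hs; lra.
Qed.

Definition zfactor (y z : Cn R n) : R[i] := 1 - ((enorm y ^+ 2)^-1)%:C * hdot z y.

Lemma zfactor_poly y : ispoly (zfactor y).
Proof.
apply: ispolyB; first exact: ispoly_cst.
apply: ispolyZ; have := (hdot_pow_hpoly y 1).1; by under eq_fun do rewrite expr1.
Qed.

Lemma zfactor0 y : zfactor y 0 = 1.
Proof. by rewrite /zfactor /hdot big1 ?mulr0 ?subr0 // => i _; rewrite mxE mul0r. Qed.

Lemma zfactor_self y : y != 0 -> zfactor y y = 0.
Proof.
move=> y0; have e0 : enorm y ^+ 2 != 0 by rewrite expf_neq0 //; apply: contra y0 => /eqP/enorm_eq0 ->.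
by rewrite /zfactor hdotzz -rmorphM mulVf // subrr.
Qed.

Lemma vanishing_poly (s : seq (Cn R n)) : (forall y, y \in s -> y != 0) -> exists q, [/\ ispoly q, q 0 = 1 & forall y, y \in s -> q y = 0].
Proof.
move=> hs0; exists (fun z => \prod_(y <- s) zfactor y z); split.
- by apply: ispoly_prod => y _; exact: zfactor_poly.
- by rewrite big1 // => y _; exact: zfactor0.
- by move=> y ys; rewrite (big_rem y) //= zfactor_self ?mul0r // hs0.
Qed.

Lemma schur_small_supnorm eta : schur_class eta -> supnorm eta <> 1%:E -> exists2 r, r < 1 & forall z, normc (eta z) <= r.
Proof.
move=> [[ha _] h1] h; have lt1 : (supnorm eta < 1%:E)%E by rewrite lt_neqAle h1 andbT; apply/eqP.
have c0 : cball (0 : Cn R n) by rewrite /cball /= enorm0.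
have ub z : cball z -> ((normc (eta z))%:E <= supnorm eta)%E by move=> zb; apply: ereal_sup_ubound; exists z.
have s0 : (0 <= supnorm eta)%E by apply: le_trans (ub 0 c0); rewrite lee_fin normc_ge0.
move: lt1 ub s0; case: (supnorm eta) => [r| |] //=; rewrite lte_fin => r1 ub.
rewrite lee_fin => r0; exists r => // z; have [zb|zb] := pselect (cball z); first by rewrite -lee_fin; exact: ub.
by rewrite ha.2 // normc0.
Qed.

(** The constant component alone has square norm 1, which leaves nothing for the others. *)
Lemma schur_unit_const phi : schur_class phi -> normc (phi 0) = 1 -> forall z, cball z -> phi z = phi 0.
Proof.
move=> sp p1 z zb; have hp := schur_H2 sp; have [F hF] := H2_expands hp.
have F0 y : F 0%N y = F 0%N 0 by rewrite -[0 in RHS](scale0r y) (hF.1 0%N).2 expr0 mul1r.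
have small e y : 0 < e -> cball y -> exists K, normc (phi y - psum F K.+1 y) <= e.
  by move=> e0 yb; have [K hK] := expands_unif hF yb e0; exists K; apply: hK.
have c0 : cball (0 : Cn R n) by rewrite /cball /= enorm0.
have Fk0 k : F k.+1 0 = 0 by have := (hF.1 k.+1).2 0 0; rewrite scale0r expr0n mul0r.
have p0 : phi 0 = F 0%N 0.
  apply: eqc_small => e e0.
  have [K] := small e 0 e0 c0; rewrite /psum big_ord_recl big1 ?addr0 // => k _; exact: Fk0.
have n0 : sqn (F 0%N) = 1.
  rewrite /sqn (_ : (fun z => normc (F 0%N z) ^+ 2) = fun=> 1) ?Rint_cst //.
  by apply/funext => y; rewrite F0 -p0 p1 expr1n.
have nk k : sqn (F k.+1) = 0.
  have := H2_coef hp hF k.+2; rewrite big_ord_recl big_ord_recr /= n0 => h.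
  have h1 : H2norm phi ^+ 2 <= 1 by rewrite expr_le1 // schur_norm.
  apply/eqP; rewrite eq_le sqn_ge0 andbT; have := le_trans h h1.
  have : 0 <= \sum_(i < k) sqn (F (widen_ord (leqnSn k) i).+1) by apply: sumr_ge0 => i _; exact: sqn_ge0.
  by rewrite /bump /=; move: (\sum_(i < k) _) (sqn _); clear -hs; move=> a b; lra.
have Fz k : F k.+1 z = 0.
  have [M [t [M0 t0 t1 hM]]] := hpoly_eval (zb : enorm z < 1).
  have := hM _ _ z (hF.1 k.+1) (lexx _); rewrite /l2 nk sqrtr0 mulr0 => h.
  by apply/eqP; rewrite -normc_eq0 eq_le h normc_ge0.
apply: eqc_small => e e0.
have [K] := small e z e0 zb; rewrite /psum big_ord_recl big1 => [|k _]; last exact: Fz.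
by rewrite addr0 F0 p0.
Qed.

(* Among the Schur functions with the prescribed values at the points of s, one maximising the real part at 0 is extremal:
   a competitor with the same values and norm < 1 could still be pushed up at 0 by a polynomial vanishing on s. *)
Lemma extremal_interp f (s : seq (Cn R n)) : schur_class f -> uniq s -> (forall y, y \in s -> y != 0 /\ cball y) ->
  (forall y, y \in s -> normc (f y) < 1) -> (0 < size s)%N -> exists phi, [/\ schur_class phi, extremal_functions phi & forall y, y \in s -> phi y = f y].
Proof.
move=> sf us sb fs0 s0.
pose E := [set eta | schur_class eta /\ forall y, y \in s -> eta y = f y].
pose A := [set Re (eta 0) | eta in E].
have A1 x : A x -> x <= 1.
  by move=> [eta [se _] <-]; apply: le_trans (ler_norm _) (le_trans (Re_le_normc _) _); exact: schur_le.
have hA : has_sup A by split; [exists (Re (f 0)), f|exists 1].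
pose alpha := sup A.
have /choice[etas hetas] : forall j : nat, exists eta, E eta /\ alpha - j.+1%:R^-1 < Re (eta 0).
  move=> j; have j0 : 0 < j.+1%:R^-1 :> R by rewrite invr_gt0 ltr0n.
  by have [_ [eta Ee <-] h] := sup_adherent j0 hA; exists eta.
have Ej j := (hetas j).1; have Hj j := schur_H2 (Ej j).1.
have [U [UU hU]] := @ultraFilterLemma nat \oo _.
have [phi [hphi _ pphi _]] := ulim_H2 UU Hj (fun j => schur_norm (Ej j).1).
have bphi z : normc (phi z) <= 1 by apply: (ulim_le (pphi z)); apply: filterE => j; apply: schur_le; exact: (Ej j).1.
have sphi : schur_class phi by apply: (schurP (H2_analytic hphi)) => z _; exact: bphi.
have vphi y : y \in s -> phi y = f y.
  move=> ys; have c2 : etas j y @[j --> U] ~~> f y.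
    by apply/cvgcP => e e0; apply: filterE => j; rewrite (Ej j).2 // subrr normc0.
  exact: (cvg_unique _ (pphi y) c2).
have aphi : alpha <= Re (phi 0).
  apply/ler_addgt0Pr => e e0; have e2 := half_gt0 e0.
  have /cvgcP/(_ _ e2) h1 := pphi 0.
  have h2 : \forall j \near U, j.+1%:R^-1 < e / 2 by apply: hU; exact: (near_infty_natSinv_lt (PosNum e2)).
  have [j [h3 h4]] := filter_ex (filterI h1 h2); have h5 := (hetas j).2.
  have := le_lt_trans (Re_le_normc _) h3; rewrite ReD ReN ltr_norml => /andP[_]; exact: (half_gap h5 h4).
exists phi; split; [exact: sphi| |exact: vphi].
(* The value at the added node 0 must lie in the open disc; modulus 1 would make phi constant,
   against its values on s. *)
have phi0 : normc (phi 0) < 1.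
  rewrite lt_neqAle bphi andbT; apply/eqP => h; case: s s0 sb fs0 vphi {us E A A1 hA alpha hetas Ej aphi etas Hj pphi} => // y t _ sb fs0 vphi.
  have yt : y \in y :: t by rewrite mem_head.
  have := fs0 y yt; rewrite -vphi // (schur_unit_const sphi h) ?h ?ltxx //; exact: (sb y yt).2.
split; first exact: sphi.
exists (size s).+1, (fun j => nth 0 (0 :: s) j), (fun j => phi (nth 0 (0 :: s) j)); split=> //.
- move=> i j /eqP; rewrite nth_uniq ?ltn_ord //= ?us ?andbT; first by move=> /eqP/val_inj.
  by apply/negP => /sb[] /eqP.
- move=> j; have := mem_nth 0 (ltn_ord j : (j < size (0%R :: s))%N); rewrite inE => /orP[/eqP ->|/sb[]//].
  by rewrite /cball /= enorm0.
- move=> j; have := mem_nth 0 (ltn_ord j : (j < size (0%R :: s))%N); rewrite inE => /orP[/eqP ->//|ys].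
  by rewrite vphi //; exact: fs0.
move=> eta se he; apply: contrapT => ne; have [r r1 hr] := schur_small_supnorm se ne.
have eta0 : eta 0 = phi 0 by have := he ord0.
have etas' y : y \in s -> eta y = f y.
  move=> ys; rewrite -vphi //; have is' : (index y s < size s)%N by rewrite index_mem.
  by have := he (Ordinal (is' : ((index y s).+1 < (size s).+1)%N)); rewrite /= nth_index.
have [q [pq q0 qs]] := vanishing_poly (fun y ys => (sb y ys).1).
have [M hM] := cut_poly_bounded pq; have M0 : 0 <= M := le_trans (normc_ge0 _) (hM 0).
pose eps := (1 - r) / (M + 1); have eps0 : 0 < eps by rewrite divr_gt0 ?subr_gt0 // ltr_wpDl.
have c0 : cball (0 : Cn R n) by rewrite /cball /= enorm0.
pose theta z := eta z + eps%:C * cut q z.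
have ht : H2 theta by apply: (H2D (schur_H2 se)); apply: H2Z; exact: (cut_poly_H2 pq).
have Et : E theta.
  split=> [|y ys].
    apply: (schurP (H2_analytic ht)) => z _; apply: normcD_le.
    rewrite normcM normcR gtr0_norm //; apply: (le_via (r + eps * M)); first by rewrite lerD // ler_pM2l.
    have : eps * (M + 1) = 1 - r by rewrite divfK // gt_eqF // ltr_wpDl.
    by move=> h; rewrite -lerBrDl -h mulrDr mulr1 lerDl ltW.
  by rewrite /theta etas' // cut_in ?qs ?mulr0 ?addr0 //; exact: (sb y ys).2.
have : Re (theta 0) <= alpha by apply: (ub_le_sup hA.2); exists theta.
rewrite /theta eta0 cut_in // q0 mulr1 ReD /= leNgt => /negP; apply; apply: le_lt_trans aphi _.
by rewrite ltrDl.
Qed.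

Lemma ratpt_uniq f g : (0 < n)%N -> H2 f -> H2 g ->
  (forall r : 'rV_n, ratpt r != 0 -> cball (ratpt r) -> g (ratpt r) = f (ratpt r)) -> g = f.
Proof.
move=> n0 hf hg h; apply/funext => z; have [zb|zb] := pselect (cball z); last by rewrite (H2_out hf zb) (H2_out hg zb).
apply: eqc_small => e e0.
have e2 := half_gt0 e0.
have [d1 d10 h1] := polyapprox_cont (analytic_polyapprox (H2_analytic hf)) zb e2.
have [d2 d20 h2] := polyapprox_cont (analytic_polyapprox (H2_analytic hg)) zb e2.
have d0 : 0 < Num.min (1 - enorm z) (Num.min d1 d2) by rewrite !lt_min d10 d20 subr_gt0 !andbT.
have [r r0 rz] := ratpt_dense z n0 d0; move: rz; rewrite !lt_min => /andP[rb /andP[r1 r2]].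
have cr : cball (ratpt r).
  rewrite /cball /= -[ratpt r](subrK z); apply: le_lt_trans (enormD _ _) _; move: rb; clear -hs; lra.
have -> : g z - f z = (f (ratpt r) - f z) - (g (ratpt r) - g z) by rewrite (h r r0 cr); ring.
by apply: normcB_le; rewrite [e]splitr; apply: lerD; apply: ltW; [exact: h1|exact: h2].
Qed.

(** The k-th function interpolates [f k] at more and more rational points; convergence on this set
    of uniqueness is enough by [bounded_seq_weak_on]. *)
Lemma extremal_weak phi : (0 < n)%N -> schur_class phi -> exists phis : nat -> Cfun R n,
  [/\ forall k, schur_class (phis k), forall k, extremal_functions (phis k) &
    forall g, H2 g -> (H2dot (phis k) g) @[k --> \oo] ~~> H2dot phi g].
Proof.
move=> n0 sp; have [f [rho [fp rk fb cf]]] := schur_poly_seq sp.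
have [y1 y11] := sphere_ex; pose y2 : Cn R n := (1 / 2)%:C *: y1.
have hf0 : 0 <= 1 / 2 :> R by rewrite divr_ge0.
have y2n : enorm y2 = 1 / 2 by rewrite (enormZR _ hf0) y11 mulr1.
have y2b : cball y2 by rewrite /cball /= y2n ltr_pdivrMr // mul1r ltr1n.
have y20 : y2 != 0.
  by apply/eqP => h; move: y2n; rewrite h enorm0 => /eqP; rewrite eq_sym mulf_eq0 oner_eq0 invr_eq0 pnatr_eq0.
pose pt (i : nat) : Cn R n := if unpickle i is Some r then ratpt r else 0.
(* y2 keeps the list nonempty, as [extremal_interp] requires; 0 is left out because the real part is
   maximised there. *)
pose s k := undup (y2 :: [seq y <- map pt (iota 0 k) | (y != 0) && `[< cball y >]]).
have sb k y : y \in s k -> y != 0 /\ cball y.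
  by rewrite mem_undup inE mem_filter => /orP[/eqP ->//|/andP[/andP[a /asboolP b] _]].
have s0 k : (0 < size (s k))%N by rewrite -has_predT; apply/hasP; exists y2 => //; rewrite mem_undup mem_head.
have sc k : schur_class (cut (f k)).
  apply: (schurP (cut_analytic (polyapprox_poly (fp k)))) => z zb; rewrite cut_in //.
  by apply: le_trans (fb k z (ltW zb)) _; exact: ltW.
have fs k y : y \in s k -> normc (cut (f k) y) < 1.
  move=> /sb[_ yb]; rewrite cut_in //; exact: (le_lt_trans (fb k y (ltW yb)) (rk k)).
have /choice[phis hphis] := fun k => extremal_interp (sc k) (undup_uniq _) (sb k) (fs k) (s0 k).
exists phis; split=> [k|k|]; [by case: (hphis k)|by case: (hphis k)|].
have sk k : schur_class (phis k) by case: (hphis k).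
pose D := [set y : Cn R n | exists r : 'rV_n, [/\ ratpt r = y, y != 0 & cball y]].
apply: (bounded_seq_weak_on (D := D) (fun k => schur_H2 (sk k)) (fun k => schur_norm (sk k)) (schur_H2 sp)).
  move=> y [r [ry yn yb]]; have /cvgcP h := cf y yb; apply/cvgcP => e e0.
  have h1 := h e e0; near=> k; have -> : phis k y = f k y.
    have [_ _ hv] := hphis k; rewrite hv ?cut_in // mem_undup inE mem_filter yn /=.
    apply/orP; right; apply/andP; split; first exact/asboolP.
    apply/mapP; exists (pickle r); last by rewrite /pt pickleK.
    by rewrite mem_iota /= add0n; near: k; exact: nbhs_infty_gt.
  by near: k.
move=> g hg gf; apply: (ratpt_uniq n0 (schur_H2 sp) hg) => r r0 rb; apply: gf; by exists r.
Unshelve. all: by end_near.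
Qed.

Opaque bdfun.

(** * The lifting problem *)

Section Lifting.
Variable Q : set (Cfun R n).
Hypothesis hQ : quotient_module sigma Q.

Let cQ : closed_subspace Q. Proof. by case: hQ. Qed.
Let QH f : Q f -> H2 f. Proof. exact: (closed_sub_H2 cQ). Qed.

(** The projection enters only through its characterisation; the identities below are proved modulo
    Q^perp. *)
Variable proj : Cfun R n -> Cfun R n.
Hypothesis projP : forall f, H2 f -> Q (proj f) /\
  forall h, Q h -> L2dot (bd f) (bd h) = L2dot (bd (proj f)) (bd h).

Lemma proj_perp f : H2 f -> H2perp Q (fun z => proj f z - f z).
Proof.
move=> hf; have [Qp pp] := projP hf; have hp := QH Qp; have Lp := bd_L2 hp; have Lf := bd_L2 hf.
apply: (H2perpP _ cQ).2; split; first exact: (H2B hp hf).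
move=> h Qh; have Lh := bd_L2 (QH Qh).
by rewrite (dot_ae (bdB hp hf) (ae_all (fun z => erefl (bd h z)))) (dotBl Lp Lf Lh) (pp _ Qh) subrr.
Qed.

Lemma perp_Q0 f : Q f -> H2perp Q f -> f = (fun=> 0).
Proof.
move=> Qf /(H2perpP _ cQ)[hf pf]; have h0 := pf _ Qf; have Lf := bd_L2 hf.
apply: (H2_eq0 hf); rewrite (H2norm_bd hf) /l2; move: h0; rewrite dot_sqn => /(congr1 (@Re R)) /= ->.
exact: sqrtr0.
Qed.

Lemma perp_chain f g h : H2perp Q (fun z => f z - g z) -> H2perp Q (fun z => g z - h z) -> H2perp Q (fun z => f z - h z).
Proof.
move=> h1 h2; have := H2perp_lin 1 cQ h1 h2.
by under eq_fun do rewrite mul1r addrA subrK.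
Qed.

Lemma perp_opp f g : H2perp Q (fun z => f z - g z) -> H2perp Q (fun z => g z - f z).
Proof.
move=> h1; have := H2perp_lin (-1) cQ h1 (H2perp_zero cQ).
by under eq_fun do rewrite mulN1r addr0 opprB.
Qed.

Lemma perp_eq f g : Q f -> Q g -> H2perp Q (fun z => f z - g z) -> f = g.
Proof.
move=> Qf Qg pfg; have Qd := closed_lin (-1) cQ Qg Qf.
have E : (fun z => -1 * g z + f z) = (fun z => f z - g z) by apply/funext => z; rewrite mulN1r addrC.
rewrite E in Qd; have h := perp_Q0 Qd pfg; apply/funext => z; apply/eqP; rewrite -subr_eq0; apply/eqP.
exact: (congr1 (fun y : Cfun R n => y z) h).
Qed.

Lemma proj_uniq f g : H2 f -> Q g -> H2perp Q (fun z => g z - f z) -> proj f = g.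
Proof.
move=> hf Qg pg; have [Qp _] := projP hf; apply: (perp_eq Qp Qg).
exact: (perp_chain (proj_perp hf) (perp_opp pg)).
Qed.

Lemma proj_id f : Q f -> proj f = f.
Proof.
move=> Qf; apply: (proj_uniq (QH Qf) Qf); have E : (fun z => f z - f z) = (fun=> 0).
  by apply/funext => z; rewrite subrr.
rewrite E; exact: (H2perp_zero cQ).
Qed.

Lemma proj_eq f g : H2 f -> H2 g -> H2perp Q (fun z => f z - g z) -> proj f = proj g.
Proof.
move=> hf hg fg; have [Qp _] := projP hg; apply: (proj_uniq hf Qp).
exact: (perp_chain (proj_perp hg) (perp_opp fg)).
Qed.

Lemma proj_Q f : H2 f -> Q (proj f). Proof. by move=> hf; have [] := projP hf. Qed.

Lemma proj_lin a f g : H2 f -> H2 g ->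
  proj (fun z => a * f z + g z) = (fun z => a * proj f z + proj g z).
Proof.
move=> hf hg; apply: proj_uniq; [exact: (H2D (H2Z a hf) hg)|exact: (closed_lin a cQ (proj_Q hf) (proj_Q hg))|].
have := H2perp_lin a cQ (proj_perp hf) (proj_perp hg); congr (H2perp Q _).
apply/funext => z; move: (proj f z) (proj g z) => c d; ring.
Qed.

Lemma proj_norm f : H2 f -> H2norm (proj f) <= H2norm f.
Proof.
move=> hf; have [Qp pp] := projP hf; have hp := QH Qp; have Lp := bd_L2 hp; have Lf := bd_L2 hf.
rewrite (H2norm_bd hp) (H2norm_bd hf); have := CS_l2 Lf Lp.
rewrite (pp _ Qp) dot_sqn normcR (ger0_norm (sqn_ge0 _)) -l2_sqr expr2.
have := l2_ge0 (bd (proj f)); rewrite le_eqVlt => /orP[/eqP <- _|l0]; first exact: l2_ge0.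
by rewrite ler_pM2r.
Qed.

Section Operator.
Variable X : Cfun R n -> Cfun R n.
Hypothesis hX : op_unit_ball sigma Q X.

Lemma op_Q f : Q f -> Q (X f). Proof. by move: hX => [[h _] _]; exact: h. Qed.

Lemma op_lin a f g : Q f -> Q g -> X (fun z => a * f z + g z) = (fun z => a * X f z + X g z).
Proof. by move: hX => [[_ h] _]; exact: h. Qed.

Lemma op_zero : X (fun=> 0) = (fun=> 0).
Proof.
have Q0 : Q (fun=> 0) by case: cQ.
have := op_lin 1 Q0 Q0; under eq_fun do rewrite mulr0 addr0; move=> h; apply/funext => z.
have := congr1 (fun y => y z) h; rewrite /= mul1r => e.
by apply: (addrI (X (fun=> 0) z)); rewrite addr0 -e.
Qed.

Lemma op_scale a f : Q f -> X (fun z => a * f z) = (fun z => a * X f z).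
Proof.
move=> Qf; have Q0 : Q (fun=> 0) by case: cQ.
have := op_lin a Qf Q0; rewrite op_zero; under eq_fun do rewrite addr0; under [in RHS]eq_fun do rewrite addr0.
by [].
Qed.

Lemma Q_scale a f : Q f -> Q (fun z => a * f z).
Proof.
move=> Qf; have Q0 : Q (fun=> 0) by case: cQ.
have := closed_lin a cQ Qf Q0; by under eq_fun do rewrite addr0.
Qed.

Lemma H2norm_scale a f : H2 f -> H2norm (fun z => a * f z) = normc a * H2norm f.
Proof.
move=> hf; rewrite (H2norm_bd (H2Z a hf)) (H2norm_bd hf) (l2_ae (bdZ a hf)).
exact: (l2Z a (bd_L2 hf)).
Qed.

Lemma op_norm f : Q f -> H2norm (X f) <= H2norm f.
Proof.
move=> Qf; have hf := QH Qf; have [f0|f0] := eqVneq (H2norm f) 0.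
  by rewrite (H2_eq0 hf f0) op_zero.
have fp : 0 < H2norm f by rewrite lt_def f0 H2norm_ge0.
pose a := ((H2norm f)^-1)%:C : R[i]; have Qa := Q_scale a Qf.
have na : normc a = (H2norm f)^-1 by rewrite normcR ger0_norm // invr_ge0 ltW.
have n1 : H2norm (fun z => a * f z) <= 1 by rewrite H2norm_scale // na mulVf.
have h : ((H2norm (X (fun z => a * f z)))%:E <= 1%:E)%E.
  by move: hX => [_ o]; apply: le_trans o; apply: ereal_sup_ubound; exists (fun z => a * f z).
move: h; rewrite lee_fin op_scale // H2norm_scale; last exact: (QH (op_Q Qf)).
by rewrite na mulrC ler_pdivrMr // mul1r.
Qed.

Hypothesis hmod : forall (i : 'I_n) f, Q f -> X (proj (fun z => coordf i z * f z)) = proj (fun z => coordf i z * X f z).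

Lemma op_poly p f : ispoly p -> Q f -> X (proj (fun z => p z * f z)) = proj (fun z => p z * X f z).
Proof.
(* The induction principle does not provide polynomiality of the parts, so it is carried along. *)
suff : ispoly p -> ispoly p /\ forall f, Q f -> X (proj (fun z => p z * f z)) = proj (fun z => p z * X f z).
  by move=> h /h[_]; exact.
move: p f => + _; apply: ispoly_ind => [c|i|p q [pp IHp] [pq IHq]|p q [pp IHp] [pq IHq]].
- split=> [|f Qf]; first exact: ispoly_cst.
  rewrite (proj_id (Q_scale c Qf)) (op_scale c Qf).
  by rewrite (proj_id (Q_scale c (op_Q Qf))).
- split=> [|f Qf]; first exact: ispoly_coord.
  exact: (hmod i Qf).
- split=> [|f Qf]; first exact: ispolyD.
  have [hp _] := H2_pmul pp (QH Qf); have [hq _] := H2_pmul pq (QH Qf).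
  have [hp' _] := H2_pmul pp (QH (op_Q Qf)); have [hq' _] := H2_pmul pq (QH (op_Q Qf)).
  have E g : (fun z => (p z + q z) * g z) = (fun z => 1 * (p z * g z) + q z * g z).
    by apply/funext => z; rewrite mul1r mulrDl.
  rewrite !E (proj_lin 1 hp hq) (proj_lin 1 hp' hq') (op_lin 1 (proj_Q hp) (proj_Q hq)).
  exact: (f_equal2 (fun a b : Cfun R n => fun z => 1 * a z + b z) (IHp f Qf) (IHq f Qf)).
- split=> [|f Qf]; first exact: ispolyM.
  have E g : Q g -> proj (fun z => (p z * q z) * g z) = proj (fun z => p z * proj (fun z => q z * g z) z).
    move=> Qg; have [hq _] := H2_pmul pq (QH Qg); have hpq := QH (proj_Q hq).
    have [h1 _] := H2_pmul pp hpq; have [h2 _] := H2_pmul (ispolyM pp pq) (QH Qg).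
    apply: proj_eq; [exact: h2|exact: h1|apply: perp_opp].
    have := perp_pmul hQ pp (proj_perp hq); congr (H2perp Q _).
    by apply/funext => z; rewrite mulrBr mulrA.
  have [hq _] := H2_pmul pq (QH Qf).
  by rewrite (E _ Qf) (IHp _ (proj_Q hq)) (IHq f Qf) (E _ (op_Q Qf)).
Qed.

Local Notation P1 := (proj one_ball).
Local Notation psi := (X P1).

Lemma P1_Q : Q P1. Proof. exact: (proj_Q one_H2). Qed.

Lemma op_proj_poly p : ispoly p -> X (proj (cut p)) = proj (fun z => p z * psi z).
Proof.
move=> hp; rewrite -[RHS](op_poly hp P1_Q); apply: (congr1 X).
have [h1 _] := H2_pmul hp (QH P1_Q); have h2 := cut_poly_H2 hp.
apply: (proj_eq h2 h1); apply: perp_opp.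
have := perp_pmul hQ hp (proj_perp one_H2); congr (H2perp Q _).
apply/funext => z; rewrite mulrBr; congr (_ - _); rewrite one_ballE; have [zb|zb] := pselect (cball z).
  by rewrite !cut_in // mulr1.
by rewrite !cut_out // mulr0.
Qed.

Lemma poly_dense f e : H2 f -> 0 < e -> exists2 p, ispoly p & H2norm (fun z => f z - cut p z) <= e.
Proof.
move=> hf e0; have [F hF] := H2_expands hf; have [K hK] := bd_approx hf hF e0.
have pp := psum_poly K hF.1; have hp := cut_poly_H2 pp; exists (psum F K); first exact: pp.
rewrite (H2norm_bd (H2B hf hp)) (l2_ae (bdB hf hp)).
rewrite (@l2_ae _ (fun z => bd f z - psum F K z)) ?hK //.
by apply: ae_mono (bd_poly pp) => z ->.
Qed.

Lemma perp_mul_sub phi f g : schur_class phi ->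
  H2perp Q (fun z => f z - g z) -> H2perp Q (fun z => phi z * f z - phi z * g z).
Proof.
move=> sp h; have := perp_mul hQ sp h; congr (H2perp Q _).
by apply/funext => z; rewrite mulrBr.
Qed.

Lemma perp_pmul_sub p f g : ispoly p -> H2perp Q (fun z => f z - g z) -> H2perp Q (fun z => p z * f z - p z * g z).
Proof.
move=> hp h; have := perp_pmul hQ hp h; congr (H2perp Q _).
by apply/funext => z; rewrite mulrBr.
Qed.

(** With P the projection onto Q, X (P p) = P (p psi) = P (p phi) = P (phi P p) for a polynomial p;
    the P p are dense in Q and both operators are contractions. *)
Lemma lift_of_perp phi : schur_class phi -> H2perp Q (fun z => psi z - phi z) ->
  forall f, Q f -> X f = proj (fun z => phi z * f z).
Proof.
move=> sp pp f Qf; have ha := sp.1.1; have hb z := schur_le z sp; have hphi := schur_H2 sp.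
have mulH g : H2 g -> H2 (fun z => phi z * g z) by move=> hg; have [] := H2M ha hb hg.
have mulN g : H2 g -> H2norm (fun z => phi z * g z) <= H2norm g.
  by move=> hg; have [_] := H2M ha hb hg; rewrite mul1r.
have onp p : ispoly p -> X (proj (cut p)) = proj (fun z => phi z * proj (cut p) z).
  move=> hp; rewrite (op_proj_poly hp); have hc := cut_poly_H2 hp; have hq := QH (proj_Q hc).
  have [h1 _] := H2_pmul hp (QH (op_Q P1_Q)).
  apply: (proj_eq h1 (mulH _ hq)); apply: (perp_chain (perp_pmul_sub hp pp)).
  have E : (fun z => phi z * cut p z - phi z * proj (cut p) z) = (fun z => p z * phi z - phi z * proj (cut p) z).
    apply/funext => z; have := congr1 (fun y : Cfun R n => y z) (cut_mul p hphi); rewrite /= => ->.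
    by rewrite [cut p z * _]mulrC.
  rewrite -E.
  exact: (perp_mul_sub sp (perp_opp (proj_perp hc))).
pose D z := -1 * proj (fun z => phi z * f z) z + X f z.
have hf := QH Qf; have Qm := proj_Q (mulH _ hf); have QX := op_Q Qf.
have QD : Q D := closed_lin (-1) cQ Qm QX.
have DE e : 0 < e -> H2norm D <= e + e.
  move=> e0; have [p hp he] := poly_dense hf e0; have hc := cut_poly_H2 hp.
  have Qg := proj_Q hc; have hg := QH Qg.
  pose d z := -1 * proj (cut p) z + f z; have Qd : Q d := closed_lin (-1) cQ Qg Qf.
  have dE : d = proj (fun z => -1 * cut p z + f z) by rewrite (proj_lin (-1) hc hf) (proj_id Qf).
  have dn : H2norm d <= e.
    rewrite dE; apply: le_trans (proj_norm (H2D (H2Z (-1) hc) hf)) _; apply: le_trans he.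
    by under eq_fun do rewrite mulN1r addrC.
  have Xd : X d = (fun z => -1 * X (proj (cut p)) z + X f z) := op_lin (-1) Qg Qf.
  have Pd : proj (fun z => phi z * d z) = (fun z => -1 * proj (fun z => phi z * proj (cut p) z) z + proj (fun z => phi z * f z) z).
    rewrite -(proj_lin (-1) (mulH _ hg) (mulH _ hf)); apply: (congr1 proj).
    by apply/funext => z; rewrite /d mulrDr mulrCA.
  have hpd := mulH _ (QH Qd); have Qpd := proj_Q hpd.
  have -> : D = (fun z => -1 * proj (fun z => phi z * d z) z + X d z).
    rewrite Xd Pd (onp p hp); apply/funext => z; rewrite /D.
    move: (proj (fun z => phi z * f z) z) (proj (fun z => phi z * proj (cut p) z) z) (X f z) => a b c; ring.
  apply: le_trans (H2norm_tri (H2Z (-1) (QH Qpd)) (QH (op_Q Qd))) _.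
  rewrite (H2norm_scale (-1) (QH Qpd)) normcN normc1 mul1r; apply: lerD; last exact: (le_trans (op_norm Qd) dn).
  apply: le_trans (proj_norm hpd) _; exact: (le_trans (mulN _ (QH Qd)) dn).
have D0 : D = (fun=> 0).
  apply: (H2_eq0 (QH QD)); apply/eqP; rewrite eq_le H2norm_ge0 andbT; apply/ler_addgt0Pr => e e0; rewrite add0r.
  have e2 := half_gt0 e0.
  by apply: le_trans (DE _ e2) _; rewrite -splitr.
apply/funext => z; have := congr1 (fun y : Cfun R n => y z) D0; rewrite /D mulN1r => /eqP.
by rewrite addrC subr_eq0 => /eqP.
Qed.

Lemma perp_of_lift phi : schur_class phi -> (forall f, Q f -> X f = proj (fun z => phi z * f z)) ->
  H2perp Q (fun z => psi z - phi z).
Proof.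
move=> sp hl; have ha := sp.1.1; have hb z := schur_le z sp; have hphi := schur_H2 sp.
have hm : H2 (fun z => phi z * P1 z) by have [] := H2M ha hb (QH P1_Q).
rewrite (hl _ P1_Q); apply: (perp_chain (proj_perp hm)).
have := perp_mul_sub sp (proj_perp one_H2); congr (H2perp Q _).
apply/funext => z; congr (_ - _); rewrite one_ballE; have [zb|zb] := pselect (cball z).
  by rewrite cut_in // mulr1.
by rewrite cut_out // mulr0 (H2_out hphi zb).
Qed.

(** If psi were 0, the function 0 would lift X by [lift_of_perp]. *)
Lemma psi_neq0 : (exists2 f, Q f & X f <> (fun=> 0)) -> psi <> (fun=> 0).
Proof.
move=> [f Qf Xf] p0; apply: Xf.
have sz : schur_class ((fun=> 0) : Cfun R n) by apply: (schurP (H2_analytic H2_zero)) => z _; rewrite normc0.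
rewrite (lift_of_perp sz _ Qf); last first.
  rewrite p0; have -> : (fun z : Cn R n => 0 - 0 : R[i]) = (fun=> 0) by apply/funext => z; rewrite subrr.
  exact: (H2perp_zero cQ).
have Q0 : Q (fun=> 0) by case: cQ.
by rewrite -[RHS](proj_id Q0); apply: (congr1 proj); apply/funext => z; rewrite mul0r.
Qed.

End Operator.
End Lifting.

(** * Annihilators, contractivity and the distance problem *)

Section Duality.
Variable Q : set (Cfun R n).
Hypothesis cQ : closed_subspace Q.

Lemma perp_closed : closed_subspace (H2perp Q).
Proof.
split=> [f [hf _]||a f g hf hg|F f hF hf lim].
- exact: hf.
- exact: (H2perp_zero cQ).
- exact: (H2perp_lin a cQ hf hg).
apply: (H2perpP _ cQ).2; split; first exact: hf.
move=> h Qh; have hh := closed_sub_H2 cQ Qh; have Lh := bd_L2 hh; have Lf := bd_L2 hf.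
apply: eqc_small => e e0; rewrite subr0.
have l1 : 0 < l2 (bd h) + 1 by rewrite ltr_wpDl // l2_ge0.
have e1 : 0 < e / (l2 (bd h) + 1) by rewrite divr_gt0.
move/cvgrPdist_lt : lim => /(_ _ e1)[N _ /(_ N (leqnn N))] /=; rewrite sub0r normrN ger0_norm // => hN.
have [hFN pN] := (H2perpP _ cQ).1 (hF N); have LF := bd_L2 hFN.
have := CS_l2 (bd_L2 (H2B hFN hf)) Lh.
rewrite (dot_ae (bdB hFN hf) (ae_all (fun z => erefl (bd h z)))) (dotBl LF Lf Lh) pN // sub0r normcN => h1.
apply: le_trans h1 _; rewrite -(H2norm_bd (H2B hFN hf)).
apply: (le_via (e / (l2 (bd h) + 1) * (l2 (bd h) + 1))); last by rewrite divfK // gt_eqF.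
by apply: ler_pM; rewrite ?lerDl ?ler01 //; exact: ltW.
Qed.

Lemma Qconj_MQ f : Qconj sigma Q f -> MQ Q f.
Proof.
move=> hf; exists f; first exact: hf.
exists (fun=> 0); last by apply/funext => z; exact: addr0.
have S0 := H2S_cst 0; have L0 := L2_cst (0 : R[i]).
have d0 v : L2 v -> L2dot (fun=> 0) v = 0.
  by move=> Lv; have := dotZl 0 L0 Lv; rewrite !mul0r.
exists (fun=> 0).
  split; first exact: L0.
  move=> v [a [La _] [b [c [Lc _] <-] <-]]; apply: d0; exact: (L2D La (L2_conj Lc)).
exists (fun=> 0); last by apply/funext => z; exact: addr0.
split; first exact: S0.
by move=> v ->; apply: d0; exact: L2_cst.
Qed.

Lemma Qconj_bd q : Q q -> Qconj sigma Q (fun z => (bd q z)^*).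
Proof.
move=> Qq; have hq := closed_sub_H2 cQ Qq; exists (bd q) => //; split; first exact: (bd_L2 hq).
by exists q => //; apply: ae_mono (bd_bdry hq) => z ->.
Qed.

Lemma boundary_setP u : boundary_set sigma Q u -> L2 u /\ exists2 q, Q q & (\ae z, u z = bd q z).
Proof.
move=> [Lu [q Qq uq]]; split; first exact: Lu.
exists q => //; apply: ae_mono (ae_and uq (bd_bdry (closed_sub_H2 cQ Qq))) => z [-> ->] //.
Qed.

Lemma MQ_pairing f : MQ Q f -> L2 f /\
  exists2 q, Q q & forall phi, H2 phi -> pairing phi f = L2dot (bd phi) (bd q).
Proof.
move=> [a [u bu <-] [_ [m hm [h hh <-]] <-]]; have [Lu [q Qq uq]] := boundary_setP bu.
split; first by apply: (L2D (L2_conj Lu)); exact: (L2D hm.1 hh.1.1).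
exists q => // phi hp; rewrite (pairingE hp Lu hm hh).
by apply: dot_ae; [exact: ae_all|exact: uq].
Qed.

Lemma pairing_Qconj phi q : H2 phi -> Q q -> pairing phi (fun z => (bd q z)^*) = H2dot phi q.
Proof.
move=> hp Qq; rewrite (H2dotE hp (closed_sub_H2 cQ Qq)); apply: cintegral_ae.
by apply: ae_mono (bd_bdry hp) => z ->.
Qed.

Lemma perp_dot psi phi q : H2 psi -> H2 phi -> H2perp Q (fun z => psi z - phi z) -> Q q ->
  L2dot (bd psi) (bd q) = L2dot (bd phi) (bd q).
Proof.
move=> h1 h2 /(H2perpP _ cQ)[_ h] Qq; have := h _ Qq; have Lq := bd_L2 (closed_sub_H2 cQ Qq).
rewrite (dot_ae (bdB h1 h2) (ae_all (fun z => erefl (bd q z)))) (dotBl (bd_L2 h1) (bd_L2 h2) Lq).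
by move=> /eqP; rewrite subr_eq0 => /eqP.
Qed.

(** Against [MQ Q], psi may be replaced by phi, whose boundary function is bounded by 1. *)
Lemma contraction_of_lift psi phi : H2 psi -> schur_class phi -> H2perp Q (fun z => psi z - phi z) ->
  forall f, MQ Q f -> ((normc (pairing psi f))%:E <= cLnorm 1%:E f)%E.
Proof.
move=> hpsi sp pp f Mf; have [Lf [q Qq fq]] := MQ_pairing Mf; have hphi := schur_H2 sp.
rewrite (fq _ hpsi) (perp_dot hpsi hphi pp Qq) -(fq _ hphi) (cLnorm1E (L2_cI Lf)) lee_fin.
have Lp := bd_L2 hphi; have iI := L2_mulI Lp Lf.
have -> : pairing phi f = cintegral (fun z => bd phi z * f z).
  by apply: cintegral_ae; apply: ae_mono (bd_bdry hphi) => z ->.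
apply: le_trans (le_cintegral iI) _; apply: Rint_le_ae; [exact: (cI_normc iI)|exact: (cI_normc (L2_cI Lf))|].
apply: ae_mono (bd_le sp.1.1 (fun z => schur_le z sp)) => z h; rewrite normcM ler_piMl //.
Qed.

Section Minimise.
Variable psi : Cfun R n.
Hypothesis hpsi : H2 psi.
Hypothesis contr : forall f, MQ Q f -> ((normc (pairing psi f))%:E <= cLnorm 1%:E f)%E.

(** Contractivity in the form used for residuals: being orthogonal to Q^perp, they are conjugates of
    elements of [MQ Q]. *)
Lemma dot_psi_le h : L2 h -> (forall g, H2perp Q g -> L2dot h (bd g) = 0) ->
  normc (L2dot h (bd psi)) <= Rint (fun z => normc (h z)).
Proof.
move=> Lw ow; have Lp := bd_L2 hpsi; have := contr (MQ_of_orth cQ Lw ow).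
rewrite (cLnorm1E (L2_cI (L2_conj Lw))) lee_fin; under [X in _ <= Rint X]eq_fun do rewrite normcJ'.
have -> : pairing psi (fun z => (h z)^*) = L2dot (bd psi) h.
  by apply: cintegral_ae; apply: ae_mono (bd_bdry hpsi) => z ->.
by rewrite (dotC Lw Lp) normcJ'.
Qed.

Definition unitk : set (Cfun R n) := [set k | cmeas k /\ forall z, normc (k z) <= 1].

Lemma unitk_L2 k : unitk k -> L2 k.
Proof. by move=> [mk k1]; apply: (L2_bnd_ae mk (M := 1)); exact: ae_all. Qed.
Lemma l2_unitk k : unitk k -> l2 k <= 1.
Proof. by move=> [mk k1]; apply: (l2_le_sup mk) => z _; exact: k1. Qed.

Definition resid k v : Cfun R n := fun z => (k z - bd psi z) - bd v z.

(** v is the best choice for the given k, which puts the residual within the scope of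
    [dot_psi_le]. *)
Definition residues := [set y : R | exists k v, [/\ unitk k, H2perp Q v,
  forall g, H2perp Q g -> L2dot (resid k v) (bd g) = 0 & y = sqn (resid k v)]].

Lemma resid_ex k : unitk k -> exists v, H2perp Q v /\ forall g, H2perp Q g -> L2dot (resid k v) (bd g) = 0.
Proof.
move=> hk; have Lk := unitk_L2 hk; have [v [pv ov]] := H2_projection perp_closed (L2B Lk (bd_L2 hpsi)).
by exists v.
Qed.

(** This is - h / |h|, with e added to the denominator so that nothing happens where h vanishes. *)
Lemma shrink_unitk h e : 0 < e -> L2 h -> unitk (fun z => - (((normc (h z) + e)^-1)%:C * h z)).
Proof.
move=> e0 Lw; have mw := L2_cmeas Lw; have p0 z : 0 < normc (h z) + e by rewrite ltr_wpDl // normc_ge0.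
split=> [|z].
  apply: cmeasN; apply: cmeasM => //; apply: cmeas_real; apply: rmeas_inv => //.
  by apply: rmeasD; [exact: cmeas_normc|exact: rmeas_cst].
rewrite normcN normcM normcR ger0_norm ?invr_ge0 ?(ltW (p0 z)) // mulrC ler_pdivrMr // mul1r lerDl; exact: ltW.
Qed.

Lemma shrink_dot h e : 0 < e -> L2 h ->
  Re (L2dot h (fun z => - (((normc (h z) + e)^-1)%:C * h z))) <= e - Rint (fun z => normc (h z)).
Proof.
move=> e0 Lw; have hk := shrink_unitk e0 Lw; have Lk := unitk_L2 hk; have iI := L2dot_I Lw Lk.
have p0 z : 0 < normc (h z) + e by rewrite ltr_wpDl // normc_ge0.
have -> : Re (L2dot h (fun z => - (((normc (h z) + e)^-1)%:C * h z))) =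
    Rint (fun z => - (normc (h z) ^+ 2 / (normc (h z) + e))).
  rewrite /L2dot cintegralE /=; congr Rint; apply/funext => z.
  by rewrite conjcN conjcM conjcR mulrN mulrCA mulcJ ReN -rmorphM /= mulrC.
have iw := cI_normc (L2_cI Lw).
rewrite -[X in _ <= X - _](Rint_cst e) -RintB //; last exact: rI_cst.
apply: Rint_le.
- have := iI.1; congr (rI _); apply/funext => z.
  by rewrite conjcN conjcM conjcR mulrN mulrCA mulcJ ReN -rmorphM /= mulrC.
- by apply: rI_B => //; exact: rI_cst.
move=> z; have n0 := normc_ge0 (h z); rewrite lerNl opprB.
rewrite ler_pdivlMr //; move: (normc (h z)) n0 => x x0; nra.
Qed.

Lemma resid_L2 k v : unitk k -> H2 v -> L2 (resid k v).
Proof. by move=> hk hv; exact: (L2B (L2B (unitk_L2 hk) (bd_L2 hpsi)) (bd_L2 hv)). Qed.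

Lemma resid_min k v v2 : unitk k -> H2perp Q v -> H2perp Q v2 ->
  (forall g, H2perp Q g -> L2dot (resid k v2) (bd g) = 0) -> sqn (resid k v2) <= sqn (resid k v).
Proof.
move=> hk pv pv2 ov2; have Lv := bd_L2 pv.1; have Lv2 := bd_L2 pv2.1; have Lr := resid_L2 hk pv2.1.
have -> : resid k v = (fun z => resid k v2 z + (bd v2 z - bd v z)) by apply/funext => z; rewrite /resid; ring.
rewrite (sqnD Lr (L2B Lv2 Lv)) (dotBr Lv2 Lv Lr) !ov2 // subrr mulr0 addr0 lerDl; exact: sqn_ge0.
Qed.

(** Going from k to k + t (k2 - k) adds 2 t Re <w, k2 - k> + t^2 |k2 - k|^2 to the square norm. The
    real part is at most e - |w|^2: <w, k> = |w|^2 + <w, psi>, Re <w, k2> is at most e minus the L^1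
    norm of w, and this norm dominates |<w, psi>| by contractivity. *)
Lemma descent (y d2 t e : R) : residues y -> (forall x, residues x -> d2 <= x) -> 0 <= t -> t <= 1 -> 0 < e ->
  d2 <= y * (1 - 2 * t) + 2 * t * e + 4 * t ^+ 2.
Proof.
move=> [k [v [hk pv ov ->]]] hd t0 t1 e0; pose w := resid k v; rewrite -/w.
have Lpsi := bd_L2 hpsi; have Lv := bd_L2 pv.1; have Lk := unitk_L2 hk; have Lw : L2 w := resid_L2 hk pv.1.
pose k2 z := - (((normc (w z) + e)^-1)%:C * w z); have hk2 : unitk k2 := shrink_unitk e0 Lw.
have Lk2 := unitk_L2 hk2; pose kt z := k z + t%:C * (k2 z - k z).
have hkt : unitk kt.
  split=> [|z]; first by apply: cmeasD; [exact: hk.1|apply: cmeasM; [exact: cmeas_cst|exact: (cmeasB hk2.1 hk.1)]].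
  have -> : kt z = (1 - t)%:C * k z + t%:C * k2 z by rewrite /kt rmorphB; ring.
  apply: normcD_le; rewrite !normcM !normcR !ger0_norm ?subr_ge0 //.
  have := hk.2 z; have := hk2.2 z; move: t0 t1; clear -hs; move: (normc _) (normc _) => a b; nra.
have [v2 [pv2 ov2]] := resid_ex hkt.
have Ld := L2B Lk2 Lk.
have l2d : sqn (fun z => k2 z - k z) <= 4.
  rewrite -l2_sqr; have h := l2B Lk2 Lk; have := l2_unitk hk; have := l2_unitk hk2.
  have := l2_ge0 (fun z => k2 z - k z); move: h; clear -hs; move: (l2 _) (l2 _) (l2 _) => a b c; nra.
have wk : L2dot w k = (sqn w)%:C + L2dot w (bd psi).
  have kE : k = (fun z => w z + (bd psi z + bd v z)) by apply/funext => z; rewrite /w /resid; ring.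
  rewrite {1}kE (dotDr Lw (L2D Lpsi Lv) Lw) (dotDr Lpsi Lv Lw) dot_sqn.
  have -> : L2dot w (bd v) = 0 by exact: ov.
  by rewrite addr0.
have re : Re (L2dot w (fun z => k2 z - k z)) <= e - sqn w.
  rewrite (dotBr Lk2 Lk Lw) wk ReD ReN ReD; have -> : Re (sqn w)%:C = sqn w by [].
  have h1 := shrink_dot e0 Lw; have h2 := dot_psi_le Lw ov.
  have h3 := Re_le_normc (L2dot w (bd psi)); move: h3; rewrite ler_norml => /andP[h3 _].
  rewrite -/k2 in h1; move: h1 h2 h3; clear -hs.
  by move: (Re _) (Re _) (Rint _) (normc _) (sqn _) => a b c d x; lra.
apply: le_trans (hd (sqn (resid kt v2)) _) _; first by exists kt, v2.
apply: le_trans (resid_min hkt pv pv2 ov2) _.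
have -> : resid kt v = (fun z => w z + t%:C * (k2 z - k z)) by apply/funext => z; rewrite /w /resid /kt; ring.
rewrite (sqnD Lw (L2Z _ Ld)) (dotZr _ Ld Lw) conjcR (sqnZ _ Ld) normcR (ger0_norm t0) Re_scale.
have := ler_wpM2l t0 re; have := ler_wpM2l (sqr_ge0 t) l2d; clear -hs; lra.
Qed.

(** A positive infimum d2 is contradicted by [descent] at a nearly minimal residue, with 4 t <= d2.
    The infimum is not claimed to be attained: the limit is taken later, in H^2. *)
Lemma resid_small (eta : R) : 0 < eta -> exists k v, [/\ unitk k, H2perp Q v & sqn (resid k v) < eta].
Proof.
move=> eta0; have k0 : unitk (fun=> 0) by split=> [|z]; [exact: cmeas_cst|rewrite normc0].
have [v0 [pv0 ov0]] := resid_ex k0.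
have hi : has_inf residues.
  by split; [exists (sqn (resid (fun=> 0) v0)), (fun=> 0), v0|exists 0 => _ [k [v [_ _ _ ->]]]; exact: sqn_ge0].
have [d2 [d20 d2l d2a]] : exists d2 : R, [/\ 0 <= d2, forall x, residues x -> d2 <= x & forall e, 0 < e -> exists2 y, residues y & y < d2 + e].
  exists (inf residues); split=> [|x hx|e e0]; [|exact: (ge_inf hi.2)|exact: inf_adherent].
  by apply: lb_le_inf; [exact: hi.1|move=> _ [k [v [_ _ _ ->]]]; exact: sqn_ge0].
suff d0 : d2 = 0.
  have [y [k [v [hk pv _ yE]]] yl] := d2a eta eta0; exists k, v; split=> //; by rewrite -yE -[eta]add0r -d0.
apply/eqP; rewrite eq_le d20 andbT leNgt; apply/negP => dp.
have [t [t0 t1 t2]] : exists t, [/\ 0 < t, t <= 1 / 2 & 4 * t <= d2].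
  exists (Num.min (1 / 2) (d2 / 4)); split; first by rewrite lt_min !divr_gt0.
    by rewrite ge_min lexx.
  by rewrite mulrC -ler_pdivlMr // ge_min lexx orbT.
have e0 : 0 < t * d2 / 2 by rewrite divr_gt0 // mulr_gt0.
have [y ry yl] := d2a _ e0; have t1' : t <= 1 by lra.
have := descent ry d2l (ltW t0) t1' e0; move: t0 t1 t2 yl dp; clear -hs => t0 t1 t2 yl dp h.
have : y * (1 - 2 * t) <= (d2 + t * d2 / 2) * (1 - 2 * t) by apply: ler_wpM2r; lra.
by nra.
Qed.

End Minimise.

(** Weak limits in H^2 are tested only against H^2; replacing u by its projection extends the test
    to all of L^2. *)
Lemma dot_bd_proj u : L2 u -> exists2 p, H2 p & forall g, H2 g -> L2dot (bd g) u = H2dot g p.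
Proof.
move=> Lu; have [p [hp op]] := H2_projection H2_closed Lu; exists p => // g hg.
have Lg := bd_L2 hg; have Lp := bd_L2 hp; rewrite (H2dotE hg hp); apply/eqP; rewrite -subr_eq0 -(dotBr Lu Lp Lg).
by rewrite (dotC (L2B Lu Lp) Lg) (op _ hg) rmorph0.
Qed.

Definition clip (b : R[i]) : R[i] := ((Num.max 1 (normc b))^-1)%:C * b.

(** The variational inequality of [clip] as the nearest point map onto the closed unit disc. *)
Lemma clip_test (k b : R[i]) : normc k <= 1 -> Re ((k - clip b) * (b - clip b)^*) <= 0.
Proof.
move=> k1; have m1 : 1 <= Num.max 1 (normc b) by rewrite le_max lexx.
have mp : 0 < Num.max 1 (normc b) := lt_le_trans ltr01 m1.
have [bl|bl] := leP (normc b) 1; first by rewrite /clip max_l // invr1 mul1r subrr rmorph0 mulr0.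
rewrite /clip (max_r (ltW bl)).
have b0 : 0 < normc b := lt_trans ltr01 bl.
have -> : b - ((normc b)^-1)%:C * b = (1 - (normc b)^-1)%:C * b by rewrite rmorphB mulrBl mul1r.
rewrite conjcM conjcR mulrCA ReM /= mul0r subr0.
have i1 : (normc b)^-1 <= 1 by rewrite invf_le1 // ltW.
apply: mulr_ge0_le0; first by rewrite subr_ge0.
rewrite mulrBl -mulrA mulcJ -rmorphM /= ReD ReN /= subr_le0 expr2 mulrA mulVf ?gt_eqF // mul1r.
apply: le_trans (ler_norm _) (le_trans (Re_le_normc _) _); rewrite normcM normcJ' ler_piMl //.
Qed.

Lemma clip_fix (b : R[i]) : b = clip b -> normc b <= 1.
Proof.
move=> e; have := congr1 (fun x : R[i] => normc x) e; rewrite /clip normcM normcR.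
have m1 : 1 <= Num.max 1 (normc b) by rewrite le_max lexx.
have [//|bl] := leP (normc b) 1; have b0 : 0 < normc b := lt_trans ltr01 bl.
by rewrite gtr0_norm ?invr_gt0 // mulVf ?gt_eqF // => h; move: bl; rewrite h ltxx.
Qed.

(** Each psi + v j is close in L^2 to a function bounded by 1; phi is an ultrafilter limit of these.
    The weak limit tested against u = phi - clip phi gives, by [clip_test], Re <phi - clip phi, u>
    <= 0, so u = 0 and |phi| <= 1 on the sphere. *)
Lemma lift_of_contr psi : H2 psi ->
  (forall f, MQ Q f -> ((normc (pairing psi f))%:E <= cLnorm 1%:E f)%E) ->
  exists2 phi, schur_class phi & H2perp Q (fun z => psi z - phi z).
Proof.
move=> hpsi contr; have Lpsi := bd_L2 hpsi.
have /choice[kv hkv] : forall j : nat, exists kv : Cfun R n * Cfun R n, [/\ unitk kv.1, H2perp Q kv.2 &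
    l2 (resid psi kv.1 kv.2) <= j.+1%:R^-1].
  move=> j; have j0 : 0 < j.+1%:R^-1 :> R by rewrite invr_gt0 ltr0n.
  have [k [v [hk pv hr]]] := resid_small hpsi contr (exprn_gt0 2 j0); exists (k, v); split=> //.
  by rewrite -(@ler_pXn2r _ 2) ?nnegrE ?(ltW j0) // l2_sqr ltW.
pose k j := (kv j).1; pose v j := (kv j).2.
have hk j : unitk (k j) by case: (hkv j).
have pv j : H2perp Q (v j) by case: (hkv j).
have rj j : l2 (resid psi (k j) (v j)) <= j.+1%:R^-1 by case: (hkv j).
have hv j := (pv j).1; have Lk j := unitk_L2 (hk j); have Lr j := resid_L2 hpsi (hk j) (hv j).
pose q j z := psi z + v j z; have hq j : H2 (q j) := H2D hpsi (hv j).
have qae j : (\ae z, bd (q j) z = k j z - resid psi (k j) (v j) z).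
  by apply: ae_mono (bdD hpsi (hv j)) => z ->; rewrite /resid; ring.
have nq j : H2norm (q j) <= 2.
  rewrite (H2norm_bd (hq j)) (l2_ae (qae j)); apply: le_trans (l2B (Lk j) (Lr j)) _.
  have h1 := l2_unitk (hk j); have h2 := rj j; have : j.+1%:R^-1 <= 1 :> R by rewrite invf_le1 ?ltr0n // ler1n.
  by move: h1 h2; clear -hs; move: (l2 _) (l2 _) (_^-1) => a b c; lra.
have [U [UU hU]] := @ultraFilterLemma nat \oo _.
have [phi [hphi _ _ wphi]] := ulim_H2 UU hq nq.
have Lphi := bd_L2 hphi.
pose m z := clip (bd phi z); pose u z := bd phi z - m z.
have Lm : L2 m.
  apply: (L2_bnd_ae (M := 1)).
    apply: cmeasM; last exact: (L2_cmeas Lphi); apply: cmeas_real; apply: rmeas_inv => [z|].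
      by rewrite lt_max ltr01.
    by apply: rmeas_max; [exact: rmeas_cst|apply: cmeas_normc; exact: (L2_cmeas Lphi)].
  apply: ae_all => z; rewrite /m /clip normcM normcR.
  have m1 : 1 <= Num.max 1 (normc (bd phi z)) by rewrite le_max lexx.
  rewrite ger0_norm ?invr_ge0 ?(le_trans ler01) // mulrC ler_pdivrMr ?(lt_le_trans ltr01) // mul1r.
  by rewrite le_max lexx orbT.
have Lu : L2 u := L2B Lphi Lm.
have [p hp dp] := dot_bd_proj Lu.
have le1 : Re (L2dot (bd phi) u) <= Re (L2dot m u).
  apply/ler_addgt0Pr => e e0; have e2 := half_gt0 e0.
  have l1 : 0 < l2 u + 1 by rewrite ltr_wpDl // l2_ge0.
  have e3 : 0 < e / 2 / (l2 u + 1) by rewrite divr_gt0.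
  have /cvgcP/(_ _ e2) h1 := wphi p hp.
  have h2 : \forall j \near U, j.+1%:R^-1 < e / 2 / (l2 u + 1) by apply: hU; exact: (near_infty_natSinv_lt (PosNum e3)).
  have [j [h3 h4]] := filter_ex (filterI h1 h2); cbv beta in h3, h4.
  rewrite -(dp _ (hq j)) -(dp _ hphi) in h3.
  have d1 : L2dot (bd (q j)) u = L2dot (k j) u - L2dot (resid psi (k j) (v j)) u.
    by rewrite (dot_ae (qae j) (ae_all (fun z => erefl (u z)))) (dotBl (Lk j) (Lr j) Lu).
  have d2 : Re (L2dot (k j) u) <= Re (L2dot m u).
    rewrite -subr_le0 -ReN -ReD -(dotBl (Lk j) Lm Lu) /L2dot cintegralE /= -(Rint_cst 0).
    have iI := L2dot_I (L2B (Lk j) Lm) Lu.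
    apply: Rint_le; [exact: iI.1|exact: rI_cst|] => z; apply: clip_test; exact: (hk j).2.
  have d3 : normc (L2dot (resid psi (k j) (v j)) u) <= e / 2.
    apply: le_trans (CS_l2 (Lr j) Lu) _; apply: (le_via (e / 2 / (l2 u + 1) * (l2 u + 1))); last first.
      by rewrite divfK // gt_eqF.
    apply: ler_pM; rewrite ?lerDl ?ler01 //; exact: (le_trans (rj j) (ltW h4)).
  rewrite d1 in h3; have h5 := le_lt_trans (Re_le_normc _) h3; move: h5; rewrite !ReD !ReN ltr_norml => /andP[h5 _].
  have h6 := le_trans (Re_le_normc _) d3; move: h6; rewrite ler_norml => /andP[_ h6'].
  have h6 := le_trans (Re_le_normc _) d3; move: h6; rewrite ler_norml => /andP[h6 _].
  move: d2 h5 h6 h6'; clear -hs; move: (Re _) (Re _) (Re _) (Re _) => a b c d; lra.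
have su : sqn u = 0.
  apply/eqP; rewrite eq_le sqn_ge0 andbT.
  have : (sqn u)%:C = L2dot (bd phi) u - L2dot m u by rewrite -dot_sqn (dotBl Lphi Lm Lu).
  by move=> /(congr1 (@Re R)); rewrite ReD ReN /= => ->; rewrite subr_le0.
exists phi.
  apply: (max_principle hphi); apply: ae_mono (sqn0_ae Lu su) => z /eqP; rewrite subr_eq0 => /eqP; exact: clip_fix.
split; first exact: (H2B hpsi hphi).
move=> g Qg; have hg := closed_sub_H2 cQ Qg; have Lg := bd_L2 hg.
have c2 : (H2dot (q j) g) @[j --> U] ~~> H2dot psi g.
  apply/cvgcP => e e0; apply: filterE => j; have [_ o] := (H2perpP _ cQ).1 (pv j).
  rewrite (H2dotE (hq j) hg) (dot_ae (bdD hpsi (hv j)) (ae_all (fun z => erefl (bd g z)))).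
  rewrite (dotDl Lpsi (bd_L2 (hv j)) Lg) (o _ Qg) addr0 (H2dotE hpsi hg) subrr normc0 //.
have e : H2dot phi g = H2dot psi g by exact: (cvg_unique _ (wphi g hg) c2).
apply: (dotB0 hpsi hphi hg).2; rewrite -(H2dotE hpsi hg) -(H2dotE hphi hg) e; exact: erefl.
Qed.

Lemma pairing_bd phi f : H2 phi -> pairing phi f = cintegral (fun z => bd phi z * f z).
Proof. by move=> hp; apply: cintegral_ae; apply: ae_mono (bd_bdry hp) => z ->. Qed.

Lemma pairing_lin (a b : R[i]) phi f g : H2 phi -> L2 f -> L2 g ->
  pairing phi (fun z => a * f z + b * g z) = a * pairing phi f + b * pairing phi g.
Proof.
move=> hp Lf Lg; have Lp := bd_L2 hp; rewrite !(pairing_bd _ hp).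
have i1 := L2_mulI Lp Lf; have i2 := L2_mulI Lp Lg.
rewrite -(cintegralZ a i1) -(cintegralZ b i2) -(cintegralD (cI_Z a i1) (cI_Z b i2)).
by congr cintegral; apply/funext => z; ring.
Qed.

Lemma MQP f : MQ Q f <-> L2 f /\ forall g, H2perp Q g -> pairing g f = 0.
Proof.
split=> [Mf|[Lf o1]].
  have [Lf [q Qq fq]] := MQ_pairing Mf; split; first exact: Lf.
  by move=> g pg; rewrite (fq _ pg.1); exact: (((H2perpP _ cQ).1 pg).2 _ Qq).
have -> : f = (fun z => ((f z)^*)^*) by apply/funext => z; rewrite conjcK'.
apply: (MQ_of_orth cQ (L2_conj Lf)) => g pg; have Lg := bd_L2 pg.1.
have h : L2dot (bd g) (fun z => (f z)^*) = 0.
  rewrite -(o1 g pg) (pairing_bd _ pg.1) /L2dot; congr cintegral; apply/funext => z.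
  by rewrite conjcK'.
by rewrite (dotC Lg (L2_conj Lf)) h rmorph0.
Qed.

Lemma MQ_lin (a b : R[i]) f g : MQ Q f -> MQ Q g -> MQ Q (fun z => a * f z + b * g z).
Proof.
move=> /MQP[Lf o1] /MQP[Lg o2]; apply: (MQP _).2; split; first exact: (L2D (L2Z a Lf) (L2Z b Lg)).
by move=> h ph; rewrite (pairing_lin a b ph.1 Lf Lg) o1 // o2 // !mulr0 addr0.
Qed.

(** The functional sees only the component in Q^conj, so orthogonality of that component to the
    conjugate of psi is its vanishing: the space in (4) is the kernel of the functional in (3). *)
Lemma MQtildeP psi v : H2 psi -> MQtilde sigma Q psi v <-> MQ Q v /\ pairing psi v = 0.
Proof.
move=> hpsi; have dE u : L2dot (fun z => (u z)^*) (fun z => (bdry psi z)^*) = L2dot (bd psi) u.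
  rewrite /L2dot; apply: cintegral_ae; apply: ae_mono (bd_bdry hpsi) => z ->.
  by rewrite conjcK' mulrC.
split=> [[a [[u bu uE] oa] [r hr vE]]|[Mv pv]].
  have Mv : MQ Q v by exists a; [exists u|exists r].
  split; first exact: Mv.
  have [Lu _] := boundary_setP bu; case: hr vE => m hm [h hh rE] vE.
  have := oa _ (erefl _); rewrite -uE dE -vE -rE -uE => <-; exact: (pairingE hpsi Lu hm hh).
move: Mv => [a [u bu uE] [r hr vE]]; exists a; last by exists r.
split; first by exists u.
have [Lu _] := boundary_setP bu; case: hr vE => m hm [h hh rE] vE.
move=> _ ->; rewrite -uE dE -pv -vE -rE -uE; exact/esym/(pairingE hpsi Lu hm hh).
Qed.

Section Distance.
Variable psi : Cfun R n.
Hypothesis Qpsi : Q psi.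
Hypothesis psi0 : psi <> (fun=> 0).

Let hpsi : H2 psi. Proof. exact: (closed_sub_H2 cQ Qpsi). Qed.
Let c := sqn (bd psi).

Let c0 : c%:C != 0.
Proof.
apply/eqP => /(congr1 (@Re R)) /= h; apply: psi0; apply: (H2_eq0 hpsi).
by rewrite (H2norm_bd hpsi) /l2 -/c h sqrtr0.
Qed.

(** The point of (4), written with the measurable representative; the normalisation makes the
    functional equal to 1 there. *)
Definition dual_psi : Cfun R n := fun z => (bd psi z)^* / c%:C.

Lemma dual_psiE : (\ae z, (bdry psi z)^* / (fine (cLnorm 2%:E (bdry psi)) ^+ 2)%:C = dual_psi z).
Proof.
have e2 : (2%:E : \bar R) = 1%:E \/ (2%:E : \bar R) = 2%:E by right.
rewrite (cLnorm_ae e2 (bd_bdry hpsi)) (cLnorm2E (bd_L2 hpsi)) /= l2_sqr.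
by apply: ae_mono (bd_bdry hpsi) => z ->.
Qed.

Lemma dual_psi_MQ : MQ Q dual_psi.
Proof.
have Mc := Qconj_MQ (Qconj_bd Qpsi); have := MQ_lin (c%:C^-1) 0 Mc Mc.
by under eq_fun do rewrite mul0r addr0 mulrC.
Qed.

Lemma dual_psi_pairing : pairing psi dual_psi = 1.
Proof.
rewrite (pairing_bd _ hpsi); have -> : (fun z => bd psi z * dual_psi z) = (fun z => c%:C^-1 * (bd psi z * (bd psi z)^*)).
  by apply/funext => z; rewrite /dual_psi; ring.
have Lp := bd_L2 hpsi; rewrite (cintegralZ _ (L2dot_I Lp Lp)) -/(L2dot (bd psi) (bd psi)) dot_sqn -/c.
by rewrite mulVf.
Qed.

Lemma MQ_pairing_one f : MQ Q f -> pairing psi f = 1 -> MQtilde sigma Q psi (fun z => dual_psi z - f z).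
Proof.
move=> Mf pf; apply: (MQtildeP _ hpsi).2; have E : (fun z => dual_psi z - f z) = (fun z => 1 * dual_psi z + (-1) * f z).
  by apply/funext => z; rewrite mul1r mulN1r.
rewrite E; split; first exact: (MQ_lin 1 (-1) dual_psi_MQ Mf).
have Lf := ((MQP _).1 Mf).1; have Ld := ((MQP _).1 dual_psi_MQ).1.
by rewrite (pairing_lin 1 (-1) hpsi Ld Lf) dual_psi_pairing pf mul1r mulN1r subrr.
Qed.

Lemma dist_of_contr : (forall f, MQ Q f -> ((normc (pairing psi f))%:E <= cLnorm 1%:E f)%E) ->
  (1%:E <= L1dist sigma (fun z => ((bdry psi z)^* / (fine (cLnorm 2%:E (bdry psi)) ^+ 2)%:C)%R) (MQtilde sigma Q psi))%E.
Proof.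
move=> contr; apply: le_ereal_inf_tmp => _ [v /(MQtildeP _ hpsi)[Mv pv] <-].
have e1 : (1%:E : \bar R) = 1%:E \/ (1%:E : \bar R) = 2%:E by left.
rewrite (@cLnorm_ae _ (fun z => 1 * dual_psi z + (-1) * v z) _ e1); last first.
  by apply: ae_mono dual_psiE => z h; rewrite mul1r mulN1r -h.
have Lv := ((MQP _).1 Mv).1; have Ld := ((MQP _).1 dual_psi_MQ).1.
have := contr _ (MQ_lin 1 (-1) dual_psi_MQ Mv).
by rewrite (pairing_lin 1 (-1) hpsi Ld Lv) dual_psi_pairing pv mul1r mulr0 addr0 normc1.
Qed.

(** If f has pairing a != 0, then f / a differs from [dual_psi] by an element of the kernel, so its
    L^1 norm is one of the distances in (4). *)
Lemma contr_of_dist :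
  (1%:E <= L1dist sigma (fun z => ((bdry psi z)^* / (fine (cLnorm 2%:E (bdry psi)) ^+ 2)%:C)%R) (MQtilde sigma Q psi))%E ->
  forall f, MQ Q f -> ((normc (pairing psi f))%:E <= cLnorm 1%:E f)%E.
Proof.
move=> hd f Mf; have Lf := ((MQP _).1 Mf).1; pose a := pairing psi f.
rewrite (cLnorm1E (L2_cI Lf)) lee_fin -/a; have [->|a0] := eqVneq a 0.
  by rewrite normc0; apply: Rint_ge0 => z; exact: normc_ge0.
have na : 0 < normc a by rewrite normc_gt0.
pose g z := a^-1 * f z + 0 * f z; have Mg : MQ Q g by exact: MQ_lin.
have pg : pairing psi g = 1 by rewrite /g (pairing_lin _ _ hpsi Lf Lf) -/a mul0r addr0 mulVf.
have Mt := MQ_pairing_one Mg pg.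
have e1 : (1%:E : \bar R) = 1%:E \/ (1%:E : \bar R) = 2%:E by left.
have gE : g = (fun z => a^-1 * f z) by apply/funext => z; rewrite /g mul0r addr0.
have := le_trans hd (ereal_inf_lbound (ex_intro2 _ _ _ Mt erefl)).
rewrite (@cLnorm_ae _ g _ e1); last first.
  by apply: ae_mono dual_psiE => z h; rewrite -[LHS]/(_ - (dual_psi z - g z)) h subKr.
rewrite gE (cLnorm1E (L2_cI (L2Z a^-1 Lf))) lee_fin.
under [X in _ <= Rint X -> _]eq_fun do rewrite normcM.
rewrite (RintZ _ (cI_normc (L2_cI Lf))) => h.
have ai : normc a * normc a^-1 = 1 by rewrite -normcM mulfV // normc1.
by have := ler_wpM2l (ltW na) h; rewrite mulr1 mulrA ai mul1r.
Qed.

End Distance.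

Lemma pairing_weak psi phi phis : H2 psi -> H2 phi -> H2perp Q (fun z => psi z - phi z) ->
  (forall k : nat, H2 (phis k)) ->
  (forall g, H2 g -> (H2dot (phis k) g) @[k --> \oo] ~~> H2dot phi g) ->
  forall f, MQ Q f -> (pairing (phis k) f) @[k --> \oo] ~~> pairing psi f.
Proof.
move=> hpsi hphi pp hk hw f Mf; have [Lf [q Qq fq]] := MQ_pairing Mf; have hq := closed_sub_H2 cQ Qq.
rewrite (fq _ hpsi) (perp_dot hpsi hphi pp Qq) -(H2dotE hphi hq).
under eq_fun => k do rewrite (fq _ (hk k)) -(H2dotE (hk k) hq).
exact: hw.
Qed.

Lemma inner_schur phi : inner_functions sigma phi -> schur_class phi.
Proof.
move=> [hp h1]; have [M _ hM] := HinftyP hp; have hH := Hinfty_H2 hp.1 hM.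
apply: (max_principle hH); apply: ae_mono (ae_and h1 (bd_bdry hH)) => z [e <-].
by rewrite e.
Qed.

(** The sequence need not converge weakly, but every ultrafilter limit of it is a Schur function
    with the same products against Q as psi. *)
Lemma lift_of_weak psi phis : H2 psi -> (forall k : nat, schur_class (phis k)) ->
  (forall f, Qconj sigma Q f -> (pairing (phis k) f) @[k --> \oo] ~~> pairing psi f) ->
  exists2 phi, schur_class phi & H2perp Q (fun z => psi z - phi z).
Proof.
move=> hpsi sk hw; have [U [UU hU]] := @ultraFilterLemma nat \oo _.
have [phi [hphi _ pphi wphi]] := ulim_H2 UU (fun k : nat => schur_H2 (sk k)) (fun k : nat => schur_norm (sk k)).
exists phi.
  apply: (schurP (H2_analytic hphi)) => z _; apply: (ulim_le (pphi z)); apply: filterE => k; exact: schur_le.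
split; first exact: (H2B hpsi hphi).
move=> q Qq; have hq := closed_sub_H2 cQ Qq.
have c2 : (H2dot (phis k) q) @[k --> U] ~~> H2dot psi q.
  have /cvgcP h := hw _ (Qconj_bd Qq); apply/cvgcP => e e0; have := h e e0.
  move=> he; apply: filterS (hU _ he) => k /=.
  by rewrite (pairing_Qconj hpsi Qq) (pairing_Qconj (schur_H2 (sk k)) Qq).
have e : H2dot phi q = H2dot psi q by exact: (cvg_unique _ (wphi q hq) c2).
apply: (dotB0 hpsi hphi hq).2; rewrite -(H2dotE hpsi hq) -(H2dotE hphi hq) e; exact: erefl.
Qed.

End Duality.

End Sphere.

(** * The equivalences *)

Theorem theorem4 (R : realType) (n : nat) (hn : (0 < n)%N)
    (sigma : probability (CnBorel R n) R)
    (hsigma : normalized_surface_measure sigma)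
    (Q : set (Cfun R n)) (hQ : quotient_module sigma Q)
    (X : Cfun R n -> Cfun R n) (hX : op_unit_ball sigma Q X)
    (hXmod : module_map sigma Q X)
    (hX0 : exists2 f, Q f & X f <> (fun=> 0))
    (A : set (Cfun R n))
    (hA : A = inner_functions sigma \/ A = extremal_functions) :
  let psi := X (H2proj sigma Q one_ball) in
  [<->
    (* (1) *)
    exists2 phi, schur_class phi &
      forall f, Q f -> X f = compression sigma Q phi f;
    (* (2) *)
    exists2 phi, schur_class phi & H2perp sigma Q (psi - phi);
    (* (3) *)
    forall f, MQ sigma Q f ->
      ((normc (pairing sigma psi f))%:E <= cLnorm sigma 1%:E f)%E;
    (* (4) *)
    (1%:E <= L1dist sigma
       (fun z => (bdry psi z)^*
                 / (fine (cLnorm sigma 2%:E (bdry psi)) ^+ 2)%:C)%R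
       (MQtilde sigma Q psi))%E;
    (* (5) *)
    exists2 phi_ : nat -> Cfun R n,
      (forall k, A (phi_ k)) &
      forall f, MQ sigma Q f ->
        (pairing sigma (phi_ k) f : R[i]^o) @[k --> \oo] -->
        (pairing sigma psi f : R[i]^o);
    (* (6) *)
    exists2 phi_ : nat -> Cfun R n,
      (forall k, A (phi_ k)) &
      forall f, Qconj sigma Q f ->
        (pairing sigma (phi_ k) f : R[i]^o) @[k --> \oo] -->
        (pairing sigma psi f : R[i]^o)
  ]
  /\ (forall phi, schur_class phi -> H2perp sigma Q (psi - phi) ->
        forall f, Q f -> X f = compression sigma Q phi f).
Proof.
move=> psi; have [cQ _ _] := hQ.
have projP f : H2 sigma f -> Q (H2proj sigma Q f) /\
    forall h, Q h -> L2dot sigma (bdfun sigma f) (bdfun sigma h) = L2dot sigma (bdfun sigma (H2proj sigma Q f)) (bdfun sigma h).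
  exact: (H2proj_spec hsigma cQ).
have lift phi : schur_class phi -> H2perp sigma Q (psi - phi) -> forall f, Q f -> X f = compression sigma Q phi f.
  exact: (lift_of_perp hsigma hQ projP hX hXmod).
have Qpsi : Q psi := op_Q hX (P1_Q hsigma projP).
have psi0 : psi <> (fun=> 0) := psi_neq0 hsigma hQ projP hX hXmod hX0.
have hpsi := closed_sub_H2 cQ Qpsi.
have contr_lift := lift_of_contr hsigma cQ hpsi.
have schurA phi : A phi -> schur_class phi.
  by case: hA => ->; [exact: inner_schur|case].
have dense phi : schur_class phi -> exists phis : nat -> Cfun R n, [/\ forall k, schur_class (phis k), forall k, A (phis k) &
    forall g, H2 sigma g -> (H2dot sigma (phis k) g : R[i]^o) @[k --> \oo] --> (H2dot sigma phi g : R[i]^o)].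
  by case: hA => ->; [exact: inner_weak|exact: extremal_weak].
split; last exact: lift.
(* One cycle, in the order of the conditions. From (4) to (5) it goes back to a lift phi through
   (3); the sequences converge weakly to phi, which agrees with psi only against [MQ Q]. *)
tfae.
- by move=> [phi sp hl]; exists phi; [exact: sp|exact: (perp_of_lift hsigma hQ projP sp hl)].
- by move=> [phi sp pp]; exact: (contraction_of_lift hsigma cQ hpsi sp pp).
- exact: (dist_of_contr hsigma cQ Qpsi psi0).
- move=> /(contr_of_dist hsigma cQ Qpsi psi0)/contr_lift[phi sp pp].
  have [phis [sk Ak wk]] := dense phi sp; exists phis; first exact: Ak.
  move=> f Mf; exact: (pairing_weak hsigma cQ hpsi (schur_H2 hsigma sp) pp (fun k => schur_H2 hsigma (sk k)) wk Mf).
- by move=> [phis Ak wk]; exists phis; [exact: Ak|move=> f hf; apply: wk; exact: Qconj_MQ].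
- move=> [phis Ak wk]; have [phi sp pp] := lift_of_weak hsigma cQ hpsi (fun k => schurA _ (Ak k)) wk.
  by exists phi; [exact: sp|exact: lift].
Qed.
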